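(* Let $\Omega\subset\mathbb R^2$ be a connected open bounded domain, let $(x_0,y_0)\in\Omega$ be arbitrarily fixed, and let $\omega(x_0,y_0)\subset\Omega$ be an open neighborhood of $(x_0,y_0)$. Let $(a_{ijk\ell})_{1\le i,j,k,\ell\le 2}$ be a tensor of real-valued functions on $\overline\Omega$, and let $b_{ijk}, c_{ij}$ ($i,j,k=1,2$) be real-valued functions on $\Omega$, such that all $a_{ijk\ell}$ are locally Lipschitz in $\Omega$ and all $b_{ijk},c_{ij}$ are locally bounded in $\Omega$. Assume that $(a_{ijk\ell})$ is fully symmetric, i.e. $a_{ijk\ell}=a_{jik\ell}=a_{k\ell ij}$ on $\overline\Omega$ for all $i,j,k,\ell=1,2$, that it satisfies the strong elliptic condition (defined in the context), and that the local eigenpair assumption (defined in the context) holds throughout $\Omega$. Let $\boldsymbol u=(u_1,u_2)^{\mathrm T}\in (C^2(\overline\Omega))^2$ be a classical solution (i.e. satisfying the equations pointwise) of $$\sum_{j,k,\ell=1}^2 a_{ijk\ell}(x,y)\,\partial_j\partial_\ell u_k+\sum_{j,k=1}^2 b_{ijk}(x,y)\,\partial_k u_j+\sum_{j=1}^2 c_{ij}(x,y)\,u_j=0,\quad i=1,2,\quad\text{in }\Omega.$$ Suppose that $$\Delta:=(a_{1212}+a_{1122})^2-4\,a_{1112}\,a_{1222}>0\quad\text{on }\overline{\omega(x_0,y_0)}.$$ If $u_1=0$ in $\omega(x_0,y_0)$ and $$u_2=\partial_x u_2=\partial_y u_2=\partial_x^2u_2=\partial_y^2u_2=0\quad\text{at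 }(x_0,y_0),$$ then $\boldsymbol u\equiv\boldsymbol 0$ in $\Omega$.
   Context: Notation: $\partial_1=\partial_x=\partial/\partial x$, $\partial_2=\partial_y=\partial/\partial y$; $(\cdot)^{\mathrm T}$ is the transpose; the bar over a complex number denotes complex conjugation. Strong elliptic condition: there exists a constant $\kappa_0>0$ such that for all $(x,y)\in\overline\Omega$ and all $(\xi_1,\xi_2),(\eta_1,\eta_2)\in\mathbb R^2$, $$\sum_{i,j,k,\ell=1}^2 a_{ijk\ell}(x,y)\,\xi_i\eta_j\xi_k\eta_\ell\ge\kappa_0(\xi_1^2+\xi_2^2)(\eta_1^2+\eta_2^2).$$ Principal-part matrices: by the full symmetry of the tensor, the system can be written as $\Lambda_{11}\partial_x^2\boldsymbol u+\Lambda_{12}\partial_x\partial_y\boldsymbol u+\Lambda_{22}\partial_y^2\boldsymbol u+D(\boldsymbol u)=\boldsymbol 0$ in $\Omega$, where $D$ is a first order differential operator with locally bounded coefficients and $$\Lambda_{11}=\begin{pmatrix} a_{1111} & a_{1112} \\ a_{1112} & a_{1212} \end{pmatrix},\quad \Lambda_{12}=\begin{pmatrix} 2a_{1112} & a_{1212}+a_{1122} \\ a_{1212}+a_{1122} & 2a_{1222} \end{pmatrix},\quad \Lambda_{22}=\begin{pmatrix} a_{1212} & a_{1222} \\ a_{1222} & a_{2222} \end{pmatrix}.$$ Local eigenpair assumption (throughout $\Omega$): for every $(x,y)\in\Omega$ there are a sufficiently small open neighborhood $\omega(x,y)\subset\Omega$ of $(x,y)$ and a local eigenpair $(\theta,(z_1,z_2)^{\mathrm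 T})$ of the quadratic pencil $\Lambda_{11}\zeta^2+\Lambda_{12}\zeta+\Lambda_{22}$, i.e. complex-valued functions $\theta,z_1,z_2$ on $\omega(x,y)$ with $$(\Lambda_{11}\theta^2+\Lambda_{12}\theta+\Lambda_{22})(z_1,z_2)^{\mathrm T}=\boldsymbol 0\quad\text{in }\omega(x,y),$$ such that $\theta$ and $(z_1,z_2)^{\mathrm T}$ are Lipschitz in $\omega(x,y)$ and the matrix function $\begin{pmatrix} z_1 & \overline{z_1} \\ z_2 & \overline{z_2} \end{pmatrix}$ is nonsingular in $\omega(x,y)$. *)

(* Defs.v *)
From HB Require Import structures.
From mathcomp Require Export all_boot all_order all_algebra.
From mathcomp Require Export all_classical all_reals all_analysis.
From mathcomp Require Export complex.
Export Order.TTheory GRing.Theory Num.Theory.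
Export numFieldNormedType.Exports.
#[export] Set Implicit Arguments.
#[export] Unset Strict Implicit.
#[export] Unset Printing Implicit Defensive.

#[export] Set Warnings "-notation-overridden".

Local Open Scope classical_set_scope.
Local Open Scope ring_scope.

(* The indices 1 and 2 of the mathematics are the elements i1 (of value 0) and
   i2 (of value 1) of 'I_2. *)
Definition i1 : 'I_2 := ord0.
Definition i2 : 'I_2 := ord_max.

Definition mx2 (K : Type) (m11 m12 m21 m22 : K) : 'M[K]_2 :=
  \matrix_(i, j) if i == i1 then (if j == i1 then m11 else m12)
                 else (if j == i1 then m21 else m22).

Definition cv2 (K : Type) (v1 v2 : K) : 'cV[K]_2 :=
  \col_i if i == i1 then v1 else v2.

Section PlaneCalculus.
Variable R : realType.

Definition dir (k : 'I_2) : R * R := if k == i1 then (1, 0) else (0, 1).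

Definition partial (k : 'I_2) (f : R * R -> R) : R * R -> R := 'D_(dir k) f.

Definition continuously_extendable (Omega : set (R * R)) (f : R * R -> R) :=
  exists2 g : R * R -> R,
    {within closure Omega, continuous g} & forall p, Omega p -> f p = g p.

(* C^2 up to the boundary: the values of f on the closure are part of the data,
   whereas the derivatives, which only exist in the open set Omega, are
   required to extend continuously to the closure. *)
Definition C2_closure (Omega : set (R * R)) (f : R * R -> R) :=
  [/\ forall k p, Omega p -> derivable f p (dir k),
      forall k l p, Omega p -> derivable (partial l f) p (dir k),
      {within closure Omega, continuous f},
      forall k, continuously_extendable Omega (partial k f)
    & forall k l, continuously_extendable Omega (partial k (partial l f))].

(* Library notion [lipschitz _ | _ in _] is not available here because R[i]
   carries no normedModType R structure. *)
Definition complex_lipschitz (A : set (R * R)) (f : R * R -> R[i]) :=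
  exists M : R, forall p q, A p -> A q ->
    Normc.normc (f p - f q) <= M * `|p - q|.

End PlaneCalculus.

Section EllipticSystem.
Variable R : realType.
Variable a : 'I_2 -> 'I_2 -> 'I_2 -> 'I_2 -> R * R -> R.

Definition fully_symmetric (D : set (R * R)) :=
  forall i j k l p, D p ->
    a i j k l p = a j i k l p /\ a j i k l p = a k l i j p.

Definition strongly_elliptic (D : set (R * R)) :=
  exists2 kappa0 : R, 0 < kappa0 &
    forall p, D p -> forall xi eta : 'I_2 -> R,
      \sum_i \sum_j \sum_k \sum_l
        a i j k l p * xi i * eta j * xi k * eta l
      >= kappa0 * (xi i1 ^+ 2 + xi i2 ^+ 2) * (eta i1 ^+ 2 + eta i2 ^+ 2).

Definition Lambda11 (p : R * R) : 'M[R]_2 :=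
  mx2 (a i1 i1 i1 i1 p) (a i1 i1 i1 i2 p)
      (a i1 i1 i1 i2 p) (a i1 i2 i1 i2 p).

Definition Lambda12 (p : R * R) : 'M[R]_2 :=
  mx2 (2 * a i1 i1 i1 i2 p) (a i1 i2 i1 i2 p + a i1 i1 i2 i2 p)
      (a i1 i2 i1 i2 p + a i1 i1 i2 i2 p) (2 * a i1 i2 i2 i2 p).

Definition Lambda22 (p : R * R) : 'M[R]_2 :=
  mx2 (a i1 i2 i1 i2 p) (a i1 i2 i2 i2 p)
      (a i1 i2 i2 i2 p) (a i2 i2 i2 i2 p).

Definition pencil (zeta : R[i]) (p : R * R) : 'M[R[i]]_2 :=
  zeta ^+ 2 *: map_mx (real_complex R) (Lambda11 p)
  + zeta *: map_mx (real_complex R) (Lambda12 p)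
  + map_mx (real_complex R) (Lambda22 p).

Definition local_eigenpair (Omega : set (R * R)) (p0 : R * R) :=
  exists (omega : set (R * R)) (theta z1 z2 : R * R -> R[i]),
    [/\ open omega, omega p0 & omega `<=` Omega] /\
    [/\ complex_lipschitz omega theta,
        complex_lipschitz omega z1, complex_lipschitz omega z2,
        forall p, omega p -> pencil (theta p) p *m cv2 (z1 p) (z2 p) = 0
      & forall p, omega p ->
          mx2 (z1 p) (conjc (z1 p)) (z2 p) (conjc (z2 p)) \in unitmx].

Variables (b : 'I_2 -> 'I_2 -> 'I_2 -> R * R -> R) (c : 'I_2 -> 'I_2 -> R * R -> R).

Definition system_lhs (u : 'I_2 -> R * R -> R) (i : 'I_2) (p : R * R) : R :=
  \sum_j \sum_k \sum_l a i j k l p * partial j (partial l (u k)) p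
  + \sum_j \sum_k b i j k p * partial k (u j) p
  + \sum_j c i j p * u j p.

Definition Delta (p : R * R) : R :=
  (a i1 i2 i1 i2 p + a i1 i1 i2 i2 p) ^+ 2
  - 4 * a i1 i1 i1 i2 p * a i1 i2 i2 i2 p.

End EllipticSystem.

(* Main.v *)
(** Near [p0] only [v = u2] survives, and the system becomes two second order
    equations for [v].  As [Delta > 0], the first one is hyperbolic; the second
    one couples the second derivatives along the two characteristic directions
    with the same sign.  On the net of characteristics issued from [p0], the
    slopes of [grad v] over dyadic scales are almost nonincreasing as the scale
    decreases, and they tend to [0] because the Hessian of [v] vanishes at [p0];
    so [v] vanishes on the net, whose points become dense in a nonempty open set
    when the mesh tends to [0].

    Unique continuation from an open set then rests on the eigenpair: the
    function [w = Z^T Lambda11 u_x + Z^T (theta Lambda11 + Lambda12) u_y]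
    satisfies [(d_x - theta d_y) w = O(|u| + |grad u|)], and expressing [u_x] by
    [w] and [u_y] leaves a first order elliptic system for [u], which one
    complex combination [v] of [u1, u2] turns into [(d_x + mu d_y) v = O(|u| + |w|)].
    A Carleman estimate with weight [exp (tau (1 + 4 eta - |p|^2)^2)] handles
    both equations at once.  It is proved for difference quotients on a finite
    periodic lattice, where summation by parts is exact and where Lipschitz
    coefficients need not be differentiated. *)
From mathcomp Require Import all_boot all_order all_algebra all_classical reals.
From mathcomp Require Import topology normedtype sequences exp.
From mathcomp Require Import lra ring zify.
Import Order.TTheory GRing.Theory Num.Theory.
Set Implicit Arguments.
Unset Strict Implicit.
Unset Printing Implicit Defensive.

Local Open Scope ring_scope.

(** * Carleman estimate on a lattice *)


Section Lattice.
Variables (R : realType) (G : finType) (sa sa' sb sb' : G -> G) (h : R).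
Hypothesis (h_gt0 : 0 < h).
Hypothesis (saK : cancel sa sa') (sa'K : cancel sa' sa).
Hypothesis (sbK : cancel sb sb') (sb'K : cancel sb' sb).
Hypothesis (sabC : forall g, sa (sb g) = sb (sa g)).

Definition cdiff (s s' : G -> G) (f : G -> R) (g : G) : R :=
  (f (s g) - f (s' g)) / (2 * h).

Local Notation D1 := (cdiff sa sa').
Local Notation D2 := (cdiff sb sb').

Lemma sum_bij (s s' : G -> G) (f : G -> R) : cancel s s' -> cancel s' s ->
  \sum_g f (s g) = \sum_g f g.
Proof.
by move=> K K'; rewrite [RHS](reindex s) //; exists s' => x _; rewrite ?K ?K'.
Qed.

Lemma sum_cdiff (s s' : G -> G) (u v : G -> R) : cancel s s' -> cancel s' s ->
  \sum_g u g * cdiff s s' v g = - \sum_g cdiff s s' u g * v g.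
Proof.
move=> K K'; rewrite /cdiff.
have E1 : \sum_g u g * v (s g) = \sum_g u (s' g) * v g.
  by rewrite -[RHS](sum_bij _ K K'); apply: eq_bigr => g _; rewrite K.
have E2 : \sum_g u g * v (s' g) = \sum_g u (s g) * v g.
  by rewrite -[RHS](sum_bij _ K' K); apply: eq_bigr => g _; rewrite K'.
transitivity ((\sum_g u g * v (s g) - \sum_g u g * v (s' g)) / (2 * h)).
  by rewrite -sumrB mulr_suml; apply: eq_bigr => g _; ring.
rewrite E1 E2 -sumrB mulr_suml -sumrN; apply: eq_bigr => g _; ring.
Qed.

Lemma cdiffC (f : G -> R) g : D1 (D2 f) g = D2 (D1 f) g.
Proof.
have C1 x : sa' (sb x) = sb (sa' x) by rewrite -[in LHS](sa'K x) -sabC saK.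
have C2 x : sa (sb' x) = sb' (sa x) by rewrite -[in RHS](sb'K x) sabC sbK.
have C3 x : sa' (sb' x) = sb' (sa' x) by rewrite -[in LHS](sa'K x) -C2 saK.
rewrite /cdiff !sabC !C1 !C2 !C3; ring.
Qed.

Lemma sum_mul_cdiff (s s' : G -> G) (c f : G -> R) : cancel s s' -> cancel s' s ->
  \sum_g f g * (c g * cdiff s s' f g) =
  - (2 * h)^-1 * \sum_g f g * f (s g) * (c (s g) - c g).
Proof.
move=> K K'; rewrite /cdiff.
have E2 : \sum_g f g * (c g * f (s' g)) = \sum_g f g * f (s g) * c (s g).
  rewrite -[LHS](sum_bij _ K K'); apply: eq_bigr => g _; rewrite K; ring.
transitivity ((\sum_g f g * f (s g) * c g - \sum_g f g * (c g * f (s' g))) / (2 * h)).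
  by rewrite -sumrB mulr_suml; apply: eq_bigr => g _; ring.
rewrite E2 -sumrB mulr_suml mulr_sumr; apply: eq_bigr => g _; ring.
Qed.

(* The leading term [beta (D1 D2 v - D2 D1 v)] cancels after moving the
   difference operators off [u], so only increments of [beta] survive. *)
Lemma jacobian_bound (beta u v : G -> R) (L tau : R) : 0 < tau -> 0 <= L ->
  (forall g, u g != 0 ->
    [/\ `|beta (sa g) - beta g| <= L * h, `|beta (sa' g) - beta g| <= L * h,
        `|beta (sb g) - beta g| <= L * h & `|beta (sb' g) - beta g| <= L * h]) ->
  `| \sum_g beta g * (D1 u g * D2 v g - D1 v g * D2 u g) |
   <= L * (tau * \sum_g u g ^+ 2
        + tau^-1 * (\sum_g (D1 v g ^+ 2 + D2 v g ^+ 2))).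
Proof.
move=> tau0 L0 Lip.
pose V1 := D1 v; pose V2 := D2 v.
pose ra g := ((beta (sa g) - beta g) * V2 (sa g)
              - (beta (sa' g) - beta g) * V2 (sa' g)) / (2 * h).
pose rb g := ((beta (sb g) - beta g) * V1 (sb g)
              - (beta (sb' g) - beta g) * V1 (sb' g)) / (2 * h).
have E : \sum_g beta g * (D1 u g * D2 v g - D1 v g * D2 u g)
         = \sum_g u g * (rb g - ra g).
  transitivity (\sum_g D1 u g * (beta g * V2 g) - \sum_g D2 u g * (beta g * V1 g)).
    by rewrite -sumrB; apply: eq_bigr => g _; rewrite /V1 /V2; ring.
  have S1 : \sum_g D1 u g * (beta g * V2 g) =
      - \sum_g u g * D1 (fun g => beta g * V2 g) g.
    by rewrite (sum_cdiff _ _ saK sa'K) opprK.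
  have S2 : \sum_g D2 u g * (beta g * V1 g) =
      - \sum_g u g * D2 (fun g => beta g * V1 g) g.
    by rewrite (sum_cdiff _ _ sbK sb'K) opprK.
  rewrite S1 S2 opprK addrC -sumrB; apply: eq_bigr => g _.
  have C : D1 V2 g = D2 V1 g by exact: cdiffC.
  have -> : D1 (fun g => beta g * V2 g) g = beta g * D1 V2 g + ra g.
    by rewrite /ra /cdiff; ring.
  have -> : D2 (fun g => beta g * V1 g) g = beta g * D2 V1 g + rb g.
    by rewrite /rb /cdiff; ring.
  rewrite C; ring.
rewrite E.
pose q g := V2 (sa g) ^+ 2 + V2 (sa' g) ^+ 2 + V1 (sb g) ^+ 2 + V1 (sb' g) ^+ 2.
have P g : `|u g * (rb g - ra g)| <= L * (tau * u g ^+ 2 + tau^-1 * (q g / 4)).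
  have tv : 0 < tau^-1 by rewrite invr_gt0.
  have q0 : 0 <= q g by rewrite /q; rewrite !addr_ge0 // sqr_ge0.
  have [->|un0] := eqVneq (u g) 0.
    rewrite mul0r normr0 expr0n /= mulr0 add0r.
    by apply: mulr_ge0 => //; apply: mulr_ge0; [exact: ltW | exact: divr_ge0].
  have [l1 l2 l3 l4] := Lip g un0.
  have B (x y V W : R) : `|x| <= L * h -> `|y| <= L * h ->
      `|(x * V - y * W) / (2 * h)| <= L / 2 * (`|V| + `|W|).
    move=> hx hy; rewrite normrM normfV (gtr0_norm (x := 2 * h)) ?mulr_gt0 //.
    rewrite ler_pdivrMr ?mulr_gt0 //.
    apply: le_trans (ler_normB _ _) _; rewrite !normrM.
    have v0 := normr_ge0 V; have w0 := normr_ge0 W.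
    have a1 := ler_wpM2r v0 hx; have a2 := ler_wpM2r w0 hy.
    lra.
  have b1 : `|ra g| <= _ := B _ _ (V2 (sa g)) (V2 (sa' g)) l1 l2.
  have b2 : `|rb g| <= _ := B _ _ (V1 (sb g)) (V1 (sb' g)) l3 l4.
  rewrite normrM.
  have am (x : R) : `|u g| * `|x| <= (tau * u g ^+ 2 + tau^-1 * x ^+ 2) / 2.
    have e : tau * tau^-1 = 1 by rewrite divff // gt_eqF.
    have := mulr_ge0 (ltW tv) (sqr_ge0 (tau * `|u g| - `|x|)).
    rewrite -(real_normK (num_real (u g))) -(real_normK (num_real x)).
    set U := `|u g|; set Y := `|x|.
    have -> : tau^-1 * (tau * U - Y) ^+ 2 =
      (tau * tau^-1) * (tau * U ^+ 2 - 2 * (U * Y)) + tau^-1 * Y ^+ 2 by ring.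
    rewrite e; lra.
  have nb : `|rb g - ra g| <= `|rb g| + `|ra g| := ler_normB _ _.
  have u0 := normr_ge0 (u g).
  have t1 := ler_wpM2l u0 (le_trans nb (lerD b2 b1)).
  have s1 := am (V2 (sa g)); have s2 := am (V2 (sa' g)).
  have s3 := am (V1 (sb g)); have s4 := am (V1 (sb' g)).
  apply: le_trans t1 _.
  have -> : `|u g| * (L / 2 * (`|V1 (sb g)| + `|V1 (sb' g)|)
            + L / 2 * (`|V2 (sa g)| + `|V2 (sa' g)|)) =
    L / 2 * (`|u g| * `|V1 (sb g)| + `|u g| * `|V1 (sb' g)| +
            `|u g| * `|V2 (sa g)| + `|u g| * `|V2 (sa' g)|) by ring.
  have L2 : 0 <= L / 2 by rewrite divr_ge0.
  have := ler_wpM2l L2 (lerD (lerD (lerD s3 s4) s1) s2).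
  move=> H; apply: le_trans H _; rewrite /q.
  by set it := tau^-1; lra.
apply: le_trans (ler_norm_sum _ _ _) _.
apply: le_trans (ler_sum _ (fun g _ => P g)) _.
rewrite -mulr_sumr ler_wpM2l // big_split /= -!mulr_sumr lerD2l.
rewrite ler_wpM2l ?invr_ge0 ?(ltW tau0) // /q -mulr_suml !big_split /=.
rewrite (sum_bij (fun g => V2 g ^+ 2) saK sa'K) (sum_bij (fun g => V2 g ^+ 2) sa'K saK).
rewrite (sum_bij (fun g => V1 g ^+ 2) sbK sb'K) (sum_bij (fun g => V1 g ^+ 2) sb'K sbK).
have A1 : 0 <= \sum_g V1 g ^+ 2 by apply: sumr_ge0 => g _; exact: sqr_ge0.
have A2 : 0 <= \sum_g V2 g ^+ 2 by apply: sumr_ge0 => g _; exact: sqr_ge0.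
rewrite -/V1 -/V2; lra.
Qed.

Section Conjugated.
Variables (al be p1 p2 f1 f2 : G -> R) (tau : R).

(* Real and imaginary parts of (d1 - theta d2) f - tau (p1 - theta p2) f,
   with theta = al + i be and f = f1 + i f2. *)
Definition conj_op1 g := D1 f1 g - al g * D2 f1 g + be g * D2 f2 g
  - tau * ((p1 g - al g * p2 g) * f1 g + be g * p2 g * f2 g).
Definition conj_op2 g := D1 f2 g - al g * D2 f2 g - be g * D2 f1 g
  - tau * ((p1 g - al g * p2 g) * f2 g - be g * p2 g * f1 g).
Definition adj_op1 g := D1 f1 g - al g * D2 f1 g - be g * D2 f2 g
  + tau * ((p1 g - al g * p2 g) * f1 g - be g * p2 g * f2 g).
Definition adj_op2 g := D1 f2 g - al g * D2 f2 g + be g * D2 f1 g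
  + tau * ((p1 g - al g * p2 g) * f2 g + be g * p2 g * f1 g).

Definition cdir1 g := p1 g - al g * p2 g.
Definition cdir2 g := be g ^+ 2 * p2 g - al g * cdir1 g.

Lemma conj_op_identity g :
  conj_op1 g ^+ 2 + conj_op2 g ^+ 2 - (adj_op1 g ^+ 2 + adj_op2 g ^+ 2) =
  - 4 * tau * (f1 g * (cdir1 g * D1 f1 g) + f1 g * (cdir2 g * D2 f1 g)
             + (f2 g * (cdir1 g * D1 f2 g) + f2 g * (cdir2 g * D2 f2 g)))
  + 4 * (be g * (D1 f1 g * D2 f2 g - D1 f2 g * D2 f1 g)).
Proof. rewrite /conj_op1 /conj_op2 /adj_op1 /adj_op2 /cdir2 /cdir1; ring. Qed.

Lemma conj_op_elliptic (c0 C : R) g : 0 < c0 -> 0 < C ->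
  `|al g| <= C -> c0 <= `|be g| -> `|be g| <= C -> `|p1 g| <= C -> `|p2 g| <= C ->
  (2 + (2 * C ^+ 2 + 1) / c0 ^+ 2)^-1 *
    (D1 f1 g ^+ 2 + D2 f1 g ^+ 2 + (D1 f2 g ^+ 2 + D2 f2 g ^+ 2)) <=
  conj_op1 g ^+ 2 + conj_op2 g ^+ 2 + (adj_op1 g ^+ 2 + adj_op2 g ^+ 2) +
    2 * ((C + C ^+ 2) ^+ 2 + C ^+ 4) * tau ^+ 2 * (f1 g ^+ 2 + f2 g ^+ 2).
Proof.
move=> c00 C0 hal hbe hbeC hp1 hp2.
set k := 2 + _.
have k0 : 0 < k.
  rewrite /k; apply: ltr_wpDr; last by [].
  apply: divr_ge0; last exact: sqr_ge0.
  by have := sqr_ge0 C; lra.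
have b2 : c0 ^+ 2 <= be g ^+ 2.
  rewrite -[be g ^+ 2]real_normK ?num_real //.
  by rewrite lerXn2r ?nnegrE ?(ltW c00) ?(ltW C0).
have sq (x : R) : `|x| <= C -> x ^+ 2 <= C ^+ 2.
  move=> hx; rewrite -[x ^+ 2]real_normK ?num_real //.
  by rewrite lerXn2r ?nnegrE ?(ltW c00) ?(ltW C0).
have E1 (x y : R) : x ^+ 2 + y ^+ 2 <= k * ((x - al g * y) ^+ 2 + (be g * y) ^+ 2).
  have c2 : 0 < c0 ^+ 2 by rewrite exprn_gt0.
  have := sq _ hal => ha.
  have q : (2 * C ^+ 2 + 1) * y ^+ 2 <= (2 * C ^+ 2 + 1) / c0 ^+ 2 * (be g * y) ^+ 2.
    rewrite -mulrA ler_wpM2l; [by []|by have := sqr_ge0 C; lra|].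
    rewrite mulrC ler_pdivlMr // mulrC exprMn ler_wpM2r //; exact: sqr_ge0.
  have e : k * ((x - al g * y) ^+ 2 + (be g * y) ^+ 2) =
     2 * (x - al g * y) ^+ 2 + 2 * (be g * y) ^+ 2 +
     (2 * C ^+ 2 + 1) / c0 ^+ 2 * (x - al g * y) ^+ 2 +
     (2 * C ^+ 2 + 1) / c0 ^+ 2 * (be g * y) ^+ 2 by rewrite /k; ring.
  have z1 : 0 <= (2 * C ^+ 2 + 1) / c0 ^+ 2 * (x - al g * y) ^+ 2.
    apply: mulr_ge0 (sqr_ge0 _); apply: divr_ge0; last exact: sqr_ge0.
    by have := sqr_ge0 C; lra.
  have z2 := sqr_ge0 (be g * y).
  have z3 : al g ^+ 2 * y ^+ 2 <= C ^+ 2 * y ^+ 2 by rewrite ler_wpM2r ?sqr_ge0.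
  have z4 : x ^+ 2 <= 2 * (x - al g * y) ^+ 2 + 2 * (al g ^+ 2 * y ^+ 2).
    have := sqr_ge0 (x - 2 * (al g * y)).
    have -> : (x - 2 * (al g * y)) ^+ 2 =
      2 * (x - al g * y) ^+ 2 + 2 * (al g ^+ 2 * y ^+ 2) - x ^+ 2 by ring.
    by rewrite subr_ge0.
  rewrite e; lra.
rewrite mulrC ler_pdivrMr // mulrC.
have d1 := E1 (D1 f1 g) (D2 f1 g); have d2 := E1 (D1 f2 g) (D2 f2 g).
apply: le_trans (lerD d1 d2) _; rewrite -mulrDr ler_wpM2l ?(ltW k0) //.
have q1 : (p1 g - al g * p2 g) ^+ 2 <= (C + C ^+ 2) ^+ 2.
  rewrite -[X in X <= _]real_normK ?num_real // lerXn2r ?nnegrE //.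
    by have := sqr_ge0 C; lra.
  apply: le_trans (ler_normB _ _) _; apply: lerD => //.
  by rewrite normrM expr2 ler_pM.
have q2 : (be g * p2 g) ^+ 2 <= C ^+ 4.
  rewrite (_ : C ^+ 4 = C ^+ 2 * C ^+ 2); last by ring.
  by rewrite exprMn ler_pM ?sqr_ge0 ?sq.
have q3 : 0 <= tau ^+ 2 * (f1 g ^+ 2 + f2 g ^+ 2).
  by rewrite mulr_ge0 ?sqr_ge0 // addr_ge0 ?sqr_ge0.
have q4 := ler_wpM2r q3 (lerD q1 q2).
set X1 := D1 f1 g - al g * D2 f1 g; set X2 := D1 f2 g - al g * D2 f2 g.
set Y1 := be g * D2 f1 g; set Y2 := be g * D2 f2 g.
set u1 := tau * ((p1 g - al g * p2 g) * f1 g + be g * p2 g * f2 g).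
set u2 := tau * ((p1 g - al g * p2 g) * f2 g - be g * p2 g * f1 g).
set v1 := tau * ((p1 g - al g * p2 g) * f1 g - be g * p2 g * f2 g).
set v2 := tau * ((p1 g - al g * p2 g) * f2 g + be g * p2 g * f1 g).
have uv : u1 ^+ 2 + u2 ^+ 2 + (v1 ^+ 2 + v2 ^+ 2) = 2 *
   (((p1 g - al g * p2 g) ^+ 2 + (be g * p2 g) ^+ 2) *
    (tau ^+ 2 * (f1 g ^+ 2 + f2 g ^+ 2))).
  by rewrite /u1 /u2 /v1 /v2; ring.
rewrite /conj_op1 /conj_op2 /adj_op1 /adj_op2 -/X1 -/X2 -/Y1 -/Y2 -/u1 -/u2 -/v1 -/v2.
have S (x y : R) : x ^+ 2 <= 2 * (x - y) ^+ 2 + 2 * y ^+ 2.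
  by have := sqr_ge0 (x - 2 * y); lra.
have S' (x y : R) : x ^+ 2 <= 2 * (x + y) ^+ 2 + 2 * y ^+ 2.
  by have := sqr_ge0 (x + 2 * y); lra.
have s1 := S (X1 + Y2) u1; have s2 := S (X2 - Y1) u2.
have s3 := S' (X1 - Y2) v1; have s4 := S' (X2 + Y1) v2.
have par (x y : R) : (x + y) ^+ 2 + (x - y) ^+ 2 = 2 * x ^+ 2 + 2 * y ^+ 2 by ring.
have := par X1 Y2; have := par X2 Y1.
lra.
Qed.

Lemma lattice_carleman (c0 C g0 L e : R) (A : pred G) :
  0 < c0 -> 0 < C -> 0 < g0 -> 1 <= tau -> 0 <= L ->
  let k := (2 + (2 * C ^+ 2 + 1) / c0 ^+ 2)^-1 in
  let C2 := 2 * ((C + C ^+ 2) ^+ 2 + C ^+ 4) in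
  4 * L <= g0 -> 8 * L <= k -> 8 * (C2 + g0) * L <= k * g0 ->
  (forall g, ~~ A g -> [/\ f1 g = 0, f2 g = 0, D1 f1 g = 0 & D2 f1 g = 0] /\
                       (D1 f2 g = 0 /\ D2 f2 g = 0)) ->
  (forall g, A g ->
    [/\ `|al g| <= C, c0 <= `|be g|, `|be g| <= C, `|p1 g| <= C & `|p2 g| <= C]) ->
  (forall g, A g ->
    [/\ `|be (sa g) - be g| <= L * h, `|be (sa' g) - be g| <= L * h,
        `|be (sb g) - be g| <= L * h & `|be (sb' g) - be g| <= L * h]) ->
  (forall g, (f1 g != 0) || (f2 g != 0) ->
    [/\ 2 * g0 * h <= (cdir1 (sa g) - cdir1 g) + (cdir2 (sb g) - cdir2 g),
        `|cdir1 (sa g) - cdir1 g| <= C * h & `|cdir2 (sb g) - cdir2 g| <= C * h]) ->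
  (forall g, [/\ `|f1 g * (f1 (sa g) - f1 g)| <= e, `|f2 g * (f2 (sa g) - f2 g)| <= e,
        `|f1 g * (f1 (sb g) - f1 g)| <= e & `|f2 g * (f2 (sb g) - f2 g)| <= e]) ->
  let P := \sum_g (conj_op1 g ^+ 2 + conj_op2 g ^+ 2) in
  let F := \sum_g (f1 g ^+ 2 + f2 g ^+ 2) in
  2 * g0 * tau * F <= 3 * P + 16 * tau * C * e * #|G|%:R /\
  k * (\sum_g (D1 f1 g ^+ 2 + D2 f1 g ^+ 2 + (D1 f2 g ^+ 2 + D2 f2 g ^+ 2))) <=
    4 * P + 2 * (C2 + g0) * tau ^+ 2 * F + 16 * tau * C * e * #|G|%:R.
Proof.
move=> c00 C0 g00 tau1 L0 k C2 HL1 HL2 HL3 HA Hb HLip Hconv He P F.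
have tau0 : 0 < tau by apply: lt_le_trans tau1.
set X := \sum_g _.
pose S' := \sum_g (adj_op1 g ^+ 2 + adj_op2 g ^+ 2).
pose J := \sum_g be g * (D1 f1 g * D2 f2 g - D1 f2 g * D2 f1 g).
set N := #|G|%:R : R.
have F0 : 0 <= F by apply: sumr_ge0 => g _; rewrite addr_ge0 ?sqr_ge0.
have S'0 : 0 <= S' by apply: sumr_ge0 => g _; rewrite addr_ge0 ?sqr_ge0.
have P0 : 0 <= P by apply: sumr_ge0 => g _; rewrite addr_ge0 ?sqr_ge0.
have X0 : 0 <= X by apply: sumr_ge0 => g _; rewrite !addr_ge0 ?sqr_ge0.
have k0 : 0 < k.
  rewrite /k invr_gt0; apply: ltr_wpDr; last by [].
  apply: divr_ge0; last exact: sqr_ge0.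
  by have := sqr_ge0 C; lra.
have C20 : 0 <= C2.
  rewrite /C2; apply: mulr_ge0 => //; apply: addr_ge0; first exact: sqr_ge0.
  by rewrite exprn_ge0 // ltW.
have HJ : `|J| <= L * (tau * F + tau^-1 * X).
  have Hsupp g : f1 g != 0 -> [/\ `|be (sa g) - be g| <= L * h, `|be (sa' g) - be g| <= L * h,
        `|be (sb g) - be g| <= L * h & `|be (sb' g) - be g| <= L * h].
    move=> u0; apply: HLip; apply: contraT => /HA [[f10 _ _ _] _].
    by rewrite f10 eqxx in u0.
  apply: le_trans (@jacobian_bound be f1 f2 L tau tau0 L0 Hsupp) _.
  apply: ler_wpM2l => //; apply: lerD; [rewrite ler_wpM2l ?(ltW tau0) //|
    rewrite ler_wpM2l ?invr_ge0 ?(ltW tau0) //];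
  apply: ler_sum => g _; have := sqr_ge0 (f2 g); have := sqr_ge0 (D1 f1 g);
  have := sqr_ge0 (D2 f1 g); lra.
have HC : P - S' >= 4 * g0 * tau * F - 8 * tau * C * e * N + 4 * J.
  have -> : P - S' = \sum_g (- 4 * tau * (f1 g * (cdir1 g * D1 f1 g) + f1 g * (cdir2 g * D2 f1 g)
             + (f2 g * (cdir1 g * D1 f2 g) + f2 g * (cdir2 g * D2 f2 g))))
             + 4 * J.
    rewrite /P /S' /J mulr_sumr -big_split -sumrB /=.
    by apply: eq_bigr => g _; exact: conj_op_identity.
  rewrite lerD2r.
  have E4 : 4 * g0 * tau * F - 8 * tau * C * e * N =
      \sum_g (4 * g0 * tau * (f1 g ^+ 2 + f2 g ^+ 2) - 8 * tau * C * e).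
    by rewrite /F sumrB -mulr_sumr; congr (_ - _); rewrite sumr_const -[RHS]mulr_natr.
  rewrite E4 -[X in _ <= X]mulr_sumr !big_split /=.
  set LHS := (X in X <= _).
  rewrite !(sum_mul_cdiff _ _ saK sa'K) !(sum_mul_cdiff _ _ sbK sb'K).
  rewrite -!mulrDr -!big_split /= mulrA.
  have -> : - 4 * tau * - (2 * h)^-1 = 2 * tau / h by field; rewrite gt_eqF.
  rewrite mulr_sumr /LHS -big_split /=.
  apply: ler_sum => g _.
  have h0 := ltW h_gt0.
  have e0 : 0 <= e by have [+ _ _ _] := He g; apply: le_trans.
  have [Ag|] := boolP ((f1 g != 0) || (f2 g != 0)); last first.
    rewrite negb_or !negbK => /andP[/eqP -> /eqP ->].
    rewrite !expr0n /= !mul0r !addr0 mulr0.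
    have : 0 <= tau * C * e by rewrite !mulr_ge0 // ltW.
    lra.
  have [c1 c2 c3] := Hconv g Ag; have [e1 e2 e3 e4] := He g.
  set d1 := cdir1 (sa g) - cdir1 g in c1 c2 *.
  set d2 := cdir2 (sb g) - cdir2 g in c1 c3 *.
  set x1 := f1 g * (f1 (sa g) - f1 g) in e1.
  set x2 := f2 g * (f2 (sa g) - f2 g) in e2.
  set x3 := f1 g * (f1 (sb g) - f1 g) in e3.
  set x4 := f2 g * (f2 (sb g) - f2 g) in e4.
  have -> : f1 g * f1 (sa g) * d1 + f1 g * f1 (sb g) * d2 +
     (f2 g * f2 (sa g) * d1 + f2 g * f2 (sb g) * d2) =
     (f1 g ^+ 2 + f2 g ^+ 2) * (d1 + d2) + (x1 * d1 + x2 * d1 + x3 * d2 + x4 * d2).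
    by rewrite /x1 /x2 /x3 /x4; ring.
  have B (x d : R) : `|x| <= e -> `|d| <= C * h -> - (e * (C * h)) <= x * d.
    move=> hx hd; have : `|x * d| <= e * (C * h) by rewrite normrM ler_pM.
    by rewrite ler_norml => /andP[].
  have b1 := B _ _ e1 c2; have b2 := B _ _ e2 c2.
  have b3 := B _ _ e3 c3; have b4 := B _ _ e4 c3.
  have q0 : 0 <= f1 g ^+ 2 + f2 g ^+ 2 by rewrite addr_ge0 ?sqr_ge0.
  have b5 := ler_wpM2l q0 c1.
  have t0 : 0 <= 2 * tau / h by rewrite divr_ge0 // mulr_ge0 // ltW.
  have := ler_wpM2l t0 (lerD b5 (lerD (lerD (lerD b1 b2) b3) b4)).
  apply: le_trans.
  rewrite le_eqVlt; apply/orP; left; apply/eqP; field; by rewrite gt_eqF.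
have HX : k * X <= P + S' + C2 * tau ^+ 2 * F.
  rewrite /X /P /S' /F !mulr_sumr -!big_split /=; apply: ler_sum => g _.
  have [Ag|nAg] := boolP (A g).
    by have [a1 a2 a3 a4 a5] := Hb g Ag; exact: conj_op_elliptic.
  have [[-> -> -> ->] [-> ->]] := HA g nAg.
  rewrite !expr0n /= !addr0 !mulr0 addr0.
  by rewrite !addr_ge0 ?sqr_ge0.
have J1 : - J <= L * (tau * F + tau^-1 * X).
  by apply: le_trans HJ; rewrite -normrN ler_norm.
have tX : tau^-1 * X <= X.
  by rewrite ler_piMl // invf_le1.
have N0 : 0 <= e * N.
  rewrite /N; case: (pickP (fun _ : G => true)) => [g _|em].
    have [+ _ _ _] := He g => /(le_trans (normr_ge0 _)) e0.
    by apply: mulr_ge0.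
  by rewrite (eq_card0 em) mulr0.
have TF0 : 0 <= tau * F by rewrite mulr_ge0 // ltW.
have EN0 : 0 <= tau * C * (e * N).
  by apply: mulr_ge0 => //; apply: mulr_ge0; exact: ltW.
have TTF : tau * F <= tau ^+ 2 * F.
  by rewrite ler_wpM2r // expr2 ler_peMl // ltW.
clearbody P F X S' J N k C2.
have m1 : 4 * L * (tau * F) <= g0 * (tau * F) by exact: ler_wpM2r.
have m2 : 8 * L * X <= k * X by exact: ler_wpM2r.
have m3 : L * (tau^-1 * X) <= L * X by exact: ler_wpM2l.
have HX2 : k * X <= 4 * P + 2 * (C2 + g0) * tau ^+ 2 * F + 16 * tau * C * e * N.
  have m4 : 0 <= g0 * (tau ^+ 2 * F).
    by apply: mulr_ge0; [exact: ltW | apply: mulr_ge0 => //; exact: sqr_ge0].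
  have m5 : g0 * (tau * F) <= g0 * (tau ^+ 2 * F) by apply: ler_wpM2l => //; exact: ltW.
  have m6 : 0 <= g0 * (tau * F) by apply: mulr_ge0 => //; exact: ltW.
  move: HC HX J1 m1 m2 m3 m4 m5 m6 EN0 P0; set it := tau^-1; set t2 := tau ^+ 2 => *; lra.
split => //.
have it0 : 0 <= tau^-1 by rewrite invr_ge0 ltW.
have n1 : 8 * L * (tau^-1 * X) <= tau^-1 * (k * X).
  by rewrite (_ : tau^-1 * (k * X) = k * (tau^-1 * X)); [rewrite ler_wpM2r // mulr_ge0|ring].
have n2 : k * (L * (tau^-1 * X)) <=
   L * tau^-1 * (4 * P + 16 * tau * C * e * N) + 2 * (C2 + g0) * L * (tau * F).
  have := ler_wpM2l (mulr_ge0 L0 it0) HX2.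
  have -> : L / tau * (4 * P + 2 * (C2 + g0) * tau ^+ 2 * F + 16 * tau * C * e * N)
     = L * tau^-1 * (4 * P + 16 * tau * C * e * N) + 2 * (C2 + g0) * L * (tau * F) * (tau * tau^-1).
    by ring.
  rewrite divff ?gt_eqF // mulr1.
  by apply: le_trans; rewrite le_eqVlt; apply/orP; left; apply/eqP; ring.
have q : 0 <= 4 * P + 16 * tau * C * e * N.
  rewrite (_ : 16 * tau * C * e * N = 16 * (tau * C * (e * N))); last by ring.
  by apply: addr_ge0; apply: mulr_ge0.
have n3 : L * tau^-1 * (4 * P + 16 * tau * C * e * N) <= L * (4 * P + 16 * tau * C * e * N).
  by apply: ler_wpM2r => //; rewrite ler_piMr // invf_le1.
have n4 : 8 * L * (4 * P + 16 * tau * C * e * N) <= k * (4 * P + 16 * tau * C * e * N).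
  exact: ler_wpM2r.
have n5 : 8 * (C2 + g0) * L * (tau * F) <= k * g0 * (tau * F) by exact: ler_wpM2r.
have n6 : k * (L * (tau^-1 * X)) <= k * ((4 * P + 16 * tau * C * e * N) / 8 + g0 / 4 * (tau * F)).
  by clear HC HX HX2 J1 m1 m2 m3 n1 HJ tX TTF HL1 HL2 HL3 it0; lra.
rewrite ler_pM2l // in n6.
have := HC; lra.
Qed.

End Conjugated.
End Lattice.

Section C11.
Variable R : realType.

Lemma expR_taylor1 (M d : R) : `|d| <= M ->
  `|expR d - 1 - d| <= (2 + 4 * (expR M + 1 + M)) * d ^+ 2.
Proof.
move=> dM; have M0 : 0 <= M := le_trans (normr_ge0 d) dM.
have eM : 0 < expR M := expR_gt0 M.
have d2 : 0 <= d ^+ 2 := sqr_ge0 d.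
have lo : 0 <= expR d - 1 - d by have := expR_ge1Dx d; lra.
rewrite ger0_norm //.
have [d12|d12] := lerP `|d| (1 / 2).
  have : expR d * (1 - d) <= 1.
    rewrite -[leRHS](expRxMexpNx_1 d).
    rewrite ler_pM2l ?expR_gt0 //; exact: expR_ge1Dx.
  move: d12; rewrite ler_norml => /andP[a b] q.
  have d1 : 0 < 1 - d by lra.
  have : expR d - 1 - d <= 2 * d ^+ 2.
    rewrite -(ler_pM2r d1); apply: (@le_trans _ _ (d ^+ 2)); first nra.
    by nra.
  have : 0 <= 4 * (expR M + 1 + M) * d ^+ 2 by apply: mulr_ge0 => //; lra.
  lra.
have ed : expR d <= expR M.
  by rewrite ler_expR; apply: le_trans dM; exact: ler_norm.
have : 1 / 4 <= d ^+ 2.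
  rewrite -[d ^+ 2]real_normK ?num_real //; nra.
have dm : - M <= d by move: dM; rewrite ler_norml => /andP[].
have : 0 <= 2 * d ^+ 2 by lra.
have X : 0 <= expR M + 1 + M by lra.
move=> h1 h2; have := ler_wpM2l X h2; lra.
Qed.

Definition dom2 (p : R * R) := (`|p.1| <= 2) && (`|p.2| <= 2).

(* [sh] is a translation flow, below always along a coordinate axis. *)
Definition c11 (sh : R * R -> R -> R * R) (f f' : R * R -> R) :=
  exists2 M : R, 0 <= M & forall p t, `|t| <= 4 -> dom2 p -> dom2 (sh p t) ->
    [/\ `|f p| <= M, `|f' p| <= M & `|f (sh p t) - f p - t * f' p| <= M * t ^+ 2].

Variable sh : R * R -> R -> R * R.

Lemma c11_incr (f f' : R * R -> R) (M t : R) p : 0 <= M -> `|t| <= 4 -> `|f' p| <= M ->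
  `|f (sh p t) - f p - t * f' p| <= M * t ^+ 2 ->
  `|f (sh p t) - f p| <= 5 * M * `|t|.
Proof.
move=> M0 t4 hf' hr.
have -> : f (sh p t) - f p = (f (sh p t) - f p - t * f' p) + t * f' p by ring.
apply: le_trans (ler_normD _ _) _; rewrite normrM.
have t0 := normr_ge0 t.
have : `|t| * `|f' p| <= `|t| * M by rewrite ler_wpM2l.
have : M * t ^+ 2 <= 4 * M * `|t|.
  rewrite -(real_normK (num_real t)) expr2 mulrA -(mulrC `|t|) mulrA.
  rewrite ler_wpM2r // mulrC mulrC; nra.
lra.
Qed.

Lemma c11_const (c : R) : c11 sh (fun=> c) (fun=> 0).
Proof.
exists `|c| => // p t _ _ _; split => //; first by rewrite normr0.
by rewrite subrr mulr0 subr0 normr0 mulr_ge0 ?sqr_ge0.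
Qed.

Lemma c11D f f' g g' : c11 sh f f' -> c11 sh g g' ->
  c11 sh (fun p => f p + g p) (fun p => f' p + g' p).
Proof.
move=> [M M0 hM] [N N0 hN]; exists (M + N) => [|p t t4 dp dq]; first exact: addr_ge0.
have [a1 a2 a3] := hM _ _ t4 dp dq; have [b1 b2 b3] := hN _ _ t4 dp dq.
split.
- exact: le_trans (ler_normD _ _) (lerD a1 b1).
- exact: le_trans (ler_normD _ _) (lerD a2 b2).
- have -> : f (sh p t) + g (sh p t) - (f p + g p) - t * (f' p + g' p) =
    (f (sh p t) - f p - t * f' p) + (g (sh p t) - g p - t * g' p) by ring.
  by rewrite mulrDl; exact: le_trans (ler_normD _ _) (lerD a3 b3).
Qed.

Lemma c11M f f' g g' : c11 sh f f' -> c11 sh g g' ->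
  c11 sh (fun p => f p * g p) (fun p => f' p * g p + f p * g' p).
Proof.
move=> [M M0 hM] [N N0 hN]; exists (27 * (M * N)) => [|p t t4 dp dq].
  by rewrite !mulr_ge0.
have [a1 a2 a3] := hM _ _ t4 dp dq; have [b1 b2 b3] := hN _ _ t4 dp dq.
have MN : 0 <= M * N by rewrite mulr_ge0.
have ia := c11_incr M0 t4 a2 a3; have ib := c11_incr N0 t4 b2 b3.
have t0 := normr_ge0 t.
split.
- rewrite normrM; apply: (@le_trans _ _ (M * N)); [exact: ler_pM | lra].
- apply: le_trans (ler_normD _ _) _; rewrite !normrM.
  have : `|f' p| * `|g p| <= M * N by exact: ler_pM.
  have : `|f p| * `|g' p| <= M * N by exact: ler_pM.
  lra.
- have -> : f (sh p t) * g (sh p t) - f p * g p - t * (f' p * g p + f p * g' p) =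
    (f (sh p t) - f p) * (g (sh p t) - g p) + f p * (g (sh p t) - g p - t * g' p)
    + g p * (f (sh p t) - f p - t * f' p) by ring.
  apply: le_trans (ler_normD _ _) _.
  apply: le_trans (lerD (ler_normD _ _) (lexx _)) _; rewrite !normrM.
  have l1 := ler_pM (normr_ge0 _) (normr_ge0 _) ia ib.
  have l2 := ler_pM (normr_ge0 _) (normr_ge0 _) a1 b3.
  have l3 := ler_pM (normr_ge0 _) (normr_ge0 _) b1 a3.
  have e : `|t| * `|t| = t ^+ 2 by rewrite -(real_normK (num_real t)) expr2.
  have e' : 5 * M * `|t| * (5 * N * `|t|) = 25 * (M * N) * t ^+ 2.
    by rewrite -e; ring.
  rewrite e' in l1; apply: le_trans (lerD (lerD l1 l2) l3) _.
  rewrite le_eqVlt; apply/orP; left; apply/eqP; ring.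
Qed.

Lemma c11_comp (f f' : R * R -> R) (psi psi' : R -> R) :
  (forall M, exists K, 0 <= K /\ forall a b, `|a| <= M -> `|b| <= M ->
     [/\ `|psi a| <= K, `|psi' a| <= K &
       `|psi b - psi a - (b - a) * psi' a| <= K * (b - a) ^+ 2]) ->
  c11 sh f f' -> c11 sh (fun p => psi (f p)) (fun p => f' p * psi' (f p)).
Proof.
move=> Hpsi [M M0 hM]; have [K [K0 hK]] := Hpsi (21 * M).
exists (K + M * K + 25 * (M ^+ 2 * K)) => [|p t t4 dp dq].
  by rewrite !addr_ge0 // !mulr_ge0 // sqr_ge0.
have [a1 a2 a3] := hM _ _ t4 dp dq.
have i := c11_incr M0 t4 a2 a3.
have t0 := normr_ge0 t.
have q1 : 0 <= M * K by rewrite mulr_ge0.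
have q2 : 0 <= M ^+ 2 * K by rewrite mulr_ge0 ?sqr_ge0.
have f1 : `|f p| <= 21 * M by lra.
have f2 : `|f (sh p t)| <= 21 * M.
  have -> : f (sh p t) = f p + (f (sh p t) - f p) by ring.
  apply: le_trans (ler_normD _ _) _; nra.
have [b1 b2 b3] := hK _ _ f1 f2.
split.
- by lra.
- rewrite normrM.
  have : `|f' p| * `|psi' (f p)| <= M * K by exact: ler_pM.
  lra.
- have -> : psi (f (sh p t)) - psi (f p) - t * (f' p * psi' (f p)) =
     (psi (f (sh p t)) - psi (f p) - (f (sh p t) - f p) * psi' (f p)) +
     (f (sh p t) - f p - t * f' p) * psi' (f p) by ring.
  apply: le_trans (ler_normD _ _) _; rewrite normrM.
  have l1 : `|f (sh p t) - f p - t * f' p| * `|psi' (f p)| <= M * t ^+ 2 * K.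
    exact: ler_pM.
  have l2 : (f (sh p t) - f p) ^+ 2 <= 25 * M ^+ 2 * t ^+ 2.
    rewrite -(real_normK (num_real (f (sh p t) - f p))) -(real_normK (num_real t)).
    have -> : 25 * M ^+ 2 * `|t| ^+ 2 = (5 * M * `|t|) ^+ 2 by ring.
    by rewrite lerXn2r // nnegrE // !mulr_ge0.
  have l3 := ler_wpM2l K0 l2.
  have t2 : 0 <= K * t ^+ 2 by rewrite mulr_ge0 ?sqr_ge0.
  apply: le_trans (lerD b3 l1) _; lra.
Qed.

Lemma c11_expR f f' : c11 sh f f' ->
  c11 sh (fun p => expR (f p)) (fun p => f' p * expR (f p)).
Proof.
apply: c11_comp => M.
have [M0|M0] := lerP 0 M; last first.
  exists 0; split=> // a b /(le_trans (normr_ge0 _)) a0.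
  by move: (le_lt_trans a0 M0); rewrite ltxx.
have eM := expR_gt0 M.
pose c := 2 + 4 * (expR (2 * M) + 1 + 2 * M).
have c0 : 2 <= c by rewrite /c; have := expR_gt0 (2 * M); lra.
exists (expR M * c); split; first by apply: mulr_ge0; lra.
move=> a b aM bM.
have ea : expR a <= expR M by rewrite ler_expR; exact: le_trans (ler_norm _) aM.
have ea0 := expR_gt0 a.
have ec : expR M <= expR M * c by rewrite ler_peMr; lra.
split; rewrite ?(gtr0_norm ea0); [lra|lra|].
have -> : expR b - expR a - (b - a) * expR a =
    expR a * (expR (b - a) - 1 - (b - a)).
  rewrite [in LHS](_ : b = a + (b - a)) ?expRD; last by ring.
  rewrite (_ : a + (b - a) - a = b - a); ring.
rewrite normrM (gtr0_norm ea0) -mulrA.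
apply: ler_pM => //; first exact: ltW.
apply: expR_taylor1; apply: le_trans (ler_normB _ _) _; lra.
Qed.

Lemma c11_pos_sqr f f' : c11 sh f f' ->
  c11 sh (fun p => Num.max 0 (f p) ^+ 2) (fun p => f' p * (2 * Num.max 0 (f p))).
Proof.
apply: (@c11_comp f f' (fun a => Num.max 0 a ^+ 2) (fun a => 2 * Num.max 0 a)) => M.
have [M0|M0] := lerP 0 M; last first.
  exists 0; split=> // a b /(le_trans (normr_ge0 _)) a0.
  by move: (le_lt_trans a0 M0); rewrite ltxx.
exists (M ^+ 2 + 2 * M + 1); split; first nra.
move=> a b; rewrite 2!ler_norml => /andP[a1 a2] /andP[b1 b2].
have MM := sqr_ge0 M.
have K1 : (b - a) ^+ 2 <= (M ^+ 2 + 2 * M + 1) * (b - a) ^+ 2.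
  by rewrite ler_peMl ?sqr_ge0 //; lra.
have [a0|a0] := lerP 0 a; rewrite ?expr0n /=; split.
- rewrite ger0_norm ?sqr_ge0 //; nra.
- rewrite ger0_norm; lra.
- apply: le_trans K1; have [b0|b0] := lerP 0 b; rewrite ?expr0n /= ler_norml; have := sqr_ge0 (b - a); have := sqr_ge0 a => s1 s2;
  [|have ab : 0 <= a * - b by rewrite mulr_ge0 //; lra]; apply/andP; split; nra.
- rewrite normr0; lra.
- rewrite mulr0 normr0; lra.
- apply: le_trans K1; have [b0|b0] := lerP 0 b; rewrite ?expr0n /= ler_norml; have := sqr_ge0 (b - a) => s1;
  [have ab : 0 <= b * - a by rewrite mulr_ge0 //; lra|]; apply/andP; split; nra.
Qed.

End C11.

Section Plane.
Variable R : realType.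
Implicit Types (p q e : R * R) (h : R).

Definition she e p (t : R) : R * R := (p.1 + t * e.1, p.2 + t * e.2).
Definition e1 : R * R := (1, 0).
Definition e2 : R * R := (0, 1).

Definition dd e h (f : R * R -> R) p := (f (she e p h) - f (she e p (- h))) / (2 * h).

Definition sqn p : R := p.1 ^+ 2 + p.2 ^+ 2.

Definition lip2 (D : R * R -> bool) (L : R) (f : R * R -> R) :=
  forall p q, D p -> D q -> `|f p - f q| <= L * (`|p.1 - q.1| + `|p.2 - q.2|).

Definition inner p := (`|p.1| <= 3 / 2) && (`|p.2| <= 3 / 2).
Definition outer p := (5 / 4 <= `|p.1|) || (5 / 4 <= `|p.2|).

Section Grid.
Variable n : nat.
Definition step : R := 4 / n.+1%:R.
Definition grid : finType := ('I_n.+2 * 'I_n.+2)%type.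
Definition pt (g : grid) : R * R := (- 2 + step * g.1%:R, - 2 + step * g.2%:R).
Definition sa (g : grid) : grid := (ordS g.1, g.2).
Definition sa' (g : grid) : grid := (ord_pred g.1, g.2).
Definition sb (g : grid) : grid := (g.1, ordS g.2).
Definition sb' (g : grid) : grid := (g.1, ord_pred g.2).

Lemma saK : cancel sa sa'. Proof. by case=> i j; rewrite /sa /sa' /= ordSK. Qed.
Lemma sa'K : cancel sa' sa. Proof. by case=> i j; rewrite /sa /sa' /= ord_predK. Qed.
Lemma sbK : cancel sb sb'. Proof. by case=> i j; rewrite /sb /sb' /= ordSK. Qed.
Lemma sb'K : cancel sb' sb. Proof. by case=> i j; rewrite /sb /sb' /= ord_predK. Qed.
Lemma sabC g : sa (sb g) = sb (sa g). Proof. by []. Qed.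

Lemma step_gt0 : 0 < step.
Proof. by rewrite divr_gt0 // ltr0n. Qed.

Lemma step_last : - 2 + step * n.+1%:R = 2.
Proof. by rewrite /step divfK ?pnatr_eq0 //; lra. Qed.

Lemma coord_ordS (i : 'I_n.+2) :
  - 2 + step * (ordS i)%:R = (- 2 + step * i%:R) + step \/
  (- 2 + step * i%:R = 2 /\ - 2 + step * (ordS i)%:R = - 2).
Proof.
rewrite /=; have := ltn_ord i; rewrite ltnS leq_eqVlt => /orP[/eqP ->|lt].
  right; rewrite modnn mulr0 addr0; split=> //; exact: step_last.
by left; rewrite modn_small ?ltnS // -[i.+1%:R]natr1 mulrDr mulr1 addrA.
Qed.

Lemma coord_ord_pred (i : 'I_n.+2) :
  - 2 + step * (ord_pred i)%:R = (- 2 + step * i%:R) - step \/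
  (- 2 + step * i%:R = - 2 /\ - 2 + step * (ord_pred i)%:R = 2).
Proof.
have := coord_ordS (ord_pred i); rewrite ord_predK => -[->|[-> ->]]; last by right.
by left; ring.
Qed.

Hypothesis step_small : step <= 1 / 4.

Let bnd (x y : R) : x = y + step \/ x = y - step -> 3 / 2 < `|y| -> 5 / 4 <= `|x|.
Proof.
have s0 := step_gt0; have ss := step_small; move=> H.
rewrite ltr_normr ler_normr => /orP[|] y3; apply/orP; case: H => ->.
by left; lra.
by left; lra.
by right; lra.
by right; lra.
Qed.

Lemma pt_inner g : inner (pt g) ->
  [/\ pt (sa g) = she e1 (pt g) step, pt (sa' g) = she e1 (pt g) (- step),
      pt (sb g) = she e2 (pt g) step & pt (sb' g) = she e2 (pt g) (- step)].
Proof.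
case: g => i j /andP[/= hi hj]; rewrite /pt /she /= !mulr1 !mulr0 !addr0.
have n2 (x : R) : `|x| <= 3 / 2 -> x = 2 \/ x = - 2 -> False.
  by move=> + [E|E]; rewrite E ?normrN ger0_norm; lra.
split.
- by case: (coord_ordS i) => [->//|[E _]]; case: (n2 _ hi); left.
- by case: (coord_ord_pred i) => [->//|[E _]]; case: (n2 _ hi); right.
- by case: (coord_ordS j) => [->//|[E _]]; case: (n2 _ hj); left.
- by case: (coord_ord_pred j) => [->//|[E _]]; case: (n2 _ hj); right.
Qed.

Lemma pt_not_inner g : ~~ inner (pt g) ->
  [/\ outer (pt g), outer (pt (sa g)), outer (pt (sa' g)), outer (pt (sb g))
    & outer (pt (sb' g))].
Proof.
case: g => i j; rewrite /inner negb_and -!ltNge /outer /= => H.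
have two : 5 / 4 <= `|2 : R| /\ 5 / 4 <= `|- 2 : R|.
  by rewrite normrN ger0_norm; lra.
have l (x : R) : 3 / 2 < x -> 5 / 4 <= x by lra.
case/orP: H => [h1|h1]; (split; apply/orP).
- by left; exact: l.
- left; case: (coord_ordS i) => [E|[_ ->]]; last by case: two.
  by apply: bnd h1; left.
- left; case: (coord_ord_pred i) => [E|[_ ->]]; last by case: two.
  by apply: bnd h1; right.
- by left; exact: l.
- by left; exact: l.
- by right; exact: l.
- by right; exact: l.
- by right; exact: l.
- right; case: (coord_ordS j) => [E|[_ ->]]; last by case: two.
  by apply: bnd h1; left.
- right; case: (coord_ord_pred j) => [E|[_ ->]]; last by case: two.
  by apply: bnd h1; right.
Qed.

End Grid.

Section Weight.
Variables (eta tau : R).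

Definition ph1 p : R := - 4 * p.1 * (1 + 4 * eta - sqn p).
Definition ph2 p : R := - 4 * p.2 * (1 + 4 * eta - sqn p).
Definition cut p : R := Num.max 0 (1 + 3 * eta - sqn p).
Definition wexp p : R := expR (tau * (1 + 4 * eta - sqn p) ^+ 2).
Definition weight p : R := cut p ^+ 2 * wexp p.
Definition dweight e p : R :=
  e.1 * (tau * ph1 p * weight p - 4 * p.1 * cut p * wexp p) +
  e.2 * (tau * ph2 p * weight p - 4 * p.2 * cut p * wexp p).

Lemma c11_weight e : c11 (she e) weight (dweight e).
Proof.
have C1 : c11 (she e) (fun p => p.1) (fun=> e.1).
  exists (2 + `|e.1|) => [|p t _ /andP[d1 _] _]; first exact: addr_ge0.
  split; [by have := normr_ge0 e.1; lra|lra|].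
  have -> : (she e p t).1 - p.1 - t * e.1 = 0 by rewrite /she /=; ring.
  by rewrite normr0 mulr_ge0 ?sqr_ge0 // addr_ge0.
have C2 : c11 (she e) (fun p => p.2) (fun=> e.2).
  exists (2 + `|e.2|) => [|p t _ /andP[_ d1] _]; first exact: addr_ge0.
  split; [by have := normr_ge0 e.2; lra|lra|].
  have -> : (she e p t).2 - p.2 - t * e.2 = 0 by rewrite /she /=; ring.
  by rewrite normr0 mulr_ge0 ?sqr_ge0 // addr_ge0.
have CS := c11D (c11M C1 C1) (c11M C2 C2).
have CK c := c11D (c11_const (she e) c) (c11M (c11_const (she e) (-1)) CS).
have CW := c11M (c11_pos_sqr (CK (1 + 3 * eta)))
  (c11_expR (c11M (c11_const (she e) tau) (c11M (CK (1 + 4 * eta)) (CK (1 + 4 * eta))))).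
case: CW => M M0 HM; exists M => // p t t4 dp dq.
have Em q : Num.max 0 (1 + 3 * eta + -1 * (q.1 * q.1 + q.2 * q.2)) = cut q.
  by rewrite /cut /sqn; congr Num.max; ring.
have Ee q : expR (tau * ((1 + 4 * eta + -1 * (q.1 * q.1 + q.2 * q.2)) *
    (1 + 4 * eta + -1 * (q.1 * q.1 + q.2 * q.2)))) = wexp q.
  by rewrite /wexp /sqn; congr expR; ring.
have [] := HM p t t4 dp dq; rewrite !Em !Ee => a b c; split.
- by [].
- apply: le_trans b; rewrite le_eqVlt; apply/orP; left; apply/eqP; congr `|_|.
  by rewrite /dweight /weight /ph1 /ph2 /sqn; ring.
- apply: le_trans c; rewrite le_eqVlt; apply/orP; left; apply/eqP; congr `|_|.
  by rewrite /dweight /weight /ph1 /ph2 /sqn; ring.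
Qed.

End Weight.
End Plane.

Tactic Notation "lra_from" hyp_list(hs) := clear - hs; lra.

Section Single.
Variable R : realType.
Implicit Types (p q e : R * R) (h : R).

Lemma ler_norm_sqr (x c : R) : `|x| <= c -> x ^+ 2 <= c ^+ 2.
Proof.
move=> hx; rewrite -(real_normK (num_real x)) lerXn2r // nnegrE.
exact: le_trans hx.
Qed.

Lemma sqr_normE (x : R) : `|x| ^+ 2 = x ^+ 2.
Proof. exact: real_normK (num_real x). Qed.

Lemma normr_bound (x c : R) : - c <= x -> x <= c -> `|x| <= c.
Proof. by move=> a b; rewrite ler_norml a b. Qed.

Lemma weighted_sum3 (K a b c x y z : R) : 0 <= x -> 0 <= y -> 0 <= z ->
  a <= K -> b <= K -> c <= K -> a * x + b * y + c * z <= K * (x + y + z).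
Proof.
move=> x0 y0 z0 aK bK cK.
have := ler_wpM2r x0 aK; have := ler_wpM2r y0 bK; have := ler_wpM2r z0 cK; lra.
Qed.

Lemma inner_she p e t : inner p -> `|t| <= 1 / 4 -> `|e.1| <= 1 -> `|e.2| <= 1 ->
  dom2 (she e p t).
Proof.
move=> /andP[h1 h2] t4 a b; apply/andP; split.
  apply: le_trans (ler_normD _ _) _; rewrite normrM.
  have : `|t| * `|e.1| <= 1 / 4 * 1 by exact: ler_pM.
  lra.
apply: le_trans (ler_normD _ _) _; rewrite normrM.
have : `|t| * `|e.2| <= 1 / 4 * 1 by exact: ler_pM.
lra.
Qed.

Lemma inner_dom2 p : inner p -> dom2 p.
Proof. by case/andP => a b; apply/andP; split; lra. Qed.

Lemma unit_e1 : `|(e1 R).1| <= 1 /\ `|(e1 R).2| <= 1.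
Proof. by rewrite /= normr1 normr0. Qed.
Lemma unit_e2 : `|(e2 R).1| <= 1 /\ `|(e2 R).2| <= 1.
Proof. by rewrite /= normr1 normr0. Qed.

Lemma lip2_she (D : R * R -> bool) (L : R) (f : R * R -> R) e p t :
  lip2 D L f -> 0 <= L -> D p -> D (she e p t) -> `|e.1| + `|e.2| <= 1 ->
  `|f (she e p t) - f p| <= L * `|t|.
Proof.
move=> lf L0 dp dq eb; apply: le_trans (lf _ _ dq dp) _; rewrite ler_wpM2l //.
rewrite /she /= [p.1 + _]addrC [p.2 + _]addrC !addrK !normrM -mulrDr.
by rewrite ler_piMr.
Qed.

Lemma dd_c11_mul (E E' z : R * R -> R) (M L B h : R) e p :
  (forall p t, `|t| <= 4 -> dom2 p -> dom2 (she e p t) ->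
    [/\ `|E p| <= M, `|E' p| <= M & `|E (she e p t) - E p - t * E' p| <= M * t ^+ 2]) ->
  0 <= M -> 0 <= L -> `|e.1| + `|e.2| <= 1 ->
  lip2 (@dom2 R) L z -> (forall p, dom2 p -> `|z p| <= B) -> 0 < h -> h <= 1 / 4 -> inner p ->
  `|dd e h (fun p => E p * z p) p - (E p * dd e h z p + E' p * z p)| <= M * (L + B) * h.
Proof.
move=> HE M0 L0 eb lz bz h0 h4 ip.
have n1 : `|e.1| <= 1 by have := normr_ge0 e.2; lra.
have n2 : `|e.2| <= 1 by have := normr_ge0 e.1; lra.
have hn : `|h| = h by rewrite gtr0_norm.
have hn' : `|- h| = h by rewrite normrN gtr0_norm.
have dp := inner_dom2 ip.
have d1 : dom2 (she e p h) by apply: inner_she => //; rewrite hn.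
have d2 : dom2 (she e p (- h)) by apply: inner_she => //; rewrite hn'.
have [_ b1 b2] := HE p h ltac:(rewrite hn; lra) dp d1.
have [_ _ b3] := HE p (- h) ltac:(rewrite hn'; lra) dp d2.
have l1 := lip2_she lz L0 dp d1 eb; have l2 := lip2_she lz L0 dp d2 eb.
have B0 : 0 <= B := le_trans (normr_ge0 _) (bz p dp).
rewrite hn in l1; rewrite hn' in l2.
set r1 := _ - h * E' p in b2; set r2 := _ - (- h) * E' p in b3.
have -> : dd e h (fun p => E p * z p) p - (E p * dd e h z p + E' p * z p) =
   (h * E' p * ((z (she e p h) - z p) + (z (she e p (- h)) - z p))
    + (r1 * z (she e p h) - r2 * z (she e p (- h)))) / (2 * h).
  rewrite /dd /r1 /r2; field; by rewrite gt_eqF.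
rewrite normrM normfV (gtr0_norm (x := 2 * h)); last by lra.
rewrite ler_pdivrMr; last by lra.
apply: le_trans (ler_normD _ _) _; rewrite !normrM hn.
have c1 : h * `|E' p| * `|(z (she e p h) - z p) + (z (she e p (- h)) - z p)|
   <= h * M * (L * h + L * h).
  apply: ler_pM => //; [by rewrite mulr_ge0 // ltW|by rewrite ler_wpM2l // ltW|].
  exact: le_trans (ler_normD _ _) (lerD l1 l2).
have c2 : `|r1 * z (she e p h) - r2 * z (she e p (- h))| <= M * h ^+ 2 * B + M * h ^+ 2 * B.
  apply: le_trans (ler_normB _ _) _; rewrite !normrM.
  rewrite sqrrN in b3.
  by apply: lerD; apply: ler_pM => //; exact: bz.
apply: le_trans (lerD c1 c2) _; rewrite le_eqVlt; apply/orP; left; apply/eqP; ring.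
Qed.

Lemma convexity_incr (C k lam h eta x y a b a1 a2 b2 : R) :
  1 <= C -> 0 <= lam -> 0 < h -> h <= 1 / 4 -> 0 < eta -> eta <= 1 / 12 ->
  `|x| <= 3 / 2 -> `|y| <= 3 / 2 -> 1 <= x ^+ 2 + y ^+ 2 ->
  x ^+ 2 + y ^+ 2 <= 1 + 3 * eta ->
  `|a| <= C -> `|b| <= C -> `|a2| <= C -> `|b2| <= C ->
  `|a1 - a| <= lam * h -> `|a2 - a| <= lam * h -> `|b2 - b| <= lam * h ->
  k * (x ^+ 2 + y ^+ 2) <= (x - a * y) ^+ 2 + (b * y) ^+ 2 -> 0 < k ->
  4 * eta * (1 + 2 * C ^+ 2) <= k ->
  let P1 (x y : R) := - 4 * x * (1 + 4 * eta - (x ^+ 2 + y ^+ 2)) in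
  let P2 (x y : R) := - 4 * y * (1 + 4 * eta - (x ^+ 2 + y ^+ 2)) in
  let d1 := (P1 (x + h) y - a1 * P2 (x + h) y) - (P1 x y - a * P2 x y) in
  let d2 := (b2 ^+ 2 * P2 x (y + h) - a2 * (P1 x (y + h) - a2 * P2 x (y + h)))
            - (b ^+ 2 * P2 x y - a * (P1 x y - a * P2 x y)) in
  [/\ 4 * k * h - 1000 * C ^+ 2 * h * (h + lam) <= d1 + d2,
      `|d1| <= 1000 * C ^+ 2 * h * (1 + lam) & `|d2| <= 1000 * C ^+ 2 * h * (1 + lam)].
Proof.
move=> C1 lam0 h0 h4 eta0 eta12 hx hy s1 s2 ha hb ha2 hb2 ha1 ha2' hb2' hk k0 hek P1 P2 d1 d2.
pose D := 1 + 4 * eta - (x ^+ 2 + y ^+ 2).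
have D0 : 0 <= D by rewrite /D; lra_from s2 eta0.
have D4 : D <= 4 * eta by rewrite /D; lra_from s1.
pose u1 := 12 * x * h ^+ 2 + 4 * h ^+ 3.
pose u2 := 4 * y * h ^+ 2.
pose v1 := 4 * x * h ^+ 2.
pose v2 := 12 * y * h ^+ 2 + 4 * h ^+ 3.
pose A11 := 8 * x ^+ 2 - 4 * D; pose A12 := 8 * x * y; pose A22 := 8 * y ^+ 2 - 4 * D.
have h2 : 0 <= h ^+ 2 := sqr_ge0 h.
have H0 : 0 <= h by exact: ltW.
have h3 : 0 <= h ^+ 3 by rewrite exprn_ge0.
have h3' : h ^+ 3 <= h ^+ 2 / 4.
  rewrite exprS mulrC; have := ler_wpM2l h2 h4; set q := h ^+ 2; lra_from D.
have hlx := hx; rewrite ler_norml in hlx; case/andP: hlx => x1 x2.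
have hly := hy; rewrite ler_norml in hly; case/andP: hly => y1 y2.
have xx : x ^+ 2 <= 9 / 4 by have := ler_norm_sqr hx; lra_from D.
have yy : y ^+ 2 <= 9 / 4 by have := ler_norm_sqr hy; lra_from D.
have x20 := sqr_ge0 x; have y20 := sqr_ge0 y.
have xh1 := ler_wpM2r h2 x1; have xh2 := ler_wpM2r h2 x2.
have yh1 := ler_wpM2r h2 y1; have yh2 := ler_wpM2r h2 y2.
have bu1 : `|u1| <= 22 * h ^+ 2.
  by apply: normr_bound; rewrite /u1; lra_from xh1 xh2 h3 h3' h2.
have bu2 : `|u2| <= 22 * h ^+ 2.
  by apply: normr_bound; rewrite /u2; lra_from yh1 yh2 h2.
have bv1 : `|v1| <= 22 * h ^+ 2.
  by apply: normr_bound; rewrite /v1; lra_from xh1 xh2 h2.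
have bv2 : `|v2| <= 22 * h ^+ 2.
  by apply: normr_bound; rewrite /v2; lra_from yh1 yh2 h3 h3' h2.
have bA11 : `|A11| <= 20.
  by apply: normr_bound; rewrite /A11; lra_from xx x20 D0 D4 eta12.
have bA22 : `|A22| <= 20.
  by apply: normr_bound; rewrite /A22; lra_from yy y20 D0 D4 eta12.
have bA12 : `|A12| <= 20.
  rewrite /A12 !normrM ger0_norm //; have := ler_pM (normr_ge0 _) (normr_ge0 _) hx hy.
  by lra_from D.
have dP s t : `|s| <= 2 -> `|t| <= 2 -> `|P1 s t| <= 64 /\ `|P2 s t| <= 64.
  move=> hs ht; have s4 := ler_norm_sqr hs; have t4 := ler_norm_sqr ht.
  have s0 := sqr_ge0 s; have t0 := sqr_ge0 t.
  have q : `|1 + 4 * eta - (s ^+ 2 + t ^+ 2)| <= 8.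
    by apply: normr_bound; lra_from s4 t4 s0 t0 eta0 eta12.
  rewrite /P1 /P2 !normrM normrN [`|4|]ger0_norm //; split.
    by have := ler_pM (normr_ge0 _) (normr_ge0 _) hs q; lra_from D.
  by have := ler_pM (normr_ge0 _) (normr_ge0 _) ht q; lra_from D.
have xh : `|x + h| <= 2 by apply: normr_bound; lra_from x1 x2 h0 h4.
have yh : `|y + h| <= 2 by apply: normr_bound; lra_from y1 y2 h0 h4.
have x2' : `|x| <= 2 by lra_from hx.
have y2' : `|y| <= 2 by lra_from hy.
have [p1a p2a] := dP _ _ xh y2'; have [p1b p2b] := dP _ _ x2' yh.
have E1 : d1 = h * (A11 - a * A12) + (u1 - a * u2 - (a1 - a) * P2 (x + h) y).
  by rewrite /d1 /A11 /A12 /u1 /u2 /P1 /P2 /D; ring.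
have E2 : d2 = h * ((a ^+ 2 + b ^+ 2) * A22 - a * A12) +
  ((a ^+ 2 + b ^+ 2) * v2 - a * v1 - (a2 - a) * P1 x (y + h)
   + ((b2 + b) * (b2 - b) + (a2 + a) * (a2 - a)) * P2 x (y + h)).
  by rewrite /d2 /A22 /A12 /v1 /v2 /P1 /P2 /D; ring.
have C0 : 0 <= C by lra_from C1.
have CC : C <= C ^+ 2 by rewrite expr2 ler_peMl.
have CC1 : 1 <= C ^+ 2 by lra_from CC C1.
have aa := ler_norm_sqr ha; have bb := ler_norm_sqr hb.
have a20 := sqr_ge0 a; have b20 := sqr_ge0 b.
have lh : 0 <= lam * h by rewrite mulr_ge0.
have Ch : 0 <= C ^+ 2 * h ^+ 2 by rewrite mulr_ge0 ?sqr_ge0.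
have Cl : 0 <= C ^+ 2 * (lam * h) by rewrite mulr_ge0 ?sqr_ge0.
have NM (s t S T : R) : `|s| <= S -> `|t| <= T -> `|s * t| <= S * T.
  by move=> *; rewrite normrM ler_pM.
have C1h : h ^+ 2 <= C ^+ 2 * h ^+ 2 by rewrite ler_peMl.
have C2h : C * h ^+ 2 <= C ^+ 2 * h ^+ 2 by rewrite ler_wpM2r.
have C1l : lam * h <= C ^+ 2 * (lam * h) by rewrite ler_peMl.
have C2l : C * (lam * h) <= C ^+ 2 * (lam * h) by rewrite ler_wpM2r.
have ab : `|a ^+ 2 + b ^+ 2| <= 2 * C ^+ 2.
  by rewrite ger0_norm; [lra_from aa bb|lra_from a20 b20].
have sum1 (s t : R) : `|s| <= C -> `|t| <= C -> `|s + t| <= 2 * C.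
  by move=> hs ht; apply: le_trans (ler_normD _ _) _; lra_from hs ht.
have r1 : `|u1 - a * u2 - (a1 - a) * P2 (x + h) y| <= 64 * (C ^+ 2 * h ^+ 2) + 64 * (C ^+ 2 * (lam * h)).
  apply: le_trans (ler_normB _ _) _; apply: le_trans (lerD (ler_normB _ _) (lexx _)) _.
  have := NM _ _ _ _ ha bu2; have := NM _ _ _ _ ha1 p2a.
  move: bu1 C1h C2h C1l C2l Ch Cl; clear.
  set U := `|u1|; set V := `|a * u2|; set W := `|(a1 - a) * _|.
  set X1 := C ^+ 2 * h ^+ 2; set X2 := C ^+ 2 * (lam * h); set X3 := h ^+ 2.
  by set X4 := lam * h; lra.
have r2 : `|(a ^+ 2 + b ^+ 2) * v2 - a * v1 - (a2 - a) * P1 x (y + h)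
   + ((b2 + b) * (b2 - b) + (a2 + a) * (a2 - a)) * P2 x (y + h)|
   <= 66 * (C ^+ 2 * h ^+ 2) + 320 * (C ^+ 2 * (lam * h)).
  apply: le_trans (ler_normD _ _) _.
  apply: le_trans (lerD (ler_normB _ _) (lexx _)) _.
  apply: le_trans (lerD (lerD (ler_normB _ _) (lexx _)) (lexx _)) _.
  have w1 : `|(b2 + b) * (b2 - b) + (a2 + a) * (a2 - a)| <= 4 * C * (lam * h).
    apply: le_trans (ler_normD _ _) _.
    have := NM _ _ _ _ (sum1 _ _ hb2 hb) hb2'.
    have := NM _ _ _ _ (sum1 _ _ ha2 ha) ha2'.
    set X1 := `|_|; set X2 := `|_|; set X4 := lam * h; lra_from D.
  have := NM _ _ _ _ ab bv2; have := NM _ _ _ _ ha bv1.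
  have := NM _ _ _ _ ha2' p1b; have := NM _ _ _ _ w1 p2b.
  move: C1h C2h C1l C2l Ch Cl; clear.
  set V1 := `|_|; set V2 := `|_|; set V3 := `|_|; set V4 := `|_|.
  set X3 := h ^+ 2; set X4 := lam * h; lra.
have hC : h <= C ^+ 2 * h by rewrite ler_peMl.
have hC' : C * h <= C ^+ 2 * h by rewrite ler_wpM2r.
have hh : C ^+ 2 * h ^+ 2 <= C ^+ 2 * h / 4.
  rewrite -mulrA ler_wpM2l ?sqr_ge0 // expr2.
  by have := ler_wpM2l H0 h4; lra_from D.
have lCh : C ^+ 2 * h * lam = C ^+ 2 * (lam * h) by ring.
have hhE : C ^+ 2 * h * h = C ^+ 2 * h ^+ 2 by ring.
have rhs1 : 1000 * C ^+ 2 * h * (1 + lam) = 1000 * (C ^+ 2 * h) + 1000 * (C ^+ 2 * (lam * h)).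
  by ring.
have rhs2 : 1000 * C ^+ 2 * h * (h + lam) = 1000 * (C ^+ 2 * h ^+ 2) + 1000 * (C ^+ 2 * (lam * h)).
  by ring.
split.
- have main : 4 * k <= A11 - a * A12 + ((a ^+ 2 + b ^+ 2) * A22 - a * A12).
    have -> : A11 - a * A12 + ((a ^+ 2 + b ^+ 2) * A22 - a * A12) =
      8 * ((x - a * y) ^+ 2 + (b * y) ^+ 2) - 4 * (D * (1 + (a ^+ 2 + b ^+ 2))).
      by rewrite /A11 /A12 /A22; ring.
    have q1 : D * (1 + (a ^+ 2 + b ^+ 2)) <= 4 * eta * (1 + 2 * C ^+ 2).
      by apply: ler_pM => //; [lra_from a20 b20 | lra_from aa bb].
    have q2 : k <= k * (x ^+ 2 + y ^+ 2) by rewrite ler_peMr // ltW.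
    move: q1 q2 hk hek; clear; set X1 := D * _; set X2 := k * _; set X3 := _ + (b * y) ^+ 2.
    set X4 := 4 * eta * _; lra.
  have := ler_wpM2r H0 main.
  rewrite ler_norml in r1; rewrite ler_norml in r2.
  case/andP: r1 => r1 _; case/andP: r2 => r2 _.
  rewrite rhs2 E1 E2; move: r1 r2 Ch Cl; clear.
  set X1 := u1 - _ - _; set X2 := _ + _ * P2 x (y + h); set Y1 := A11 - _; set Y2 := _ - a * A12.
  set Z1 := C ^+ 2 * h ^+ 2; set Z2 := C ^+ 2 * (lam * h); lra.
- rewrite E1 rhs1; apply: le_trans (ler_normD _ _) _.
  have m1 : `|A11 - a * A12| <= 20 + C * 20.
    by apply: le_trans (ler_normB _ _) _; have := NM _ _ _ _ ha bA12; lra_from bA11.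
  have m2 : `|h * (A11 - a * A12)| <= h * (20 + C * 20).
    by rewrite normrM (ger0_norm H0) ler_wpM2l.
  move: m2 r1 hC hC' hh Cl Ch; clear.
  set X1 := `|_|; set X2 := `|_|; set Z1 := C ^+ 2 * h ^+ 2; set Z2 := C ^+ 2 * (lam * h).
  set Z3 := C ^+ 2 * h; lra.
- rewrite E2 rhs1; apply: le_trans (ler_normD _ _) _.
  have m1 : `|(a ^+ 2 + b ^+ 2) * A22 - a * A12| <= 2 * C ^+ 2 * 20 + C * 20.
    apply: le_trans (ler_normB _ _) _.
    by have := NM _ _ _ _ ha bA12; have := NM _ _ _ _ ab bA22; lra_from D.
  have m2 : `|h * ((a ^+ 2 + b ^+ 2) * A22 - a * A12)| <= h * (2 * C ^+ 2 * 20 + C * 20).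
    by rewrite normrM (ger0_norm H0) ler_wpM2l.
  have m3 : h * (2 * C ^+ 2 * 20 + C * 20) = 40 * (C ^+ 2 * h) + 20 * (C * h) by ring.
  rewrite m3 in m2; move: m2 r2 hC hC' hh Cl Ch; clear.
  set X1 := `|_|; set X2 := `|_|; set Z1 := C ^+ 2 * h ^+ 2; set Z2 := C ^+ 2 * (lam * h).
  set Z3 := C ^+ 2 * h; lra.
Qed.

End Single.

Section Single2.
Variable R : realType.
Implicit Types (p q e : R * R) (h : R).

(* Real and imaginary parts of the difference analogue of
   [(d_1 - (al + i be) d_2) (z1 + i z2)]. *)
Definition dop1 (al be : R * R -> R) h (z1 z2 : R * R -> R) p : R :=
  dd (e1 R) h z1 p - al p * dd (e2 R) h z1 p + be p * dd (e2 R) h z2 p.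
Definition dop2 (al be : R * R -> R) h (z1 z2 : R * R -> R) p : R :=
  dd (e1 R) h z2 p - al p * dd (e2 R) h z2 p - be p * dd (e2 R) h z1 p.

(* The region where the cutoff is not controlled by the weight is
   [sqn p >= 1 + 2 eta], where the exponential is comparatively small. *)
Lemma cut_region eta tau p : 0 < eta -> eta <= 1 / 12 -> 0 <= tau ->
  0 < cut eta p ->
  16 * sqn p * (cut eta p * wexp eta tau p) ^+ 2 <=
    32 / eta ^+ 2 * weight eta tau p ^+ 2
    + 32 * eta ^+ 2 * expR (8 * tau * eta ^+ 2).
Proof.
move=> eta0 eta12 tau0 m0.
have e20 : 0 < eta ^+ 2 by rewrite exprn_gt0.
have s1 : sqn p < 1 + 3 * eta by move: m0; rewrite /cut lt_max ltxx /=; lra.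
have s0 : 0 <= sqn p by rewrite addr_ge0 ?sqr_ge0.
have cE : cut eta p = 1 + 3 * eta - sqn p by rewrite /cut; apply: max_r; lra.
have w0 : 0 < wexp eta tau p by exact: expR_gt0.
have E0 : 0 < expR (8 * tau * eta ^+ 2) by exact: expR_gt0.
have z0 : 0 <= 32 * eta ^+ 2 * expR (8 * tau * eta ^+ 2) by rewrite !mulr_ge0 // ltW.
have z1 : 0 <= 32 / eta ^+ 2 * weight eta tau p ^+ 2.
  by rewrite mulr_ge0 ?sqr_ge0 // divr_ge0 // ltW.
have q0 : 0 <= (cut eta p * wexp eta tau p) ^+ 2 by exact: sqr_ge0.
have s32 : 16 * sqn p * (cut eta p * wexp eta tau p) ^+ 2 <=
   32 * (cut eta p * wexp eta tau p) ^+ 2 by rewrite ler_wpM2r //; lra.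
apply: le_trans s32 _.
have [me|me] := lerP eta (cut eta p).
  apply: (@le_trans _ _ (32 / eta ^+ 2 * weight eta tau p ^+ 2)); last lra.
  rewrite -mulrA ler_wpM2l // [leRHS]mulrC ler_pdivlMr //.
  have -> : weight eta tau p ^+ 2 = (cut eta p * wexp eta tau p) ^+ 2 * cut eta p ^+ 2.
    by rewrite /weight; ring.
  by rewrite ler_wpM2l // lerXn2r // nnegrE ltW.
apply: (@le_trans _ _ (32 * eta ^+ 2 * expR (8 * tau * eta ^+ 2))); last lra.
rewrite -mulrA ler_wpM2l // exprMn; apply: ler_pM; try exact: sqr_ge0.
  by rewrite lerXn2r // ?nnegrE ltW.
rewrite expr2 /wexp -expRD ler_expR.
have : (1 + 4 * eta - sqn p) ^+ 2 <= (2 * eta) ^+ 2.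
  by rewrite lerXn2r // ?nnegrE; lra.
move=> H; have := ler_wpM2l tau0 H; lra.
Qed.

Lemma small_step (c e : R) : 0 <= c -> 0 < e ->
  exists2 h0 : R, 0 < h0 & forall h, 0 < h -> h < h0 -> c * h <= e.
Proof.
move=> c0 e0; exists (e / (c + 1)) => [|h h0]; first by rewrite divr_gt0 //; lra.
rewrite ltr_pdivlMr; last lra.
lra.
Qed.

Lemma sum_cst (T : finType) (c : R) : \sum_(g : T) c = c * #|T|%:R.
Proof. by rewrite sumr_const mulr_natr. Qed.

Lemma sqr_add3 (x y z : R) : (x + y + z) ^+ 2 <= 3 * (x ^+ 2 + y ^+ 2 + z ^+ 2).
Proof.
have := sqr_ge0 (x - y); have := sqr_ge0 (x - z); have := sqr_ge0 (y - z); lra.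
Qed.

Lemma sqr_add4 (x y z t : R) :
  (x + y + z + t) ^+ 2 <= 4 * (x ^+ 2 + y ^+ 2 + z ^+ 2 + t ^+ 2).
Proof.
have := sqr_ge0 (x - y); have := sqr_ge0 (x - z); have := sqr_ge0 (x - t).
have := sqr_ge0 (y - z); have := sqr_ge0 (y - t); have := sqr_ge0 (z - t); lra.
Qed.

Lemma conj_expand (a b C W d11 d12 d21 d22 D11 D12 D21 D22 q1 q2 R1 R2 tau z1 z2 de : R) :
  `|a| <= C -> `|b| <= C ->
  `|D11 - (W * d11 + (tau * q1 * W + R1) * z1)| <= de ->
  `|D12 - (W * d12 + (tau * q1 * W + R1) * z2)| <= de ->
  `|D21 - (W * d21 + (tau * q2 * W + R2) * z1)| <= de ->
  `|D22 - (W * d22 + (tau * q2 * W + R2) * z2)| <= de ->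
  (D11 - a * D21 + b * D22 - tau * ((q1 - a * q2) * (W * z1) + b * q2 * (W * z2))) ^+ 2
  + (D12 - a * D22 - b * D21 - tau * ((q1 - a * q2) * (W * z2) - b * q2 * (W * z1))) ^+ 2
  <= 3 * (W ^+ 2 * ((d11 - a * d21 + b * d22) ^+ 2 + (d12 - a * d22 - b * d21) ^+ 2))
     + 3 * ((2 + 3 * C ^+ 2) * ((R1 ^+ 2 + R2 ^+ 2) * (z1 ^+ 2 + z2 ^+ 2)))
     + 6 * ((1 + 2 * C) * de) ^+ 2.
Proof.
move=> ha hb; set x11 := D11 - _; set x12 := D12 - _; set x21 := D21 - _; set x22 := D22 - _.
move=> e11 e12 e21 e22.
have -> : D11 - a * D21 + b * D22 - tau * ((q1 - a * q2) * (W * z1) + b * q2 * (W * z2)) =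
  W * (d11 - a * d21 + b * d22) + ((R1 - a * R2) * z1 + b * R2 * z2) + (x11 - a * x21 + b * x22).
  by rewrite /x11 /x21 /x22; ring.
have -> : D12 - a * D22 - b * D21 - tau * ((q1 - a * q2) * (W * z2) - b * q2 * (W * z1)) =
  W * (d12 - a * d22 - b * d21) + ((R1 - a * R2) * z2 - b * R2 * z1) + (x12 - a * x22 - b * x21).
  by rewrite /x12 /x21 /x22; ring.
have NM (s t S T : R) : `|s| <= S -> `|t| <= T -> `|s * t| <= S * T.
  by move=> *; rewrite normrM ler_pM.
have k1 : `|x11 - a * x21 + b * x22| <= (1 + 2 * C) * de.
  apply: le_trans (ler_normD _ _) _; apply: le_trans (lerD (ler_normB _ _) (lexx _)) _.
  have := NM _ _ _ _ ha e21; have := NM _ _ _ _ hb e22.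
  set Y := `|_ * _|; set Y' := `|_ * _|; lra_from e11.
have k2 : `|x12 - a * x22 - b * x21| <= (1 + 2 * C) * de.
  apply: le_trans (ler_normB _ _) _; apply: le_trans (lerD (ler_normB _ _) (lexx _)) _.
  have := NM _ _ _ _ ha e22; have := NM _ _ _ _ hb e21.
  set Y := `|_ * _|; set Y' := `|_ * _|; lra_from e12.
have k1' := ler_norm_sqr k1; have k2' := ler_norm_sqr k2.
have aa := ler_norm_sqr ha; have bb := ler_norm_sqr hb.
have rr : ((R1 - a * R2) * z1 + b * R2 * z2) ^+ 2 + ((R1 - a * R2) * z2 - b * R2 * z1) ^+ 2
   <= (2 + 3 * C ^+ 2) * ((R1 ^+ 2 + R2 ^+ 2) * (z1 ^+ 2 + z2 ^+ 2)).
  have -> : ((R1 - a * R2) * z1 + b * R2 * z2) ^+ 2 + ((R1 - a * R2) * z2 - b * R2 * z1) ^+ 2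
    = ((R1 - a * R2) ^+ 2 + b ^+ 2 * R2 ^+ 2) * (z1 ^+ 2 + z2 ^+ 2) by ring.
  rewrite mulrA ler_wpM2r ?addr_ge0 ?sqr_ge0 //.
  have r1 := sqr_ge0 R1; have r2 := sqr_ge0 R2; have c2 := sqr_ge0 C.
  have a1 := ler_wpM2r r2 aa; have b1 := ler_wpM2r r2 bb.
  have m1 := mulr_ge0 c2 r1.
  have m2 := sqr_ge0 (R1 + a * R2).
  have -> : (R1 - a * R2) ^+ 2 = 2 * R1 ^+ 2 + 2 * (a ^+ 2 * R2 ^+ 2) - (R1 + a * R2) ^+ 2.
    by ring.
  move: r1 r2 a1 b1 m1 m2; clear; set Y1 := R1 ^+ 2; set Y2 := R2 ^+ 2; set Y3 := (R1 + _) ^+ 2.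
  by set Y4 := C ^+ 2; lra.
have := sqr_add3 (W * (d11 - a * d21 + b * d22)) ((R1 - a * R2) * z1 + b * R2 * z2) (x11 - a * x21 + b * x22).
have := sqr_add3 (W * (d12 - a * d22 - b * d21)) ((R1 - a * R2) * z2 - b * R2 * z1) (x12 - a * x22 - b * x21).
rewrite !(exprMn _ W).
move: k1' k2' rr; clear.
set Y1 := (_ + _ * x22) ^+ 2; set Y2 := (_ - _ * x21) ^+ 2.
set Y3 := (_ * z1 + _) ^+ 2; set Y4 := (_ * z2 - _) ^+ 2.
set Y5 := _ * (_ * (z1 ^+ 2 + _)).
set Y6 := ((1 + _) * de) ^+ 2; set Y7 := (_ + _) ^+ 2; set Y8 := (_ + _) ^+ 2.
set Y9 := (d11 - _ + _) ^+ 2; set Y10 := (d12 - _ - _) ^+ 2; set Y11 := W ^+ 2; lra.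
Qed.

Lemma diff_expand (W d D q S tau z de : R) :
  `|D - (W * d + (tau * q * W + S) * z)| <= de ->
  W ^+ 2 * d ^+ 2 <= 4 * D ^+ 2 + 4 * (tau ^+ 2 * q ^+ 2 * (W ^+ 2 * z ^+ 2))
     + 4 * (S ^+ 2 * z ^+ 2) + 4 * de ^+ 2.
Proof.
move=> hx; have := ler_norm_sqr hx; set x := D - _.
have := sqr_add4 D (- (tau * q * W * z)) (- (S * z)) (- x).
have -> : D + - (tau * q * W * z) + - (S * z) + - x = W * d by rewrite /x; ring.
have -> : (- (tau * q * W * z)) ^+ 2 = tau ^+ 2 * q ^+ 2 * (W ^+ 2 * z ^+ 2) by ring.
have -> : (- (S * z)) ^+ 2 = S ^+ 2 * z ^+ 2 by ring.
rewrite sqrrN exprMn; clear.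
set Y1 := W ^+ 2 * _; set Y2 := _ * (W ^+ 2 * _); set Y3 := S ^+ 2 * _; lra.
Qed.

Lemma weight_outer eta tau p : eta <= 1 / 12 -> outer p -> weight eta tau p = 0.
Proof.
move=> e12 /orP op; rewrite /weight /cut.
have : 5 / 4 <= sqn p.
  have b (x : R) : 5 / 4 <= `|x| -> 5 / 4 <= x ^+ 2.
    move=> H; rewrite -sqr_normE expr2.
    have : 5 / 4 * (5 / 4) <= `|x| * `|x| by apply: ler_pM => //; lra.
    lra.
  have := sqr_ge0 p.1; have := sqr_ge0 p.2; rewrite /sqn.
  case: op => /b; lra.
by move=> H; rewrite max_l ?expr0n ?mul0r //; lra.
Qed.

Lemma ph_bound eta p : 0 < eta -> eta <= 1 / 12 -> dom2 p ->
  `|ph1 eta p| <= 64 /\ `|ph2 eta p| <= 64.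
Proof.
move=> eta0 eta12 /andP[hs ht]; have s4 := ler_norm_sqr hs; have t4 := ler_norm_sqr ht.
have s0 := sqr_ge0 p.1; have t0 := sqr_ge0 p.2.
have q : `|1 + 4 * eta - sqn p| <= 8 by apply: normr_bound; rewrite /sqn; lra.
rewrite /ph1 /ph2 !normrM normrN [`|4|]ger0_norm //; split.
  by have := ler_pM (normr_ge0 _) (normr_ge0 _) hs q; lra.
by have := ler_pM (normr_ge0 _) (normr_ge0 _) ht q; lra.
Qed.

Lemma she1E p t : she (e1 R) p t = (p.1 + t, p.2).
Proof. by rewrite /she /= mulr1 mulr0 addr0. Qed.
Lemma she2E p t : she (e2 R) p t = (p.1, p.2 + t).
Proof. by rewrite /she /= mulr1 mulr0 addr0. Qed.

Lemma quad_lower (c0 C a b x y : R) : 0 < c0 -> `|a| <= C -> c0 <= `|b| ->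
  x ^+ 2 + y ^+ 2 <= (2 + (2 * C ^+ 2 + 1) / c0 ^+ 2) * ((x - a * y) ^+ 2 + (b * y) ^+ 2).
Proof.
move=> c00 ha hb.
have c2 : 0 < c0 ^+ 2 by rewrite exprn_gt0.
have aa := ler_norm_sqr ha.
have b2 : c0 ^+ 2 <= b ^+ 2.
  by rewrite -(sqr_normE b) lerXn2r // ?nnegrE // ltW.
have C0 := sqr_ge0 C.
have q : (2 * C ^+ 2 + 1) * y ^+ 2 <= (2 * C ^+ 2 + 1) / c0 ^+ 2 * (b * y) ^+ 2.
  rewrite -mulrA ler_wpM2l; [by []|by lra_from C0|].
  rewrite mulrC ler_pdivlMr // mulrC exprMn ler_wpM2r //; exact: sqr_ge0.
have z1 : 0 <= (2 * C ^+ 2 + 1) / c0 ^+ 2 * (x - a * y) ^+ 2.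
  by apply: mulr_ge0 (sqr_ge0 _); apply: divr_ge0; [lra_from C0|exact: ltW].
have z2 := sqr_ge0 (b * y).
have z3 : a ^+ 2 * y ^+ 2 <= C ^+ 2 * y ^+ 2 by rewrite ler_wpM2r ?sqr_ge0.
have z4 : x ^+ 2 <= 2 * (x - a * y) ^+ 2 + 2 * (a ^+ 2 * y ^+ 2).
  have := sqr_ge0 (x - 2 * (a * y)).
  have -> : (x - 2 * (a * y)) ^+ 2 =
    2 * (x - a * y) ^+ 2 + 2 * (a ^+ 2 * y ^+ 2) - x ^+ 2 by ring.
  by rewrite subr_ge0.
have -> : (2 + (2 * C ^+ 2 + 1) / c0 ^+ 2) * ((x - a * y) ^+ 2 + (b * y) ^+ 2) =
   2 * (x - a * y) ^+ 2 + 2 * (b * y) ^+ 2 + (2 * C ^+ 2 + 1) / c0 ^+ 2 * (x - a * y) ^+ 2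
   + (2 * C ^+ 2 + 1) / c0 ^+ 2 * (b * y) ^+ 2 by ring.
move: q z1 z2 z3 z4; clear.
set Y1 := _ / _ * (b * y) ^+ 2; set Y2 := _ / _ * (x - _) ^+ 2; set Y3 := (b * y) ^+ 2; lra.
Qed.

End Single2.

Section Single3.
Variable R : realType.
Implicit Types (p q e : R * R) (h : R).

Lemma carleman_single (c0 C : R) : 0 < c0 -> 1 <= C ->
  exists eta lam0 K : R, [/\ 0 < eta, eta <= 1 / 12, 0 < lam0, 1 <= K &
  forall (lam : R) (al be : R * R -> R), 0 <= lam -> lam <= lam0 ->
    (forall p, dom2 p -> [/\ `|al p| <= C, c0 <= `|be p| & `|be p| <= C]) ->
    lip2 (@dom2 R) lam al -> lip2 (@dom2 R) lam be ->
  forall (tau : R) (z1 z2 : R * R -> R) (L M : R), 1 <= tau -> 0 <= L ->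
    lip2 (@dom2 R) L z1 -> lip2 (@dom2 R) L z2 ->
    (forall p, dom2 p -> z1 p ^+ 2 + z2 p ^+ 2 <= M) ->
    (forall p, sqn p < 1 -> z1 p = 0 /\ z2 p = 0) ->
  forall eps : R, 0 < eps -> exists2 h0 : R, 0 < h0 & forall n, step R n < h0 ->
    let E p := weight eta tau p ^+ 2 in
    let F := \sum_(g : grid n) E (pt R g) * (z1 (pt R g) ^+ 2 + z2 (pt R g) ^+ 2) in
    let Q := \sum_(g : grid n | inner (pt R g)) E (pt R g) *
      (dop1 al be (step R n) z1 z2 (pt R g) ^+ 2 + dop2 al be (step R n) z1 z2 (pt R g) ^+ 2) in
    let X := \sum_(g : grid n | inner (pt R g)) E (pt R g) *
      (dd (e2 R) (step R n) z1 (pt R g) ^+ 2 + dd (e2 R) (step R n) z2 (pt R g) ^+ 2) in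
    let Z := #|grid n|%:R * (M * expR (8 * tau * eta ^+ 2) + eps) in
    tau * F <= K * (Q + F + Z) /\ X <= K * (Q + tau ^+ 2 * F + Z)].
Proof.
move=> c00 C1.
pose Cl := 2000 * C ^+ 2.
have CC : C <= C ^+ 2 by rewrite expr2 ler_peMl //; lra.
have CCl : C <= Cl by rewrite /Cl; lra.
have Cl0 : 0 < Cl by lra.
pose k := (2 + (2 * Cl ^+ 2 + 1) / c0 ^+ 2)^-1.
have c20 : 0 < c0 ^+ 2 by rewrite exprn_gt0.
have ik : 0 < 2 + (2 * Cl ^+ 2 + 1) / c0 ^+ 2.
  apply: ltr_wpDr; last by [].
  by apply: divr_ge0; [have := sqr_ge0 Cl; lra|lra].
have k0 : 0 < k by rewrite invr_gt0.
have k1 : k <= 1.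
  rewrite invf_le1 //; have : 0 <= (2 * Cl ^+ 2 + 1) / c0 ^+ 2.
    by apply: divr_ge0; [have := sqr_ge0 Cl; lra|lra].
  lra.
pose C2 := 2 * ((Cl + Cl ^+ 2) ^+ 2 + Cl ^+ 4).
have C20 : 0 <= C2.
  rewrite /C2; apply: mulr_ge0 => //; apply: addr_ge0; first exact: sqr_ge0.
  by rewrite exprn_ge0 // ltW.
have C22 : 0 < 1 + 2 * C ^+ 2 by have := sqr_ge0 C; lra.
pose eta := Num.min (1 / 12) (k / (4 * (1 + 2 * C ^+ 2))).
have eta0 : 0 < eta.
  by rewrite /eta lt_min; apply/andP; split; [lra|rewrite divr_gt0 // mulr_gt0].
have eta12 : eta <= 1 / 12 by rewrite /eta ge_min lexx.
have etak : 4 * eta * (1 + 2 * C ^+ 2) <= k.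
  have : eta <= k / (4 * (1 + 2 * C ^+ 2)) by rewrite /eta ge_min lexx orbT.
  by rewrite ler_pdivlMr ?mulr_gt0 // => H; lra.
have eta2 : 0 < eta ^+ 2 by rewrite exprn_gt0.
pose lam0 := Num.min 1 (Num.min (k * k / (8 * (C2 + 1))) (k / (2000 * C ^+ 2))).
have C10 : 0 < 2000 * C ^+ 2 by lra_from CC C1.
have lam00 : 0 < lam0.
  rewrite /lam0 !lt_min; apply/and3P; split; first by [].
    by rewrite divr_gt0 ?mulr_gt0 //; lra_from C20.
  by rewrite divr_gt0.
have lam01 : lam0 <= 1 by rewrite /lam0 ge_min lexx.
have lam02 : 8 * (C2 + 1) * lam0 <= k * k.
  have : lam0 <= k * k / (8 * (C2 + 1)) by rewrite /lam0 !ge_min lexx !orbT.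
  rewrite ler_pdivlMr; [lra_from C20|lra_from C20].
have lam03 : 2000 * C ^+ 2 * lam0 <= k.
  have : lam0 <= k / (2000 * C ^+ 2) by rewrite /lam0 !ge_min lexx !orbT.
  by rewrite ler_pdivlMr // mulrC.
have i2 : 0 <= 32 / eta ^+ 2 by rewrite divr_ge0 // ltW.
have i3 : 0 <= 32 * eta ^+ 2 by rewrite mulr_ge0 // ltW.
pose A1 := 2 + 3 * C ^+ 2.
have A10 : 0 <= A1 by rewrite /A1; lra_from CC C1.
pose T1 := 32 / eta ^+ 2; pose T2 := 32 * eta ^+ 2.
have T10 : 0 <= T1 by []. have T20 : 0 <= T2 by [].
have A1T1 : 0 <= A1 * T1 by rewrite mulr_ge0.
have A1T2 : 0 <= A1 * T2 by rewrite mulr_ge0.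
pose K1 := 3 + 3 * (A1 * T1) + 3 * (A1 * T2) + 2.
have K10 : 0 <= K1 by rewrite /K1; lra_from A1T1 A1T2.
pose K2 := 12 * K1 / k.
have K20 : 0 <= K2 by rewrite /K2 divr_ge0 ?(ltW k0) // mulr_ge0.
pose K3 := 4 * (8 * K1 + 2 * (C2 + k)) / k.
have K30 : 0 <= K3 by rewrite /K3 divr_ge0 ?(ltW k0) // mulr_ge0 //; lra_from K10 C20 k0.
pose K := 1 + K2 + K3 + 4 * 64 ^+ 2 + 4 * T1 + 4 * T2 + 1.
have KK : 1 <= K by rewrite /K; lra_from K20 K30 T10 T20.
exists eta, lam0, K; split => // lam al be lam_ge0 lam_le Hb lal lbe.
move=> tau z1 z2 L M tau1 L0 lz1 lz2 HM Hv eps eps0.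
have [Mw1 Mw10 HMw1] := c11_weight eta tau (e1 R).
have [Mw2 Mw20 HMw2] := c11_weight eta tau (e2 R).
have tau0 : 0 < tau by lra_from tau1.
have M0 : 0 <= M.
  have := HM (0, 0); rewrite /dom2 /= normr0 ler0n => /(_ isT).
  by apply: le_trans; rewrite addr_ge0 ?sqr_ge0.
pose B := M + 1.
have bz (x y : R) : x ^+ 2 + y ^+ 2 <= M -> `|x| <= B.
  move=> H; have y0 := sqr_ge0 y; have x0 := normr_ge0 x.
  have : `|x| ^+ 2 <= M by rewrite sqr_normE; lra_from H y0.
  rewrite /B => H'; have := sqr_ge0 (`|x| - 1); lra_from H' x0.
have bz1 p : dom2 p -> `|z1 p| <= B by move=> /HM/bz.
have bz2 p : dom2 p -> `|z2 p| <= B by move=> /HM; rewrite addrC => /bz.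
have B0 : 0 <= B by rewrite /B; lra_from M0.
pose Mw := Mw1 + Mw2.
have Mw0 : 0 <= Mw by rewrite addr_ge0.
pose dl := Mw * (L + B).
have dl0 : 0 <= dl by rewrite mulr_ge0 // addr_ge0.
pose cf := Mw * B * (5 * Mw * B + Mw * L).
have cf0 : 0 <= cf by rewrite mulr_ge0 ?addr_ge0 ?mulr_ge0.
have cc0 : 0 <= 16 * tau * Cl * cf.
  by apply: mulr_ge0 cf0; apply: mulr_ge0 (ltW Cl0); apply: mulr_ge0 => //; exact: ltW.
have [h1 h10 Hh1] := small_step cc0 eps0.
have [h2 h20 Hh2] := small_step (c := 6 * ((1 + 2 * C) * dl) ^+ 2 + 8 * dl ^+ 2)
   ltac:(have := sqr_ge0 ((1 + 2 * C) * dl); have := sqr_ge0 dl; clear; lra) eps0.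
have [h3 h30 Hh3] := small_step (c := 1000 * C ^+ 2) ltac:(lra_from CC C1) k0.
exists (Num.min (1 / 4) (Num.min h1 (Num.min h2 (Num.min h3 (k / 2000 / C ^+ 2))))).
  rewrite !lt_min h10 h20 h30 /=; apply/andP; split; first by lra_from k0.
  by rewrite !divr_gt0 //; lra_from CC C1.
move=> n; rewrite !lt_min => /and5P[s4 sh1 sh2 sh3 sh4].
have := step_gt0 R n; set h := step R n in s4 sh1 sh2 sh3 sh4 * => h_gt0.
move=> E F Q X Z.
pose W p := weight eta tau p.
pose f1 (g : grid n) := W (pt R g) * z1 (pt R g).
pose f2 (g : grid n) := W (pt R g) * z2 (pt R g).
pose N := #|grid n|%:R : R.
have N0 : 0 <= N by rewrite /N.
have h1' : h <= 1 / 4 by exact: ltW.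
have h1le : h <= 1 by lra_from h1'.
have hn : `|h| <= 1 / 4 by rewrite gtr0_norm.
have hn' : `|- h| <= 1 / 4 by rewrite normrN.
have hE : `|h| = h by rewrite gtr0_norm.
have hE' : `|- h| = h by rewrite normrN.
have u1 : `|(e1 R).1| + `|(e1 R).2| <= 1 by rewrite /= normr1 normr0 addr0.
have u2 : `|(e2 R).1| + `|(e2 R).2| <= 1 by rewrite /= normr1 normr0 add0r.
have [v11 v12] := unit_e1 R; have [v21 v22] := unit_e2 R.
have nbhd (p : R * R) : inner p -> [/\ dom2 p, dom2 (she (e1 R) p h), dom2 (she (e1 R) p (- h)),
   dom2 (she (e2 R) p h) & dom2 (she (e2 R) p (- h))].
  by move=> ip; split; [exact: inner_dom2 | exact: inner_she ..].
have outW (g : grid n) : ~~ inner (pt R g) -> [/\ W (pt R g) = 0, W (pt R (sa g)) = 0, W (pt R (sa' g)) = 0,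
    W (pt R (sb g)) = 0 & W (pt R (sb' g)) = 0].
  move=> ni; have [o1 o2 o3 o4 o5] := pt_not_inner h1' ni.
  by split; apply: weight_outer.
have Mw1w : Mw1 <= Mw by rewrite /Mw lerDl.
have Mw2w : Mw2 <= Mw by rewrite /Mw lerDr.
have HMw1' p t : `|t| <= 4 -> dom2 p -> dom2 (she (e1 R) p t) ->
    [/\ `|W p| <= Mw, `|dweight eta tau (e1 R) p| <= Mw &
       `|W (she (e1 R) p t) - W p - t * dweight eta tau (e1 R) p| <= Mw * t ^+ 2].
  move=> t4 dp dq; have [a1 a2 a3] := HMw1 p t t4 dp dq.
  split; [exact: le_trans Mw1w|exact: le_trans Mw1w|].
  by apply: le_trans a3 _; rewrite ler_wpM2r ?sqr_ge0.
have HMw2' p t : `|t| <= 4 -> dom2 p -> dom2 (she (e2 R) p t) ->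
    [/\ `|W p| <= Mw, `|dweight eta tau (e2 R) p| <= Mw &
       `|W (she (e2 R) p t) - W p - t * dweight eta tau (e2 R) p| <= Mw * t ^+ 2].
  move=> t4 dp dq; have [a1 a2 a3] := HMw2 p t t4 dp dq.
  split; [exact: le_trans Mw2w|exact: le_trans Mw2w|].
  by apply: le_trans a3 _; rewrite ler_wpM2r ?sqr_ge0.
have ddE z (g : grid n) : inner (pt R g) ->
   cdiff h (@sa n) (@sa' n) (fun g => W (pt R g) * z (pt R g)) g =
     dd (e1 R) h (fun p => W p * z p) (pt R g) /\
   cdiff h (@sb n) (@sb' n) (fun g => W (pt R g) * z (pt R g)) g =
     dd (e2 R) h (fun p => W p * z p) (pt R g).
  by move=> ig; have [q1 q2 q3 q4] := pt_inner ig; rewrite /cdiff /dd q1 q2 q3 q4.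
have f_nz (g : grid n) : (f1 g != 0) || (f2 g != 0) ->
   [/\ inner (pt R g), 0 < cut eta (pt R g) & 1 <= sqn (pt R g)].
  move=> H; have [ig|/outW [w0 _ _ _ _]] := boolP (inner (pt R g)); last first.
    by move: H; rewrite /f1 /f2 w0 !mul0r eqxx.
  split=> //.
    rewrite lt_def; apply/andP; split; last by rewrite /cut le_max lexx.
    apply: contraL H => /eqP c; rewrite negb_or !negbK.
    by rewrite /f1 /f2 /W /weight c expr0n /= !mul0r eqxx.
  rewrite leNgt; apply: contraL H => /Hv [zz1 zz2].
  by rewrite negb_or !negbK /f1 /f2 zz1 zz2 !mulr0 eqxx.
have lamlam0 : lam * h <= lam0 * h by rewrite ler_wpM2r // ltW.
have LC := @lattice_carleman R (grid n) (@sa n) (@sa' n) (@sb n) (@sb' n) h h_gt0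
  (@saK n) (@sa'K n) (@sbK n) (@sb'K n) (@sabC n)
  (fun g => al (pt R g)) (fun g => be (pt R g)) (fun g => ph1 eta (pt R g))
  (fun g => ph2 eta (pt R g)) f1 f2 tau c0 Cl k lam0 (cf * h) (fun g => inner (pt R g))
  c00 Cl0 k0 tau1 (ltW lam00).
rewrite /= in LC.
have cond1 : 4 * lam0 <= k.
  by move: lam03; have : 2 * 2 * lam0 <= 2000 * C ^+ 2 * lam0;
     [rewrite ler_wpM2r ?(ltW lam00) //; lra_from CC C1| clear; lra].
have cond2 : 8 * lam0 <= k.
  have : 8 * lam0 <= 2000 * C ^+ 2 * lam0.
    by rewrite ler_wpM2r ?(ltW lam00) //; lra_from CC C1.
  move: lam03; set X1 := _ * lam0; clear; lra.
have cond3 : 8 * (C2 + k) * lam0 <= k * k.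
  apply: le_trans lam02; rewrite ler_wpM2r ?(ltW lam00) //; lra_from k1.
have hyp1 (g : grid n) : ~~ inner (pt R g) ->
  [/\ f1 g = 0, f2 g = 0, cdiff h (@sa n) (@sa' n) f1 g = 0 & cdiff h (@sb n) (@sb' n) f1 g = 0] /\
  (cdiff h (@sa n) (@sa' n) f2 g = 0 /\ cdiff h (@sb n) (@sb' n) f2 g = 0).
  move=> /outW [w1 w2 w3 w4 w5]; rewrite /cdiff /f1 /f2 w1 w2 w3 w4 w5 !mul0r subrr mul0r.
  by [].
have hyp2 (g : grid n) : inner (pt R g) -> [/\ `|al (pt R g)| <= Cl, c0 <= `|be (pt R g)|,
   `|be (pt R g)| <= Cl, `|ph1 eta (pt R g)| <= Cl & `|ph2 eta (pt R g)| <= Cl].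
  move=> ig; have dg := inner_dom2 ig; have [a1 a2 a3] := Hb _ dg.
  have [p1 p2] := ph_bound eta0 eta12 dg.
  have c64 : 64 <= Cl by rewrite /Cl; lra_from CC C1.
  split=> //; [exact: le_trans CCl|exact: le_trans CCl|exact: le_trans c64|exact: le_trans c64].
have lipg (f : R * R -> R) (g : grid n) : lip2 (@dom2 R) lam f -> inner (pt R g) ->
  [/\ `|f (pt R (sa g)) - f (pt R g)| <= lam * h, `|f (pt R (sa' g)) - f (pt R g)| <= lam * h,
   `|f (pt R (sb g)) - f (pt R g)| <= lam * h & `|f (pt R (sb' g)) - f (pt R g)| <= lam * h].
  move=> lf ig; have [q1 q2 q3 q4] := pt_inner ig; have [d0 d1 d2 d3 d4] := nbhd _ ig.
  rewrite q1 q2 q3 q4 -/h; split.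
  - by have := lip2_she lf lam_ge0 d0 d1 u1; rewrite hE.
  - by have := lip2_she lf lam_ge0 d0 d2 u1; rewrite hE'.
  - by have := lip2_she lf lam_ge0 d0 d3 u2; rewrite hE.
  - by have := lip2_she lf lam_ge0 d0 d4 u2; rewrite hE'.
have hyp3 (g : grid n) : inner (pt R g) -> [/\ `|be (pt R (sa g)) - be (pt R g)| <= lam0 * h,
   `|be (pt R (sa' g)) - be (pt R g)| <= lam0 * h, `|be (pt R (sb g)) - be (pt R g)| <= lam0 * h
   & `|be (pt R (sb' g)) - be (pt R g)| <= lam0 * h].
  by move=> ig; have [a1 a2 a3 a4] := lipg be g lbe ig; split; apply: le_trans lamlam0.
have hyp4 (g : grid n) : (f1 g != 0) || (f2 g != 0) ->
  [/\ 2 * k * h <= cdir1 (fun g => al (pt R g)) (fun g => ph1 eta (pt R g)) (fun g => ph2 eta (pt R g)) (sa g)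
        - cdir1 (fun g => al (pt R g)) (fun g => ph1 eta (pt R g)) (fun g => ph2 eta (pt R g)) g
        + (cdir2 (fun g => al (pt R g)) (fun g => be (pt R g)) (fun g => ph1 eta (pt R g)) (fun g => ph2 eta (pt R g)) (sb g)
        - cdir2 (fun g => al (pt R g)) (fun g => be (pt R g)) (fun g => ph1 eta (pt R g)) (fun g => ph2 eta (pt R g)) g),
     `|cdir1 (fun g => al (pt R g)) (fun g => ph1 eta (pt R g)) (fun g => ph2 eta (pt R g)) (sa g)
        - cdir1 (fun g => al (pt R g)) (fun g => ph1 eta (pt R g)) (fun g => ph2 eta (pt R g)) g| <= Cl * h
   & `|cdir2 (fun g => al (pt R g)) (fun g => be (pt R g)) (fun g => ph1 eta (pt R g)) (fun g => ph2 eta (pt R g)) (sb g)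
        - cdir2 (fun g => al (pt R g)) (fun g => be (pt R g)) (fun g => ph1 eta (pt R g)) (fun g => ph2 eta (pt R g)) g| <= Cl * h].
  move=> /f_nz [ig cg sg].
  have [q1 q2 q3 q4] := pt_inner ig; have [d0 d1 d2 d3 d4] := nbhd _ ig.
  rewrite -/h she1E in q1; rewrite -/h she2E in q3.
  rewrite she1E in d1; rewrite she2E in d3.
  have [a1 a2 a3 _] := lipg al g lal ig; have [_ _ b3 _] := lipg be g lbe ig.
  have [ca cb cb'] := Hb _ d0; have [ca3 _ cb3] := Hb _ d3.
  rewrite q1 in a1; rewrite q3 in a3 b3.
  have [i1 i2'] := andP ig.
  have sg3 : (pt R g).1 ^+ 2 + (pt R g).2 ^+ 2 <= 1 + 3 * eta.
    by move: cg; rewrite /cut lt_max ltxx orFb /sqn; clear; lra.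
  have kk : k * ((pt R g).1 ^+ 2 + (pt R g).2 ^+ 2) <=
     ((pt R g).1 - al (pt R g) * (pt R g).2) ^+ 2 + (be (pt R g) * (pt R g).2) ^+ 2.
    rewrite /k ler_pdivrMl //.
    exact: (quad_lower _ _ c00 (le_trans ca CCl) cb).
  have [m1 m2 m3] := convexity_incr C1 lam_ge0 h_gt0 h1' eta0 eta12 i1 i2' sg sg3
    ca cb' ca3 cb3 a1 a3 b3 kk k0 etak.
  rewrite /cdir1 /cdir2 /cdir1 q1 q3.
  have l1 : 1000 * C ^+ 2 * h * (1 + lam) <= Cl * h.
    have : 1000 * C ^+ 2 * h * (1 + lam) <= 1000 * C ^+ 2 * h * 2.
      apply: ler_wpM2l; last by lra_from lam_le lam01.
      by apply: mulr_ge0; [lra_from CC C1|exact: ltW].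
    by rewrite /Cl; set X1 := C ^+ 2; lra_from h.
  split.
  - apply: le_trans m1.
    have l2 : 1000 * C ^+ 2 * lam <= k.
      apply: le_trans lam03.
      by apply: ler_pM; [lra_from CC C1|exact: lam_ge0|lra_from CC C1|exact: lam_le].
    have l3 : 1000 * C ^+ 2 * h * (h + lam) = (1000 * C ^+ 2 * h) * h + (1000 * C ^+ 2 * lam) * h.
      by ring.
    have l4 := ler_wpM2r (ltW h_gt0) l2.
    have l5 := ler_wpM2r (ltW h_gt0) (Hh3 _ h_gt0 sh3).
    rewrite l3; move: l4 l5; set Y1 := _ * h * h; set Y2 := _ * lam * h; clear; lra.
  - exact: le_trans m2 l1.
  - exact: le_trans m3 l1.
have incr (z : R * R -> R) (g : grid n) : lip2 (@dom2 R) L z -> (forall p, dom2 p -> `|z p| <= B) ->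
  `|W (pt R g) * z (pt R g) * (W (pt R (sa g)) * z (pt R (sa g)) - W (pt R g) * z (pt R g))| <= cf * h
  /\ `|W (pt R g) * z (pt R g) * (W (pt R (sb g)) * z (pt R (sb g)) - W (pt R g) * z (pt R g))| <= cf * h.
  move=> lz bz0; have cfh : 0 <= cf * h by rewrite mulr_ge0 // ltW.
  have [ig|/outW [w0 _ _ _ _]] := boolP (inner (pt R g)); last first.
    by rewrite w0 !mul0r normr0.
  have [q1 q2 q3 q4] := pt_inner ig; have [d0 d1 d2 d3 d4] := nbhd _ ig.
  rewrite q1 q3 -/h.
  have h4 : `|h| <= 4 by lra_from hn.
  have key (e : R * R) (dW : R * R -> R) : `|e.1| + `|e.2| <= 1 -> dom2 (she e (pt R g) h) ->
     [/\ `|W (pt R g)| <= Mw, `|dW (pt R g)| <= Mw &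
       `|W (she e (pt R g) h) - W (pt R g) - h * dW (pt R g)| <= Mw * h ^+ 2] ->
     `|W (pt R g) * z (pt R g) * (W (she e (pt R g) h) * z (she e (pt R g) h) - W (pt R g) * z (pt R g))| <= cf * h.
    move=> ue dq [b1 b2 b3].
    have i1 := c11_incr Mw0 h4 b2 b3; rewrite hE in i1.
    have i2' := lip2_she lz L0 d0 dq ue; rewrite hE in i2'.
    rewrite normrM (_ : cf * h = (Mw * B) * (5 * Mw * h * B + Mw * (L * h))); last first.
      by rewrite /cf; ring.
    apply: ler_pM => //; first by rewrite normrM ler_pM // bz0.
    rewrite (_ : W (she e (pt R g) h) * z (she e (pt R g) h) - W (pt R g) * z (pt R g) =
      (W (she e (pt R g) h) - W (pt R g)) * z (she e (pt R g) h)
       + W (pt R g) * (z (she e (pt R g) h) - z (pt R g))); last by ring.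
    apply: le_trans (ler_normD _ _) _.
    apply: lerD; rewrite normrM; apply: ler_pM => //; exact: bz0.
  split.
    exact: (key _ _ u1 d1 (HMw1' _ _ h4 d0 d1)).
  exact: (key _ _ u2 d3 (HMw2' _ _ h4 d0 d3)).
have hyp5 (g : grid n) : [/\ `|f1 g * (f1 (sa g) - f1 g)| <= cf * h,
   `|f2 g * (f2 (sa g) - f2 g)| <= cf * h, `|f1 g * (f1 (sb g) - f1 g)| <= cf * h
   & `|f2 g * (f2 (sb g) - f2 g)| <= cf * h].
  by have [a1 a2] := incr z1 g lz1 bz1; have [b1 b2] := incr z2 g lz2 bz2.
have [{LC} LF LX] := LC cond1 cond2 cond3 hyp1 hyp2 hyp3 hyp4 hyp5.
move: LF LX.
set P := \sum_g (conj_op1 _ _ _ _ _ _ _ _ _ _ _ _ _ ^+ 2 + _).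
set F' := \sum_g (f1 g ^+ 2 + f2 g ^+ 2).
set XL := \sum_g (_ + _).
have -> : F' = F.
  by apply: eq_bigr => g _; rewrite /f1 /f2 /E /W; ring.
rewrite -/N -/C2 => LF LX.
pose ez := expR (8 * tau * eta ^+ 2).
have ez0 : 0 < ez by exact: expR_gt0.
have Mez : 0 <= M * ez by rewrite mulr_ge0 // ltW.
have dlh (p : R * R) (z : R * R -> R) : inner p -> lip2 (@dom2 R) L z -> (forall p, dom2 p -> `|z p| <= B) ->
  `|dd (e1 R) h (fun p => W p * z p) p - (W p * dd (e1 R) h z p
     + (tau * ph1 eta p * W p + (- 4 * p.1 * cut eta p * wexp eta tau p)) * z p)| <= dl * h /\
  `|dd (e2 R) h (fun p => W p * z p) p - (W p * dd (e2 R) h z p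
     + (tau * ph2 eta p * W p + (- 4 * p.2 * cut eta p * wexp eta tau p)) * z p)| <= dl * h.
  move=> ip lz bz0; split.
    have := dd_c11_mul HMw1' Mw0 L0 u1 lz bz0 h_gt0 h1' ip.
    by rewrite /dweight /= mul1r mul0r addr0 !mulNr.
  have := dd_c11_mul HMw2' Mw0 L0 u2 lz bz0 h_gt0 h1' ip.
  by rewrite /dweight /= mul1r mul0r add0r !mulNr.
have cutb (p : R * R) : inner p ->
  ((- 4 * p.1 * cut eta p * wexp eta tau p) ^+ 2 + (- 4 * p.2 * cut eta p * wexp eta tau p) ^+ 2)
   * (z1 p ^+ 2 + z2 p ^+ 2) <= T1 * (E p * (z1 p ^+ 2 + z2 p ^+ 2)) + T2 * (M * ez).
  move=> ip.
  have z0 : 0 <= z1 p ^+ 2 + z2 p ^+ 2 by rewrite addr_ge0 ?sqr_ge0.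
  have -> : (- 4 * p.1 * cut eta p * wexp eta tau p) ^+ 2 + (- 4 * p.2 * cut eta p * wexp eta tau p) ^+ 2
     = 16 * sqn p * (cut eta p * wexp eta tau p) ^+ 2 by rewrite /sqn; ring.
  have [c0'|c0'] := ltrP 0 (cut eta p); last first.
    have -> : cut eta p = 0 by apply/eqP; rewrite eq_le c0' /cut le_max lexx.
    rewrite mul0r expr0n /= mulr0 mul0r addr_ge0 //; first by rewrite mulr_ge0 // mulr_ge0 // sqr_ge0.
    by rewrite mulr_ge0.
  have cr := ler_wpM2r z0 (cut_region eta0 eta12 (ltW tau0) c0').
  apply: le_trans cr _; rewrite mulrDl; apply: lerD; first by rewrite [leRHS]mulrA.
  rewrite -/ez -/T2 -mulrA ler_wpM2l // [leLHS]mulrC.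
  by rewrite ler_wpM2r ?(ltW ez0) // HM // inner_dom2.
have hh2 : h ^+ 2 <= h by rewrite expr2 ler_piMl // ltW.
have nonneg_F (g : grid n) : 0 <= E (pt R g) * (z1 (pt R g) ^+ 2 + z2 (pt R g) ^+ 2).
  by rewrite mulr_ge0 ?addr_ge0 ?sqr_ge0.
have HP : P <= 3 * Q + 3 * (A1 * (T1 * F + T2 * (M * ez) * N)) + 6 * ((1 + 2 * C) * (dl * h)) ^+ 2 * N.
  have -> : 3 * Q + 3 * (A1 * (T1 * F + T2 * (M * ez) * N)) + 6 * ((1 + 2 * C) * (dl * h)) ^+ 2 * N
    = \sum_(g : grid n) (3 * (if inner (pt R g) then E (pt R g) *
      (dop1 al be h z1 z2 (pt R g) ^+ 2 + dop2 al be h z1 z2 (pt R g) ^+ 2) else 0)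
      + 3 * (A1 * (T1 * (E (pt R g) * (z1 (pt R g) ^+ 2 + z2 (pt R g) ^+ 2)) + T2 * (M * ez)))
      + 6 * ((1 + 2 * C) * (dl * h)) ^+ 2).
    rewrite big_split big_split /=; congr (_ + _ + _); last by rewrite sum_cst.
      by rewrite -mulr_sumr -big_mkcond.
    rewrite -mulr_sumr; congr (_ * _); rewrite -mulr_sumr; congr (_ * _).
    by rewrite big_split /= sum_cst -mulr_sumr.
  apply: ler_sum => g _.
  have [ig|nig] := boolP (inner (pt R g)); last first.
    have [[E1 E2 E3 E4] [E5 E6]] := hyp1 g nig.
    rewrite [leLHS](_ : _ = 0); last by rewrite /conj_op1 /conj_op2 E1 E2 E3 E4 E5 E6; ring.
    rewrite mulr0 add0r addr_ge0 //; last by rewrite mulr_ge0 // sqr_ge0.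
    rewrite mulr_ge0 // mulr_ge0 // addr_ge0 //; first by rewrite mulr_ge0.
    by rewrite mulr_ge0.
  have [[D1 D2] [D3 D4]] := (ddE z1 g ig, ddE z2 g ig).
  have [x1 x2] := dlh _ _ ig lz1 bz1; have [x3 x4] := dlh _ _ ig lz2 bz2.
  have [ca cb cb'] := Hb _ (inner_dom2 ig).
  rewrite /conj_op1 /conj_op2 /f1 /f2 D1 D2 D3 D4.
  apply: le_trans (conj_expand ca cb' x1 x3 x2 x4) _.
  rewrite lerD2r; apply: lerD; first by rewrite /dop1 /dop2.
  by rewrite ler_wpM2l // -/A1 ler_wpM2l // cutb.
have HX : X <= 4 * XL + 4 * (64 ^+ 2 * tau ^+ 2 * F) + 4 * (T1 * F + T2 * (M * ez) * N) + 8 * (dl * h) ^+ 2 * N.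
  have -> : 4 * XL + 4 * (64 ^+ 2 * tau ^+ 2 * F) + 4 * (T1 * F + T2 * (M * ez) * N) + 8 * (dl * h) ^+ 2 * N
    = \sum_(g : grid n) (4 * (cdiff h (@sa n) (@sa' n) f1 g ^+ 2 + cdiff h (@sb n) (@sb' n) f1 g ^+ 2
       + (cdiff h (@sa n) (@sa' n) f2 g ^+ 2 + cdiff h (@sb n) (@sb' n) f2 g ^+ 2))
      + 4 * (64 ^+ 2 * tau ^+ 2 * (E (pt R g) * (z1 (pt R g) ^+ 2 + z2 (pt R g) ^+ 2)))
      + 4 * (T1 * (E (pt R g) * (z1 (pt R g) ^+ 2 + z2 (pt R g) ^+ 2)) + T2 * (M * ez))
      + 8 * (dl * h) ^+ 2).
    rewrite big_split big_split big_split /=; congr (_ + _ + _ + _); last by rewrite sum_cst.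
    - by rewrite -mulr_sumr.
    - by rewrite -mulr_sumr; congr (_ * _); rewrite -mulr_sumr.
    rewrite -mulr_sumr; congr (_ * _).
    by rewrite big_split /= sum_cst -mulr_sumr.
  rewrite /X big_mkcond; apply: ler_sum => g _.
  have t64 : 0 <= 64 ^+ 2 * tau ^+ 2 by rewrite mulr_ge0 ?sqr_ge0.
  have [ig|nig] := boolP (inner (pt R g)); last first.
    rewrite !addr_ge0 // mulr_ge0 // ?sqr_ge0 // ?addr_ge0 ?sqr_ge0 // mulr_ge0 //.
  have [[D1 D2] [D3 D4]] := (ddE z1 g ig, ddE z2 g ig).
  have [_ x2] := dlh _ _ ig lz1 bz1; have [_ x4] := dlh _ _ ig lz2 bz2.
  have y1 := diff_expand x2; have y2 := diff_expand x4.
  have y3 := cutb _ ig.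
  have [_ p2] := ph_bound eta0 eta12 (inner_dom2 ig).
  have p3 := ler_norm_sqr p2.
  have y4 : tau ^+ 2 * ph2 eta (pt R g) ^+ 2 * (E (pt R g) * (z1 (pt R g) ^+ 2 + z2 (pt R g) ^+ 2)) <=
    64 ^+ 2 * tau ^+ 2 * (E (pt R g) * (z1 (pt R g) ^+ 2 + z2 (pt R g) ^+ 2)).
    by rewrite ler_wpM2r // mulrC ler_wpM2r // sqr_ge0.
  rewrite /f1 /f2 D1 D2 D3 D4.
  have s1 := sqr_ge0 (dd (e1 R) h (fun p => W p * z1 p) (pt R g)).
  have s2 := sqr_ge0 (dd (e1 R) h (fun p => W p * z2 p) (pt R g)).
  have y5 : (- 4 * (pt R g).2 * cut eta (pt R g) * wexp eta tau (pt R g)) ^+ 2 * (z1 (pt R g) ^+ 2 + z2 (pt R g) ^+ 2) <=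
    ((- 4 * (pt R g).1 * cut eta (pt R g) * wexp eta tau (pt R g)) ^+ 2 + (- 4 * (pt R g).2 * cut eta (pt R g) * wexp eta tau (pt R g)) ^+ 2)
   * (z1 (pt R g) ^+ 2 + z2 (pt R g) ^+ 2).
    by rewrite ler_wpM2r ?addr_ge0 ?sqr_ge0 // lerDr sqr_ge0.
  move: y1 y2 (le_trans y5 y3) y4 s1 s2; rewrite /E -/(W _); clear.
  set Y1 := dd _ _ _ _ ^+ 2; set Y2 := dd _ _ _ _ ^+ 2; set Y3 := dd _ _ _ _ ^+ 2.
  set Y4 := dd _ _ _ _ ^+ 2; set Y5 := dd _ _ _ _ ^+ 2; set Y6 := dd _ _ _ _ ^+ 2.
  set U := W (pt R g) ^+ 2; set V1 := z1 _ ^+ 2; set V2 := z2 _ ^+ 2.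
  set S := (- 4 * _ * _ * _) ^+ 2; set q := ph2 _ _ ^+ 2; set t2 := tau ^+ 2.
  set dh := (dl * h) ^+ 2; set T3 := T2 * _.
  rewrite !(mulrDr _ V1) !(mulrDr U) => y1 y2 y3 y4 s1 s2.
  lra.
have Q0 : 0 <= Q by apply: sumr_ge0 => g _; rewrite mulr_ge0 ?addr_ge0 ?sqr_ge0.
have F0 : 0 <= F by apply: sumr_ge0 => g _; exact: nonneg_F.
have eN : 0 <= eps * N by rewrite mulr_ge0 // ltW.
have MN : 0 <= M * ez * N by rewrite mulr_ge0.
have ZE : Z = M * ez * N + eps * N by rewrite /Z -/N -/ez; ring.
have Z0 : 0 <= Z by rewrite ZE addr_ge0.
have r1 : 16 * tau * Cl * (cf * h) * N <= eps * N.
  by rewrite ler_wpM2r // mulrA Hh1.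
have hq := Hh2 _ h_gt0 sh2.
have r2 : 6 * ((1 + 2 * C) * (dl * h)) ^+ 2 * N <= eps * N.
  rewrite ler_wpM2r // mulrA exprMn; apply: le_trans hq.
  have := ler_wpM2l (sqr_ge0 ((1 + 2 * C) * dl)) hh2.
  have := mulr_ge0 (sqr_ge0 dl) (ltW h_gt0); clear.
  by set Y1 := dl ^+ 2; set Y2 := _ ^+ 2; set Y3 := h ^+ 2; lra.
have r3 : 8 * (dl * h) ^+ 2 * N <= eps * N.
  rewrite ler_wpM2r // exprMn; apply: le_trans hq.
  have := ler_wpM2l (sqr_ge0 dl) hh2.
  have := mulr_ge0 (sqr_ge0 ((1 + 2 * C) * dl)) (ltW h_gt0); clear.
  by set Y1 := dl ^+ 2; set Y2 := _ ^+ 2; set Y3 := h ^+ 2; lra.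
have S0 : 0 <= Q + F + Z by rewrite !addr_ge0.
have P1 : P <= K1 * (Q + F + Z).
  have w := weighted_sum3 (K := K1) (a := 3) (b := 3 * (A1 * T1)) (c := 3 * (A1 * T2) + 1) Q0 F0 Z0
    ltac:(rewrite /K1; lra_from A1T1 A1T2) ltac:(rewrite /K1; lra_from A1T1 A1T2)
    ltac:(rewrite /K1; lra_from A1T1 A1T2).
  apply: le_trans w; apply: le_trans HP _.
  have m := mulr_ge0 A1T2 eN.
  move: r2 m eN MN; rewrite ZE; clear; set Y := 6 * _ * N; set U := M * ez * N; set V := eps * N.
  rewrite (_ : T2 * (M * ez) * N = T2 * U); last by rewrite /U; ring.
  lra.
have tF : F <= tau ^+ 2 * F.
  by rewrite ler_peMl // expr2 -[1]mulr1 ler_pM.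
have tF0 : 0 <= tau ^+ 2 * F by rewrite mulr_ge0 ?sqr_ge0.
have S20 : 0 <= Q + tau ^+ 2 * F + Z by rewrite !addr_ge0.
have SS : Q + F + Z <= Q + tau ^+ 2 * F + Z by rewrite lerD2r lerD2l.
have K1S := ler_wpM2l K10 SS.
have K1g : 2 <= K1 by rewrite /K1; lra_from A1T1 A1T2.
have ZS : Z <= Q + F + Z by rewrite lerDr addr_ge0.
have ZS2 : 2 * (Q + F + Z) <= K1 * (Q + F + Z) by rewrite ler_wpM2r.
have eNZ : eps * N <= Z by rewrite ZE lerDr.
split.
  apply: (@le_trans _ _ (K2 * (Q + F + Z))); last first.
    by rewrite ler_wpM2r // /K; lra_from K30 T10 T20.
  rewrite /K2 mulrAC ler_pdivlMr //.
  move: LF P1 r1 ZS ZS2 eNZ S0; rewrite -(mulrA _ _ (Q + F + Z)); clear.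
  set S := Q + F + Z; set Y1 := K1 * S; set Y2 := 16 * _ * _ * _ * _; set Y3 := eps * N.
  rewrite (_ : 2 * k * tau * F = 2 * (tau * F * k)); last by ring.
  set Y4 := tau * F * k; lra.
have k3 : 4 * XL <= K3 * (Q + tau ^+ 2 * F + Z).
  rewrite /K3 mulrAC ler_pdivlMr //.
  have t1 : (C2 + k) * (tau ^+ 2 * F) <= (C2 + k) * (Q + tau ^+ 2 * F + Z).
    rewrite ler_wpM2l //; first by lra_from C20 k0.
    by lra_from Q0 Z0.
  move: LX P1 r1 ZS ZS2 eNZ t1 K1S S0; clear.
  set S := Q + F + Z; set S2 := Q + _ + Z; set Y2 := 16 * _ * _ * _ * _; set Y3 := eps * N.
  rewrite (_ : 4 * XL * k = 4 * (k * XL)); last by ring.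
  rewrite (_ : 4 * _ * S2 = 32 * (K1 * S2) + 8 * ((C2 + k) * S2)); last by ring.
  rewrite -(mulrA _ _ F) -(mulrA 2 (C2 + k)).
  set Y4 := k * XL; set Y5 := K1 * S; set Y6 := K1 * S2; set Y7 := _ * S2.
  set Y8 := _ * (_ * F); lra.
have w := weighted_sum3 (K := K - K3) (a := 0) (b := 4 * 64 ^+ 2 + 4 * T1) (c := 4 * T2 + 1) Q0 tF0 Z0
    ltac:(rewrite /K; lra_from K20 K30 T10 T20) ltac:(rewrite /K; lra_from K20 K30 T10 T20)
    ltac:(rewrite /K; lra_from K20 K30 T10 T20).
rewrite mulrBl in w.
have t1 := ler_wpM2l T10 tF.
have t2 := mulr_ge0 T20 eN.
move: HX w k3 t1 t2 r3 eN MN; rewrite ZE; clear.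
set S2 := Q + _ + _; set Y := 8 * _ * N; set U := M * ez * N; set V := eps * N.
rewrite (_ : T2 * (M * ez) * N = T2 * U); last by rewrite /U; ring.
rewrite -(mulrA (64 ^+ 2)); set G := tau ^+ 2 * F.
rewrite mul0r add0r; lra.
Qed.

End Single3.

(** * Unique continuation across a circle *)


Section Core.
Variable R : realType.
Implicit Types (p q e : R * R) (h : R).

(* Absorption: [W], [V], [X] are the weighted norms of w, v and grad v. *)
Lemma absorb_pair (K C lam tau W V X Z : R) :
  1 <= K -> 1 <= C -> 0 <= lam -> 16 * (2 * K * C) ^+ 3 * lam <= 1 -> 8 * K * C <= tau ->
  0 <= W -> 0 <= V -> 0 <= X -> 0 <= Z ->
  tau * W <= K * (lam * (W + V + X) + W + Z) ->
  tau * V <= K * (C * (W + V) + V + Z) ->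
  X <= K * (C * (W + V) + tau ^+ 2 * V + Z) -> V <= 2 * Z.
Proof.
move=> K1 C1 lam0 hlam htau W0 V0 X0 Z0 HW HV HX.
pose a := 2 * K * C.
have KC : K <= K * C by rewrite ler_peMr //; lra_from K1.
have a2 : 2 <= a by rewrite /a; lra_from KC K1.
have a0 : 0 <= a by lra_from a2.
have K0 : 0 <= K by lra_from K1.
have tau4 : 4 * a <= tau by rewrite /a; lra_from htau.
have tau8 : 8 <= tau by lra_from tau4 a2.
have tau0 : 0 < tau by lra_from tau8.
have WV : 0 <= W + V by rewrite addr_ge0.
have V1 : tau * V <= a * (W + V + Z).
  apply: le_trans HV _.
  have h1 : 0 <= K * C * W by rewrite !mulr_ge0 //; lra_from C1.
  have h2 := ler_wpM2r V0 KC; have h3 := ler_wpM2r Z0 KC.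
  have h4 : 0 <= K * C * Z by rewrite !mulr_ge0 //; lra_from C1.
  move: h1 h2 h3 h4; rewrite /a; clear.
  rewrite (_ : K * (C * (W + V) + V + Z) = K * C * W + K * C * V + K * V + K * Z); last by ring.
  rewrite (_ : 2 * K * C * (W + V + Z) = 2 * (K * C * W) + 2 * (K * C * V) + 2 * (K * C * Z)); last by ring.
  set Y1 := K * C * W; set Y2 := K * C * V; set Y3 := K * C * Z; set Y4 := K * V; set Y5 := K * Z; lra.
have WZ : 0 <= W + Z by rewrite addr_ge0.
have aWZ : 0 <= a * (W + Z) by rewrite mulr_ge0.
have V2 : tau * V <= 2 * (a * (W + Z)).
  have h1 := ler_wpM2r V0 tau4.
  move: V1 h1 aWZ; clear; rewrite (_ : a * (W + V + Z) = a * (W + Z) + a * V); last by ring.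
  by rewrite -!mulrA; set Y1 := a * V; set Y2 := a * (W + Z); set Y3 := tau * V; lra.
have V3 : V <= W + Z.
  have h1 := ler_wpM2r V0 tau4; have a0' : 0 < a by lra_from a2.
  rewrite -(ler_pM2l a0'); move: V2 h1 aWZ; clear; rewrite -!mulrA.
  set Y1 := a * V; set Y2 := a * (W + Z); set Y3 := tau * V; move=> *.
  lra.
have tV : tau ^+ 2 * V <= 2 * a * tau * (W + Z).
  have := ler_wpM2l (ltW tau0) V2.
  rewrite (_ : tau ^+ 2 * V = tau * (tau * V)); last by ring.
  by rewrite (_ : 2 * a * tau * (W + Z) = tau * (2 * (a * (W + Z)))) //; ring.
have at0 : 0 <= a * tau * (W + Z) by rewrite mulr_ge0 // mulr_ge0 // ltW.
have X1 : X <= 3 * (a ^+ 2 * tau * (W + Z)).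
  apply: le_trans HX _.
  have h1 := ler_wpM2l K0 tV.
  have KKC : 2 * K <= a by rewrite /a; lra_from KC.
  have h2 := ler_wpM2r at0 KKC.
  have h3 := ler_wpM2r WZ KKC.
  have CK : K * C * (W + V) <= a * (W + Z).
    rewrite (_ : K * C = a / 2); last by rewrite /a; field.
    have := ler_wpM2l a0 (lerD (lexx W) V3); have := mulr_ge0 a0 Z0; clear.
    rewrite (_ : a / 2 * (W + V) = a * (W + V) / 2); last by ring.
    rewrite (_ : a * (W + (W + Z)) = 2 * (a * W) + a * Z); last by ring.
    rewrite [a * (W + Z)]mulrDr.
    set Y1 := a * W; set Y2 := a * (W + V); set Y3 := a * Z; lra.
  have h4 : a * (W + Z) <= a * (W + Z) * (a * tau / 16).
    rewrite ler_peMr // ?mulr_ge0 //.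
    have : 2 * 8 <= a * tau by apply: ler_pM.
    lra_from h1.
  have h5 : K * Z <= K * (W + Z) by rewrite ler_wpM2l // lerDr.
  move: h1 h2 h3 h4 h5 CK.
  rewrite (_ : K * (C * (W + V) + tau ^+ 2 * V + Z) = K * C * (W + V) + K * (tau ^+ 2 * V) + K * Z); last by ring.
  rewrite (_ : K * (2 * a * tau * (W + Z)) = 2 * K * (a * tau * (W + Z))); last by ring.
  rewrite (_ : a * (a * tau * (W + Z)) = a ^+ 2 * tau * (W + Z)); last by ring.
  rewrite (_ : a * (W + Z) * (a * tau / 16) = a ^+ 2 * tau * (W + Z) / 16); last by ring.
  have : 0 <= a ^+ 2 * tau * (W + Z) by rewrite mulr_ge0 // mulr_ge0 ?sqr_ge0 // ltW.
  rewrite -(mulrA 2 K (W + Z)).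
  clear; set Y1 := a ^+ 2 * tau * _; set Y2 := 2 * K * (a * _ * _); set Y3 := K * (tau ^+ 2 * V).
  set Y4 := K * C * _; set Y5 := K * Z; set Y6 := a * (W + Z); set Y7 := K * (W + Z); lra.
have lX : lam * X <= 3 / (16 * a) * tau * (W + Z).
  have h1 := ler_wpM2l lam0 X1.
  have a0' : 0 < a by lra_from a2.
  apply: le_trans h1 _.
  have -> : lam * (3 * (a ^+ 2 * tau * (W + Z))) = 16 * a ^+ 3 * lam * (3 / (16 * a) * tau * (W + Z)).
    by field; rewrite gt_eqF.
  rewrite ler_piMl // mulr_ge0 // mulr_ge0 ?(ltW tau0) // divr_ge0 //.
  by rewrite mulr_ge0.
have lam1 : lam <= 1 / 128.
  have h1 : 16 * 8 * lam <= 16 * a ^+ 3 * lam.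
    rewrite ler_wpM2r // ler_wpM2l // (_ : 8 = 2 ^+ 3); last by ring.
    by rewrite lerXn2r // nnegrE.
  by move: h1 hlam; rewrite -/a; set Y := 16 * a ^+ 3 * lam; clear; lra.
have W1 : tau * W <= tau / 2 * (W + Z).
  apply: le_trans HW _.
  have h1 : lam * (W + V) <= 1 / 128 * (2 * (W + Z)).
    by apply: ler_pM => //; lra_from V3 Z0.
  have KKC : 2 * K <= a by rewrite /a; lra_from KC.
  have h2 := ler_wpM2l K0 (lerD h1 lX).
  have h3 : K * (3 / (16 * a) * tau * (W + Z)) <= 3 / 32 * (tau * (W + Z)).
    have a0' : 0 < a by lra_from a2.
    rewrite (_ : K * _ = 3 / 16 * (K / a) * (tau * (W + Z))); last by field; rewrite gt_eqF.
    rewrite ler_wpM2r // ?mulr_ge0 ?(ltW tau0) //.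
    have : K / a <= 1 / 2 by rewrite ler_pdivrMr //; lra_from KKC.
    by set Y := K / a; clear; lra.
  have h4 : K * (W + Z) <= tau / 8 * (W + Z).
    by rewrite ler_wpM2r //; lra_from KKC tau4.
  have tWZ : 0 <= tau * (W + Z) by rewrite mulr_ge0 // ltW.
  have h5 : K * (1 / 128 * (2 * (W + Z))) <= 1 / 64 * (tau / 8 * (W + Z)).
    rewrite (_ : K * (1 / 128 * (2 * (W + Z))) = 1 / 64 * (K * (W + Z))); last by field.
    by apply: ler_wpM2l => //; clear; lra.
  move: h2 h3 h4 h5 tWZ.
  rewrite (_ : K * (lam * (W + V + X) + W + Z) = K * (lam * (W + V) + lam * X) + K * (W + Z)); last by ring.
  rewrite [K * (1 / 128 * _ + _)]mulrDr.
  rewrite (_ : tau / 8 * (W + Z) = tau * (W + Z) / 8); last by ring.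
  rewrite (_ : tau / 2 * (W + Z) = tau * (W + Z) / 2); last by ring.
  clear; set Y1 := K * (lam * _ + _); set Y2 := K * (_ / _ * _ * _); set Y3 := K * (W + Z).
  set Y4 := K * (1 / _ * _); set Y5 := tau * (W + Z); lra.
have W2 : W <= Z.
  have : W <= 1 / 2 * (W + Z).
    rewrite -(ler_pM2l tau0); apply: le_trans W1 _.
    by rewrite le_eqVlt; apply/orP; left; apply/eqP; field.
  by clear; lra.
lra_from V3 W2.
Qed.

Lemma grid_count (n : nat) (x rho : R) : `|x| <= 3 / 2 -> 0 < rho -> rho <= 1 / 2 ->
  step R n <= rho -> rho / step R n <=
    #|[set i : 'I_n.+2 | `|- 2 + step R n * i%:R - x| <= rho]|%:R.
Proof.
rewrite ler_norml => /andP[x1 x2] r0 r1 hr; set h := step R n in hr *.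
have h0 : 0 < h by exact: step_gt0.
pose i0 := Num.truncn ((x + 2) / h); pose m := Num.truncn (rho / h).
have q0 : 0 <= (x + 2) / h by rewrite divr_ge0 ?(ltW h0) //; lra_from x1.
have /andP[i1 i2] := truncn_itv q0.
have q1 : 0 <= rho / h by rewrite divr_ge0 ?(ltW h0) // ltW.
have /andP[m1 m2] := truncn_itv q1.
rewrite -/i0 in i1 i2; rewrite -/m in m1 m2.
rewrite ler_pdivlMr // in i1; rewrite ltr_pdivrMr // in i2; rewrite ler_pdivlMr // in m1.
have hl : h * n.+1%:R = 4 by have := step_last R n; rewrite -/h; clear; lra.
have bnd k : (k <= m)%N -> (i0 + k < n.+2)%N.
  move=> km; rewrite ltnS -(ler_nat R) -(ler_pM2l h0) hl natrD.
  have hk : h * k%:R <= h * m%:R by rewrite ler_wpM2l ?ler_nat // ltW.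
  move: i1 m1 x2 r1 hk; rewrite mulrDr [h * m%:R]mulrC [h * i0%:R]mulrC.
  by clear; set Y := h * _; set Y1 := _ * h; set Y2 := _ * h; lra.
pose f (k : 'I_m.+1) : 'I_n.+2 := Ordinal (bnd k (ltn_ord k : (k <= m)%N)).
have finj : injective f.
  by move=> a b [] /eqP; rewrite eqn_add2l => /eqP; exact: val_inj.
have : (#|[set f k | k : 'I_m.+1]| <= #|[set i : 'I_n.+2 | (`|- 2 + h * i%:R - x| <= rho)%R]|)%N.
  apply: subset_leq_card; apply/fintype.subsetP => i /imsetP[k _ ->]; rewrite inE /= natrD.
  have km : k%:R <= m%:R :> R by rewrite ler_nat -ltnS.
  have k0 : 0 <= k%:R :> R by [].
  have hk : h * k%:R <= h * m%:R by rewrite ler_wpM2l // ltW.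
  have hk0 : 0 <= h * k%:R by rewrite mulr_ge0 // ltW.
  rewrite -[i0.+1%:R]natr1 mulrDl mul1r in i2.
  rewrite ler_norml mulrDr; move: i1 i2 m1 hk hk0 hr; clear.
  rewrite [h * m%:R]mulrC [h * i0%:R]mulrC; set Y := h * _; set Y1 := _ * h; set Y2 := _ * h => *.
  by apply/andP; split; lra.
rewrite card_imset // card_ord -(ler_nat R); apply: le_trans; exact: ltW.
Qed.

End Core.

Section Ucp.
Variable R : realType.
Implicit Types (p q e : R * R) (h : R).

Lemma exists_step (d : R) : 0 < d -> exists n, step R n < d.
Proof.
move=> d0; exists (Num.truncn (4 / d)).
have /andP[_] : (Num.truncn (4 / d))%:R <= 4 / d < (Num.truncn (4 / d)).+1%:R.
  by apply: truncn_itv; rewrite divr_ge0 // ltW.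
by rewrite /step ltr_pdivrMr // => H; rewrite ltr_pdivrMr // mulrC.
Qed.

Lemma card_grid_le n : #|grid n|%:R * step R n ^+ 2 <= 64.
Proof.
rewrite /grid card_prod !card_ord natrM /step.
have n1 : 0 < n.+1%:R :> R by rewrite ltr0n.
have n2 : n.+2%:R <= 2 * n.+1%:R :> R by rewrite -natrM ler_nat mul2n -addnn addSnnS leq_addl.
rewrite expr_div_n mulrA ler_pdivrMr ?exprn_gt0 //.
have n20 : 0 <= n.+2%:R :> R by [].
have := ler_pM n20 n20 n2 n2; clear; lra.
Qed.

Lemma weight_lower eta tau p : 0 < eta -> 0 <= tau -> sqn p < 1 + eta ->
  16 * eta ^+ 4 * expR (18 * tau * eta ^+ 2) <= weight eta tau p ^+ 2.
Proof.
move=> e0 t0 sp.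
have c2 : 2 * eta <= cut eta p by rewrite /cut le_max; apply/orP; right; lra.
have -> : weight eta tau p ^+ 2 = cut eta p ^+ 4 * wexp eta tau p ^+ 2.
  by rewrite /weight; ring.
have -> : 16 * eta ^+ 4 = (2 * eta) ^+ 4 by ring.
apply: ler_pM.
- by rewrite exprn_ge0 // mulr_ge0 // ltW.
- exact: expR_ge0.
- by rewrite lerXn2r ?nnegrE; lra.
rewrite [leRHS]expr2 /wexp -expRD ler_expR.
have : (3 * eta) ^+ 2 <= (1 + 4 * eta - sqn p) ^+ 2.
  by rewrite lerXn2r ?nnegrE; lra.
move=> H; have := ler_wpM2l t0 H; lra.
Qed.

Theorem ucp_core (c0 C : R) : 0 < c0 -> 1 <= C ->
  exists eta lam0 : R, [/\ 0 < eta, eta <= 1 / 12, 0 < lam0 &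
  forall (lam L : R) (al be ga de w1 w2 v1 v2 : R * R -> R), 0 <= lam -> lam <= lam0 ->
    (forall p, dom2 p -> [/\ `|al p| <= C, c0 <= `|be p| & `|be p| <= C]) ->
    (forall p, dom2 p -> [/\ `|ga p| <= C, c0 <= `|de p| & `|de p| <= C]) ->
    [/\ lip2 (@dom2 R) lam al, lip2 (@dom2 R) lam be, lip2 (@dom2 R) lam ga
      & lip2 (@dom2 R) lam de] ->
    0 <= L ->
    [/\ lip2 (@dom2 R) L w1, lip2 (@dom2 R) L w2, lip2 (@dom2 R) L v1
      & lip2 (@dom2 R) L v2] ->
    (forall p, sqn p < 1 -> [/\ w1 p = 0, w2 p = 0, v1 p = 0 & v2 p = 0]) ->
    (forall eps, 0 < eps -> exists2 h0 : R, 0 < h0 & forall h p, 0 < h -> h < h0 -> inner p ->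
       dop1 al be h w1 w2 p ^+ 2 + dop2 al be h w1 w2 p ^+ 2 <=
         lam * (w1 p ^+ 2 + w2 p ^+ 2 + (v1 p ^+ 2 + v2 p ^+ 2)
                + (dd (e2 R) h v1 p ^+ 2 + dd (e2 R) h v2 p ^+ 2)) + eps /\
       dop1 ga de h v1 v2 p ^+ 2 + dop2 ga de h v1 v2 p ^+ 2 <=
         C * (w1 p ^+ 2 + w2 p ^+ 2 + (v1 p ^+ 2 + v2 p ^+ 2)) + eps) ->
    forall p, sqn p < 1 + eta -> v1 p = 0 /\ v2 p = 0].
Proof.
move=> c00 C1.
have [eta [lam1 [K [eta0 eta12 lam10 K1 Hsingle]]]] := carleman_single c00 C1.
have KC0 : 0 < 16 * (2 * K * C) ^+ 3.
  by rewrite mulr_gt0 // exprn_gt0 // !mulr_gt0 //; lra.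
exists eta, (Num.min lam1 (16 * (2 * K * C) ^+ 3)^-1); split=> //.
  by rewrite lt_min lam10 invr_gt0.
move=> lam L al be ga de w1 w2 v1 v2 lam_ge0; rewrite le_min => /andP[lam_le1 lam_le2].
move=> Hb1 Hb2 [lal lbe lga lde] L0 [lw1 lw2 lv1 lv2] Hvan Hop p1 sp1.
have lamK : 16 * (2 * K * C) ^+ 3 * lam <= 1.
  by move: lam_le2; rewrite -[X in lam <= X]mul1r ler_pdivlMr // mulrC.
suff : v1 p1 ^+ 2 + v2 p1 ^+ 2 <= 0.
  have s1 := sqr_ge0 (v1 p1); have s2 := sqr_ge0 (v2 p1) => H.
  have /eqP : v1 p1 ^+ 2 = 0 by lra.
  have /eqP : v2 p1 ^+ 2 = 0 by lra.
  by rewrite !sqrf_eq0 => /eqP -> /eqP ->.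
rewrite leNgt; apply/negP; set kap := _ + _ => kap0.
pose M := 32 * L ^+ 2.
have M0 : 0 <= M by rewrite mulr_ge0 // sqr_ge0.
have bM (z1 z2 : R * R -> R) : lip2 (@dom2 R) L z1 -> lip2 (@dom2 R) L z2 ->
    z1 (0, 0) = 0 -> z2 (0, 0) = 0 -> forall p, dom2 p -> z1 p ^+ 2 + z2 p ^+ 2 <= M.
  have d00 : dom2 (0 : R, 0 : R) by rewrite /dom2 /= normr0 ler0n.
  have b1 (z : R * R -> R) p : lip2 (@dom2 R) L z -> z (0, 0) = 0 -> dom2 p -> z p ^+ 2 <= 16 * L ^+ 2.
    move=> lz z0 dp; have := lz _ _ dp d00; rewrite z0 !subr0 /= => H.
    have : `|z p| <= L * 4.
      apply: le_trans H _; rewrite ler_wpM2l //; have /andP[] := dp; clear; lra.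
    by move/ler_norm_sqr; clear; lra.
  move=> l1 l2 z10 z20 p dp; have := b1 _ _ l1 z10 dp; have := b1 _ _ l2 z20 dp.
  by rewrite /M; clear; set Y := L ^+ 2; lra.
have [w10 w20 v10 v20] : [/\ w1 (0, 0) = 0, w2 (0, 0) = 0, v1 (0, 0) = 0 & v2 (0, 0) = 0].
  by apply: Hvan; rewrite /sqn /= expr0n /= addr0.
have gap : 0 < 1 + eta - sqn p1 by lra_from sp1.
have [r1 r10 Hr1] := small_step (c := 8 * L ^+ 2) (e := kap / 4)
  ltac:(rewrite mulr_ge0 // sqr_ge0 //) ltac:(lra_from kap0).
pose rho := Num.min (1 / 2) (Num.min (r1 / 2) ((1 + eta - sqn p1) / 16)).
have rho0 : 0 < rho.
  by rewrite /rho !lt_min; apply/and3P; split; [clear; lra|lra_from r10|lra_from gap].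
have rho2 : rho <= 1 / 2 by rewrite /rho ge_min lexx.
have rhor : rho < r1.
  have : rho <= r1 / 2 by rewrite /rho !ge_min lexx orbT.
  by lra_from r10.
have rhog : 16 * rho <= 1 + eta - sqn p1.
  have : rho <= (1 + eta - sqn p1) / 16 by rewrite /rho !ge_min lexx !orbT.
  by clear; lra.
have rk := Hr1 _ rho0 rhor.
pose c := rho ^+ 2 * eta ^+ 4 * kap / 16.
have c_gt0 : 0 < c by rewrite /c divr_gt0 // !mulr_gt0.
pose tau := 8 * K * C + 2 * (M + 2) / (10 * c * eta ^+ 2).
have d0 : 0 < 10 * c * eta ^+ 2 by apply: mulr_gt0; [exact: mulr_gt0 | exact: exprn_gt0].
have t1 : 0 <= 2 * (M + 2) / (10 * c * eta ^+ 2).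
  by rewrite divr_ge0 ?(ltW d0) // mulr_ge0 //; lra_from M0.
have KC1 : 1 <= K * C by rewrite -[1]mulr1 ler_pM.
have tau1 : 1 <= tau by rewrite /tau; lra_from t1 KC1.
have tau0 : 0 < tau by lra_from tau1.
have tauK : 8 * K * C <= tau by rewrite /tau lerDl.
pose ez := expR (8 * tau * eta ^+ 2).
have ez0 : 0 < ez by exact: expR_gt0.
have [Mw Mw0 HMw] := c11_weight eta tau (e1 R).
pose eps := ez / 1.
have eps0 : 0 < eps by rewrite divr_gt0.
have Mw21 : 0 < Mw ^+ 2 + 1 by have := sqr_ge0 Mw; clear; lra.
pose ep := eps / (Mw ^+ 2 + 1).
have ep0 : 0 < ep by rewrite divr_gt0.
have [h1 h10 Hh1] := Hop ep ep0.
have [h2 h20 Hh2] := Hsingle lam al be lam_ge0 lam_le1 Hb1 lal lbe tau w1 w2 L M tau1 L0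
  lw1 lw2 (bM _ _ lw1 lw2 w10 w20) ltac:(by move=> p /Hvan[]) eps eps0.
have [h3 h30 Hh3] := Hsingle lam ga de lam_ge0 lam_le1 Hb2 lga lde tau v1 v2 L M tau1 L0
  lv1 lv2 (bM _ _ lv1 lv2 v10 v20) ltac:(by move=> p /Hvan[]) eps eps0.
have [n] : exists n, step R n < Num.min h1 (Num.min h2 (Num.min h3 rho)).
  by apply: exists_step; rewrite lt_min h10 lt_min h20 lt_min h30 rho0.
rewrite lt_min => /andP[sh1]; rewrite lt_min => /andP[sh2]; rewrite lt_min => /andP[sh3 sh4].
have := Hh2 n sh2; have := Hh3 n sh3; move: Hh2 Hh3 => _ _.
set h := step R n in sh1 sh2 sh3 sh4 *.
have h_gt0 : 0 < h by exact: step_gt0.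
set E := fun p => weight eta tau p ^+ 2.
rewrite /= -/ez.
set V := \sum_g _; set Qv := \sum_(g | _) _; set Xv := \sum_(g | _) _.
set N := #|grid n|%:R.
set Z := N * (M * ez + eps).
move=> [HV HX]; set W := \sum_g _; set Qw := \sum_(g | _) _; set Xw := \sum_(g | _) _.
move=> [HW _].
have N0 : 0 <= N by rewrite /N.
have Enn p : 0 <= E p by exact: sqr_ge0.
have sq2 (x y : R) : 0 <= x ^+ 2 + y ^+ 2 by rewrite addr_ge0 ?sqr_ge0.
have W0 : 0 <= W by apply: sumr_ge0 => g _; rewrite mulr_ge0.
have V0 : 0 <= V by apply: sumr_ge0 => g _; rewrite mulr_ge0.
have X0 : 0 <= Xv by apply: sumr_ge0 => g _; rewrite mulr_ge0.
have Z0 : 0 <= Z.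
  by apply: mulr_ge0 => //; apply: addr_ge0; [apply: mulr_ge0 => //|]; exact: ltW.
have eN : 0 <= eps * N by rewrite mulr_ge0 // ltW.
have Eep p : inner p -> E p * ep <= eps.
  move=> ip; have dp := inner_dom2 ip.
  have s0 : she (e1 R) p 0 = p by case: p {ip dp} => x y; rewrite /she /= !mul0r !addr0.
  have [a1 _ _] := HMw p 0 ltac:(by rewrite normr0) dp ltac:(by rewrite s0).
  have := ler_norm_sqr a1; rewrite -/(E p) => a2.
  rewrite /ep mulrA ler_pdivrMr // mulrC ler_wpM2l ?(ltW eps0) //.
  by move: a2; set Y := _ ^+ 2; clear; lra.
have QW : Qw <= lam * (W + V + Xv) + eps * N.
  have -> : lam * (W + V + Xv) + eps * N = \sum_(g : grid n)
     (lam * (E (pt R g) * (w1 (pt R g) ^+ 2 + w2 (pt R g) ^+ 2)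
        + E (pt R g) * (v1 (pt R g) ^+ 2 + v2 (pt R g) ^+ 2)
        + (if inner (pt R g) then E (pt R g) *
            (dd (e2 R) h v1 (pt R g) ^+ 2 + dd (e2 R) h v2 (pt R g) ^+ 2) else 0)) + eps).
    rewrite big_split /= sum_cst; congr (_ + _); rewrite -mulr_sumr; congr (_ * _).
    by rewrite big_split big_split /= -big_mkcond.
  rewrite /Qw big_mkcond; apply: ler_sum => g _.
  have [ig|nig] := boolP (inner (pt R g)); last first.
    by rewrite addr_ge0 ?(ltW eps0) // mulr_ge0 // !addr_ge0 // mulr_ge0.
  have [H _] := Hh1 h _ h_gt0 sh1 ig.
  have := ler_wpM2l (Enn (pt R g)) H; have := Eep _ ig; clear.
  set A1 := _ ^+ 2 + _; set A2 := w1 _ ^+ 2 + _; set A3 := v1 _ ^+ 2 + _.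
  set A4 := dd _ _ v1 _ ^+ 2 + _; set e0 := E _ => Z1 H; apply: le_trans H _.
  rewrite (_ : e0 * (lam * (A2 + A3 + A4) + ep) = lam * (e0 * A2 + e0 * A3 + e0 * A4) + e0 * ep); last by ring.
  by rewrite lerD2l.
have QV : Qv <= C * (W + V) + eps * N.
  have -> : C * (W + V) + eps * N = \sum_(g : grid n)
     (C * (E (pt R g) * (w1 (pt R g) ^+ 2 + w2 (pt R g) ^+ 2)
        + E (pt R g) * (v1 (pt R g) ^+ 2 + v2 (pt R g) ^+ 2)) + eps).
    rewrite big_split /= sum_cst; congr (_ + _); rewrite -mulr_sumr; congr (_ * _).
    by rewrite big_split.
  rewrite /Qv big_mkcond; apply: ler_sum => g _.
  have [ig|nig] := boolP (inner (pt R g)); last first.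
    by apply: addr_ge0; [apply: mulr_ge0; [lra_from C1|apply: addr_ge0; exact: mulr_ge0]|exact: ltW].
  have [_ H] := Hh1 h _ h_gt0 sh1 ig.
  have := ler_wpM2l (Enn (pt R g)) H; have := Eep _ ig; clear.
  set A1 := _ ^+ 2 + _; set A2 := w1 _ ^+ 2 + _; set A3 := v1 _ ^+ 2 + _.
  set e0 := E _ => Z1 H; apply: le_trans H _.
  rewrite (_ : e0 * (C * (A2 + A3) + ep) = C * (e0 * A2 + e0 * A3) + e0 * ep); last by ring.
  by rewrite lerD2l.
have K0 : 0 <= K by lra_from K1.
have VZ : V <= 2 * (Z + eps * N).
  apply: (absorb_pair (K := K) (C := C) (lam := lam) (tau := tau) (W := W) (X := Xv)) => //.
  - by rewrite addr_ge0.
  - apply: le_trans HW _; rewrite ler_wpM2l //; move: QW; set Y := lam * _; clear; lra.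
  - apply: le_trans HV _; rewrite ler_wpM2l //; move: QV; set Y := C * _; clear; lra.
  - apply: le_trans HX _; rewrite ler_wpM2l //; move: QV; set Y := C * _; set Y' := _ * V; clear; lra.
have [x1 y1] : `|p1.1| <= 3 / 2 /\ `|p1.2| <= 3 / 2.
  have b (x y : R) : x ^+ 2 + y ^+ 2 < 1 + eta -> `|x| <= 3 / 2.
    move=> H; rewrite -(@ler_pXn2r _ 2) // ?nnegrE //; last by clear; lra.
    by rewrite sqr_normE; have := sqr_ge0 y; lra_from H eta12.
  by split; [apply: (b _ p1.2)|apply: (b _ p1.1); rewrite addrC].
have cA := grid_count x1 rho0 rho2 (ltW sh4); have cB := grid_count y1 rho0 rho2 (ltW sh4).
rewrite -/h in cA cB.
set SA := [set i : _ | _] in cA; set SB := [set i : _ | _] in cB.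
have low (g : grid n) : g.1 \in SA -> g.2 \in SB ->
   16 * eta ^+ 4 * expR (18 * tau * eta ^+ 2) * (kap / 4) <=
   E (pt R g) * (v1 (pt R g) ^+ 2 + v2 (pt R g) ^+ 2).
  rewrite !inE => g1 g2; have dx : `|(pt R g).1 - p1.1| <= rho by [].
  have dy : `|(pt R g).2 - p1.2| <= rho by [].
  move: (pt R g) dx dy => p dx dy {g1 g2}.
  have px : `|p.1| <= 2.
    rewrite (_ : p.1 = p1.1 + (p.1 - p1.1)); last by ring.
    by apply: le_trans (ler_normD _ _) _; lra_from x1 dx rho2.
  have py : `|p.2| <= 2.
    rewrite (_ : p.2 = p1.2 + (p.2 - p1.2)); last by ring.
    by apply: le_trans (ler_normD _ _) _; lra_from y1 dy rho2.
  have dp : dom2 p by rewrite /dom2 px py.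
  have dp1 : dom2 p1 by apply/andP; split; [lra_from x1|lra_from y1].
  have sdiff (x y : R) : `|x| <= 2 -> `|y| <= 3 / 2 -> `|x - y| <= rho -> x ^+ 2 <= y ^+ 2 + 4 * rho.
    move=> hx hy hxy; rewrite (_ : x ^+ 2 = y ^+ 2 + (x - y) * (x + y)); last by ring.
    rewrite lerD2l; apply: le_trans (ler_norm _) _; rewrite normrM mulrC.
    apply: ler_pM => //; apply: le_trans (ler_normD _ _) _; lra_from hx hy.
  have sp : sqn p < 1 + eta.
    have := sdiff _ _ px x1 dx; have := sdiff _ _ py y1 dy; rewrite /sqn.
    move: rhog rho0; rewrite /sqn; clear; set Y1 := p.1 ^+ 2; set Y2 := p.2 ^+ 2.
    by set Y3 := p1.1 ^+ 2; set Y4 := p1.2 ^+ 2; lra.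
  have vd (z : R * R -> R) : lip2 (@dom2 R) L z -> z p1 ^+ 2 / 2 - 4 * L ^+ 2 * rho <= z p ^+ 2.
    move=> lz; have : `|z p - z p1| <= L * (2 * rho).
      by apply: le_trans (lz _ _ dp dp1) _; rewrite ler_wpM2l //; lra_from dx dy.
    move/ler_norm_sqr => H.
    have r2 : rho ^+ 2 <= rho by rewrite expr2 ler_piMl ?(ltW rho0) //; lra_from rho2.
    have r2' := ler_wpM2l (sqr_ge0 L) r2.
    have := sqr_ge0 (z p1 - 2 * z p + 0); move: H r2'; clear.
    rewrite (_ : (L * (2 * rho)) ^+ 2 = 4 * (L ^+ 2 * rho ^+ 2)); last by ring.
    rewrite -mulrA; set Y1 := L ^+ 2 * _; set Y2 := L ^+ 2 * _; lra.
  apply: ler_pM.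
  - by apply: mulr_ge0; [apply: mulr_ge0 => //; exact: exprn_ge0 (ltW eta0)|exact: expR_ge0].
  - by lra_from kap0.
  - exact: (weight_lower eta0 (ltW tau0) sp).
  have := vd _ lv1; have := vd _ lv2; move: rk; rewrite /kap; clear.
  rewrite -(mulrA 8) -!(mulrA 4); set Y := L ^+ 2 * rho; set Y1 := v1 p1 ^+ 2; set Y2 := v2 p1 ^+ 2; lra.
set ll := _ * (kap / 4) in low.
have ll0 : 0 <= ll.
  apply: mulr_ge0; last by lra_from kap0.
  by apply: mulr_ge0; [apply: mulr_ge0 => //; exact: exprn_ge0 (ltW eta0)|exact: expR_ge0].
have VL : ll * (#|SA|%:R * #|SB|%:R) <= V.
  rewrite -natrM -cardsX mulr_natr -sumr_const.
  rewrite /V [leRHS](bigID (fun g => g \in finset.setX SA SB)) /=.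
  apply: le_trans (_ : _ <= \sum_(g in finset.setX SA SB)
     E (pt R g) * (v1 (pt R g) ^+ 2 + v2 (pt R g) ^+ 2)) _.
    by apply: ler_sum => -[gi gj]; rewrite finset.in_setX => /andP[]; exact: (low (gi, gj)).
  by rewrite lerDl; apply: sumr_ge0 => g _; rewrite mulr_ge0.
have rh0 : 0 <= rho / h by rewrite divr_ge0 // ltW.
have AB := ler_pM rh0 rh0 cA cB.
have NB : N <= 64 / h ^+ 2 by rewrite ler_pdivlMr ?exprn_gt0 //; exact: card_grid_le.
have NAB : N * (rho ^+ 2 / 64) <= rho / h * (rho / h).
  have q : 0 <= rho ^+ 2 / 64 by rewrite divr_ge0 ?sqr_ge0.
  have := ler_wpM2r q NB; congr (_ <= _); field; by rewrite gt_eqF.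
have Npos : 0 < N by rewrite /N ltr0n; apply/card_gt0P; exists (ord0, ord0).
have F1 : N * (rho ^+ 2 / 64 * ll) <= N * (2 * (M * ez + 2 * eps)).
  have h1' := ler_wpM2l ll0 (le_trans NAB AB).
  apply: le_trans (_ : _ <= 2 * (Z + eps * N)) _; last first.
    by rewrite le_eqVlt; apply/orP; left; apply/eqP; rewrite /Z; ring.
  apply: le_trans VZ; apply: le_trans VL; apply: le_trans h1'.
  by rewrite le_eqVlt; apply/orP; left; apply/eqP; ring.
rewrite ler_pM2l // in F1.
have E18 : expR (18 * tau * eta ^+ 2) = ez * expR (10 * tau * eta ^+ 2).
  by rewrite /ez -expRD; congr expR; ring.
have F2 : ez * (c * expR (10 * tau * eta ^+ 2)) <= ez * (2 * (M + 2)).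
  apply: le_trans (_ : _ <= rho ^+ 2 / 64 * ll) _; last apply: le_trans F1 _.
    by rewrite /ll E18 /c le_eqVlt; apply/orP; left; apply/eqP; field.
  by rewrite /eps le_eqVlt; apply/orP; left; apply/eqP; field.
rewrite ler_pM2l // in F2.
have F3 : c * (1 + 10 * tau * eta ^+ 2) <= 2 * (M + 2).
  by apply: le_trans F2; rewrite ler_wpM2l ?(ltW c_gt0) // expR_ge1Dx.
have F4 : 2 * (M + 2) <= tau * (10 * c * eta ^+ 2).
  rewrite /tau [leRHS]mulrDl divfK ?gt_eqF // lerDr mulr_ge0 ?(ltW d0) //.
  by lra_from KC1.
move: F3 F4 c_gt0; clear; rewrite mulrDr mulr1.
rewrite (_ : c * (10 * tau * eta ^+ 2) = tau * (10 * c * eta ^+ 2)); last by ring.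
set Y := tau * _; lra.
Qed.

End Ucp.

(** * Nets of characteristics *)


Section Net.
Variable R : realType.
Implicit Types (p q : R * R).

Definition dist1 p q : R := `|q.1 - p.1| + `|q.2 - p.2|.

Variables (k l : R * R -> R) (p0 : R * R) (h : R).

Definition step_eta p (a : R) : R * R := (p.1 + a, p.2 + a * k p).
Definition step_xi p (b : R) : R * R := (p.1 + b * l p, p.2 + b).

(* Abscissa of the intersection of the line through [p] in the direction
   (1, k p) with the line through [q] in the direction (l q, 1). *)
Definition meet_par p q : R :=
  ((q.1 - p.1) + l q * (p.2 - q.2)) / (1 - k p * l q).

Fixpoint next_row (row : nat -> R * R) (i : nat) : R * R :=
  if i is i'.+1 then
    let p := next_row row i' in step_eta p (meet_par p (row i))
  else step_xi (row 0%N) h.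

Definition net (i j : nat) : R * R :=
  iter j next_row (fun i => iter i (fun p => step_eta p h) p0) i.

Definition sideA i j : R := (net i.+1 j).1 - (net i j).1.
Definition sideB i j : R := (net i j.+1).2 - (net i j).2.

Lemma net_eta i j : net i.+1 j = step_eta (net i j) (sideA i j).
Proof.
rewrite /sideA; case: j => [|j] /=.
  by rewrite /net /= /step_eta /= addrAC subrr add0r.
by rewrite /net /= /step_eta /= addrAC subrr add0r.
Qed.

Lemma sideA0 i : sideA i 0 = h.
Proof. by rewrite /sideA /net /= addrAC subrr add0r. Qed.

Lemma sideB0 j : sideB 0 j = h.
Proof. by rewrite /sideB /net /= addrAC subrr add0r. Qed.

Variable K : R.
Hypothesis (K1 : 1 <= K).
Hypothesis (kK : forall p, `|k p| <= K) (lK : forall p, `|l p| <= K).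
Hypothesis (k_lip : forall p q, `|k q - k p| <= K * dist1 p q).
Hypothesis (l_lip : forall p q, `|l q - l p| <= K * dist1 p q).
Hypothesis (transv : forall p q, 1 <= K * (1 - k p * l q)).
Hypothesis h_gt0 : 0 < h.

Let K0 : 0 < K. Proof. by move: K1; lra. Qed.

Let transv0 p q : 0 < 1 - k p * l q.
Proof. by have := transv p q => H; rewrite -(pmulr_rgt0 _ K0); move: H; lra. Qed.

Lemma net_xi i j : net i j.+1 = step_xi (net i j) (sideB i j).
Proof.
case: i => [|i].
  by rewrite sideB0.
rewrite /sideB /step_xi.
have t0 := transv0 (net i j.+1) (net i.+1 j).
have E : net i.+1 j.+1 = step_eta (net i j.+1) (meet_par (net i j.+1) (net i.+1 j)) by [].
rewrite [LHS]surjective_pairing; congr (_, _); last by ring.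
rewrite E /step_eta /=; set p := net i j.+1 in t0 *; set q := net i.+1 j in t0 *.
rewrite /meet_par; field; by rewrite gt_eqF.
Qed.

Let kap := 1 + K.
Let kap1 : 1 <= kap. Proof. by rewrite /kap; move: K0; lra. Qed.

Definition side_const : R := 2 * (1 + K) ^+ 5.

Ltac keep := clear - k l p0 h K K1 kK lK k_lip l_lip transv h_gt0 K0 transv0 kap kap1.

Lemma dist1_eta p a : dist1 p (step_eta p a) <= `|a| * kap.
Proof.
rewrite /dist1 /step_eta /= ![p.1 + a]addrC ![p.2 + _]addrC !addrK normrM.
have := ler_wpM2l (normr_ge0 a) (kK p); rewrite /kap; keep; lra.
Qed.

Lemma dist1_xi p b : dist1 p (step_xi p b) <= `|b| * kap.
Proof.
rewrite /dist1 /step_xi /= ![p.2 + b]addrC ![p.1 + _]addrC !addrK normrM.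
have := ler_wpM2l (normr_ge0 b) (lK p); rewrite /kap; keep; lra.
Qed.

Lemma side_incr i j :
  `|sideA i j.+1 - sideA i j| <= side_const * (`|sideA i j| * `|sideB i j|) /\
  `|sideB i.+1 j - sideB i j| <= side_const * (`|sideA i j| * `|sideB i j|).
Proof.
set a := sideA i j; set b := sideB i j; set a' := sideA i j.+1; set b' := sideB i.+1 j.
have e1 : net i.+1 j = step_eta (net i j) a := net_eta i j.
have e2 : net i j.+1 = step_xi (net i j) b := net_xi i j.
have e3 : net i.+1 j.+1 = step_eta (net i j.+1) a' := net_eta i j.+1.
have e4 : net i.+1 j.+1 = step_xi (net i.+1 j) b' := net_xi i.+1 j.
set p := net i j in e1 e2.
set dk := k (net i j.+1) - k p; set dl := l (net i.+1 j) - l p.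
have bk : `|dk| <= K * (`|b| * kap).
  apply: le_trans (k_lip p _) _; rewrite ler_wpM2l ?(ltW K0) // e2; exact: dist1_xi.
have bl : `|dl| <= K * (`|a| * kap).
  apply: le_trans (l_lip p _) _; rewrite ler_wpM2l ?(ltW K0) // e1; exact: dist1_eta.
have e5 : step_eta (net i j.+1) a' = step_xi (net i.+1 j) b' by rewrite -e3 -e4.
have [X Y] : (net i j.+1).1 + a' = (net i.+1 j).1 + b' * l (net i.+1 j) /\
             (net i j.+1).2 + a' * k (net i j.+1) = (net i.+1 j).2 + b'.
  by move: e5; rewrite /step_eta /step_xi; case.
rewrite {1}e2 {1}e1 /step_xi /step_eta /= in X.
rewrite {1}e2 [X in _ = X + _](_ : _ = p.2 + a * k p) in Y; last by rewrite e1.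
rewrite /step_xi /= in Y.
have tr := transv (net i j.+1) (net i.+1 j).
set k' := k (net i j.+1) in dk bk Y tr X; set l' := l (net i.+1 j) in dl bl X tr Y.
have hda : (a' - a) * (1 - k' * l') = a * dk * l' + b * dl.
  have X' : a' = a + b' * l' - b * l p by move: X; keep; lra.
  have Y' : b' = b + a' * k' - a * k p by move: Y; keep; lra.
  rewrite /dk /dl mulrBr mulr1 [in X in X - _]X' Y'; ring.
have hdb : b' - b = (a' - a) * k' + a * dk.
  have Y' : b' = b + a' * k' - a * k p by move: Y; keep; lra.
  by rewrite Y' /dk; ring.
have ab0 : 0 <= `|a| * `|b| by rewrite mulr_ge0.
have kl : `|a * dk * l' + b * dl| <= K * (K * kap + kap) * (`|a| * `|b|).
  apply: le_trans (ler_normD _ _) _; rewrite !normrM.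
  have h1 : `|a| * `|dk| * `|l'| <= `|a| * (K * (`|b| * kap)) * K.
    by apply: ler_pM => //; [rewrite mulr_ge0|rewrite ler_wpM2l|exact: lK].
  have h2 : `|b| * `|dl| <= `|b| * (K * (`|a| * kap)) by rewrite ler_wpM2l.
  apply: le_trans (lerD h1 h2) _; rewrite le_eqVlt; apply/orP; left; apply/eqP; ring.
have bda : `|a' - a| <= K ^+ 2 * kap ^+ 2 * (`|a| * `|b|).
  have : `|a' - a| <= K * (`|a' - a| * (1 - k' * l')).
    rewrite mulrCA; have := ler_wpM2l (normr_ge0 (a' - a)) tr.
    by rewrite mulr1.
  move=> /le_trans; apply.
  have -> : `|a' - a| * (1 - k' * l') = `|a * dk * l' + b * dl|.
    by rewrite -hda normrM; congr (_ * _); rewrite gtr0_norm // transv0.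
  have := ler_wpM2l (ltW K0) kl; rewrite /kap; set Y0 := `|a| * `|b|.
  by rewrite (_ : K * (K * (K * (1 + K) + (1 + K)) * Y0) = K ^+ 2 * (1 + K) ^+ 2 * Y0) //; ring.
have pw m n : (m <= n)%N -> kap ^+ m <= kap ^+ n by move=> mn; exact: ler_weXn2l.
have Kkap : K <= kap by rewrite /kap; keep; lra.
have Kp n : K ^+ n <= kap ^+ n.
  by rewrite lerXn2r // nnegrE ltW //; apply: lt_le_trans Kkap.
have kap0 : 0 <= kap by apply: le_trans kap1.
rewrite /side_const -/kap.
split.
  apply: le_trans bda _; rewrite ler_wpM2r //.
  have h1 : K ^+ 2 * kap ^+ 2 <= kap ^+ 2 * kap ^+ 2 by rewrite ler_wpM2r ?exprn_ge0 // Kp.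
  rewrite -exprD in h1; have := pw 4 5 isT; have := exprn_ge0 5 kap0.
  by move: h1; set Y1 := kap ^+ 5; set Y2 := kap ^+ (2 + 2); set Y3 := K ^+ 2 * _; keep; lra.
rewrite hdb; apply: le_trans (ler_normD _ _) _; rewrite !normrM.
have h1 : `|a' - a| * `|k'| <= K ^+ 2 * kap ^+ 2 * (`|a| * `|b|) * K by apply: ler_pM => //; exact: kK.
have h2 : `|a| * `|dk| <= `|a| * (K * (`|b| * kap)) by rewrite ler_wpM2l.
apply: le_trans (lerD h1 h2) _.
rewrite (_ : _ + _ = (K ^+ 3 * kap ^+ 2 + K * kap) * (`|a| * `|b|)); last by ring.
rewrite ler_wpM2r //.
have h3 : K ^+ 3 * kap ^+ 2 <= kap ^+ 3 * kap ^+ 2 by rewrite ler_wpM2r ?exprn_ge0 // Kp.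
have h4 : K * kap <= kap * kap by rewrite ler_wpM2r.
rewrite -exprD in h3; rewrite -expr2 in h4; have := pw 2 5 isT.
by move: h3 h4; set Y1 := kap ^+ 5; set Y2 := kap ^+ 2; set Y3 := K ^+ 3 * _; set Y4 := K * _; keep; lra.
Qed.

Lemma side_bounds (N i j : nat) : 8 * side_const * (N%:R * h) <= 1 -> (i <= N)%N -> (j <= N)%N ->
  `|sideA i j - h| <= 4 * side_const * (j%:R * h ^+ 2) /\
  `|sideB i j - h| <= 4 * side_const * (i%:R * h ^+ 2).
Proof.
move=> small; set C := side_const in small *.
have C0 : 0 <= C by rewrite /C /side_const mulr_ge0 // exprn_ge0 //; move: K0; lra.
have near_h (x : R) n : (n <= N)%N -> `|x - h| <= 4 * C * (n%:R * h ^+ 2) -> `|x| <= 2 * h.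
  move=> nN H; rewrite (_ : x = h + (x - h)); last by ring.
  apply: le_trans (ler_normD _ _) _; rewrite (gtr0_norm h_gt0).
  suff : 4 * C * (n%:R * h ^+ 2) <= h by move: H; set Y := 4 * _ * _; keep; lra.
  have : n%:R * h <= N%:R * h by rewrite ler_wpM2r ?(ltW h_gt0) // ler_nat.
  move=> q; have := ler_wpM2l C0 q => q'.
  have hh := ltW h_gt0.
  have : 4 * C * (n%:R * h) * h <= 1 * h.
    rewrite ler_wpM2r //; move: q' small; rewrite -!(mulrA _ C).
    by set Y1 := C * _; set Y2 := C * _; keep; lra.
  by rewrite mul1r expr2 !mulrA.
have incr (x y a b : R) n : `|a| <= 2 * h -> `|b| <= 2 * h ->
   `|x - h| <= 4 * C * (n%:R * h ^+ 2) -> `|y - x| <= C * (`|a| * `|b|) ->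
   `|y - h| <= 4 * C * (n.+1%:R * h ^+ 2).
  move=> ha hb hx hy; rewrite (_ : y - h = (y - x) + (x - h)); last by ring.
  apply: le_trans (ler_normD _ _) _.
  have : C * (`|a| * `|b|) <= C * (2 * h * (2 * h)) by rewrite ler_wpM2l // ler_pM.
  rewrite -[n.+1%:R]natr1 (_ : C * (2 * h * (2 * h)) = 4 * C * h ^+ 2); last by ring.
  rewrite (_ : 4 * C * ((n%:R + 1) * h ^+ 2) = 4 * C * (n%:R * h ^+ 2) + 4 * C * h ^+ 2); last by ring.
  move: hx hy; set Y1 := 4 * _ * _; set Y2 := C * _.
  by set Y3 := 4 * C * _; keep; lra.
elim: j i => [|j IH] i iN jN.
  have A0 n : `|sideA n 0 - h| <= 4 * C * (0%:R * h ^+ 2).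
    by rewrite sideA0 subrr normr0 mul0r mulr0.
  split=> //; elim: i iN => [|i IHi] iN; first by rewrite sideB0 subrr normr0 mul0r mulr0.
  have b := IHi (ltnW iN); apply: (incr _ _ _ _ _ _ _ b (side_incr i 0).2).
    exact: near_h (A0 i).
  exact: near_h (ltnW iN) b.
have A1 n : (n <= N)%N -> `|sideA n j.+1 - h| <= 4 * C * (j.+1%:R * h ^+ 2).
  move=> nN; have [a b] := IH n nN (ltnW jN).
  apply: (incr _ _ _ _ _ _ _ a (side_incr n j).1).
    exact: near_h (ltnW jN) a.
  exact: near_h nN b.
split; first exact: A1.
elim: i iN => [|i IHi] iN; first by rewrite sideB0 subrr normr0 mul0r mulr0.
have b := IHi (ltnW iN); apply: (incr _ _ _ _ _ _ _ b (side_incr i j.+1).2).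
  exact: near_h jN (A1 i (ltnW iN)).
exact: near_h (ltnW iN) b.
Qed.

Lemma side_le (N i j : nat) : 8 * side_const * (N%:R * h) <= 1 -> (i <= N)%N -> (j <= N)%N ->
  `|sideA i j| <= 2 * h /\ `|sideB i j| <= 2 * h.
Proof.
move=> small iN jN; have [a b] := side_bounds small iN jN.
have C0 : 0 <= side_const by rewrite /side_const mulr_ge0 // exprn_ge0 //; move: K0; lra.
have near_h (x : R) n : (n <= N)%N -> `|x - h| <= 4 * side_const * (n%:R * h ^+ 2) -> `|x| <= 2 * h.
  move=> nN H; rewrite (_ : x = h + (x - h)); last by ring.
  apply: le_trans (ler_normD _ _) _; rewrite (gtr0_norm h_gt0).
  suff : 4 * side_const * (n%:R * h ^+ 2) <= h by move: H; set Y := 4 * _ * _; keep; lra.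
  have : n%:R * h <= N%:R * h by rewrite ler_wpM2r ?(ltW h_gt0) // ler_nat.
  move=> q; have := ler_wpM2l C0 q => q'.
  have hh := ltW h_gt0.
  have : 4 * side_const * (n%:R * h) * h <= 1 * h.
    rewrite ler_wpM2r //; move: q' small; rewrite -!(mulrA _ side_const).
    by set Y1 := side_const * _; set Y2 := side_const * _; keep; lra.
  by rewrite mul1r expr2 !mulrA.
by split; [exact: near_h jN a|exact: near_h iN b].
Qed.

Lemma net_dist (N i j : nat) : 8 * side_const * (N%:R * h) <= 1 -> (i <= N)%N -> (j <= N)%N ->
  dist1 p0 (net i j) <= 2 * kap * ((i + j)%:R * h).
Proof.
move=> small iN jN.
have tri p q r : dist1 p r <= dist1 p q + dist1 q r.
  rewrite /dist1; have := ler_distD q.1 r.1 p.1; have := ler_distD q.2 r.2 p.2.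
  by keep; lra.
have kap0 : 0 <= kap by apply: le_trans kap1.
elim: i iN => [|i IH] iN.
  elim: j jN => [|j IH] jN; first by rewrite /net /= /dist1 !subrr normr0 addr0 mul0r mulr0.
  apply: le_trans (tri _ (net 0 j) _) _.
  have := IH (ltnW jN); rewrite net_xi.
  have := dist1_xi (net 0 j) (sideB 0 j).
  have [_ b] := side_le small iN (ltnW jN).
  have := ler_wpM2r kap0 b; rewrite !add0n -[j.+1%:R]natr1.
  rewrite (_ : 2 * kap * ((j%:R + 1) * h) = 2 * kap * (j%:R * h) + 2 * h * kap); last by ring.
  by set Y1 := 2 * kap * _; set Y2 := dist1 _ _; set Y3 := dist1 _ _; set Y4 := `|_| * _; set Y5 := 2 * h * _; keep; lra.
apply: le_trans (tri _ (net i j) _) _.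
have := IH (ltnW iN); rewrite net_eta.
have := dist1_eta (net i j) (sideA i j).
have [b _] := side_le small (ltnW iN) jN.
have := ler_wpM2r kap0 b; rewrite !addSn -[(i + j).+1%:R]natr1.
rewrite (_ : 2 * kap * (((i + j)%:R + 1) * h) = 2 * kap * ((i + j)%:R * h) + 2 * h * kap); last by ring.
by set Y1 := 2 * kap * _; set Y2 := dist1 _ _; set Y3 := dist1 _ _; set Y4 := `|_| * _; set Y5 := 2 * h * _; keep; lra.
Qed.

End Net.

Lemma lin_incr (R : realType) (f1 f2 f1' f2' x1 x2 x1' x2' d1 d2 kap K eps M s h : R) :
  1 <= K -> kap = 1 + K -> 0 <= eps -> 0 <= M -> s <= 2 * h * kap -> 0 <= s ->
  `|f1| + `|f2| <= kap -> `|f1' - f1| <= K * s -> `|f2' - f2| <= K * s ->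
  `|x1' - x1 - d1| <= eps * s -> `|x2' - x2 - d2| <= eps * s -> `|x1'| + `|x2'| <= M ->
  `|f1' * x1' + f2' * x2' - (f1 * x1 + f2 * x2) - (f1 * d1 + f2 * d2)|
    <= 2 * kap ^+ 2 * h * (M + eps).
Proof.
move=> K1 kE e0 M0 sh s0 f f1K f2K b1 b2 xM.
have -> : f1' * x1' + f2' * x2' - (f1 * x1 + f2 * x2) - (f1 * d1 + f2 * d2) =
  (f1 * (x1' - x1 - d1) + f2 * (x2' - x2 - d2)) + ((f1' - f1) * x1' + (f2' - f2) * x2') by ring.
have kap0 : 0 <= kap by rewrite kE; lra_from K1.
have es : 0 <= eps * s by rewrite mulr_ge0.
have Ks : 0 <= K * s by rewrite mulr_ge0 //; lra_from K1.
have h1 : `|f1 * (x1' - x1 - d1) + f2 * (x2' - x2 - d2)| <= kap * (eps * s).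
  apply: le_trans (ler_normD _ _) _; rewrite !normrM.
  have := ler_wpM2l (normr_ge0 f1) b1; have := ler_wpM2l (normr_ge0 f2) b2.
  have := ler_wpM2r es f; rewrite mulrDl; clear.
  set Y1 := `|f1| * (eps * s); set Y2 := `|f2| * (eps * s); set Y3 := `|f1| * _; set Y4 := `|f2| * _.
  by set Y5 := kap * _; lra.
have h2 : `|(f1' - f1) * x1' + (f2' - f2) * x2'| <= K * s * M.
  apply: le_trans (ler_normD _ _) _; rewrite !normrM.
  have := ler_wpM2r (normr_ge0 x1') f1K; have := ler_wpM2r (normr_ge0 x2') f2K.
  have := ler_wpM2l Ks xM; rewrite mulrDr; clear.
  set Y1 := K * s * `|x1'|; set Y2 := K * s * `|x2'|; set Y3 := `|_| * `|x1'|; set Y4 := `|_| * `|x2'|.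
  by set Y5 := K * s * M; lra.
apply: le_trans (ler_normD _ _) _; apply: le_trans (lerD h1 h2) _.
have h3 : K * s * M <= kap * s * M.
  by apply: ler_wpM2r => //; apply: ler_wpM2r => //; rewrite kE; clear; lra.
have h4 : kap * s * (M + eps) <= kap * (2 * h * kap) * (M + eps).
  by apply: ler_wpM2r; [exact: addr_ge0|exact: ler_wpM2l].
move: h3 h4.
rewrite (_ : 2 * kap ^+ 2 * h * (M + eps) = kap * (2 * h * kap) * (M + eps)); last by ring.
rewrite (_ : kap * s * (M + eps) = kap * s * M + kap * (eps * s)); last by ring.
by clear; set Y1 := kap * s * M; set Y2 := kap * (eps * s); set Y3 := K * s * M; lra.
Qed.

Lemma telescope_bound (R : realType) (f : nat -> R) (d : R) n : 
  (forall i, (i < n)%N -> `|f i.+1 - f i| <= d) -> `|f n - f 0%N| <= n%:R * d.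
Proof.
elim: n => [|n IH] H; first by rewrite subrr normr0 mul0r.
have := IH (fun i hi => H i (ltnW hi)); have := H n (ltnSn n).
rewrite -[n.+1%:R]natr1 mulrDl mul1r (_ : f n.+1 - f 0%N = (f n.+1 - f n) + (f n - f 0%N)); last by ring.
have := ler_normD (f n.+1 - f n) (f n - f 0%N); clear; set Y := n%:R * d; lra.
Qed.

Lemma sum_bound (R : realType) (f : nat -> R) (d : R) n :
  (forall i, (i < n)%N -> `|f i| <= d) -> `|\sum_(i < n) f i| <= n%:R * d.
Proof.
move=> H; apply: le_trans (ler_norm_sum _ _ _) _.
apply: le_trans (_ : _ <= \sum_(i < n) d) _; last by rewrite sumr_const card_ord mulr_natl.
by apply: ler_sum => i _; exact: H.
Qed.

(* Discrete Green formula on a rectangle of indices. *)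
Lemma cell_sum (R : realType) (g1 g2 : nat -> nat -> R) (d : R) m n :
  (forall i j, (i < m)%N -> (j < n)%N ->
     `|g2 i.+1 j - g2 i j + (g1 i j.+1 - g1 i j)| <= d) ->
  `|\sum_(j < n) (g2 m j - g2 0%N j) + \sum_(i < m) (g1 i n - g1 i 0%N)| <= m%:R * n%:R * d.
Proof.
move=> H.
have -> : \sum_(j < n) (g2 m j - g2 0%N j) + \sum_(i < m) (g1 i n - g1 i 0%N) =
   \sum_(i < m) \sum_(j < n) (g2 i.+1 j - g2 i j + (g1 i j.+1 - g1 i j)).
  under [RHS]eq_bigr => i _ do rewrite big_split /=.
  rewrite [RHS]big_split /=; congr (_ + _).
    rewrite exchange_big /=; apply: eq_bigr => j _.
    by rewrite -(big_mkord xpredT (fun i => g2 i.+1 j - g2 i j)) telescope_sumr.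
  apply: eq_bigr => i _.
  by rewrite -(big_mkord xpredT (fun j => g1 i j.+1 - g1 i j)) telescope_sumr.
rewrite -mulrA; apply: (@sum_bound _ (fun i => \sum_(j < n) (g2 i.+1 j - g2 i j + (g1 i j.+1 - g1 i j)))).
move=> i im; apply: (@sum_bound _ (fun j => g2 i.+1 j - g2 i j + (g1 i j.+1 - g1 i j))) => j jn.
exact: H.
Qed.

Definition expands_at (R : realType) (eps : R) (f f1 f2 : R * R -> R) (p q : R * R) :=
  `|f q - f p - ((q.1 - p.1) * f1 p + (q.2 - p.2) * f2 p)| <= eps * dist1 p q.

Lemma net_scale (R : realType) (K : R) : 1 <= K ->
  exists2 C : R, 1 <= C &
  forall (eps h : R) (N n : nat) (box : R * R -> Prop)
    (k l c v w1 w2 H11 H12 H22 : R * R -> R) (p0 : R * R),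
  (forall p, `|k p| <= K) -> (forall p, `|l p| <= K) -> (forall p, `|c p| <= K) ->
  (forall p q, `|k q - k p| <= K * dist1 p q) ->
  (forall p q, `|l q - l p| <= K * dist1 p q) ->
  (forall p q, `|c q - c p| <= K * dist1 p q) ->
  (forall p q, 1 <= K * (1 - k p * l q)) -> 1 <= K * `|c p0| ->
  0 < h -> 0 <= eps -> C * (N%:R * h) <= 1 -> (0 < n)%N -> (n <= N)%N ->
  (forall p, dist1 p0 p <= C * (N%:R * h) -> box p) ->
  (forall p q, box p -> box q -> dist1 p q <= C * h ->
     [/\ expands_at eps v w1 w2 p q, expands_at eps w1 H11 H12 p q
       & expands_at eps w2 H12 H22 p q]) ->
  (forall p, box p ->
     `|l p * H11 p + (1 + k p * l p) * H12 p + k p * H22 p| <= K * (`|v p| + `|w1 p| + `|w2 p|) /\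
     `|(l p ^+ 2 * H11 p + 2 * l p * H12 p + H22 p)
       + c p * (H11 p + 2 * k p * H12 p + k p ^+ 2 * H22 p)| <= K * (`|v p| + `|w1 p| + `|w2 p|)) ->
  v p0 = 0 -> w1 p0 = 0 -> w2 p0 = 0 ->
  let X m := let q := net k l p0 h 0 m in `|l q * w1 q + w2 q| in
  (forall i j, (i <= n)%N -> (j <= n)%N ->
     `|v (net k l p0 h i j)| <= C * (X n + eps)) /\
  (forall m, n = m.*2 -> X n <= 2 * X m + C * (n%:R * h) * (X n + eps)).
Proof.
move=> K1; pose kap := 1 + K; pose S := kap ^+ 7.
have K0 : 0 < K by lra_from K1.
have kap2 : 2 <= kap by rewrite /kap; lra_from K1.
have kap1 : 1 <= kap by lra_from kap2.
have kap0 : 0 <= kap by lra_from kap2.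
have Kk : K <= kap by rewrite /kap; clear; lra.
have pw m n : (m <= n)%N -> kap ^+ m <= kap ^+ n by move=> mn; exact: ler_weXn2l.
have S0 : 0 < S by rewrite exprn_gt0 //; lra_from kap2.
have S1 : 1 <= S by rewrite -[1](expr0 kap) pw.
have Sk (m : nat) : (m <= 7)%N -> kap ^+ m <= S by move=> hm; exact: pw.
pose C := kap ^+ 30.
have k10 : 1000 <= kap ^+ 10.
  apply: le_trans (_ : 2 ^+ 10 <= _); last by rewrite lerXn2r // nnegrE.
  by rewrite -natrX ler_nat.
have kC m : (m <= 20)%N -> 1000 * kap ^+ m <= C.
  move=> hm; apply: le_trans (_ : kap ^+ 10 * kap ^+ m <= _).
    by rewrite ler_wpM2r ?exprn_ge0.
  by rewrite -exprD pw // -[30%N]/(10 + 20)%N leq_add2l.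
have SC : 1000 * S <= C by exact: kC.
have C1 : 1 <= C by lra_from S1 SC.
exists C => // eps h N n box k l c v w1 w2 H11 H12 H22 p0.
move=> kK lK cK k_lip l_lip c_lip transv c0K h0 eps0 smallC n0 nN Hbox Hexp Hhyp v0 w10 w20 X.
pose P i j := net k l p0 h i j.
pose aa i j := sideA k l p0 h i j; pose bb i j := sideB k l p0 h i j.
have h0' := ltW h0.
have sc : side_const K = 2 * kap ^+ 5 by [].
have kC5 := kC 5 isT; have kCk := kC 1 isT; have kC2 := kC 2 isT.
rewrite expr1 in kCk.
have Nh0 : 0 <= N%:R * h by rewrite mulr_ge0.
have smallN : 8 * side_const K * (N%:R * h) <= 1.
  apply: le_trans smallC; apply: ler_wpM2r => //; rewrite sc.
  by move: kC5 C1; set Y := kap ^+ 5; clear; lra.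
have sl i j := @side_le R k l p0 h K K1 kK lK k_lip l_lip transv h0 N i j smallN.
have sb i j := @side_bounds R k l p0 h K K1 kK lK k_lip l_lip transv h0 N i j smallN.
have nd i j := @net_dist R k l p0 h K K1 kK lK k_lip l_lip transv h0 N i j smallN.
have nx i j := @net_xi R k l p0 h K K1 transv i j.
have ne i j := @net_eta R k l p0 h i j.
pose r := n%:R * h.
have r0 : 0 < r by rewrite mulr_gt0 // ltr0n.
have rN : r <= N%:R * h by rewrite ler_wpM2r // ler_nat.
have Cr : C * r <= 1 by apply: le_trans smallC; rewrite ler_wpM2l //; lra_from C1.
have leN i : (i <= n)%N -> (i <= N)%N by move=> /leq_trans; apply.
have leNS i : (i < n)%N -> (i < N)%N by move=> /leq_trans; apply.
have inbox i j : (i <= n)%N -> (j <= n)%N -> box (P i j).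
  move=> iN jN; apply: Hbox; apply: le_trans (nd i j (leN _ iN) (leN _ jN)) _.
  have : (i + j)%:R * h <= 2 * (N%:R * h).
    rewrite [leRHS]mulrA; apply: ler_wpM2r => //; rewrite -natrM ler_nat mul2n -addnn.
    by apply: leq_add; exact: leN.
  have k20 : 0 <= 2 * kap by lra_from kap0.
  move=> H; have := ler_wpM2l k20 H => H'; apply: le_trans H' _.
  rewrite [leLHS]mulrA; apply: ler_wpM2r => //; lra_from kCk kap0.
have dC i j : (i <= n)%N -> (j <= n)%N -> dist1 p0 (P i j) <= 4 * kap * r.
  move=> iN jN; apply: le_trans (nd i j (leN _ iN) (leN _ jN)) _.
  have : (i + j)%:R * h <= 2 * r.
    rewrite /r [leRHS]mulrA; apply: ler_wpM2r => //; rewrite -natrM ler_nat mul2n -addnn.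
    exact: leq_add.
  have k20 : 0 <= 2 * kap by lra_from kap0.
  by move=> H; have := ler_wpM2l k20 H; rewrite (_ : 2 * kap * (2 * r) = 4 * kap * r) //; ring.
pose W i j := `|w1 (P i j)| + `|w2 (P i j)|.
pose M : R := \big[Num.max/0]_(g : 'I_n.+1 * 'I_n.+1) W g.1 g.2.
have M0 : 0 <= M by exact: bigmax_ge_id.
have WM i j : (i <= n)%N -> (j <= n)%N -> W i j <= M.
  move=> iN jN.
  pose g : 'I_n.+1 * 'I_n.+1 := (Ordinal (iN : (i < n.+1)%N), Ordinal (jN : (j < n.+1)%N)).
  exact: (le_bigmax _ (fun g : 'I_n.+1 * 'I_n.+1 => W g.1 g.2) g).
pose mm : R := M + eps.
have mm0 : 0 <= mm by rewrite addr_ge0.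
have Mmm : M <= mm by rewrite lerDl.
have dA i j : (i < n)%N -> (j <= n)%N -> dist1 (P i j) (P i.+1 j) <= 2 * h * kap.
  move=> iN jN; rewrite /P ne; apply: le_trans (dist1_eta kK _ _) _.
  by apply: ler_wpM2r => //; have [] := sl i j (leN _ (ltnW iN)) (leN _ jN).
have dB i j : (i <= n)%N -> (j < n)%N -> dist1 (P i j) (P i j.+1) <= 2 * h * kap.
  move=> iN jN; rewrite /P nx; apply: le_trans (dist1_xi lK _ _) _.
  by apply: ler_wpM2r => //; have [] := sl i j (leN _ iN) (leN _ (ltnW jN)).
have d0 (p q : R * R) : 0 <= dist1 p q by rewrite addr_ge0.
have hC : 2 * h * kap <= C * h.
  rewrite (_ : 2 * h * kap = 2 * kap * h); last by ring.
  by apply: ler_wpM2r => //; lra_from kCk kap0.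
have hK (p : R * R) : `|l p| + `|1 : R| <= kap.
  by rewrite normr1 /kap addrC lerD2l.
have hK' (p : R * R) : `|1 : R| + `|k p| <= kap.
  by rewrite normr1 /kap lerD2l.
have one (s : R) : 0 <= s -> `|(1 : R) - 1| <= K * s.
  by move=> s0; rewrite subrr normr0 mulr_ge0 // ltW.
have xA i j : (P i.+1 j).1 - (P i j).1 = aa i j /\ (P i.+1 j).2 - (P i j).2 = aa i j * k (P i j).
  by rewrite /P ne /step_eta /= ![_ + aa i j]addrC ![_ + aa i j * _]addrC !addrK.
have xB i j : (P i j.+1).1 - (P i j).1 = bb i j * l (P i j) /\ (P i j.+1).2 - (P i j).2 = bb i j.
  by rewrite /P nx /step_xi /= ![_ + bb i j]addrC ![_ + bb i j * _]addrC !addrK.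
pose Pf i j := l (P i j) * w1 (P i j) + 1 * w2 (P i j).
pose Qf i j := 1 * w1 (P i j) + k (P i j) * w2 (P i j).
pose hxe p := l p * H11 p + (1 + k p * l p) * H12 p + k p * H22 p.
pose hxx p := l p ^+ 2 * H11 p + 2 * l p * H12 p + H22 p.
pose hee p := H11 p + 2 * k p * H12 p + k p ^+ 2 * H22 p.
have PA i j : (i < n)%N -> (j <= n)%N ->
   `|Pf i.+1 j - Pf i j - aa i j * hxe (P i j)| <= 2 * kap ^+ 2 * h * mm.
  move=> iN jN; have [_ T2 T3] := Hexp _ _ (inbox i j (ltnW iN) jN) (inbox i.+1 j iN jN) (le_trans (dA i j iN jN) hC).
  have [x1 x2] := xA i j; rewrite /expands_at x1 x2 in T2 T3.
  have := lin_incr K1 erefl eps0 M0 (dA i j iN jN) (d0 _ _) (hK (P i j)) (l_lip _ _) (one _ (d0 _ _)) T2 T3 (WM i.+1 j iN jN).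
  by rewrite (_ : aa i j * hxe (P i j) = l (P i j) * (aa i j * H11 (P i j) + aa i j * k (P i j) * H12 (P i j))
    + 1 * (aa i j * H12 (P i j) + aa i j * k (P i j) * H22 (P i j))) //; rewrite /hxe; ring.
have QA i j : (i < n)%N -> (j <= n)%N ->
   `|Qf i.+1 j - Qf i j - aa i j * hee (P i j)| <= 2 * kap ^+ 2 * h * mm.
  move=> iN jN; have [_ T2 T3] := Hexp _ _ (inbox i j (ltnW iN) jN) (inbox i.+1 j iN jN) (le_trans (dA i j iN jN) hC).
  have [x1 x2] := xA i j; rewrite /expands_at x1 x2 in T2 T3.
  have := lin_incr K1 erefl eps0 M0 (dA i j iN jN) (d0 _ _) (hK' (P i j)) (one _ (d0 _ _)) (k_lip _ _) T2 T3 (WM i.+1 j iN jN).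
  by rewrite (_ : aa i j * hee (P i j) = 1 * (aa i j * H11 (P i j) + aa i j * k (P i j) * H12 (P i j))
    + k (P i j) * (aa i j * H12 (P i j) + aa i j * k (P i j) * H22 (P i j))) //; rewrite /hee; ring.
have PB i j : (i <= n)%N -> (j < n)%N ->
   `|Pf i j.+1 - Pf i j - bb i j * hxx (P i j)| <= 2 * kap ^+ 2 * h * mm.
  move=> iN jN; have [_ T2 T3] := Hexp _ _ (inbox i j iN (ltnW jN)) (inbox i j.+1 iN jN) (le_trans (dB i j iN jN) hC).
  have [x1 x2] := xB i j; rewrite /expands_at x1 x2 in T2 T3.
  have := lin_incr K1 erefl eps0 M0 (dB i j iN jN) (d0 _ _) (hK (P i j)) (l_lip _ _) (one _ (d0 _ _)) T2 T3 (WM i j.+1 iN jN).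
  by rewrite (_ : bb i j * hxx (P i j) = l (P i j) * (bb i j * l (P i j) * H11 (P i j) + bb i j * H12 (P i j))
    + 1 * (bb i j * l (P i j) * H12 (P i j) + bb i j * H22 (P i j))) //; rewrite /hxx; ring.
have QB i j : (i <= n)%N -> (j < n)%N ->
   `|Qf i j.+1 - Qf i j - bb i j * hxe (P i j)| <= 2 * kap ^+ 2 * h * mm.
  move=> iN jN; have [_ T2 T3] := Hexp _ _ (inbox i j iN (ltnW jN)) (inbox i j.+1 iN jN) (le_trans (dB i j iN jN) hC).
  have [x1 x2] := xB i j; rewrite /expands_at x1 x2 in T2 T3.
  have := lin_incr K1 erefl eps0 M0 (dB i j iN jN) (d0 _ _) (hK' (P i j)) (one _ (d0 _ _)) (k_lip _ _) T2 T3 (WM i j.+1 iN jN).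
  by rewrite (_ : bb i j * hxe (P i j) = 1 * (bb i j * l (P i j) * H11 (P i j) + bb i j * H12 (P i j))
    + k (P i j) * (bb i j * l (P i j) * H12 (P i j) + bb i j * H22 (P i j))) //; rewrite /hxe; ring.
have Cr4 : 4 * kap * r <= 1.
  apply: le_trans Cr; apply: ler_wpM2r; first exact: ltW.
  by lra_from kCk kap0.
have ir (x : R) i : 0 <= x -> (i <= n)%N -> i%:R * (x * h * mm) <= x * r * mm.
  move=> x0 iN; rewrite (_ : i%:R * (x * h * mm) = x * (i%:R * h) * mm); last by ring.
  apply: ler_wpM2r => //; apply: ler_wpM2l => //.
  by apply: ler_wpM2r => //; rewrite ler_nat.
have vstep p q : box p -> box q -> dist1 p q <= 2 * h * kap -> `|w1 p| + `|w2 p| <= M ->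
    `|v q - v p| <= 2 * kap * h * mm.
  move=> bp bq dpq wM; have [T1 _ _] := Hexp _ _ bp bq (le_trans dpq hC).
  rewrite /expands_at in T1; set e := _ * w1 p + _ in T1.
  rewrite (_ : v q - v p = (v q - v p - e) + e); last by ring.
  apply: le_trans (ler_normD _ _) _.
  have he : `|e| <= dist1 p q * M.
    apply: le_trans (ler_normD _ _) _; rewrite !normrM.
    have := ler_wpM2l (d0 p q) wM.
    have a1 : `|q.1 - p.1| * `|w1 p| <= dist1 p q * `|w1 p| by rewrite ler_wpM2r // lerDl.
    have a2 : `|q.2 - p.2| * `|w2 p| <= dist1 p q * `|w2 p| by rewrite ler_wpM2r // lerDr.
    by apply: le_trans; rewrite mulrDr lerD.
  apply: le_trans (lerD T1 he) _.
  have := ler_wpM2r mm0 dpq; rewrite /mm.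
  rewrite (_ : dist1 p q * (M + eps) = eps * dist1 p q + dist1 p q * M); last by ring.
  by rewrite (_ : 2 * h * kap * (M + eps) = 2 * kap * h * (M + eps)) //; ring.
have k20 : 0 <= 2 * kap by lra_from kap0.
have vb i j : (i <= n)%N -> (j <= n)%N -> `|v (P i j)| <= 4 * kap * r * mm.
  move=> iN jN.
  have t1 : `|v (P 0 j) - v (P 0 0)| <= j%:R * (2 * kap * h * mm).
    apply: (@telescope_bound _ (fun j => v (P 0 j))) => j' jj.
    have jn := leq_trans jj jN.
    by apply: vstep; [exact: inbox (ltnW jn)|exact: inbox|exact: dB|exact: WM (ltnW jn)].
  have t2 : `|v (P i j) - v (P 0 j)| <= i%:R * (2 * kap * h * mm).
    apply: (@telescope_bound _ (fun i => v (P i j))) => i' ii.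
    have i_n := leq_trans ii iN.
    by apply: vstep; [exact: inbox (ltnW i_n) jN|exact: inbox|exact: dA|exact: WM (ltnW i_n) jN].
  have e : v (P 0 0) = 0 by rewrite /P /net /=.
  rewrite e subr0 in t1.
  have := ler_normD (v (P i j) - v (P 0 j)) (v (P 0 j)); rewrite subrK.
  move: t1 t2 (ir _ i k20 iN) (ir _ j k20 jN); clear.
  rewrite (_ : 4 * kap * r * mm = 2 * (2 * kap * r * mm)); last by ring.
  set Y1 := _ * (_ * mm); set Y2 := i%:R * _; set Y3 := 2 * kap * r * mm; lra.
have q2 i j : (i <= n)%N -> (j <= n)%N ->
    `|v (P i j)| + `|w1 (P i j)| + `|w2 (P i j)| <= 2 * mm.
  move=> iN jN; have a1 := vb i j iN jN; have a2 := WM i j iN jN.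
  have a3 : 4 * kap * r * mm <= 1 * mm by exact: ler_wpM2r.
  by move: a1 a2 a3 Mmm; rewrite /W mul1r; set Y := 4 * kap * r * mm; clear; lra.
have hyp1 i j : (i <= n)%N -> (j <= n)%N -> `|hxe (P i j)| <= K * (2 * mm).
  move=> iN jN; have [H _] := Hhyp _ (inbox i j iN jN); apply: le_trans H _.
  by apply: ler_wpM2l; [exact: ltW|exact: q2].
have hyp2 i j : (i <= n)%N -> (j <= n)%N ->
    `|hxx (P i j) + c (P i j) * hee (P i j)| <= K * (2 * mm).
  move=> iN jN; have [_ H] := Hhyp _ (inbox i j iN jN); apply: le_trans H _.
  by apply: ler_wpM2l; [exact: ltW|exact: q2].
have hmm : 0 <= h * mm by rewrite mulr_ge0.
have Kk2 : K <= kap ^+ 2.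
  by apply: le_trans Kk _; rewrite -[X in X <= _]expr1 pw.
have aab i j : (i <= n)%N -> (j <= n)%N -> `|aa i j| <= 2 * h.
  by move=> iN jN; have [] := sl i j (leN _ iN) (leN _ jN).
have bbb i j : (i <= n)%N -> (j <= n)%N -> `|bb i j| <= 2 * h.
  by move=> iN jN; have [] := sl i j (leN _ iN) (leN _ jN).
have stepx (s x : R) : `|s| <= 2 * h -> `|x| <= K * (2 * mm) -> `|s * x| <= 4 * kap ^+ 2 * h * mm.
  move=> hs hx; rewrite normrM; apply: le_trans (ler_pM (normr_ge0 _) (normr_ge0 _) hs hx) _.
  rewrite (_ : 2 * h * (K * (2 * mm)) = 4 * (K * (h * mm))); last by ring.
  rewrite (_ : 4 * kap ^+ 2 * h * mm = 4 * (kap ^+ 2 * (h * mm))); last by ring.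
  by rewrite ler_pM2l // ler_wpM2r.
have P1 i j : (i < n)%N -> (j <= n)%N -> `|Pf i.+1 j - Pf i j| <= 6 * kap ^+ 2 * h * mm.
  move=> iN jN; have a := PA i j iN jN.
  have b := stepx _ _ (aab i j (ltnW iN) jN) (hyp1 i j (ltnW iN) jN).
  have := ler_normD (Pf i.+1 j - Pf i j - aa i j * hxe (P i j)) (aa i j * hxe (P i j)).
  rewrite subrK; move: a b; rewrite -!(mulrA _ h) -!(mulrA _ (kap ^+ 2)).
  set Y := kap ^+ 2 * _; set Y1 := `|_ * _|; clear; lra.
have Q1 i j : (i <= n)%N -> (j < n)%N -> `|Qf i j.+1 - Qf i j| <= 6 * kap ^+ 2 * h * mm.
  move=> iN jN; have a := QB i j iN jN.
  have b := stepx _ _ (bbb i j iN (ltnW jN)) (hyp1 i j iN (ltnW jN)).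
  have := ler_normD (Qf i j.+1 - Qf i j - bb i j * hxe (P i j)) (bb i j * hxe (P i j)).
  rewrite subrK; move: a b; rewrite -!(mulrA _ h) -!(mulrA _ (kap ^+ 2)).
  set Y := kap ^+ 2 * _; set Y1 := `|_ * _|; clear; lra.
have k60 : 0 <= 6 * kap ^+ 2 by rewrite mulr_ge0 ?exprn_ge0.
have P2 i j : (i <= n)%N -> (j <= n)%N -> `|Pf i j - Pf 0 j| <= 6 * kap ^+ 2 * r * mm.
  move=> iN jN; apply: le_trans (ir _ i k60 iN).
  apply: (@telescope_bound _ (fun i => Pf i j)) => i' ii.
  exact: P1 (leq_trans ii iN) jN.
have Q2 i j : (i <= n)%N -> (j <= n)%N -> `|Qf i j - Qf i 0| <= 6 * kap ^+ 2 * r * mm.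
  move=> iN jN; apply: le_trans (ir _ j k60 jN).
  apply: (@telescope_bound _ (fun j => Qf i j)) => j' jj.
  exact: Q1 iN (leq_trans jj jN).
have PQb i j : (i <= n)%N -> (j <= n)%N -> `|Pf i j| <= kap * mm /\ `|Qf i j| <= kap * mm.
  move=> iN jN; have wM := le_trans (WM i j iN jN) Mmm.
  have := ler_wpM2l kap0 wM; rewrite /W mulrDr => H.
  have a1 := ler_wpM2r (normr_ge0 (w1 (P i j))) (le_trans (lK (P i j)) Kk).
  have a2 := ler_wpM2r (normr_ge0 (w2 (P i j))) (le_trans (kK (P i j)) Kk).
  have b1 := ler_wpM2r (normr_ge0 (w1 (P i j))) kap1.
  have b2 := ler_wpM2r (normr_ge0 (w2 (P i j))) kap1.
  split; apply: le_trans (ler_normD _ _) _; rewrite !normrM normr1 mul1r.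
    move: H a1 b2; rewrite mul1r; clear.
    set Y1 := kap * `|w1 _|; set Y2 := kap * `|w2 _|; set Y3 := `|l _| * _; set Y4 := kap * mm; lra.
  move: H a2 b1; rewrite mul1r; clear.
  set Y1 := kap * `|w1 _|; set Y2 := kap * `|w2 _|; set Y3 := `|k _| * _; set Y4 := kap * mm; lra.
pose g1 i j := aa i j * Pf i j; pose g2 i j := c (P i j) * bb i j * Qf i j.
have hhm : 0 <= h ^+ 2 * mm by rewrite mulr_ge0 ?sqr_ge0.
have NM (s t s' t' : R) : `|s| <= s' -> `|t| <= t' -> `|s * t| <= s' * t'.
  by move=> *; rewrite normrM ler_pM.
have cell i j : (i < n)%N -> (j < n)%N ->
    `|g2 i.+1 j - g2 i j + (g1 i j.+1 - g1 i j)| <= 36 * S * (h ^+ 2 * mm).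
  move=> iN jN; have iN' := ltnW iN; have jN' := ltnW jN.
  have [sA sB] := @side_incr R k l p0 h K K1 kK lK k_lip l_lip transv i j.
  have ab4 : `|aa i j| * `|bb i j| <= 2 * h * (2 * h).
    by apply: ler_pM => //; [exact: aab|exact: bbb].
  have sc0 : 0 <= side_const K by rewrite sc mulr_ge0 ?exprn_ge0.
  have dA1 : `|aa i j.+1 - aa i j| <= 8 * kap ^+ 5 * h ^+ 2.
    apply: le_trans sA _; have := ler_wpM2l sc0 ab4; rewrite sc.
    by rewrite (_ : 2 * kap ^+ 5 * (2 * h * (2 * h)) = 8 * kap ^+ 5 * h ^+ 2) //; ring.
  have dB1 : `|bb i.+1 j - bb i j| <= 8 * kap ^+ 5 * h ^+ 2.
    apply: le_trans sB _; have := ler_wpM2l sc0 ab4; rewrite sc.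
    by rewrite (_ : 2 * kap ^+ 5 * (2 * h * (2 * h)) = 8 * kap ^+ 5 * h ^+ 2) //; ring.
  have dc1 : `|c (P i.+1 j) - c (P i j)| <= K * (2 * h * kap).
    by apply: le_trans (c_lip _ _) _; rewrite ler_wpM2l ?(ltW K0) //; exact: dA.
  have [pb' _] := PQb i j.+1 iN' jN; have [_ qb'] := PQb i.+1 j iN jN'.
  have e : g2 i.+1 j - g2 i j + (g1 i j.+1 - g1 i j) =
    aa i j * (Pf i j.+1 - Pf i j - bb i j * hxx (P i j))
    + (aa i j.+1 - aa i j) * Pf i j.+1
    + c (P i j) * bb i j * (Qf i.+1 j - Qf i j - aa i j * hee (P i j))
    + (c (P i.+1 j) * (bb i.+1 j - bb i j) + (c (P i.+1 j) - c (P i j)) * bb i j) * Qf i.+1 j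
    + aa i j * bb i j * (hxx (P i j) + c (P i j) * hee (P i j)).
    by rewrite /g1 /g2; ring.
  rewrite e.
  have t1 := NM _ _ _ _ (aab i j iN' jN') (PB i j iN' jN).
  have t2 := NM _ _ _ _ dA1 pb'.
  have t3 := NM _ _ _ _ (NM _ _ _ _ (cK (P i j)) (bbb i j iN' jN')) (QA i j iN jN').
  have t4 := NM _ _ _ _ (le_trans (ler_normD _ _) (lerD (NM _ _ _ _ (cK (P i.+1 j)) dB1) (NM _ _ _ _ dc1 (bbb i j iN' jN')))) qb'.
  have t5 := NM _ _ _ _ (NM _ _ _ _ (aab i j iN' jN') (bbb i j iN' jN')) (hyp2 i j iN' jN').
  apply: le_trans (ler_normD _ _) _; apply: le_trans (lerD (ler_normD _ _) t5) _.
  apply: le_trans (lerD (lerD (ler_normD _ _) t4) (lexx _)) _.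
  apply: le_trans (lerD (lerD (lerD (ler_normD _ _) t3) (lexx _)) (lexx _)) _.
  apply: le_trans (lerD (lerD (lerD (lerD t1 t2) (lexx _)) (lexx _)) (lexx _)) _.
  rewrite [leLHS](_ : _ = (4 * kap ^+ 2 + 8 * kap ^+ 6 + 4 * (K * kap ^+ 2)
     + (8 * (K * kap ^+ 6) + 4 * (K * kap ^+ 2)) + 8 * K) * (h ^+ 2 * mm)); last by ring.
  apply: ler_wpM2r => //.
  have Km m : (m <= 6)%N -> K * kap ^+ m <= S.
    by move=> hm; apply: le_trans (_ : kap ^+ m.+1 <= _); [rewrite exprS ler_wpM2r ?exprn_ge0|exact: Sk].
  have := Km 2 isT; have := Km 6 isT; have := Km 0%N isT; have := Sk 2 isT; have := Sk 6 isT.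
  rewrite expr0 mulr1; clear.
  by set Y1 := kap ^+ 2; set Y2 := kap ^+ 6; set Y3 := K * Y1; set Y4 := K * Y2; lra.
have P00 : Pf 0 0 = 0 by rewrite /Pf /P /net /= w10 w20 !mulr0 addr0.
have Q00 : Qf 0 0 = 0 by rewrite /Qf /P /net /= w10 w20 !mulr0 addr0.
have hrm : 0 <= h * r * mm by rewrite mulr_ge0 // mulr_ge0 // ltW.
have rh i : (i <= n)%N -> i%:R * h ^+ 2 <= r * h.
  move=> i_n; rewrite expr2 mulrA; apply: ler_wpM2r => //.
  by apply: ler_wpM2r => //; rewrite ler_nat.
have k50 : 0 <= 4 * (2 * kap ^+ 5) by rewrite !mulr_ge0 ?exprn_ge0.
have aah i j : (i <= n)%N -> (j <= n)%N -> `|aa i j - h| <= 8 * kap ^+ 5 * (r * h).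
  move=> iN jN; have [H _] := sb i j (leN _ iN) (leN _ jN); apply: le_trans H _.
  rewrite sc (_ : 8 * kap ^+ 5 = 4 * (2 * kap ^+ 5)); last by ring.
  by rewrite ler_wpM2l // rh.
have bbh i j : (i <= n)%N -> (j <= n)%N -> `|bb i j - h| <= 8 * kap ^+ 5 * (r * h).
  move=> iN jN; have [_ H] := sb i j (leN _ iN) (leN _ jN); apply: le_trans H _.
  rewrite sc (_ : 8 * kap ^+ 5 = 4 * (2 * kap ^+ 5)); last by ring.
  by rewrite ler_wpM2l // rh.
have Km m : (m <= 6)%N -> K * kap ^+ m <= S.
  by move=> hm; apply: le_trans (_ : kap ^+ m.+1 <= _); [rewrite exprS ler_wpM2r ?exprn_ge0|exact: Sk].
have G2 a j : (a <= n)%N -> (j <= n)%N ->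
    `|g2 a j - g2 0 j - c p0 * h * Qf a 0| <= 40 * S * (h * r * mm).
  move=> an jn.
  have -> : g2 a j - g2 0 j - c p0 * h * Qf a 0 = c (P a j) * bb a j * (Qf a j - Qf a 0)
    + ((c (P a j) - c p0) * bb a j + c p0 * (bb a j - h)) * Qf a 0
    - c (P 0 j) * bb 0 j * (Qf 0 j - Qf 0 0) by rewrite /g2 Q00; ring.
  have dc : `|c (P a j) - c p0| <= K * (4 * kap * r).
    by apply: le_trans (c_lip _ _) _; rewrite ler_wpM2l ?(ltW K0) //; exact: dC.
  have [_ qb] := PQb a 0%N an (leq0n n).
  have t1 := NM _ _ _ _ (NM _ _ _ _ (cK (P a j)) (bbb a j an jn)) (Q2 a j an jn).
  have t2 := NM _ _ _ _ (le_trans (ler_normD _ _) (lerD (NM _ _ _ _ dc (bbb a j an jn)) (NM _ _ _ _ (cK p0) (bbh a j an jn)))) qb.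
  have t3 := NM _ _ _ _ (NM _ _ _ _ (cK (P 0 j)) (bbb 0%N j (leq0n n) jn)) (Q2 0%N j (leq0n n) jn).
  apply: le_trans (ler_normB _ _) _; apply: le_trans (lerD (ler_normD _ _) t3) _.
  apply: le_trans (lerD (lerD t1 t2) (lexx _)) _.
  rewrite [leLHS](_ : _ = (24 * (K * kap ^+ 2) + 8 * (K * kap ^+ 2) + 8 * (K * kap ^+ 6)) * (h * r * mm)); last by ring.
  apply: ler_wpM2r => //.
  have := Km 2 isT; have := Km 6 isT; clear.
  by set Y3 := K * kap ^+ 2; set Y4 := K * kap ^+ 6; lra.
have G1 i b : (i <= n)%N -> (b <= n)%N ->
    `|g1 i b - g1 i 0 - h * Pf 0 b| <= 40 * S * (h * r * mm).
  move=> i_n bn.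
  have -> : g1 i b - g1 i 0 - h * Pf 0 b = aa i b * (Pf i b - Pf 0 b)
    + (aa i b - h) * Pf 0 b - aa i 0 * (Pf i 0 - Pf 0 0) by rewrite /g1 P00; ring.
  have [pb _] := PQb 0%N b (leq0n n) bn.
  have t1 := NM _ _ _ _ (aab i b i_n bn) (P2 i b i_n bn).
  have t2 := NM _ _ _ _ (aah i b i_n bn) pb.
  have t3 := NM _ _ _ _ (aab i 0%N i_n (leq0n n)) (P2 i 0%N i_n (leq0n n)).
  apply: le_trans (ler_normB _ _) _; apply: le_trans (lerD (ler_normD _ _) t3) _.
  apply: le_trans (lerD (lerD t1 t2) (lexx _)) _.
  rewrite [leLHS](_ : _ = (24 * kap ^+ 2 + 8 * kap ^+ 6) * (h * r * mm)); last by ring.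
  apply: ler_wpM2r => //.
  have := Sk 2 isT; have := Sk 6 isT; have := S0; clear.
  by set Y3 := kap ^+ 2; set Y4 := kap ^+ 6; lra.
have nr i : (i <= n)%N -> i%:R * h <= r by move=> i_n; rewrite ler_wpM2r // ler_nat.
have rel a b : (a <= n)%N -> (b <= n)%N ->
    `|b%:R * h * c p0 * Qf a 0 + a%:R * h * Pf 0 b| <= 120 * S * r ^+ 2 * mm.
  move=> an bn.
  have t1 : `|\sum_(j < b) (g2 a j - g2 0 j) + \sum_(i < a) (g1 i b - g1 i 0)| <= a%:R * b%:R * (36 * S * (h ^+ 2 * mm)).
    apply: cell_sum => i j ia jb.
    exact: cell (leq_trans ia an) (leq_trans jb bn).
  have t2 : `|\sum_(j < b) (g2 a j - g2 0 j - c p0 * h * Qf a 0)| <= b%:R * (40 * S * (h * r * mm)).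
    apply: (@sum_bound _ (fun j => g2 a j - g2 0 j - c p0 * h * Qf a 0)) => j jb.
    exact: G2 an (ltnW (leq_trans jb bn)).
  have t3 : `|\sum_(i < a) (g1 i b - g1 i 0 - h * Pf 0 b)| <= a%:R * (40 * S * (h * r * mm)).
    apply: (@sum_bound _ (fun i => g1 i b - g1 i 0 - h * Pf 0 b)) => i ia.
    exact: G1 (ltnW (leq_trans ia an)) bn.
  rewrite sumrB sumr_const card_ord -[_ *+ b]mulr_natl in t2.
  rewrite sumrB sumr_const card_ord -[_ *+ a]mulr_natl in t3.
  set T1 := \sum_(j < b) _ in t1 t2; set T2 := \sum_(i < a) _ in t1 t3.
  have -> : b%:R * h * c p0 * Qf a 0 + a%:R * h * Pf 0 b =
    (T1 + T2) - (T1 - b%:R * (c p0 * h * Qf a 0)) - (T2 - a%:R * (h * Pf 0 b)) by ring.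
  apply: le_trans (ler_normB _ _) _; apply: le_trans (lerD (ler_normB _ _) t3) _.
  apply: le_trans (lerD (lerD t1 t2) (lexx _)) _.
  have ra := nr a an; have rb := nr b bn.
  have a0 : 0 <= a%:R * h by rewrite mulr_ge0.
  have b0 : 0 <= b%:R * h by rewrite mulr_ge0.
  have rab : a%:R * h * (b%:R * h) <= r * r by exact: ler_pM.
  have r0' := ltW r0.
  have Sm : 0 <= S * mm by rewrite mulr_ge0 // ltW.
  have Srm : 0 <= S * r * mm by rewrite mulr_ge0 // mulr_ge0 // ltW.
  have u1 := ler_wpM2l Sm rab; have u2 := ler_wpM2l Srm ra; have u3 := ler_wpM2l Srm rb.
  have u4 : 0 <= S * r ^+ 2 * mm by rewrite mulr_ge0 // mulr_ge0 ?sqr_ge0 // ltW.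
  rewrite [leLHS](_ : _ = 36 * (S * mm * (a%:R * h * (b%:R * h))) + 40 * (S * r * mm * (b%:R * h))
    + 40 * (S * r * mm * (a%:R * h))); last by ring.
  move: u1 u2 u3 u4.
  rewrite (_ : S * mm * (r * r) = S * r ^+ 2 * mm); last by ring.
  rewrite (_ : S * r * mm * r = S * r ^+ 2 * mm); last by ring.
  rewrite (_ : 120 * S * r ^+ 2 * mm = 120 * (S * r ^+ 2 * mm)); last by ring.
  set Y := S * r ^+ 2 * mm; set Y1 := S * mm * _; set Y2 := S * r * mm * (b%:R * h).
  set Y3 := S * r * mm * (a%:R * h); clear; lra.
have XE m : X m = `|Pf 0 m| by rewrite /X /Pf mul1r.
pose C6 := 120 * S.
pose E := C6 * r * mm.
have E0 : 0 <= E by rewrite mulr_ge0 // mulr_ge0 ?(ltW r0) // mulr_ge0 // ltW.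
have divr_rel (x : R) : r * x <= C6 * r ^+ 2 * mm -> x <= E.
  rewrite (_ : C6 * r ^+ 2 * mm = r * E); last by rewrite /E; ring.
  by rewrite ler_pM2l.
have rel' a b : (a <= n)%N -> (b <= n)%N ->
    `|b%:R * h / r * c p0 * Qf a 0 + a%:R * h / r * Pf 0 b| <= E.
  move=> an bn; apply: divr_rel; rewrite -[X in X * _](gtr0_norm r0) -normrM.
  rewrite (_ : r * _ = b%:R * h * c p0 * Qf a 0 + a%:R * h * Pf 0 b); first exact: rel.
  by field; rewrite gt_eqF.
have frac i : (i <= n)%N -> 0 <= i%:R * h / r <= 1.
  move=> i_n; apply/andP; split; first by rewrite divr_ge0 ?(ltW r0) // mulr_ge0.
  by rewrite ler_pdivrMr // mul1r nr.
have nn1 : n%:R * h / r = 1 by rewrite -/r divff // gt_eqF.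
have Qax a : (a <= n)%N -> `|Qf a 0| <= K * (X n + E).
  move=> an; have := rel' a n an (leqnn n); rewrite nn1 mul1r => H.
  have /andP[f0 f1] := frac a an.
  have : `|c p0 * Qf a 0| <= X n + E.
    have -> : c p0 * Qf a 0 = (c p0 * Qf a 0 + a%:R * h / r * Pf 0 n) - a%:R * h / r * Pf 0 n by ring.
    apply: le_trans (ler_normB _ _) _; rewrite addrC lerD //.
    by rewrite XE normrM (ger0_norm f0) ler_piMl.
  rewrite normrM => H2; have := ler_wpM2r (normr_ge0 (Qf a 0)) c0K.
  rewrite mul1r -mulrA => /le_trans; apply; apply: ler_wpM2l => //; exact: ltW.
have Xn0 : 0 <= X n by rewrite XE.
have K00 := ltW K0.
have Pax b : (b <= n)%N -> `|Pf 0 b| <= K * (K * (X n + E)) + E.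
  move=> bn; have := rel' n b (leqnn n) bn; rewrite nn1 mul1r => H.
  have /andP[f0 f1] := frac b bn.
  have -> : Pf 0 b = (b%:R * h / r * c p0 * Qf n 0 + Pf 0 b) - b%:R * h / r * c p0 * Qf n 0 by ring.
  apply: le_trans (ler_normB _ _) _; rewrite addrC lerD // normrM (normrM (b%:R * h / r)) (ger0_norm f0).
  have := Qax n (leqnn n) => q.
  have c1 : b%:R * h / r * `|c p0| <= 1 * K by apply: ler_pM.
  rewrite mul1r in c1; apply: ler_pM => //.
  by rewrite mulr_ge0.
have kE := Sk 2 isT.
have P2E i j : (i <= n)%N -> (j <= n)%N -> `|Pf i j - Pf 0 j| <= E.
  move=> iN jN; apply: le_trans (P2 i j iN jN) _; rewrite /E.
  apply: ler_wpM2r => //; apply: ler_wpM2r; first exact: ltW.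
  by rewrite /C6; lra_from kE S0.
have Q2E i j : (i <= n)%N -> (j <= n)%N -> `|Qf i j - Qf i 0| <= E.
  move=> iN jN; apply: le_trans (Q2 i j iN jN) _; rewrite /E.
  apply: ler_wpM2r => //; apply: ler_wpM2r; first exact: ltW.
  by rewrite /C6; lra_from kE S0.
have K2k : K * K <= kap ^+ 2 by rewrite expr2; apply: ler_pM.
have k21 : 1 <= kap ^+ 2 by rewrite -[1](expr0 kap) pw.
pose Bd := kap ^+ 2 * X n + 4 * (kap ^+ 2 * E).
have kX0 : 0 <= kap ^+ 2 * X n by rewrite mulr_ge0 ?exprn_ge0.
have Pb i j : (i <= n)%N -> (j <= n)%N -> `|Pf i j| <= Bd /\ `|Qf i j| <= Bd.
  move=> iN jN.
  have e1 : `|Pf i j| <= E + (K * (K * (X n + E)) + E).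
    rewrite -[Pf i j](subrK (Pf 0 j)); apply: le_trans (ler_normD _ _) _.
    by apply: lerD; [exact: P2E|exact: Pax].
  have e2 : `|Qf i j| <= E + K * (X n + E).
    rewrite -[Qf i j](subrK (Qf i 0)); apply: le_trans (ler_normD _ _) _.
    by apply: lerD; [exact: Q2E|exact: Qax].
  have a1 := ler_wpM2r Xn0 K2k; have a2 := ler_wpM2r E0 K2k; have a3 := ler_wpM2r E0 k21.
  have a4 := ler_wpM2r Xn0 Kk2; have a5 := ler_wpM2r E0 Kk2.
  have a3' : E <= kap ^+ 2 * E by move: a3; rewrite mul1r.
  split.
    apply: le_trans e1 _; rewrite /Bd.
    rewrite (_ : K * (K * (X n + E)) = K * K * X n + K * K * E); last by ring.
    move: a1 a2 a3' E0; clear; set Y1 := K * K * X n; set Y2 := K * K * E.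
    by set Y3 := kap ^+ 2 * E; set Y4 := kap ^+ 2 * X n; lra.
  apply: le_trans e2 _; rewrite /Bd mulrDr.
  move: a3' a4 a5 E0; clear; set Y1 := K * X n; set Y2 := K * E; set Y3 := kap ^+ 2 * E.
  by set Y4 := kap ^+ 2 * X n; lra.
have Bd0 : 0 <= Bd by rewrite addr_ge0 // mulr_ge0 // mulr_ge0 // exprn_ge0.
have Wb i j : (i <= n)%N -> (j <= n)%N -> W i j <= 2 * kap ^+ 2 * Bd.
  move=> iN jN; have [pb qb] := Pb i j iN jN.
  have tr := transv (P i j) (P i j); set D := 1 - k (P i j) * l (P i j) in tr.
  have D0 : 0 < D by rewrite -(pmulr_rgt0 _ K0); lra_from tr.
  have rec (x y : R) : `|x * D| <= y -> `|x| <= K * y.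
    move=> H; have := ler_wpM2r (normr_ge0 x) tr; rewrite mul1r => /le_trans; apply.
    by rewrite -mulrA ler_wpM2l // mulrC -(gtr0_norm D0) -normrM.
  have kB : K * Bd + Bd <= kap * Bd by rewrite /kap mulrDl mul1r addrC.
  have x1 : `|w1 (P i j)| <= K * (kap * Bd).
    apply: rec; rewrite (_ : w1 (P i j) * D = Qf i j - k (P i j) * Pf i j); last by rewrite /Qf /Pf /D; ring.
    apply: le_trans (ler_normB _ _) _; have := NM _ _ _ _ (kK (P i j)) pb.
    move: kB qb; clear; set Y := K * Bd; set Y1 := kap * Bd; lra.
  have x2 : `|w2 (P i j)| <= K * (kap * Bd).
    apply: rec; rewrite (_ : w2 (P i j) * D = Pf i j - l (P i j) * Qf i j); last by rewrite /Qf /Pf /D; ring.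
    apply: le_trans (ler_normB _ _) _; have := NM _ _ _ _ (lK (P i j)) qb.
    move: kB pb; clear; set Y := K * Bd; set Y1 := kap * Bd; lra.
  have x3 : K * (kap * Bd) <= kap * (kap * Bd) by rewrite ler_wpM2r // mulr_ge0.
  move: x1 x2 x3; rewrite /W (_ : 2 * kap ^+ 2 * Bd = 2 * (kap * (kap * Bd))); last by ring.
  by clear; set Y := K * _; set Y1 := kap * _; lra.
have M_le : M <= 2 * kap ^+ 2 * Bd.
  apply: bigmax_le => [|g _]; first by rewrite mulr_ge0 // mulr_ge0 ?exprn_ge0.
  by apply: Wb; rewrite -ltnS.
have MX : mm <= 4 * kap ^+ 4 * X n + 2 * eps.
  have e1 : 2 * kap ^+ 2 * Bd = 2 * kap ^+ 4 * X n + 8 * (kap ^+ 4 * E) by rewrite /Bd; ring.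
  have e2 : 8 * (kap ^+ 4 * E) <= mm / 2.
    rewrite (_ : 8 * (kap ^+ 4 * E) = 960 * kap ^+ 11 * r * mm); last by rewrite /E /C6 /S; ring.
    rewrite [mm / 2]mulrC; apply: ler_wpM2r => //.
    have c11 : 1000 * (kap ^+ 1 * kap ^+ 11) <= C by rewrite -exprD; exact: kC.
    have k110 : 0 <= kap ^+ 11 by rewrite exprn_ge0.
    have c12 : 2 * kap ^+ 11 <= kap ^+ 1 * kap ^+ 11 by rewrite expr1 ler_wpM2r.
    have c13 : 2 * (960 * kap ^+ 11) <= C by move: c11 c12 k110; set Y := _ * kap ^+ 11; set Y1 := kap ^+ 11; clear; lra.
    have := ler_wpM2r (ltW r0) c13; move: Cr; rewrite -(mulrA 2); set Y1 := _ * r; set Y2 := _ * r; clear; lra.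
  move: M_le; rewrite e1 => H.
  have : mm <= 2 * kap ^+ 4 * X n + mm / 2 + eps by rewrite {1}/mm; move: H e2; set Y := 8 * _; clear; lra.
  rewrite (_ : 4 * kap ^+ 4 * X n = 2 * (2 * kap ^+ 4 * X n)); last by ring.
  by set Y := 2 * kap ^+ 4 * _; clear; lra.
have kp m : 0 <= kap ^+ m by exact: exprn_ge0.
have mmC : mm <= C * (X n + eps).
  apply: le_trans MX _; rewrite mulrDr.
  have c4 := kC 4 isT.
  have : 4 * kap ^+ 4 * X n <= C * X n.
    by apply: ler_wpM2r => //; have := kp 4; lra_from c4.
  have : 2 * eps <= C * eps by apply: ler_wpM2r => //; have := pw 0%N 4 isT; rewrite expr0; lra_from c4.
  by set Y := 4 * _ * _; set Y1 := C * _; set Y2 := C * _; clear; lra.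
split.
  move=> i j iN jN; apply: le_trans mmC; apply: le_trans (vb i j iN jN) _.
  by rewrite -[leRHS]mul1r; apply: ler_wpM2r.
move=> m nm.
have mn : (m <= n)%N by rewrite nm -addnn leq_addr.
have half : m%:R * h / r = 1 / 2.
  rewrite /r nm -muln2 natrM; field; apply/andP; split; first by rewrite gt_eqF.
  by rewrite pnatr_eq0 -lt0n -double_gt0 -nm.
have r1 := rel' n m (leqnn n) mn; have r2 := rel' n n (leqnn n) (leqnn n).
rewrite nn1 !mul1r half in r1 r2.
have : `|Pf 0 n - 2 * Pf 0 m| <= E + 2 * E.
  rewrite (_ : Pf 0 n - 2 * Pf 0 m = (c p0 * Qf n 0 + Pf 0 n) - 2 * (1 / 2 * c p0 * Qf n 0 + Pf 0 m)); last by field.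
  apply: le_trans (ler_normB _ _) _; rewrite lerD // normrM ger0_norm // ler_wpM2l //.
move=> H.
have : X n <= 2 * X m + 3 * E.
  rewrite !XE; have := ler_normD (Pf 0 n - 2 * Pf 0 m) (2 * Pf 0 m); rewrite subrK normrM (ger0_norm (x := 2)) //.
  by move: H; clear; lra.
move=> /le_trans; apply; rewrite lerD2l.
rewrite -/r; have := ler_wpM2r (ltW r0) (lexx C) => _.
have c16 : 1000 * (kap ^+ 5 * kap ^+ 11) <= C by rewrite -exprD; exact: kC.
have c1 : 3 * C6 * (4 * kap ^+ 4 + 2) <= C.
  have p5 : 8 <= kap ^+ 5.
    apply: le_trans (_ : 2 ^+ 5 <= _); first by rewrite -natrX ler_nat.
    by rewrite lerXn2r // nnegrE.
  have p7 := pw 7 11 isT.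
  have p11 : 0 <= kap ^+ 11 by exact: kp.
  rewrite /C6 /S (_ : 3 * (120 * kap ^+ 7) * (4 * kap ^+ 4 + 2) = 1440 * kap ^+ 11 + 720 * kap ^+ 7); last by ring.
  have q := ler_wpM2r p11 p5.
  by move: c16 q p7 p11; set Y := kap ^+ 5 * _; set Y1 := kap ^+ 11; set Y2 := kap ^+ 7; clear; lra.
have c2 : 0 <= 3 * C6 by rewrite mulr_ge0 // mulr_ge0 // ltW.
have c3 : mm <= (4 * kap ^+ 4 + 2) * (X n + eps).
  apply: le_trans MX _; have := kp 4.
  rewrite (_ : (4 * kap ^+ 4 + 2) * (X n + eps) = 4 * kap ^+ 4 * X n + 2 * eps + (2 * X n + 4 * (kap ^+ 4 * eps))); last by ring.
  by rewrite lerDl addr_ge0 // mulr_ge0 // mulr_ge0.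
have Xe : 0 <= X n + eps by rewrite addr_ge0.
have := ler_wpM2l (mulr_ge0 c2 (ltW r0)) c3.
rewrite (_ : 3 * C6 * r * mm = 3 * E); last by rewrite /E; ring.
move=> /le_trans; apply.
rewrite (_ : 3 * C6 * r * ((4 * kap ^+ 4 + 2) * (X n + eps)) = 3 * C6 * (4 * kap ^+ 4 + 2) * (r * (X n + eps))); last by ring.
rewrite -(mulrA C r); apply: ler_wpM2r => //.
by rewrite mulr_ge0 // ltW.
Qed.

Lemma dyadic_small (R : realType) (x d : R) : 0 < d -> exists m0, forall m, (m0 <= m)%N -> x / (2 ^ m)%:R <= d.
Proof.
move=> d0; exists (Num.truncn (`|x| / d)).+1 => m hm.
have p0 : 0 < (2 ^ m)%:R :> R by rewrite ltr0n expn_gt0.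
rewrite ler_pdivrMr //; apply: le_trans (ler_norm _) _.
rewrite -ler_pdivrMl // mulrC.
have q0 : 0 <= `|x| / d by rewrite divr_ge0 // ltW.
have /andP[_ H] := truncn_itv q0.
apply: le_trans (ltW H) _; rewrite ler_nat; apply: leq_trans hm _.
exact: ltnW (ltn_expl m (ltnSn 1)).
Qed.

(* The slopes [X i / r_i] are almost nonincreasing, so that they are all
   controlled by the slope at the smallest scale. *)
Lemma dyadic_slopes (R : realType) (C eps h : R) (X : nat -> R) (s t : nat) :
  0 < C -> 0 < h -> 0 <= eps -> 4 * C * ((2 ^ (s + t))%:R * h) <= 1 -> (forall i, 0 <= X i) ->
  (forall i, (i < s + t)%N -> X i.+1 <= 2 * X i + C * ((2 ^ i.+1)%:R * h) * (X i.+1 + eps)) ->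
  X (s + t)%N <= 2 * ((2 ^ (s + t))%:R * h) * (X s / ((2 ^ s)%:R * h) + t%:R * (C * eps)).
Proof.
move=> C0 h0 eps0 small X0 HX.
pose r i : R := (2 ^ i)%:R * h.
have r0 i : 0 < r i by rewrite mulr_gt0 // ltr0n expn_gt0.
have rS i : r i.+1 = 2 * r i by rewrite /r expnS natrM mulrA.
have rmono i : (i <= s + t)%N -> 4 * C * r i <= 1.
  move=> le; apply: le_trans small; apply: ler_wpM2l; first by rewrite mulr_ge0 // ltW.
  by rewrite ler_wpM2r ?(ltW h0) // ler_nat leq_exp2l.
pose A := X s / r s.
have A0 : 0 <= A by rewrite divr_ge0 // ltW.
have key j : (j <= t)%N -> X (s + j)%N / r (s + j)%N <= (A + j%:R * (C * eps)) * (1 + 4 * C * r (s + j)%N).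
  elim: j => [|j IH] jt.
    rewrite addn0 mul0r addr0 -/A ler_peMr // lerDl.
    by apply: mulr_ge0; [apply: mulr_ge0 => //; exact: ltW|exact: ltW].
  have := IH (ltnW jt); rewrite addnS; set i := (s + j)%N => IHj.
  have it : (i < s + t)%N by rewrite ltn_add2l.
  have hX := HX i it; rewrite -/(r i.+1) in hX.
  have c4 := rmono _ it; have ri := r0 i; have ri1 := r0 i.+1.
  set q := r i.+1 in c4 ri1 hX *.
  have qE : q = 2 * r i by exact: rS.
  pose B := A + j%:R * (C * eps).
  have B0 : 0 <= B by rewrite addr_ge0 // mulr_ge0 // mulr_ge0 // ltW.
  have ce : 0 <= C * eps by rewrite mulr_ge0 // ltW.
  have Cq : 0 <= C * q by rewrite mulr_ge0 ?ltW.
  have e1 : X i.+1 / q * (1 - C * q) <= X i / r i + C * eps.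
    have : X i.+1 / q <= X i / r i + C * q * (X i.+1 / q) + C * eps.
      rewrite ler_pdivrMr //; apply: le_trans hX _.
      rewrite qE le_eqVlt; apply/orP; left; apply/eqP; field; by rewrite gt_eqF.
    by set Y := X i.+1 / q; clear; lra.
  rewrite -[j.+1%:R]natr1 (_ : A + (j%:R + 1) * (C * eps) = B + C * eps); last by rewrite /B; ring.
  have pos : 0 < 1 - C * q by move: c4; rewrite -mulrA; set Y := C * q; clear; lra.
  rewrite -(ler_pM2r pos); apply: le_trans e1 _.
  apply: le_trans (lerD IHj (lexx _)) _; rewrite -/B.
  have -> : 4 * C * r i = 2 * (C * q) by rewrite qE; ring.
  rewrite -(mulrA 4); have c4' : 4 * (C * q) <= 1 by rewrite mulrA.
  set Y := C * q in c4' Cq *; set e := C * eps in ce *.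
  have p1 : 0 <= (B + e) * (Y * (1 - 4 * Y)).
    by apply: mulr_ge0; [exact: addr_ge0|apply: mulr_ge0 => //; lra_from c4'].
  have p2 : 0 <= e * Y by exact: mulr_ge0.
  by move: p1 p2; clear; lra.
have := key t (leqnn t); rewrite -/(r (s + t)%N) ler_pdivrMr //.
have c4 := rmono _ (leqnn (s + t)%N).
have B0 : 0 <= A + t%:R * (C * eps) by rewrite addr_ge0 // mulr_ge0 // mulr_ge0 // ltW.
move=> /le_trans; apply.
rewrite -/(r s) -/A [leRHS](_ : _ = (A + t%:R * (C * eps)) * 2 * r (s + t)%N); last by rewrite /r; ring.
apply: ler_wpM2r; first exact: ltW.
by apply: ler_wpM2l => //; lra_from c4.
Qed.

(* A point of the index square minimizing the l1 distance is at distance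
   O(h), otherwise one step in the right direction would decrease it. *)
Lemma grid_nearest (R : realType) (F1 F2 : nat -> nat -> R) (N : nat) (h s t : R) : 0 < h ->
  (forall i j, (i < N)%N -> (j <= N)%N -> h / 4 <= F1 i.+1 j - F1 i j <= 2 * h /\ `|F2 i.+1 j - F2 i j| <= h / 8) ->
  (forall i j, (i <= N)%N -> (j < N)%N -> h / 4 <= F2 i j.+1 - F2 i j <= 2 * h /\ `|F1 i j.+1 - F1 i j| <= h / 8) ->
  (forall j, (j <= N)%N -> F1 0%N j < s < F1 N j) ->
  (forall i, (i <= N)%N -> F2 i 0%N < t < F2 i N) ->
  exists i j, [/\ (i <= N)%N, (j <= N)%N, `|F1 i j - s| <= 2 * h & `|F2 i j - t| <= 2 * h].
Proof.
move=> h0 H1 H2 Hs Ht.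
pose F (g : 'I_N.+1 * 'I_N.+1) := `|F1 g.1 g.2 - s| + `|F2 g.1 g.2 - t|.
pose g0 : 'I_N.+1 * 'I_N.+1 := (ord0, ord0).
pose g := [arg min_(g < g0) F g]%O.
have Hmin : forall g', F g <= F g' by rewrite /g; case: arg_minP => // x _ H g'; exact: H.
have iN : (g.1 <= N)%N by rewrite -ltnS.
have jN : (g.2 <= N)%N by rewrite -ltnS.
have ind i j (hi : (i <= N)%N) (hj : (j <= N)%N) :
    F g <= `|F1 i j - s| + `|F2 i j - t|.
  by have := Hmin (Ordinal (hi : (i < N.+1)%N), Ordinal (hj : (j < N.+1)%N)).
have Fg : F g = `|F1 g.1 g.2 - s| + `|F2 g.1 g.2 - t| by [].
rewrite Fg in ind; clear Hmin Fg; move: iN jN ind.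
move: (nat_of_ord g.1) (nat_of_ord g.2) => {g} i j iN jN ind.
exists i, j.
have tri (x y e : R) : `|y - x| <= h / 8 -> `|y - e| <= `|x - e| + h / 8.
  move=> H; rewrite (_ : y - e = (y - x) + (x - e)); last by ring.
  by apply: le_trans (ler_normD _ _) _; rewrite addrC lerD2l.
have up (x y e : R) : h / 4 <= y - x <= 2 * h -> 2 * h < e - x -> `|y - e| <= `|x - e| - h / 4.
  move=> /andP[a b] c; rewrite ler0_norm; last by lra_from b c.
  by rewrite ler0_norm; [lra_from a|lra_from c h0].
have down (x y e : R) : h / 4 <= y - x <= 2 * h -> 2 * h < y - e -> `|x - e| <= `|y - e| - h / 4.
  move=> /andP[a b] c; rewrite ger0_norm; last by lra_from b c.
  by rewrite ger0_norm; [lra_from a|lra_from c h0].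
have tri' (x y e : R) : `|y - x| <= h / 8 -> `|x - e| <= `|y - e| + h / 8.
  by rewrite distrC; exact: tri.
split=> //; rewrite leNgt; apply/negP; rewrite ltr_normr opprB => /orP[far|far].
- case: i iN ind far => [|i] iN ind far.
    by have /andP[a _] := Hs j jN; lra_from far a h0.
  have [a b] := H1 i j iN jN.
  have := ind i j (ltnW iN) jN; have := down _ _ _ a far; have := tri' _ _ t b.
  set Y1 := `|_|; set Y2 := `|_|; set Y3 := `|_|; set Y4 := `|_|; lra_from h0.
- have iN' : (i < N)%N.
    rewrite ltn_neqAle iN andbT; apply/eqP => E; subst i.
    by have /andP[_ a] := Hs j jN; lra_from far a h0.
  have [a b] := H1 i j iN' jN.
  have := ind i.+1 j iN' jN; have := up _ _ _ a far; have := tri _ _ t b.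
  set Y1 := `|_|; set Y2 := `|_|; set Y3 := `|_|; set Y4 := `|_|; lra_from h0.
- case: j jN ind far => [|j] jN ind far.
    by have /andP[a _] := Ht i iN; lra_from far a h0.
  have [a b] := H2 i j iN jN.
  have := ind i j iN (ltnW jN); have := down _ _ _ a far; have := tri' _ _ s b.
  set Y1 := `|_|; set Y2 := `|_|; set Y3 := `|_|; set Y4 := `|_|; lra_from h0.
- have jN' : (j < N)%N.
    rewrite ltn_neqAle jN andbT; apply/eqP => E; subst j.
    by have /andP[_ a] := Ht i iN; lra_from far a h0.
  have [a b] := H2 i j iN jN'.
  have := ind i j.+1 iN jN'; have := up _ _ _ a far; have := tri _ _ s b.
  set Y1 := `|_|; set Y2 := `|_|; set Y3 := `|_|; set Y4 := `|_|; lra_from h0.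
Qed.

Theorem net_vanish (R : realType) (K rho : R) (k l c v w1 w2 H11 H12 H22 : R * R -> R) (p0 : R * R) :
  1 <= K -> 0 < rho ->
  (forall p, `|k p| <= K) -> (forall p, `|l p| <= K) -> (forall p, `|c p| <= K) ->
  (forall p q, `|k q - k p| <= K * dist1 p q) ->
  (forall p q, `|l q - l p| <= K * dist1 p q) ->
  (forall p q, `|c q - c p| <= K * dist1 p q) ->
  (forall p q, 1 <= K * (1 - k p * l q)) -> 1 <= K * `|c p0| ->
  (forall eps, 0 < eps -> exists2 delta : R, 0 < delta &
     forall p q, dist1 p0 p < rho -> dist1 p0 q < rho -> dist1 p q <= delta ->
     [/\ expands_at eps v w1 w2 p q, expands_at eps w1 H11 H12 p q
       & expands_at eps w2 H12 H22 p q]) ->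
  (forall p, dist1 p0 p < rho ->
     `|l p * H11 p + (1 + k p * l p) * H12 p + k p * H22 p| <= K * (`|v p| + `|w1 p| + `|w2 p|) /\
     `|(l p ^+ 2 * H11 p + 2 * l p * H12 p + H22 p)
       + c p * (H11 p + 2 * k p * H12 p + k p ^+ 2 * H22 p)| <= K * (`|v p| + `|w1 p| + `|w2 p|)) ->
  v p0 = 0 -> w1 p0 = 0 -> w2 p0 = 0 -> H11 p0 = 0 -> H12 p0 = 0 -> H22 p0 = 0 ->
  exists (q0 : R * R) (r : R), 0 < r /\ forall p, dist1 q0 p < r -> dist1 p0 p < rho /\ v p = 0.
Proof.
move=> K1 rho0 kK lK cK k_lip l_lip c_lip transv c0K HT Hhyp v0 w10 w20 H110 H120 H220.
have [C C1 Hscale] := net_scale K1.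
pose kap := 1 + K.
have K0 : 0 < K by lra_from K1.
have kap2 : 2 <= kap by rewrite /kap; lra_from K1.
have kap0 : 0 <= kap by lra_from kap2.
have kapgt : 0 < kap by lra_from kap2.
have sc0 : 0 <= side_const K by rewrite mulr_ge0 // exprn_ge0 // -/kap.
pose Dn := 4 * C + 2 * C / rho + 8 * side_const K + 128 * kap ^+ 4 + 16 * kap / rho.
have T1 : 0 <= 2 * C / rho by rewrite divr_ge0 ?(ltW rho0) // mulr_ge0 //; lra_from C1.
have T2 : 0 <= 16 * kap / rho by rewrite divr_ge0 ?(ltW rho0) // mulr_ge0.
have T3 : 0 <= 128 * kap ^+ 4 by rewrite mulr_ge0 // exprn_ge0.
have Dn0 : 0 < Dn by rewrite /Dn; lra_from C1 T1 T2 T3 sc0.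
pose r0 := Dn^-1.
have r00 : 0 < r0 by rewrite invr_gt0.
have tm T : T <= Dn -> T * r0 <= 1 by move=> H; rewrite ler_pdivrMr // mul1r.
have c4 : 4 * C * r0 <= 1 by apply: tm; rewrite /Dn; lra_from C1 T1 T2 T3 sc0.
have crho : 2 * C * r0 <= rho.
  have : 2 * C / rho * r0 <= 1 by apply: tm; rewrite /Dn; lra_from C1 T1 T2 T3 sc0.
  by rewrite mulrAC ler_pdivrMr // mul1r.
have scr : 8 * side_const K * r0 <= 1 by apply: tm; rewrite /Dn; lra_from C1 T1 T2 T3 sc0.
have k4r : 128 * kap ^+ 4 * r0 <= 1 by apply: tm; rewrite /Dn; lra_from C1 T1 T2 T3 sc0.
have krho : 16 * kap * r0 <= rho.
  have : 16 * kap / rho * r0 <= 1 by apply: tm; rewrite /Dn; lra_from C1 T1 T2 T3 sc0.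
  by rewrite mulrAC ler_pdivrMr // mul1r.
pose hm m : R := r0 / (2 ^ m)%:R.
have p2 m : 0 < (2 ^ m)%:R :> R by rewrite ltr0n expn_gt0.
have h0 m : 0 < hm m by rewrite divr_gt0.
have Nh m : (2 ^ m)%:R * hm m = r0 by rewrite /hm mulrC divfK // gt_eqF.
pose P m i j := net k l p0 (hm m) i j.
have nd m i j : (i <= 2 ^ m)%N -> (j <= 2 ^ m)%N -> dist1 p0 (P m i j) <= 2 * kap * ((i + j)%:R * hm m).
  by apply: (@net_dist R k l p0 (hm m) K K1 kK lK k_lip l_lip transv (h0 m)); rewrite Nh.
have C0 : 0 < C by lra_from C1.
have van eps : 0 < eps -> exists m0, forall m, (m0 <= m)%N ->
    forall i j, (i <= 2 ^ m)%N -> (j <= 2 ^ m)%N -> `|v (P m i j)| <= eps.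
  move=> eps0.
  pose e1 := eps / (2 * (C * (4 * r0 * kap ^+ 2))).
  have d1 : 0 < 2 * (C * (4 * r0 * kap ^+ 2)).
    by apply: mulr_gt0 => //; apply: mulr_gt0 => //; apply: mulr_gt0; [exact: mulr_gt0|exact: exprn_gt0].
  have e10 : 0 < e1 by rewrite divr_gt0.
  have [del1 del10 Hdel1] := HT _ e10.
  have [t Ht] := dyadic_small (2 * kap * r0) del10.
  pose e2 := eps / (2 * (C * (2 * r0 * (t%:R * C) + 1))).
  have d2' : 0 < 2 * r0 * (t%:R * C) + 1.
    by apply: ltr_wpDl => //; apply: mulr_ge0; apply: mulr_ge0 => //; exact: ltW.
  have d2 : 0 < 2 * (C * (2 * r0 * (t%:R * C) + 1)) by apply: mulr_gt0 => //; apply: mulr_gt0.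
  have e20 : 0 < e2 by rewrite divr_gt0.
  have [del2 del20 Hdel2] := HT _ e20.
  have [m1 Hm1] := dyadic_small (C * r0) del20.
  exists (maxn t m1) => m; rewrite geq_max => /andP[tm1 mm1] i j iN jN.
  pose s := (m - t)%N; have st : (s + t)%N = m by rewrite subnK.
  have z1 : C * ((2 ^ m)%:R * hm m) <= 1 by rewrite Nh; move: c4; rewrite -mulrA; have := mulr_gt0 C0 r00; set Y := C * r0; clear; lra.
  have z2 p : dist1 p0 p <= C * ((2 ^ m)%:R * hm m) -> dist1 p0 p < rho.
    rewrite Nh => /le_lt_trans; apply; move: crho (mulr_gt0 C0 r00); rewrite -mulrA; set Y := C * r0; clear; lra.
  have z3 p q : dist1 p0 p < rho -> dist1 p0 q < rho -> dist1 p q <= C * hm m ->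
    [/\ expands_at e2 v w1 w2 p q, expands_at e2 w1 H11 H12 p q & expands_at e2 w2 H12 H22 p q].
    move=> bp bq d; apply: Hdel2 => //; apply: le_trans d _.
    by rewrite /hm mulrA; exact: Hm1.
  have scale n (n0 : (0 < n)%N) (nN : (n <= 2 ^ m)%N) :=
    Hscale e2 (hm m) (2 ^ m)%N n (fun p => dist1 p0 p < rho) k l c v w1 w2 H11 H12 H22 p0
     kK lK cK k_lip l_lip c_lip transv c0K (h0 m) (ltW e20) z1 n0 nN z2 z3 Hhyp v0 w10 w20.
  pose X (n : nat) : R := `|l (P m 0 n) * w1 (P m 0 n) + w2 (P m 0 n)|.
  have HX a : (a < s + t)%N -> X (2 ^ a.+1)%N <= 2 * X (2 ^ a)%N + C * ((2 ^ a.+1)%:R * hm m) * (X (2 ^ a.+1)%N + e2).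
    rewrite st => am.
    have n0 : (0 < 2 ^ a.+1)%N by rewrite expn_gt0.
    have nN : (2 ^ a.+1 <= 2 ^ m)%N by rewrite leq_exp2l.
    have [_ H] := scale _ n0 nN.
    by apply: H; rewrite expnS mul2n.
  have sm : 4 * C * ((2 ^ (s + t))%:R * hm m) <= 1 by rewrite st Nh.
  have := @dyadic_slopes R C e2 (hm m) (fun a => X (2 ^ a)%N) s t C0 (h0 m) (ltW e20) sm (fun a => normr_ge0 _) HX.
  rewrite /= st Nh => HXm.
  have [Hv _] := scale (2 ^ m)%N ltac:(by rewrite expn_gt0) (leqnn _).
  apply: le_trans (Hv i j iN jN) _; rewrite /= -/(P m 0%N (2 ^ m)%N) -/(X (2 ^ m)%N).
  have sN : (2 ^ s <= 2 ^ m)%N by rewrite leq_exp2l // leq_subr.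
  have rs : (2 ^ s)%:R * hm m = r0 / (2 ^ t)%:R.
    rewrite /hm -st expnD natrM; field; apply/andP; split; by rewrite gt_eqF.
  have ds : dist1 p0 (P m 0%N (2 ^ s)%N) <= 2 * kap * ((2 ^ s)%:R * hm m).
    exact: (nd m 0%N (2 ^ s)%N (leq0n _) sN).
  have rs0 : 0 < (2 ^ s)%:R * hm m by rewrite mulr_gt0.
  have Xs : X (2 ^ s)%N / ((2 ^ s)%:R * hm m) <= 2 * kap ^+ 2 * e1.
    rewrite ler_pdivrMr //.
    have inb : dist1 p0 (P m 0%N (2 ^ s)%N) < rho.
      apply: le_lt_trans ds _.
      have : (2 ^ s)%:R * hm m <= r0 by rewrite -(Nh m); apply: ler_wpM2r; [exact: ltW|rewrite ler_nat].
      have k20 : 0 <= 2 * kap by lra_from kap0.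
      move=> H; have := ler_wpM2l k20 H; move: krho (mulr_gt0 kapgt r00).
      rewrite -!(mulrA _ kap); set Y := kap * r0; set Y1 := kap * _; clear; lra.
    have ds1 : dist1 p0 (P m 0%N (2 ^ s)%N) <= del1.
      by apply: le_trans ds _; rewrite rs mulrA; exact: Ht.
    have p0b : dist1 p0 p0 < rho by rewrite /dist1 !subrr normr0 addr0.
    have [_ x1 x2] := Hdel1 _ _ p0b inb ds1.
    rewrite /expands_at w10 H110 H120 !mulr0 addr0 !subr0 in x1.
    rewrite /expands_at w20 H120 H220 !mulr0 addr0 !subr0 in x2.
    apply: le_trans (ler_normD _ _) _; rewrite normrM.
    have e1d : 0 <= e1 * dist1 p0 (P m 0%N (2 ^ s)%N) by rewrite mulr_ge0 ?(ltW e10) // addr_ge0.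
    have y1 := ler_pM (normr_ge0 _) (normr_ge0 _) (lK (P m 0%N (2 ^ s)%N)) x1.
    have y2 : kap * (e1 * dist1 p0 (P m 0%N (2 ^ s)%N)) <= kap * (e1 * (2 * kap * ((2 ^ s)%:R * hm m))).
      by apply: ler_wpM2l => //; apply: ler_wpM2l => //; exact: ltW.
    move: y1 y2 x2; rewrite /kap.
    rewrite (_ : 2 * (1 + K) ^+ 2 * e1 * ((2 ^ s)%:R * hm m) = (1 + K) * (e1 * (2 * (1 + K) * ((2 ^ s)%:R * hm m)))); last by ring.
    rewrite [(1 + K) * (e1 * dist1 _ _)]mulrDl mul1r; clear.
    set Y := e1 * _; set Y1 := (1 + K) * _; set Y2 := K * Y; set Y3 := `|_| * `|_|; set Y4 := `|w2 _|; lra.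
  have XN : X (2 ^ m)%N <= 2 * r0 * (2 * kap ^+ 2 * e1 + t%:R * (C * e2)).
    apply: le_trans HXm _; apply: ler_wpM2l; first by rewrite mulr_ge0 // ltW.
    by rewrite lerD2r.
  have : C * (X (2 ^ m)%N + e2) <= C * (2 * r0 * (2 * kap ^+ 2 * e1 + t%:R * (C * e2)) + e2).
    by apply: ler_wpM2l; [exact: ltW|rewrite lerD2r].
  move=> /le_trans; apply.
  have E1 : C * (4 * r0 * kap ^+ 2) * e1 = eps / 2.
    by rewrite /e1; field; rewrite !gt_eqF // exprn_gt0.
  have E2 : C * (2 * r0 * (t%:R * C) + 1) * e2 = eps / 2.
    by rewrite /e2; field; rewrite !gt_eqF.
  rewrite [leLHS](_ : _ = C * (4 * r0 * kap ^+ 2) * e1 + C * (2 * r0 * (t%:R * C) + 1) * e2); last by ring.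
  by rewrite E1 E2; clear; lra.
pose k0 := k p0; pose l0 := l p0; pose D0 := 1 - k0 * l0.
have tr : 1 <= K * D0 by exact: transv.
have D00 : 0 < D0 by rewrite -(pmulr_rgt0 _ K0); lra_from tr.
have Kkap : K <= kap by rewrite /kap; clear; lra.
have divD (x : R) : `|x / D0| <= K * `|x|.
  rewrite normrM normfV (gtr0_norm D00) ler_pdivrMr // -mulrA mulrCA ler_peMr //.
pose L1 (q : R * R) : R := ((q.1 - p0.1) - l0 * (q.2 - p0.2)) / D0.
pose L2 (q : R * R) : R := ((q.2 - p0.2) - k0 * (q.1 - p0.1)) / D0.
have dnet m i j : (i <= 2 ^ m)%N -> (j <= 2 ^ m)%N -> dist1 p0 (P m i j) <= 4 * kap * r0.
  move=> iN jN; apply: le_trans (nd m i j iN jN) _.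
  have : (i + j)%:R * hm m <= 2 * r0.
    rewrite -(Nh m) [leRHS]mulrA; apply: ler_wpM2r; first exact: ltW.
    by rewrite -natrM ler_nat mul2n -addnn leq_add.
  have k20 : 0 <= 2 * kap by lra_from kap0.
  by move=> H; have := ler_wpM2l k20 H; rewrite (_ : 2 * kap * (2 * r0) = 4 * kap * r0) //; ring.
have kd m i j : (i <= 2 ^ m)%N -> (j <= 2 ^ m)%N ->
    `|k (P m i j) - k0| <= 4 * kap ^+ 2 * r0 /\ `|l (P m i j) - l0| <= 4 * kap ^+ 2 * r0.
  move=> iN jN; have d := dnet m i j iN jN.
  have e : K * (4 * kap * r0) <= 4 * kap ^+ 2 * r0.
    rewrite (_ : 4 * kap ^+ 2 * r0 = kap * (4 * kap * r0)); last by ring.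
    by apply: ler_wpM2r => //; apply: mulr_ge0; [apply: mulr_ge0|exact: ltW].
  split; apply: le_trans e; [apply: le_trans (k_lip _ _) _|apply: le_trans (l_lip _ _) _];
    by apply: ler_wpM2l => //; exact: ltW.
have small32 (x y : R) : `|x| <= K -> `|y| <= 4 * kap ^+ 2 * r0 -> `|x * y / D0| <= 1 / 32.
  move=> hx hy; apply: le_trans (divD _) _; rewrite normrM.
  have y0 : 0 <= 4 * kap ^+ 2 * r0 by exact: le_trans hy.
  have a1 : `|x| * `|y| <= kap * (4 * kap ^+ 2 * r0).
    by apply: ler_pM => //; exact: le_trans hx _.
  have a2 : K * (`|x| * `|y|) <= kap * (kap * (4 * kap ^+ 2 * r0)).
    apply: ler_pM => //; [exact: ltW|exact: mulr_ge0].
  apply: le_trans a2 _; rewrite (_ : kap * (kap * (4 * kap ^+ 2 * r0)) = 128 * kap ^+ 4 * r0 / 32); last by field.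
  by move: k4r; set Y := _ * r0; clear; lra.
have sab m i j : (i <= 2 ^ m)%N -> (j <= 2 ^ m)%N ->
   hm m / 2 <= sideA k l p0 (hm m) i j <= 3 / 2 * hm m /\
   hm m / 2 <= sideB k l p0 (hm m) i j <= 3 / 2 * hm m.
  move=> iN jN.
  have small : 8 * side_const K * ((2 ^ m)%:R * hm m) <= 1 by rewrite Nh.
  have [a b] := @side_bounds R k l p0 (hm m) K K1 kK lK k_lip l_lip transv (h0 m) _ i j small iN jN.
  have q (x : R) n : (n <= 2 ^ m)%N -> `|x - hm m| <= 4 * side_const K * (n%:R * hm m ^+ 2) ->
     hm m / 2 <= x <= 3 / 2 * hm m.
    move=> nN H; have : 4 * side_const K * (n%:R * hm m ^+ 2) <= hm m / 2.
      have nr : n%:R * hm m <= r0 by rewrite -(Nh m); apply: ler_wpM2r; [exact: ltW|rewrite ler_nat].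
      have y1 := ler_wpM2l sc0 nr.
      have y2 : 4 * side_const K * (n%:R * hm m) <= 1 / 2.
        by move: y1 scr; rewrite -!(mulrA _ (side_const K)); set Y1 := side_const K * _; set Y2 := side_const K * _; clear; lra.
      have := ler_wpM2r (ltW (h0 m)) y2.
      rewrite (_ : 4 * side_const K * (n%:R * hm m) * hm m = 4 * side_const K * (n%:R * hm m ^+ 2)); last by ring.
      by rewrite [1 / 2 * _]mulrC mul1r.
    move: H; rewrite ler_norml => /andP[a1 a2] a3; apply/andP; split; move: a1 a2 a3; set Y := 4 * _ * _; clear; lra.
  by split; [exact: q jN a|exact: q iN b].
have stepb (a x h : R) : 0 < h -> h / 2 <= a <= 3 / 2 * h -> `|x| <= 1 / 32 -> 
   h / 4 <= a + a * x <= 2 * h /\ `|a * x| <= h / 16.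
  move=> hh /andP[a1 a2] hx.
  have a0 : 0 <= a by lra_from a1 hh.
  have ax : `|a * x| <= h / 16.
    rewrite normrM (ger0_norm a0); have := ler_wpM2l a0 hx; set Y := a * `|x|; lra_from a2 hh.
  split=> //; move: ax; rewrite ler_norml => /andP[b1 b2].
  apply/andP; split; move: b1 b2 a1 a2 hh; set Y := a * x; clear; lra.
pose F1 m i j := L1 (P m i j); pose F2 m i j := L2 (P m i j).
have HA m i j : (i < 2 ^ m)%N -> (j <= 2 ^ m)%N ->
   hm m / 4 <= F1 m i.+1 j - F1 m i j <= 2 * hm m /\ `|F2 m i.+1 j - F2 m i j| <= hm m / 16.
  move=> iN jN; have [a _] := sab m i j (ltnW iN) jN; have [dk _] := kd m i j (ltnW iN) jN.
  set s := sideA k l p0 (hm m) i j in a.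
  have e1 : F1 m i.+1 j - F1 m i j = s + s * (- l0 * (k (P m i j) - k0) / D0).
    rewrite /F1 /L1 /P net_eta /step_eta /= -/s; set kk := k _; rewrite /D0; field.
    by rewrite -/D0 gt_eqF.
  have e2 : F2 m i.+1 j - F2 m i j = s * (1 * (k (P m i j) - k0) / D0).
    rewrite /F2 /L2 /P net_eta /step_eta /= -/s; set kk := k _; rewrite /D0; field.
    by rewrite -/D0 gt_eqF.
  have x1 := small32 (- l0) _ ltac:(by rewrite normrN; exact: lK) dk.
  have x2 := small32 1 _ ltac:(by rewrite normr1) dk.
  have [y1 _] := stepb _ _ _ (h0 m) a x1; have [_ y2] := stepb _ _ _ (h0 m) a x2.
  by rewrite e1 e2.
have HB m i j : (i <= 2 ^ m)%N -> (j < 2 ^ m)%N ->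
   hm m / 4 <= F2 m i j.+1 - F2 m i j <= 2 * hm m /\ `|F1 m i j.+1 - F1 m i j| <= hm m / 16.
  move=> iN jN; have [_ a] := sab m i j iN (ltnW jN); have [_ dk] := kd m i j iN (ltnW jN).
  set s := sideB k l p0 (hm m) i j in a.
  have nx := @net_xi R k l p0 (hm m) K K1 transv i j.
  have e1 : F2 m i j.+1 - F2 m i j = s + s * (- k0 * (l (P m i j) - l0) / D0).
    rewrite /F2 /L2 /P nx /step_xi /= -/s; set kk := l _; rewrite /D0; field.
    by rewrite -/D0 gt_eqF.
  have e2 : F1 m i j.+1 - F1 m i j = s * (1 * (l (P m i j) - l0) / D0).
    rewrite /F1 /L1 /P nx /step_xi /= -/s; set kk := l _; rewrite /D0; field.
    by rewrite -/D0 gt_eqF.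
  have x1 := small32 (- k0) _ ltac:(by rewrite normrN; exact: kK) dk.
  have x2 := small32 1 _ ltac:(by rewrite normr1) dk.
  have [y1 _] := stepb _ _ _ (h0 m) a x1; have [_ y2] := stepb _ _ _ (h0 m) a x2.
  by rewrite e1 e2.
have h16 m : hm m / 16 <= hm m / 8 by have := h0 m; clear; lra.
have grow (f : nat -> R) m : (forall i, (i < 2 ^ m)%N -> hm m / 4 <= f i.+1 - f i) -> f 0%N + r0 / 4 <= f (2 ^ m)%N.
  move=> H; have : forall n, (n <= 2 ^ m)%N -> f 0%N + n%:R * hm m / 4 <= f n.
    elim=> [|n IH] nN; first by rewrite !mul0r addr0.
    have := IH (ltnW nN); have := H n nN; rewrite -[n.+1%:R]natr1 !mulrDl mul1r.
    by set Y := n%:R * _ / 4; clear; lra.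
  by move=> /(_ _ (leqnn _)); rewrite Nh.
have F00 m : F1 m 0%N 0%N = 0 /\ F2 m 0%N 0%N = 0.
  by rewrite /F1 /F2 /L1 /L2 /P /net /= !subrr !mulr0 !subrr !mul0r.
have small0 (f : nat -> R) m j : f 0%N = 0 -> (j <= 2 ^ m)%N -> (forall j, (j < 2 ^ m)%N -> `|f j.+1 - f j| <= hm m / 16) ->
    `|f j| <= r0 / 16.
  move=> f0 jN H; have := @telescope_bound _ f (hm m / 16) j (fun i ij => H i (leq_trans ij jN)).
  rewrite f0 subr0 => /le_trans; apply; rewrite mulrA ler_pM2r ?invr_gt0 // -(Nh m).
  by apply: ler_wpM2r; [exact: ltW|rewrite ler_nat].
pose q0 : R * R := (p0.1 + r0 / 8 * (1 + l0), p0.2 + r0 / 8 * (1 + k0)).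
have kap2p : 0 < kap ^+ 2 by rewrite exprn_gt0.
exists q0, (r0 / (32 * kap ^+ 2)); split; first by rewrite divr_gt0 // mulr_gt0.
move=> p dp.
have dp32 : kap ^+ 2 * dist1 q0 p < r0 / 32.
  move: dp; rewrite ltr_pdivlMr ?mulr_gt0 //; set Y := dist1 _ _.
  rewrite (_ : Y * (32 * kap ^+ 2) = kap ^+ 2 * Y * 32); last by ring.
  by set Z := kap ^+ 2 * Y; clear; lra.
have Lq (x y u : R) : `|u| <= K -> `|(x - u * y) / D0| <= kap ^+ 2 * (`|x| + `|y|).
  move=> hu; apply: le_trans (divD _) _; rewrite expr2 -mulrA; apply: ler_pM => //; first exact: ltW.
  apply: le_trans (ler_normB _ _) _; rewrite normrM.
  have := ler_wpM2r (normr_ge0 y) hu; have := ler_wpM2r (normr_ge0 x) K1.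
  have := normr_ge0 y; have := normr_ge0 x; rewrite /kap mulrDl mul1r mulrDr.
  rewrite mul1r; set Y1 := K * `|x|; set Y2 := K * `|y|; set Y3 := `|u| * _; clear; lra.
have L1p : `|L1 p - r0 / 8| < r0 / 32.
  apply: le_lt_trans dp32.
  have := Lq (p.1 - q0.1) (p.2 - q0.2) l0 (lK p0); congr (`|_| <= _).
  by rewrite /L1 /q0 /= /D0; field; rewrite -/D0 gt_eqF.
have L2p : `|L2 p - r0 / 8| < r0 / 32.
  apply: le_lt_trans dp32.
  have := Lq (p.2 - q0.2) (p.1 - q0.1) k0 (kK p0); rewrite [`|p.2 - _| + _]addrC; congr (`|_| <= _).
  by rewrite /L2 /q0 /= /D0; field; rewrite -/D0 gt_eqF.
have pb : dist1 p0 p < rho.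
  have tri : dist1 p0 p <= dist1 p0 q0 + dist1 q0 p.
    rewrite /dist1; have := ler_distD q0.1 p.1 p0.1; have := ler_distD q0.2 p.2 p0.2.
    by clear; lra.
  have dq : dist1 p0 q0 <= r0 / 8 * (2 * kap).
    rewrite /dist1 /q0 /= [p0.1 + _ - _]addrAC subrr add0r [p0.2 + _ - _]addrAC subrr add0r !(normrM (r0 / 8)).
    rewrite (gtr0_norm (x := r0 / 8)) ?divr_gt0 // -mulrDr; apply: ler_wpM2l; first by rewrite divr_ge0 // ltW.
    have := ler_normD 1 l0; have := ler_normD 1 k0; rewrite normr1.
    by have := lK p0; have := kK p0; rewrite /kap; clear; lra.
  have k21 : 1 <= kap ^+ 2 by rewrite expr2 -[1]mulr1 ler_pM //; lra_from kap2.
  have dqp : dist1 q0 p <= kap ^+ 2 * dist1 q0 p by rewrite ler_peMl // addr_ge0.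
  have kr : r0 <= kap * r0 by rewrite ler_peMl ?(ltW r00) //; lra_from kap2.
  apply: le_lt_trans tri _; apply: lt_le_trans krho.
  move: dq dqp dp32 kr r00; rewrite (_ : r0 / 8 * (2 * kap) = kap * r0 / 4); last by field.
  by rewrite -(mulrA 16); set Y := kap * r0; set Y1 := dist1 p0 q0; set Y2 := dist1 q0 p; set Y3 := _ * Y2; clear; lra.
split=> //; apply/eqP; rewrite -normr_eq0 eq_le normr_ge0 andbT leNgt; apply/negP => vp.
have [m0 Hm0] := van (`|v p| / 4) ltac:(by rewrite divr_gt0).
have [del del0 Hdel] := HT 1 ltr01.
pose B := 1 + `|w1 p| + `|w2 p|.
have B0 : 0 < B by rewrite /B -addrA ltr_wpDr // addr_ge0.
have [m1 Hm1] := dyadic_small (4 * kap * r0) del0.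
have vB0 : 0 < `|v p| / 4 / B by rewrite !divr_gt0.
have [m2 Hm2] := dyadic_small (4 * kap * r0) vB0.
pose m := maxn m0 (maxn m1 m2).
have mm0 : (m0 <= m)%N by rewrite leq_maxl.
have mm1 : (m1 <= m)%N by rewrite /m leq_max leq_maxl orbT.
have mm2 : (m2 <= m)%N by rewrite /m !leq_max leqnn !orbT.
have [i [j [iN jN f1 f2]]] : exists i j, [/\ (i <= 2 ^ m)%N, (j <= 2 ^ m)%N,
    `|F1 m i j - L1 p| <= 2 * hm m & `|F2 m i j - L2 p| <= 2 * hm m].
  apply: (grid_nearest (h0 m)).
  - by move=> i j iN jN; have [a b] := HA m i j iN jN; split=> //; exact: le_trans b (h16 m).
  - by move=> i j iN jN; have [a b] := HB m i j iN jN; split=> //; exact: le_trans b (h16 m).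
  - move=> j jN; have := grow (fun i => F1 m i j) m (fun i iN => (andP (HA m i j iN jN).1).1).
    have := small0 (fun j => F1 m 0%N j) m j (F00 m).1 jN (fun j jN => (HB m 0%N j (leq0n _) jN).2).
    move: L1p; rewrite ltr_norml ler_norml => /andP[a1 a2] /andP[b1 b2] b3.
    apply/andP; split; [lra_from a1 b2 r00|lra_from a2 b1 b3 r00].
  - move=> i iN; have := grow (fun j => F2 m i j) m (fun j jN => (andP (HB m i j iN jN).1).1).
    have := small0 (fun i => F2 m i 0%N) m i (F00 m).2 iN (fun i iN => (HA m i 0%N iN (leq0n _)).2).
    move: L2p; rewrite ltr_norml ler_norml => /andP[a1 a2] /andP[b1 b2] b3.
    apply/andP; split; [lra_from a1 b2 r00|lra_from a2 b1 b3 r00].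
have dPp : dist1 p (P m i j) <= 4 * kap * hm m.
  have u1 : (P m i j).1 - p.1 = (F1 m i j - L1 p) + l0 * (F2 m i j - L2 p).
    by rewrite /F1 /F2 /L1 /L2 /D0; field; rewrite -/D0 gt_eqF.
  have u2 : (P m i j).2 - p.2 = (F2 m i j - L2 p) + k0 * (F1 m i j - L1 p).
    by rewrite /F1 /F2 /L1 /L2 /D0; field; rewrite -/D0 gt_eqF.
  rewrite /dist1 u1 u2.
  have NM (s t s' t' : R) : `|s| <= s' -> `|t| <= t' -> `|s * t| <= s' * t'.
    by move=> *; rewrite normrM ler_pM.
  have := NM _ _ _ _ (lK p0) f2; have := NM _ _ _ _ (kK p0) f1; rewrite -/k0 -/l0.
  have := ler_normD (F1 m i j - L1 p) (l0 * (F2 m i j - L2 p)).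
  have := ler_normD (F2 m i j - L2 p) (k0 * (F1 m i j - L1 p)).
  move: f1 f2; rewrite /kap; set Y1 := `|_|; set Y2 := `|_|; set Y3 := `|_|; set Y4 := `|_ * _|.
  set Y5 := `|_|; set Y6 := `|l0 * _|; clear; lra.
have hE : 4 * kap * hm m = 4 * kap * r0 / (2 ^ m)%:R by rewrite /hm mulrA.
have Pb : dist1 p0 (P m i j) < rho.
  apply: le_lt_trans (dnet m i j iN jN) _; apply: lt_le_trans krho.
  by move: (mulr_gt0 kapgt r00); rewrite -!(mulrA _ kap); set Y := kap * r0; clear; lra.
have [x1 _ _] := Hdel p (P m i j) pb Pb ltac:(by apply: le_trans dPp _; rewrite hE; exact: Hm1).
have d2 : dist1 p (P m i j) * B <= `|v p| / 4.
  rewrite -ler_pdivlMr //; apply: le_trans dPp _; rewrite hE; exact: Hm2.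
have vP := Hm0 m mm0 i j iN jN.
rewrite /expands_at mul1r in x1.
have e1 : `|((P m i j).1 - p.1) * w1 p + ((P m i j).2 - p.2) * w2 p| <=
    dist1 p (P m i j) * (`|w1 p| + `|w2 p|).
  apply: le_trans (ler_normD _ _) _; rewrite !normrM mulrDr lerD // ler_wpM2r //.
    by rewrite lerDl.
  by rewrite lerDr.
have : `|v p| <= `|v (P m i j)| + dist1 p (P m i j) * B.
  set E := (_ * w1 p + _) in x1 e1.
  rewrite (_ : v p = v (P m i j) - (v (P m i j) - v p - E) - E); last by ring.
  apply: le_trans (ler_normB _ _) _; apply: le_trans (lerD (ler_normB _ _) e1) _.
  move: x1; rewrite (_ : dist1 p (P m i j) * B = dist1 p (P m i j) + dist1 p (P m i j) * (`|w1 p| + `|w2 p|)); last by rewrite /B; ring.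
  set Y := `|_ - _ - _|; set Y1 := _ * (_ + _); clear; lra.
move: d2 vP vp; set Y := _ * B; clear; lra.
Qed.

Require Import Defs.
Local Open Scope classical_set_scope.
Local Open Scope ring_scope.

(** * Local Taylor expansions and Lipschitz functions *)


Section PlaneTopology.
Variable R : realType.
Implicit Types (p q : R * R) (f g : R * R -> R) (Omega : set (R * R)).

Lemma dist1_norm p q : dist1 p q <= 2 * `|q - p|.
Proof. by rewrite prod_normE /dist1 /= mulrDl mul1r lerD // le_max lexx ?orbT. Qed.

Lemma norm_dist1 p q : `|q - p| <= dist1 p q.
Proof. by rewrite prod_normE /dist1 /= ge_max lerDl normr_ge0 lerDr normr_ge0. Qed.

Lemma dist1_ge0 p q : 0 <= dist1 p q.
Proof. by rewrite /dist1 addr_ge0. Qed.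

Lemma dist1C p q : dist1 p q = dist1 q p.
Proof. by rewrite /dist1 (distrC p.1) (distrC p.2). Qed.

Lemma dist1xx p : dist1 p p = 0.
Proof. by rewrite /dist1 !subrr normr0 addr0. Qed.

Lemma dist1_tri p q s : dist1 p s <= dist1 p q + dist1 q s.
Proof.
rewrite /dist1; have := ler_distD q.1 s.1 p.1; have := ler_distD q.2 s.2 p.2.
by clear; lra.
Qed.

Lemma nbhs_dist1 p (A : set (R * R)) :
  nbhs p A <-> exists2 r, 0 < r & forall q, dist1 p q < r -> A q.
Proof.
rewrite -nbhs_ballE; split=> [[r /= r0 rA]|[r r0 rA]].
  exists r => // q pq; apply: rA; rewrite -ball_normE /=.
  by apply: le_lt_trans pq; rewrite distrC; exact: norm_dist1.
exists (r / 2) => /=; first by rewrite divr_gt0.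
move=> q; rewrite -ball_normE /= => pq; apply: rA.
apply: le_lt_trans (dist1_norm _ _) _.
by rewrite distrC -ltr_pdivlMl // mulrC.
Qed.

Lemma open_dist1 Omega p : open Omega -> Omega p ->
  exists2 r, 0 < r & forall q, dist1 p q < r -> Omega q.
Proof. by move=> oO Op; apply/nbhs_dist1; exact: open_nbhs_nbhs. Qed.

Lemma continuous_dist1 f p : {for p, continuous f} -> forall eps : R, 0 < eps ->
  exists2 d : R, 0 < d & forall q, dist1 p q < d -> `|f q - f p| < eps.
Proof.
move=> fp eps eps0.
have /nbhs_dist1[d d0 dP] : \forall q \near p, `|f q - f p| < eps.
  by move/cvgr_distC_lt : fp; apply.
by exists d.
Qed.

Definition unif_cont_near f p0 (r : R) := forall eps : R, 0 < eps -> exists2 d : R, 0 < d &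
  forall p q, dist1 p0 p <= r -> dist1 p q <= d -> `|f q - f p| <= eps.

Lemma compact_unif_cont f p0 (r : R) : 0 < r ->
  (forall p, dist1 p0 p <= 2 * r -> {for p, continuous f}) -> unif_cont_near f p0 r.
Proof.
move=> r0 fc eps eps0.
pose K : set (R * R) := `[p0.1 - r, p0.1 + r] `*` `[p0.2 - r, p0.2 + r].
have cK : compact K by apply: compact_setX; exact: segment_compact.
pose P (d : R) (p : R * R) := forall q, dist1 p q <= d -> `|f q - f p| <= eps.
have : \forall d \near (0 : R)^'+, K `<=` P d.
  move/compact_near_coveringP : cK; apply=> p Kp.
  have pr : dist1 p0 p <= 2 * r.
    case: Kp => /=; rewrite !in_itv /= => /andP[a1 a2] /andP[b1 b2].
    have H1 : `|p.1 - p0.1| <= r by rewrite ler_norml; apply/andP; split; lra.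
    have H2 : `|p.2 - p0.2| <= r by rewrite ler_norml; apply/andP; split; lra.
    by rewrite /dist1; lra.
  have [d d0 Hd] := continuous_dist1 (fc p pr) (divr_gt0 eps0 (ltr0Sn R 1)).
  have N1 : \forall p' \near p, dist1 p p' < d / 2.
    by apply/nbhs_dist1; exists (d / 2); rewrite ?divr_gt0.
  have N2 : \forall e \near (0:R)^'+, e < d / 2.
    by apply: nbhs_right_lt; rewrite divr_gt0.
  near=> p' e; move=> q /= qe.
  have h1 : dist1 p p' < d / 2 by near: p'.
  have h2 : e < d / 2 by near: e.
  have x1 : `|f p' - f p| < eps / 2 by apply: Hd; lra_from h1 d0.
  have x2 : `|f q - f p| < eps / 2.
    by apply: Hd; apply: le_lt_trans (dist1_tri _ p' _) _; lra_from h1 h2 qe.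
  rewrite (_ : f q - f p' = (f q - f p) - (f p' - f p)); last by ring.
  apply: le_trans (ler_normB _ _) _.
  by rewrite [leRHS]splitr lerD // ltW.
move=> H; near (0:R)^'+ => d.
have d0 : 0 < d by [].
have KP : K `<=` P d by near: d.
exists d => // p q pr; apply: KP.
have H1 : `|p.1 - p0.1| <= r by apply: le_trans pr; rewrite /dist1 lerDl.
have H2 : `|p.2 - p0.2| <= r by apply: le_trans pr; rewrite /dist1 lerDr.
move: H1 H2; rewrite !ler_norml => /andP[a1 a2] /andP[b1 b2].
by split; rewrite /= in_itv /=; apply/andP; split; lra.
Unshelve. all: by end_near.
Qed.

Lemma unif_cont_bounded f p0 (r : R) : 0 < r ->
  unif_cont_near f p0 r -> exists2 M, 0 < M & forall p, dist1 p0 p <= r -> `|f p| <= M.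
Proof.
move=> r0 /(_ 1 ltr01)[d d0 Hd].
pose N := `|Num.ceil (r / d)|%N.+1.
have Nd : r <= N%:R * d.
  rewrite -ler_pdivrMr //; apply: le_trans (_ : N.-1%:R <= _); last by rewrite ler_nat.
  rewrite /N /= natr_absz ger0_norm ?ceil_ge //.
  by rewrite -(ler_int R); apply: le_trans (ceil_ge _); rewrite divr_ge0 ?ltW.
exists (`|f p0| + N%:R); first by rewrite ltr_wpDl // ltr0n.
move=> p pr.
pose s (i : nat) : R * R := (p0.1 + i%:R / N%:R * (p.1 - p0.1), p0.2 + i%:R / N%:R * (p.2 - p0.2)).
have N0 : 0 < N%:R :> R by rewrite ltr0n.
have s0 i : (i <= N)%N -> dist1 p0 (s i) <= r.
  move=> iN; apply: le_trans pr; rewrite /dist1 /s /= ![_ + _ * _ - _]addrAC !subrr !add0r !normrM.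
  have t1 : `|i%:R| * `|N%:R^-1| <= 1 :> R.
    by rewrite normfV !normr_nat ler_pdivrMr // mul1r ler_nat.
  by apply: lerD; rewrite ler_piMl.
have st i : (i < N)%N -> dist1 (s i) (s i.+1) <= d.
  move=> iN; have -> : dist1 (s i) (s i.+1) = dist1 p0 p / N%:R.
    have E (x y : R) : (x + i.+1%:R / N%:R * y - (x + i%:R / N%:R * y)) = y / N%:R.
      by rewrite -natr1; ring.
    by rewrite /dist1 /s /= !E !normrM normfV normr_nat mulrDl.
  by rewrite ler_pdivrMr // mulrC; exact: le_trans pr Nd.
have : forall i, (i <= N)%N -> `|f (s i)| <= `|f p0| + i%:R.
  elim=> [|i IH] iN; first by rewrite /s !mul0r !addr0 -surjective_pairing.
  have := IH (ltnW iN); have := Hd _ _ (s0 _ (ltnW iN)) (st _ iN).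
  have := ler_normD (f (s i)) (f (s i.+1) - f (s i)); rewrite addrC subrK -natr1; clear; lra.
move=> /(_ N (leqnn _)); congr (`|f _| <= _).
by rewrite /s divff ?gt_eqF // !mul1r ![_ + (_ - _)]addrC !subrK -surjective_pairing.
Qed.

End PlaneTopology.

Section MeanValue.
Variable R : realType.
Implicit Types (p q : R * R) (f g : R * R -> R) (x y : R).

Lemma mean_value (g dg : R -> R) x y :
  (forall t, `|t - x| <= `|y - x| -> is_derive t 1 g (dg t)) ->
  exists2 t, `|t - x| <= `|y - x| & g y - g x = dg t * (y - x).
Proof.
move=> H; have [xy|yx] := leP x y.
  have dH t : t \in `[x, y] -> is_derive t 1 g (dg t).
    rewrite in_itv /= => /andP[a b]; apply: H.
    by rewrite !ger0_norm ?subr_ge0 // lerB.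
  have c1 t : t \in `]x, y[ -> is_derive t 1 g (dg t).
  by move=> txy; apply: dH; apply: subset_itv_oo_cc.
have c2 : {within `[x, y], continuous g}.
  by apply: derivable_within_continuous => t tt; have [] := dH t tt.
have [t] := @MVT_segment R g dg x y xy c1 c2.
  rewrite in_itv /= => /andP[a b] E; exists t => //.
  by rewrite !ger0_norm ?subr_ge0 // lerB.
have dH t : t \in `[y, x] -> is_derive t 1 g (dg t).
  rewrite in_itv /= => /andP[a b]; apply: H.
  by rewrite !ler0_norm ?subr_le0 ?(ltW yx) // lerN2 lerB.
have c1 t : t \in `]y, x[ -> is_derive t 1 g (dg t).
  by move=> txy; apply: dH; apply: subset_itv_oo_cc.
have c2 : {within `[y, x], continuous g}.
  by apply: derivable_within_continuous => t tt; have [] := dH t tt.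
have [t] := @MVT_segment R g dg y x (ltW yx) c1 c2.
rewrite in_itv /= => /andP[a b] E; exists t.
  by rewrite !ler0_norm ?subr_le0 ?(ltW yx) // lerN2 lerB.
by rewrite -[LHS]opprB E -mulrN opprB.
Qed.

Lemma partial1_is_derive f x y : derivable f (x, y) (dir R i1) ->
  is_derive x 1 (fun t => f (t, y)) (partial i1 f (x, y)).
Proof.
move=> df.
have E : (fun h : R => h^-1 *: (((fun t => f (t, y)) \o shift x) (h *: 1) - f (x, y))) =
   (fun h : R => h^-1 *: ((f \o shift (x, y)) (h *: dir R i1) - f (x, y))).
  apply/funext => h; congr (_ *: (_ - _)); rewrite /dir eqxx /=; congr f.
  by apply/pair_equal_spec; split; rewrite /= /GRing.scale /= ?mulr0 ?add0r.
by split; [rewrite /derivable E|rewrite /derive E].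
Qed.

Lemma partial2_is_derive f x y : derivable f (x, y) (dir R i2) ->
  is_derive y 1 (fun t => f (x, t)) (partial i2 f (x, y)).
Proof.
move=> df.
have E : (fun h : R => h^-1 *: (((fun t => f (x, t)) \o shift y) (h *: 1) - f (x, y))) =
   (fun h : R => h^-1 *: ((f \o shift (x, y)) (h *: dir R i2) - f (x, y))).
  apply/funext => h; congr (_ *: (_ - _)); rewrite /dir /=; congr f.
  by apply/pair_equal_spec; split; rewrite /= /GRing.scale /= ?mulr0 ?add0r.
by split; [rewrite /derivable E|rewrite /derive E].
Qed.

Lemma C1_expand f p0 r : 0 < r ->
  (forall k p, dist1 p0 p <= 2 * r -> derivable f p (dir R k)) ->
  (forall k, unif_cont_near (partial k f) p0 r) ->
  forall eps, 0 < eps -> exists2 d : R, 0 < d &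
    forall p q, dist1 p0 p <= r -> dist1 p q <= d ->
    expands_at eps f (partial i1 f) (partial i2 f) p q.
Proof.
move=> r0 df cf eps eps0.
have [d1 d10 H1] := cf i1 _ eps0.
have [d2 d20 H2] := cf i2 _ eps0.
exists (Num.min r (Num.min d1 d2)); first by rewrite !lt_min r0 d10.
move=> p q p0p; rewrite !le_min => /and3P[pqr pq1 pq2].
have near s : `|s.1 - p.1| <= `|q.1 - p.1| -> `|s.2 - p.2| <= `|q.2 - p.2| ->
    dist1 p0 s <= 2 * r /\ dist1 p s <= dist1 p q.
  move=> a b; have ps : dist1 p s <= dist1 p q by rewrite lerD.
  split=> //; apply: le_trans (dist1_tri _ p _) _; lra_from ps p0p pqr.
have [x xq Ex] : exists2 x, `|x - p.1| <= `|q.1 - p.1| &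
    f q - f (p.1, q.2) = partial i1 f (x, q.2) * (q.1 - p.1).
  have [t tq|x xq E] := @mean_value (fun t => f (t, q.2)) (fun t => partial i1 f (t, q.2)) p.1 q.1.
    by apply/partial1_is_derive/df; case: (near (t, q.2) tq (lexx _)).
  by exists x => //; rewrite -E -surjective_pairing.
have [y yq Ey] : exists2 y, `|y - p.2| <= `|q.2 - p.2| &
    f (p.1, q.2) - f p = partial i2 f (p.1, y) * (q.2 - p.2).
  have [t tq|y yq E] := @mean_value (fun t => f (p.1, t)) (fun t => partial i2 f (p.1, t)) p.2 q.2.
    by apply/partial2_is_derive/df; case: (near (p.1, t) _ tq) => //=; rewrite subrr normr0.
  by exists y => //; rewrite -E -surjective_pairing.
rewrite /expands_at.
rewrite (_ : f q - f p - _ = (partial i1 f (x, q.2) - partial i1 f p) * (q.1 - p.1) +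
   (partial i2 f (p.1, y) - partial i2 f p) * (q.2 - p.2)); last first.
  have K (x0 x1 x2 y1 y2 z1 z2 t1 t2 : R) : x0 - x1 = y1 * t1 -> x1 - x2 = y2 * t2 ->
      x0 - x2 - (t1 * z1 + t2 * z2) = (y1 - z1) * t1 + (y2 - z2) * t2.
    by move=> h1 h2; rewrite -(subrK x1 x0) h1 -(addrA _ x1) h2; ring.
  exact: K Ex Ey.
apply: le_trans (ler_normD _ _) _; rewrite !normrM /dist1 mulrDr; apply: lerD.
  apply: ler_wpM2r => //; apply: H1 => //.
  by apply: le_trans pq1; case: (near (x, q.2) xq (lexx _)).
apply: ler_wpM2r => //; apply: H2 => //.
by apply: le_trans pq2; case: (near (p.1, y) _ yq) => //=; rewrite subrr normr0.
Qed.

Lemma schwarz f p r : 0 < r ->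
  (forall k q, dist1 p q <= r -> derivable f q (dir R k)) ->
  (forall k l q, dist1 p q <= r -> derivable (partial l f) q (dir R k)) ->
  {for p, continuous (partial i1 (partial i2 f))} ->
  {for p, continuous (partial i2 (partial i1 f))} ->
  partial i1 (partial i2 f) p = partial i2 (partial i1 f) p.
Proof.
move=> r0 df ddf c12 c21; apply/eqP; rewrite -subr_eq0 -normr_le0.
apply/ler_addgt0Pl => eps eps0; rewrite addr0.
have e20 : 0 < eps / 2 by rewrite divr_gt0.
have [d1 d10 H1] := continuous_dist1 c12 e20.
have [d2 d20 H2] := continuous_dist1 c21 e20.
pose h := Num.min r (Num.min d1 d2) / 4.
have m0 : 0 < Num.min r (Num.min d1 d2) by rewrite !lt_min r0 d10.
have h0 : 0 < h by rewrite divr_gt0.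
have hr : 4 * h <= r by rewrite mulrC divfK // ge_min lexx.
have hd1 : 4 * h <= d1 by rewrite mulrC divfK // !ge_min lexx orbT.
have hd2 : 4 * h <= d2 by rewrite mulrC divfK // !ge_min lexx !orbT.
have near x y : `|x - p.1| <= h -> `|y - p.2| <= h -> dist1 p (x, y) <= 2 * h.
  by move=> a b; rewrite /dist1 /= mulrDl mul1r lerD.
have nr x y : `|x - p.1| <= h -> `|y - p.2| <= h -> dist1 p (x, y) <= r.
  by move=> a b; apply: le_trans (near _ _ a b) _; lra_from hr h0.
have nh z : `|z + h - z| <= h by rewrite addrAC subrr add0r gtr0_norm.
have n0 z : `|z - z| <= h by rewrite subrr normr0 ltW.
have hs z : z + h - z = h by rewrite addrAC subrr add0r.
have hz z : `|z + h - z| = h by rewrite addrAC subrr add0r gtr0_norm.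
pose S := (f (p.1 + h, p.2 + h) - f (p.1 + h, p.2)) - (f (p.1, p.2 + h) - f (p.1, p.2)).
have [x1 [y1 [xh1 yh1 E1]]] : exists x y, [/\ `|x - p.1| <= h, `|y - p.2| <= h &
    S = partial i2 (partial i1 f) (x, y) * h * h].
  have [t|x] := @mean_value (fun t => f (t, p.2 + h) - f (t, p.2))
     (fun t => partial i1 f (t, p.2 + h) - partial i1 f (t, p.2)) p.1 (p.1 + h).
    rewrite hz => th; apply: is_deriveB; apply/partial1_is_derive/df; exact: nr.
  rewrite hz => xh E.
  have [t|y] := @mean_value (fun t => partial i1 f (x, t))
     (fun t => partial i2 (partial i1 f) (x, t)) p.2 (p.2 + h).
    by rewrite hz => th; apply/partial2_is_derive/ddf; exact: nr.
  rewrite hz => yh E'; exists x, y; split; [exact: xh|exact: yh|].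
  rewrite hs in E; rewrite hs in E'.
  exact (etrans E (congr1 (fun z => z * h) E')).
have [x2 [y2 [xh2 yh2 E2]]] : exists x y, [/\ `|x - p.1| <= h, `|y - p.2| <= h &
    S = partial i1 (partial i2 f) (x, y) * h * h].
  have [t|y] := @mean_value (fun t => f (p.1 + h, t) - f (p.1, t))
     (fun t => partial i2 f (p.1 + h, t) - partial i2 f (p.1, t)) p.2 (p.2 + h).
    rewrite hz => th; apply: is_deriveB; apply/partial2_is_derive/df; exact: nr.
  rewrite hz => yh E.
  have [t|x] := @mean_value (fun t => partial i2 f (t, y))
     (fun t => partial i1 (partial i2 f) (t, y)) p.1 (p.1 + h).
    by rewrite hz => th; apply/partial1_is_derive/ddf; exact: nr.
  rewrite hz => xh E'; exists x, y; split; [exact: xh|exact: yh|].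
  rewrite hs in E; rewrite hs in E'.
  rewrite [S](_ : _ = f (p.1 + h, p.2 + h) - f (p.1, p.2 + h) - (f (p.1 + h, p.2) - f (p.1, p.2))); last by rewrite /S; ring.
  exact (etrans E (congr1 (fun z => z * h) E')).
have E : partial i1 (partial i2 f) (x2, y2) = partial i2 (partial i1 f) (x1, y1).
  have hn : h != 0 by rewrite gt_eqF.
  by apply: (mulIf hn); apply: (mulIf hn); exact: etrans (esym E2) E1.
have b1 : `|partial i1 (partial i2 f) (x2, y2) - partial i1 (partial i2 f) p| < eps / 2.
  by apply: H1; apply: (le_lt_trans (near _ _ xh2 yh2)); lra_from hd1 h0.
have b2 : `|partial i2 (partial i1 f) (x1, y1) - partial i2 (partial i1 f) p| < eps / 2.
  by apply: H2; apply: (le_lt_trans (near _ _ xh1 yh1)); lra_from hd2 h0.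
move: E b1 b2; clear.
move: (partial i1 _ _) (partial i1 _ _) (partial i2 _ _) (partial i2 _ _) => a b c d ->.
rewrite !ltr_norml ler_norml => /andP[? ?] /andP[? ?]; apply/andP; split; lra.
Qed.

End MeanValue.

Section C2Local.
Variable R : realType.
Implicit Types (p q : R * R) (f g : R * R -> R) (x y : R).

Definition lip_near f p0 (r M : R) := forall p q, dist1 p0 p <= r -> dist1 p0 q <= r ->
  `|f q - f p| <= M * dist1 p q /\ `|f p| <= M.

Lemma expand_lip f f1 f2 p0 r M d : 0 < r -> 0 < d -> 0 <= M ->
  (forall p, dist1 p0 p <= r -> [/\ `|f p| <= M, `|f1 p| <= M & `|f2 p| <= M]) ->
  (forall p q, dist1 p0 p <= r -> dist1 p q <= d -> expands_at 1 f f1 f2 p q) ->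
  lip_near f p0 r (M + 1 + 2 * M / d).
Proof.
move=> r0 d0 M0 bM H p q pr qr; have [fp f1p f2p] := bM p pr; have [fq _ _] := bM q qr.
have Md : 0 <= 2 * M / d by rewrite divr_ge0 ?(ltW d0) // mulr_ge0.
split; last by lra_from fp Md.
have [pq|pq] := leP (dist1 p q) d.
  have := H p q pr pq; rewrite /expands_at mul1r => h.
  have h1 : `|(q.1 - p.1) * f1 p + (q.2 - p.2) * f2 p| <= M * dist1 p q.
    apply: le_trans (ler_normD _ _) _; rewrite !normrM [_ * dist1 _ _]mulrC /dist1 mulrDl.
    by rewrite lerD // ler_wpM2l.
  have := ler_normD (f q - f p - ((q.1 - p.1) * f1 p + (q.2 - p.2) * f2 p)) ((q.1 - p.1) * f1 p + (q.2 - p.2) * f2 p).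
  have h2 : 0 <= 2 * M / d * dist1 p q by apply: mulr_ge0 => //; exact: dist1_ge0.
  rewrite subrK [(M + 1 + _) * _]mulrDl [(M + 1) * _]mulrDl mul1r; lra_from h h1 h2.
have h1 : 2 * M <= 2 * M / d * dist1 p q.
  by rewrite mulrAC ler_pdivlMr // ler_wpM2l ?mulr_ge0 // ltW.
have h2 : 0 <= (M + 1) * dist1 p q by apply: mulr_ge0; [lra_from M0|exact: dist1_ge0].
have := ler_normB (f q) (f p); rewrite [(M + 1 + _) * _]mulrDl; lra_from h1 h2 fp fq.
Qed.

Definition C2_near f p0 (r M : R) := [/\
  forall p, dist1 p0 p <= r -> partial i2 (partial i1 f) p = partial i1 (partial i2 f) p,
  forall eps, 0 < eps -> exists2 d : R, 0 < d &
    forall p q, dist1 p0 p <= r -> dist1 p q <= d ->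
    [/\ expands_at eps f (partial i1 f) (partial i2 f) p q,
        expands_at eps (partial i1 f) (partial i1 (partial i1 f)) (partial i1 (partial i2 f)) p q
      & expands_at eps (partial i2 f) (partial i1 (partial i2 f)) (partial i2 (partial i2 f)) p q],
  lip_near f p0 r M /\ (forall k, lip_near (partial k f) p0 r M)
  & forall k l p, dist1 p0 p <= r -> `|partial k (partial l f) p| <= M].

Lemma lip_near_le f p0 r r' M M' : r' <= r -> M <= M' -> lip_near f p0 r M -> lip_near f p0 r' M'.
Proof.
move=> rr MM H p q pr qr; have [a b] := H p q (le_trans pr rr) (le_trans qr rr).
split; [apply: le_trans a _; apply: ler_wpM2r MM; exact: dist1_ge0|exact: le_trans b MM].
Qed.

Lemma C2_near_le f p0 r r' M M' : r' <= r -> M <= M' -> C2_near f p0 r M -> C2_near f p0 r' M'.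
Proof.
move=> rr MM [H1 H2 [H3 H3'] H4]; split.
- by move=> p pr; apply: H1; exact: le_trans rr.
- move=> eps /H2[d d0 H]; exists d => // p q pr; apply: H; exact: le_trans rr.
- by split=> [|k]; [exact: lip_near_le H3|exact: lip_near_le (H3' k)].
- by move=> k l p pr; apply: le_trans MM; apply: H4; exact: le_trans rr.
Qed.

Lemma extendable_continuous (Omega : set (R * R)) f p :
  open Omega -> Omega p -> continuously_extendable Omega f -> {for p, continuous f}.
Proof.
move=> oO Op [g cg fg].
have : {in Omega, continuous g}.
  by rewrite -continuous_open_subspace //; apply: continuous_subspaceW cg; exact: subset_closure.
move=> /(_ p); rewrite inE => /(_ Op) gp.
have E : \forall q \near p, g q = f q.
  have : \forall q \near p, Omega q by exact: open_nbhs_nbhs.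
  by apply: filterS => q /fg.
rewrite /prop_for /continuous_at (fg p Op); apply: cvg_trans gp; exact: near_eq_cvg.
Qed.

Lemma forall_I2 (P : 'I_2 -> Prop) : P i1 -> P i2 -> forall k, P k.
Proof.
move=> P1 P2 [[|[|//]] hk]; first by rewrite (_ : Ordinal hk = i1) //; exact: val_inj.
by rewrite (_ : Ordinal hk = i2) //; exact: val_inj.
Qed.

Lemma C2_closure_near (Omega : set (R * R)) f p0 : open Omega -> C2_closure Omega f -> Omega p0 ->
  exists r M, [/\ 0 < r, 0 < M, C2_near f p0 r M & forall p, dist1 p0 p <= r -> Omega p].
Proof.
move=> oO [df ddf cf c1 c2] Op.
have [r' r'0 rO] := open_dist1 oO Op.
pose r := r' / 4; have r0 : 0 < r by rewrite divr_gt0.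
have ballO p : dist1 p0 p <= 2 * r -> Omega p.
  by move=> pr; apply: rO; apply: le_lt_trans pr _; rewrite /r; lra_from r'0.
have C0 : unif_cont_near f p0 r.
  apply: compact_unif_cont => // p /ballO pO; apply: (extendable_continuous oO pO).
  by exists f.
have C1 k : unif_cont_near (partial k f) p0 r.
  by apply: compact_unif_cont => // p /ballO pO; exact: (extendable_continuous oO pO).
have C2 k l : unif_cont_near (partial k (partial l f)) p0 r.
  by apply: compact_unif_cont => // p /ballO pO; exact: (extendable_continuous oO pO).
have [M0 M00 B0] := unif_cont_bounded r0 C0.
have [M1 M10 B1] : exists2 M, 0 < M & forall k p, dist1 p0 p <= r -> `|partial k f p| <= M.
  have [a a0 Ha] := unif_cont_bounded r0 (C1 i1); have [b b0 Hb] := unif_cont_bounded r0 (C1 i2).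
  exists (a + b); first exact: addr_gt0.
  apply: forall_I2 => p pr; first by have := Ha p pr; lra_from b0.
  by have := Hb p pr; lra_from a0.
have [M2 M20 B2] : exists2 M, 0 < M & forall k l p, dist1 p0 p <= r -> `|partial k (partial l f) p| <= M.
  have [a a0 Ha] := unif_cont_bounded r0 (C2 i1 i1); have [b b0 Hb] := unif_cont_bounded r0 (C2 i2 i1).
  have [c cc0 Hc] := unif_cont_bounded r0 (C2 i1 i2); have [d d0 Hd] := unif_cont_bounded r0 (C2 i2 i2).
  exists (a + b + c + d); first by rewrite !addr_gt0.
  apply: forall_I2; apply: forall_I2 => p pr.
  - by have := Ha p pr; lra_from b0 cc0 d0.
  - by have := Hc p pr; lra_from a0 b0 d0.
  - by have := Hb p pr; lra_from a0 cc0 d0.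
  - by have := Hd p pr; lra_from a0 b0 cc0.
have E0 := C1_expand r0 (fun k p pr => df k p (ballO p pr)) C1.
have E1 l := C1_expand r0 (fun k p pr => ddf k l p (ballO p pr)) (fun k => C2 k l).
have sym p : dist1 p0 p <= r -> partial i2 (partial i1 f) p = partial i1 (partial i2 f) p.
  move=> pr; have pp q : dist1 p q <= r -> Omega q.
    move=> qr; apply: ballO; apply: le_trans (dist1_tri _ p _) _; lra_from pr qr.
  symmetry; apply: (schwarz r0).
  - by move=> k q /pp; exact: df.
  - by move=> k l q /pp; exact: ddf.
  - by apply: (extendable_continuous oO) => //; apply: ballO; lra_from pr r0.
  - by apply: (extendable_continuous oO) => //; apply: ballO; lra_from pr r0.
pose M := M0 + M1 + M2.
have M0' : 0 < M by rewrite !addr_gt0.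
have [d0 d00 D0] := E0 1 ltr01.
have [d1 d10 D1] := E1 i1 1 ltr01.
have [d2 d20 D2] := E1 i2 1 ltr01.
have L0 : lip_near f p0 r (M + 1 + 2 * M / d0).
  apply: (expand_lip r0 d00 (ltW M0') _ D0) => p pr.
  have := B0 p pr; have := B1 i1 p pr; have := B1 i2 p pr; rewrite /M => a b c.
  by split; [lra_from c M10 M20|lra_from b M00 M20|lra_from a M00 M20].
have LL l d : 0 < d -> (forall p q, dist1 p0 p <= r -> dist1 p q <= d ->
    expands_at 1 (partial l f) (partial i1 (partial l f)) (partial i2 (partial l f)) p q) ->
    lip_near (partial l f) p0 r (M + 1 + 2 * M / d).
  move=> dd D; apply: (expand_lip r0 dd (ltW M0') _ D) => p pr.
  have := B1 l p pr; have := B2 i1 l p pr; have := B2 i2 l p pr; rewrite /M => a b c.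
  by split; [lra_from c M00 M20|lra_from b M00 M10|lra_from a M00 M10].
have L1 := LL i1 d1 d10 D1; have L2 := LL i2 d2 d20 D2.
have T d : 0 < d -> 0 < 2 * M / d by move=> dd; rewrite divr_gt0 // mulr_gt0.
have T0 := T _ d00; have T1 := T _ d10; have T2 := T _ d20.
exists r, (M + 1 + 2 * M / d0 + 2 * M / d1 + 2 * M / d2); split=> //.
- by lra_from M0' T0 T1 T2.
- split=> //.
  + move=> eps eps0; have [a a0 Ha] := E0 eps eps0.
    have [b b0 Hb] := E1 i1 eps eps0; have [c cc0 Hc] := E1 i2 eps eps0.
    exists (Num.min a (Num.min b c)); first by rewrite !lt_min a0 b0.
    move=> p q pr; rewrite !le_min => /and3P[qa qb qc]; split; [exact: Ha| |exact: Hc].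
    by have := Hb p q pr qb; rewrite /expands_at sym.
  + split; first by apply: lip_near_le L0 => //; lra_from T1 T2.
    apply: forall_I2; [apply: lip_near_le L1|apply: lip_near_le L2] => //; [lra_from T0 T2|lra_from T0 T1].
  + move=> k l p pr; have := B2 k l p pr; rewrite /M; move: M00 M10 T0 T1 T2; rewrite /M; clear.
    set a := _ / d0; set b := _ / d1; set c := _ / d2; lra.
- by move=> p pr; apply: ballO; lra_from pr r0.
Qed.

End C2Local.

Section LocallyLipschitz.
Variable R : realType.
Variable p0 : R * R.
Implicit Types (p q : R * R) (f g c F : R * R -> R) (r M : R).

Lemma lip_near_ge0 f r M : 0 <= r -> lip_near f p0 r M -> 0 <= M.
Proof.
move=> r0 H; have pp : dist1 p0 p0 <= r by rewrite dist1xx.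
by have [_] := H _ _ pp pp; apply: le_trans.
Qed.

Lemma lip_nearD f g r M N : lip_near f p0 r M -> lip_near g p0 r N ->
  lip_near (fun p => f p + g p) p0 r (M + N).
Proof.
move=> Hf Hg p q pr qr; have [a b] := Hf p q pr qr; have [c d] := Hg p q pr qr; split.
  rewrite (_ : _ - _ = (f q - f p) + (g q - g p)); last by ring.
  by apply: le_trans (ler_normD _ _) _; rewrite mulrDl lerD.
by apply: le_trans (ler_normD _ _) _; rewrite lerD.
Qed.

Lemma lip_nearM f g r M N : 0 <= r -> lip_near f p0 r M -> lip_near g p0 r N ->
  lip_near (fun p => f p * g p) p0 r (2 * (M * N)).
Proof.
move=> r0 Hf Hg p q pr qr; have [a b] := Hf p q pr qr; have [c d] := Hg p q pr qr.
have M0 := lip_near_ge0 r0 Hf; have N0 := lip_near_ge0 r0 Hg.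
have [_ b'] := Hf q p qr pr; have d0 := dist1_ge0 p q.
split.
  rewrite (_ : _ - _ = f q * (g q - g p) + g p * (f q - f p)); last by ring.
  apply: le_trans (ler_normD _ _) _; rewrite !normrM.
  have x1 := ler_pM (normr_ge0 _) (normr_ge0 _) b' c.
  have x2 := ler_pM (normr_ge0 _) (normr_ge0 _) d a.
  rewrite (_ : 2 * (M * N) * _ = M * (N * dist1 p q) + N * (M * dist1 p q)); last by ring.
  exact: lerD.
rewrite normrM; apply: le_trans (ler_pM (normr_ge0 _) (normr_ge0 _) b d) _.
by rewrite ler_peMl ?mulr_ge0 // ler1n.
Qed.

Definition loclip f := exists r M, 0 < r /\ lip_near f p0 r M.

Lemma loclip_pair f g : loclip f -> loclip g ->
  exists r M, [/\ 0 < r, lip_near f p0 r M & lip_near g p0 r M].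
Proof.
move=> [r [M [r0 H]]] [s [N [s0 G]]].
exists (Num.min r s), (Num.max M N); split; first by rewrite lt_min r0.
  by apply: lip_near_le H; rewrite ?ge_min ?le_max lexx.
by apply: lip_near_le G; rewrite ?ge_min ?le_max lexx orbT.
Qed.

Lemma loclipD f g : loclip f -> loclip g -> loclip (fun p => f p + g p).
Proof.
by move=> Hf Hg; have [r [M [r0 H G]]] := loclip_pair Hf Hg; exists r, (M + M); split=> //; exact: lip_nearD.
Qed.

Lemma loclipM f g : loclip f -> loclip g -> loclip (fun p => f p * g p).
Proof.
move=> Hf Hg; have [r [M [r0 H G]]] := loclip_pair Hf Hg; exists r, (2 * (M * M)); split=> //.
by apply: lip_nearM => //; exact: ltW.
Qed.

Lemma loclip_cst x : loclip (fun=> x).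
Proof.
exists 1, `|x|; split=> // p q _ _; rewrite subrr normr0; split=> //.
by rewrite mulr_ge0 // dist1_ge0.
Qed.

Lemma loclipN f : loclip f -> loclip (fun p => - f p).
Proof.
move=> Hf; have := loclipM (loclip_cst (-1)) Hf; congr loclip.
by apply/funext => p; rewrite mulN1r.
Qed.

Lemma loclipB f g : loclip f -> loclip g -> loclip (fun p => f p - g p).
Proof. by move=> Hf Hg; exact: loclipD Hf (loclipN Hg). Qed.

Lemma loclip_near0 f : loclip f -> f p0 != 0 -> exists r M, [/\ 0 < r, 0 < M, lip_near f p0 r M &
  forall p, dist1 p0 p <= r -> [/\ f p != 0, (f p)^-1 <= M, `|(f p)^-1| <= M & 0 < f p0 * f p]].
Proof.
move=> [r [M [r0 H]]] f0.
have a0 : 0 < `|f p0| by rewrite normr_gt0.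
have M0 : 0 < M + 1 by have := lip_near_ge0 (ltW r0) H; clear; lra.
pose s := Num.min r (`|f p0| / (2 * (M + 1))).
have s0 : 0 < s by rewrite lt_min r0 divr_gt0 // mulr_gt0.
have sr : s <= r by rewrite ge_min lexx.
have sf : 2 * (M + 1) * s <= `|f p0|.
  have : s <= `|f p0| / (2 * (M + 1)) by rewrite ge_min lexx orbT.
  by rewrite ler_pdivlMr ?mulr_gt0 // mulrC.
pose M' := M + 1 + 2 / `|f p0|.
have M'0 : 0 < 2 / `|f p0| by rewrite divr_gt0.
exists s, M'; split=> //; first exact: addr_gt0.
  by apply: lip_near_le H => //; rewrite /M'; lra_from M'0.
move=> p ps.
have close : `|f p - f p0| <= `|f p0| / 2.
  have pp : dist1 p0 p0 <= r by rewrite dist1xx ltW.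
  have [h _] := H p0 p pp (le_trans ps sr); apply: le_trans h _.
  have : (M + 1) * dist1 p0 p <= (M + 1) * s by apply: ler_wpM2l => //; exact: ltW.
  have := dist1_ge0 p0 p; rewrite mulrDl mul1r; move: sf; rewrite -mulrA.
  set X := _ * s; set Y := M * _; clear; lra.
have big : `|f p0| / 2 <= `|f p|.
  have := ler_normB (f p) (f p - f p0); rewrite opprB addrCA subrr addr0.
  by lra_from close.
have fp : f p != 0 by rewrite -normr_gt0; apply: lt_le_trans big; rewrite divr_gt0.
have inv : `|(f p)^-1| <= M'.
  rewrite normfV (_ : M' = M + 1 + (`|f p0| / 2)^-1); last by rewrite invf_div.
  apply: le_trans (_ : (`|f p0| / 2)^-1 <= _); last by rewrite lerDr ltW.
  by rewrite lef_pV2 ?posrE ?normr_gt0 // divr_gt0.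
split=> //; first by apply: le_trans inv; rewrite ler_norm.
move: close big; rewrite ler_norml => /andP[x y].
case: (ltgtP (f p0) 0) f0 x y => // s1 _ x y big; [rewrite nmulr_rgt0|rewrite pmulr_rgt0] => //.
  by move: y; rewrite ltr0_norm //; lra_from s1.
by move: x; rewrite gtr0_norm //; lra_from s1.
Qed.

Lemma loclipV f : loclip f -> f p0 != 0 -> loclip (fun p => (f p)^-1).
Proof.
move=> Hf f0; have [r [M [r0 M0 H N]]] := loclip_near0 Hf f0.
exists r, (M * (M * M) + M); split=> // p q pr qr.
have [fp _ ip _] := N p pr; have [fq _ iq _] := N q qr; have [h _] := H p q pr qr.
have d0 := dist1_ge0 p q.
have M3 : 0 <= M * (M * M) by rewrite !mulr_ge0 // ltW.
split; last by lra_from ip M3.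
rewrite (_ : _ - _ = - ((f q - f p) * ((f p)^-1 * (f q)^-1))); last by field; apply/andP.
rewrite normrN normrM; apply: le_trans (ler_pM _ _ h (_ : _ <= M * M)) _ => //.
  by rewrite normrM ler_pM.
rewrite mulrDl; have : 0 <= M * dist1 p q by rewrite mulr_ge0 // ltW.
by rewrite (_ : M * dist1 p q * (M * M) = M * (M * M) * dist1 p q); [lra|ring].
Qed.

Lemma loclip_sqrt f : loclip f -> 0 < f p0 -> loclip (fun p => Num.sqrt (f p)).
Proof.
move=> Hf f0; have [r [M [r0 M0 H N]]] := loclip_near0 Hf (lt0r_neq0 f0).
have pos p : dist1 p0 p <= r -> 0 < f p.
  by move=> pr; have [_ _ _] := N p pr; rewrite pmulr_rgt0.
have big p : dist1 p0 p <= r -> M^-1 <= f p.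
  by move=> pr; have [_ + _ _] := N p pr; rewrite invf_ple ?posrE // pos.
pose c := Num.sqrt M^-1; have c0 : 0 < c by rewrite sqrtr_gt0 invr_gt0.
exists r, (M / c + (M + 1)); split=> // p q pr qr.
have [h b] := H p q pr qr; have d0 := dist1_ge0 p q.
have cp : c <= Num.sqrt (f p) by rewrite ler_sqrt ?big // ltW ?pos.
have cq : c <= Num.sqrt (f q) by rewrite ler_sqrt ?big // ltW ?pos.
have M1 : 0 <= M / c by rewrite divr_ge0 ?ltW.
split.
  have key : c * `|Num.sqrt (f q) - Num.sqrt (f p)| <= M * dist1 p q.
    apply: le_trans h.
    rewrite -[X in _ <= `|X - _|]sqr_sqrtr ?(ltW (pos _ _)) // -[X in _ <= `|_ - X|]sqr_sqrtr ?(ltW (pos _ _)) //.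
    rewrite subr_sqr normrM mulrC; apply: ler_wpM2l => //.
    by rewrite ger0_norm; [lra_from cp cq c0|lra_from cp cq c0].
  rewrite mulrDl; have : 0 <= (M + 1) * dist1 p q by apply: mulr_ge0 => //; lra_from M0.
  have : `|Num.sqrt (f q) - Num.sqrt (f p)| <= M / c * dist1 p q.
    by rewrite mulrAC ler_pdivlMr // mulrC.
  clear; lra.
rewrite ger0_norm ?sqrtr_ge0 //.
have : f p <= M by apply: le_trans b; exact: ler_norm.
have := sqr_ge0 (Num.sqrt (f p) - 1); rewrite sqrrB sqr_sqrtr ?(ltW (pos p pr)) // expr1n mulr1.
have := pos p pr; lra_from M1.
Qed.

End LocallyLipschitz.

Section ApproximateBounds.
Variable R : realType.
Variables (p0 : R * R) (r : R).
Implicit Types (p q e : R * R) (c F : R * R -> R) (A B V W : R -> R * R -> R) (h : R).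

Definition ale A W := exists2 C : R, 0 <= C & forall eps, 0 < eps -> exists2 h0 : R, 0 < h0 &
  forall h p, 0 < h -> h < h0 -> dist1 p0 p <= r -> `|A h p| <= C * W h p + eps.

Lemma ale_bound A W C : 0 <= C ->
  (forall h p, 0 < h -> dist1 p0 p <= r -> `|A h p| <= C * W h p) -> ale A W.
Proof.
move=> C0 H; exists C => // eps eps0; exists 1 => // h p hh _ pr.
by have := H h p hh pr; lra_from eps0.
Qed.

Lemma aleD A B W : (forall h p, dist1 p0 p <= r -> 0 <= W h p) ->
  ale A W -> ale B W -> ale (fun h p => A h p + B h p) W.
Proof.
move=> W0 [C C0 H] [D D0 G]; exists (C + D); first exact: addr_ge0.
move=> eps eps0; have e2 : 0 < eps / 2 by rewrite divr_gt0.
have [a a0 Ha] := H _ e2; have [b b0 Hb] := G _ e2.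
exists (Num.min a b); first by rewrite lt_min a0.
move=> h p h0; rewrite lt_min => /andP[ha hb] pr.
apply: le_trans (ler_normD _ _) _; have := Ha h p h0 ha pr; have := Hb h p h0 hb pr.
rewrite mulrDl; set X := C * _; set Y := D * _; clear; lra.
Qed.

Lemma aleM A W c K : 0 <= K -> (forall p, dist1 p0 p <= r -> `|c p| <= K) ->
  ale A W -> ale (fun h p => c p * A h p) W.
Proof.
move=> K0 cK [C C0 H]; exists (K * C); first exact: mulr_ge0.
move=> eps eps0; have e2 : 0 < eps / (K + 1) by rewrite divr_gt0 // ltr_wpDl.
have [a a0 Ha] := H _ e2; exists a => // h p h0 ha pr.
rewrite normrM; have x := ler_pM (normr_ge0 _) (normr_ge0 _) (cK p pr) (Ha h p h0 ha pr).
apply: le_trans x _; rewrite mulrDr mulrA lerD2l mulrA ler_pdivrMr ?ltr_wpDl // mulrC.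
by apply: ler_wpM2l; [exact: ltW|rewrite lerDl].
Qed.

Lemma ale_trans A V W : ale A V -> ale V W -> ale A W.
Proof.
move=> [C C0 H] [D D0 G]; exists (C * D); first exact: mulr_ge0.
move=> eps eps0; have e2 : 0 < eps / 2 by rewrite divr_gt0.
have e3 : 0 < eps / 2 / (C + 1) by rewrite divr_gt0 // ltr_wpDl.
have [a a0 Ha] := H _ e2; have [b b0 Hb] := G _ e3.
exists (Num.min a b); first by rewrite lt_min a0.
move=> h p h0; rewrite lt_min => /andP[ha hb] pr.
have x := Ha h p h0 ha pr; have y := le_trans (ler_norm _) (Hb h p h0 hb pr).
have z : C * (eps / 2 / (C + 1)) <= eps / 2.
  rewrite mulrA ler_pdivrMr ?ltr_wpDl // mulrC; apply: ler_wpM2l; first exact: ltW.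
  by rewrite lerDl.
have t := ler_wpM2l C0 y; rewrite mulrDr mulrA in t.
move: x t z; set X := C * V h p; set Y := _ * _ * _; set Z := C * _; clear; lra.
Qed.

Lemma ale_ext A B W : (forall h p, 0 < h -> dist1 p0 p <= r -> A h p = B h p) -> ale A W -> ale B W.
Proof.
move=> E [C C0 H]; exists C => // eps /H[a a0 Ha]; exists a => // h p h0 ha pr.
by rewrite -E //; exact: Ha.
Qed.

Lemma dist1_she e p t : `|e.1| + `|e.2| <= 1 -> dist1 p (she e p t) <= `|t|.
Proof.
move=> e1; rewrite /dist1 /she /= [p.1 + _]addrC addrK [p.2 + _]addrC addrK !normrM -mulrDr.
by rewrite ler_piMr.
Qed.

Lemma ale_dd_expand e F F1 F2 W : `|e.1| + `|e.2| <= 1 ->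
  (forall h p, dist1 p0 p <= r -> 0 <= W h p) ->
  (forall eps, 0 < eps -> exists2 d : R, 0 < d & forall p q, dist1 p0 p <= r -> dist1 p q <= d ->
    expands_at eps F F1 F2 p q) ->
  ale (fun h p => dd e h F p - (e.1 * F1 p + e.2 * F2 p)) W.
Proof.
move=> e1 W0 H; exists 0 => // eps eps0; have [d d0 Hd] := H _ eps0; exists d => // h p h0 hd pr.
rewrite mul0r add0r.
have s1 : dist1 p (she e p h) <= h by apply: le_trans (dist1_she _ _ e1) _; rewrite gtr0_norm.
have s2 : dist1 p (she e p (- h)) <= h by apply: le_trans (dist1_she _ _ e1) _; rewrite normrN gtr0_norm.
have x := Hd p _ pr (le_trans s1 (ltW hd)); have y := Hd p _ pr (le_trans s2 (ltW hd)).
have h2 : 0 < 2 * h by rewrite mulr_gt0.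
have hn : h != 0 by rewrite gt_eqF.
rewrite /expands_at in x y; set a := F _ - _ - _ in x; set b := F _ - _ - _ in y.
rewrite (_ : _ - _ = (a - b) / (2 * h)); last first.
  by rewrite /a /b /dd /she /=; field.
rewrite normrM normfV (gtr0_norm h2) ler_pdivrMr //; apply: le_trans (ler_normB _ _) _.
have := ler_wpM2l (ltW eps0) s1; have := ler_wpM2l (ltW eps0) s2; move: x y.
rewrite (_ : eps * (2 * h) = eps * h + eps * h); last by ring.
rewrite -/a -/b; set X := eps * dist1 _ _; set Y := eps * dist1 _ _; set Z := eps * h; clear; lra.
Qed.

Lemma ale_ddM e c F F' W s M : `|e.1| + `|e.2| <= 1 -> 0 <= r -> r < s ->
  (forall h p, dist1 p0 p <= r -> 0 <= W h p) ->
  lip_near c p0 s M -> lip_near F p0 s M ->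
  (forall h p, dist1 p0 p <= r -> `|F p| <= W h p) ->
  ale (fun h p => dd e h F p - F' p) W ->
  ale (fun h p => dd e h (fun q => c q * F q) p - c p * F' p) W.
Proof.
move=> e1 r0 rs W0 lc lF FW H.
have M0 : 0 <= M := lip_near_ge0 (le_trans r0 (ltW rs)) lc.
have cM p : dist1 p0 p <= r -> `|c p| <= M.
  by move=> pr; have ps := le_trans pr (ltW rs); have [_] := lc p p ps ps.
have H1 := aleM M0 cM H.
apply: (@ale_ext (fun h p => c p * (dd e h F p - F' p) +
   (((c (she e p h) - c p) * F (she e p h)) - ((c (she e p (- h)) - c p) * F (she e p (- h)))) / (2 * h))).
  move=> h p h0 pr; rewrite /dd; field; by rewrite gt_eqF.
apply: aleD => //; exists M => // eps eps0.
exists (Num.min (s - r) (eps / (M * M + 1))).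
  by rewrite lt_min subr_gt0 rs divr_gt0 // ltr_wpDl // mulr_ge0.
move=> h p h0; rewrite lt_min => /andP[hs he] pr.
have ps : dist1 p0 p <= s by apply: le_trans pr _; exact: ltW.
have h2 : 0 < 2 * h by rewrite mulr_gt0.
have st t : `|t| <= h -> `|(c (she e p t) - c p) * F (she e p t)| <= M * h * (W h p + M * h).
  move=> th; have d : dist1 p (she e p t) <= h by apply: le_trans (dist1_she _ _ e1) _.
  have qs : dist1 p0 (she e p t) <= s.
    by apply: le_trans (dist1_tri _ p _) _; lra_from d pr hs.
  have [x _] := lc p _ ps qs; have [y _] := lF p _ ps qs; rewrite normrM.
  have Mh := ler_wpM2l M0 d.
  apply: ler_pM => //; first exact: le_trans x Mh.
  have := ler_normD (F p) (F (she e p t) - F p); rewrite addrC subrK => z.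
  by have := FW h p pr; lra_from y Mh z.
have M2 : M * M * h <= eps.
  have : (M * M + 1) * h <= eps by move: (ltW he); rewrite ler_pdivlMr ?ltr_wpDl ?mulr_ge0 // mulrC.
  by rewrite mulrDl mul1r; lra_from h0.
rewrite normrM normfV (gtr0_norm h2) ler_pdivrMr //; apply: le_trans (ler_normB _ _) _.
have x := st h; rewrite (gtr0_norm h0) in x; have y := st (- h); rewrite normrN (gtr0_norm h0) in y.
have := x (lexx _); have := y (lexx _); have := ler_wpM2r (ltW h0) M2.
rewrite (_ : (M * W h p + eps) * (2 * h) = 2 * (M * h * W h p) + 2 * (eps * h)); last by ring.
rewrite (_ : M * h * (W h p + M * h) = M * h * W h p + M * M * h * h); last by ring.
set X := M * M * h * h; set Y := M * h * _; set Z := eps * h; clear; lra.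
Qed.

End ApproximateBounds.

Section Scaling.
Variable R : realType.
Implicit Types (p q e : R * R) (f : R * R -> R) (h d M : R).

Lemma ale_sqr p0 (r N : R) (A W Q : R -> R * R -> R) : 0 <= N ->
  (forall h p, dist1 p0 p <= r -> W h p ^+ 2 <= N * Q h p) -> ale p0 r A W ->
  exists2 K : R, 0 <= K & forall eps, 0 < eps -> exists2 h0 : R, 0 < h0 &
    forall h p, 0 < h -> h < h0 -> dist1 p0 p <= r -> A h p ^+ 2 <= K * Q h p + eps.
Proof.
move=> N0 WQ [C C0 H]; exists (2 * C ^+ 2 * N); first by rewrite !mulr_ge0 // sqr_ge0.
move=> eps eps0; pose e := Num.min 1 (eps / 2).
have e0 : 0 < e by rewrite lt_min ltr01 divr_gt0.
have [a a0 Ha] := H _ e0; exists a => // h p h0 ha pr.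
have x := Ha h p h0 ha pr; have y := WQ h p pr.
have e1 : e <= 1 by rewrite ge_min lexx.
have e2 : e <= eps / 2 by rewrite ge_min lexx orbT.
have ee : e * e <= e by rewrite ler_piMl // ltW.
have z := ler_pM (normr_ge0 _) (normr_ge0 _) x x; rewrite -expr2 real_normK ?num_real // in z.
apply: le_trans z _.
have := sqr_ge0 (C * W h p - e); have := ler_wpM2l (sqr_ge0 C) y.
rewrite (_ : (C * W h p - e) ^+ 2 = C ^+ 2 * W h p ^+ 2 - 2 * (C * W h p * e) + e * e); last by ring.
rewrite (_ : (C * W h p + e) * (C * W h p + e) = C ^+ 2 * W h p ^+ 2 + 2 * (C * W h p * e) + e * e); last by ring.
rewrite (_ : 2 * C ^+ 2 * N * Q h p = 2 * (C ^+ 2 * (N * Q h p))); last by ring.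
move: ee e2; clear; set a1 := C ^+ 2 * _ ^+ 2; set a2 := _ * e; set a3 := e * e; set a4 := _ * (N * _); lra.
Qed.

Lemma ale_sqr2 p0 (r N : R) (A B W Q : R -> R * R -> R) : 0 <= N ->
  (forall h p, dist1 p0 p <= r -> W h p ^+ 2 <= N * Q h p) -> ale p0 r A W -> ale p0 r B W ->
  exists2 K : R, 0 <= K & forall eps, 0 < eps -> exists2 h0 : R, 0 < h0 &
    forall h p, 0 < h -> h < h0 -> dist1 p0 p <= r -> A h p ^+ 2 + B h p ^+ 2 <= K * Q h p + eps.
Proof.
move=> N0 WQ HA HB; have [K K0 H] := ale_sqr N0 WQ HA; have [L L0 G] := ale_sqr N0 WQ HB.
exists (K + L); first exact: addr_ge0.
move=> eps eps0; have e2 : 0 < eps / 2 by rewrite divr_gt0.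
have [a a0 Ha] := H _ e2; have [b b0 Hb] := G _ e2.
exists (Num.min a b); first by rewrite lt_min a0.
move=> h p h0; rewrite lt_min => /andP[ha hb] pr.
have := Ha h p h0 ha pr; have := Hb h p h0 hb pr; rewrite mulrDl.
set X := K * _; set Y := L * _; clear; lra.
Qed.

Definition dilate q d p : R * R := (q.1 + d * p.1, q.2 + d * p.2).

Lemma dd_dilate e h d q f c p : d != 0 ->
  dd e h (fun p => c * f (dilate q d p)) p = c * d * dd e (d * h) f (dilate q d p).
Proof.
move=> d0; have S t : dilate q d (she e p t) = she e (dilate q d p) (d * t).
  by rewrite /dilate /she /=; congr pair; ring.
rewrite /dd !S mulrN.
have [->|h0] := eqVneq h 0; first by rewrite !mulr0 !invr0 !mulr0.
by field; rewrite h0 d0.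
Qed.

Theorem ucp_scaled p0 (r M : R) (al be ga de w1 w2 v1 v2 : R * R -> R) : 0 < r ->
  [/\ lip_near al p0 r M, lip_near be p0 r M, lip_near ga p0 r M & lip_near de p0 r M] ->
  [/\ lip_near w1 p0 r M, lip_near w2 p0 r M, lip_near v1 p0 r M & lip_near v2 p0 r M] ->
  (forall p, dist1 p0 p <= r -> 1 <= M * `|be p| /\ 1 <= M * `|de p|) ->
  let V := fun h p => `|w1 p| + `|w2 p| + (`|v1 p| + `|v2 p|) in
  let W := fun h p => V h p + (`|dd (e2 R) h v1 p| + `|dd (e2 R) h v2 p|) in
  ale p0 r (fun h => dop1 al be h w1 w2) W -> ale p0 r (fun h => dop2 al be h w1 w2) W ->
  ale p0 r (fun h => dop1 ga de h v1 v2) V -> ale p0 r (fun h => dop2 ga de h v1 v2) V ->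
  exists eta d0 : R, [/\ 0 < eta, 0 < d0 & forall q d, dist1 p0 q <= d0 -> 0 < d -> d <= d0 ->
    (forall p, sqn (p.1 - q.1, p.2 - q.2) < d ^+ 2 -> [/\ w1 p = 0, w2 p = 0, v1 p = 0 & v2 p = 0]) ->
    forall p, sqn (p.1 - q.1, p.2 - q.2) < d ^+ 2 * (1 + eta) -> v1 p = 0 /\ v2 p = 0].
Proof.
move=> r0 [lal lbe lga lde] [lw1 lw2 lv1 lv2] bel V W H1 H2 H3 H4.
have pp : dist1 p0 p0 <= r by rewrite dist1xx ltW.
have M0 : 0 < M.
  have [x _] := bel p0 pp; have := lip_near_ge0 (ltW r0) lbe; rewrite le_eqVlt => /orP[/eqP E|//].
  by move: x; rewrite -E mul0r ler10.
pose QV (h : R) (p : R * R) := w1 p ^+ 2 + w2 p ^+ 2 + (v1 p ^+ 2 + v2 p ^+ 2).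
pose QW (h : R) (p : R * R) := QV h p + (dd (e2 R) h v1 p ^+ 2 + dd (e2 R) h v2 p ^+ 2).
have sq2 (a b : R) : (a + b) ^+ 2 <= 2 * (a ^+ 2 + b ^+ 2).
  by have := sqr_ge0 (a - b); rewrite sqrrB sqrrD; lra.
have VQ h p : dist1 p0 p <= r -> V h p ^+ 2 <= 4 * QV h p.
  move=> _; rewrite /V /QV.
  have := sq2 (`|w1 p| + `|w2 p|) (`|v1 p| + `|v2 p|); have := sq2 `|w1 p| `|w2 p|; have := sq2 `|v1 p| `|v2 p|.
  by rewrite !sqr_normE; clear; set X := (_ + _ + (_ + _)) ^+ 2; set Y := (_ + _) ^+ 2; set Z := (_ + _) ^+ 2; lra.
have WQ h p : dist1 p0 p <= r -> W h p ^+ 2 <= 8 * QW h p.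
  move=> pr; have := VQ h p pr; rewrite /W /QW.
  have := sq2 (V h p) (`|dd (e2 R) h v1 p| + `|dd (e2 R) h v2 p|); have := sq2 `|dd (e2 R) h v1 p| `|dd (e2 R) h v2 p|.
  have := sqr_ge0 (dd (e2 R) h v1 p); have := sqr_ge0 (dd (e2 R) h v2 p).
  by rewrite !sqr_normE; lra.
have [Kw Kw0 Hw] := ale_sqr2 (ler0n R 8) WQ H1 H2.
have [Kv Kv0 Hv] := ale_sqr2 (ler0n R 4) VQ H3 H4.
pose C := M + Kv + 1.
have C1 : 1 <= C by rewrite /C; lra_from M0 Kv0.
have Mi0 : 0 < M^-1 by rewrite invr_gt0.
have [eta [lam0 [eta0 _ lam00 core]]] := ucp_core Mi0 C1.
pose d0 := Num.min 1 (Num.min (r / 8) (lam0 / (M + Kw))).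
have MK0 : 0 < M + Kw by lra_from M0 Kw0.
have d00 : 0 < d0 by rewrite !lt_min ltr01 !divr_gt0.
exists eta, d0; split=> // q d qd dgt dle van p sp.
have d1 : d <= 1 by apply: le_trans dle _; rewrite /d0 ge_min lexx.
have q8 : dist1 p0 q <= r / 8 by apply: le_trans qd _; rewrite /d0 !ge_min lexx !orbT.
have d8 : d <= r / 8 by apply: le_trans dle _; rewrite /d0 !ge_min lexx !orbT.
have dl : (M + Kw) * d <= lam0.
  have : d <= lam0 / (M + Kw) by apply: le_trans dle _; rewrite /d0 !ge_min lexx !orbT.
  by rewrite ler_pdivlMr // mulrC.
have dn : d != 0 by rewrite gt_eqF.
have ball x : dom2 x -> dist1 p0 (dilate q d x) <= r.
  move=> /andP[x1 x2]; apply: le_trans (dist1_tri _ q _) _.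
  have : dist1 q (dilate q d x) <= 4 * d.
    rewrite /dist1 /dilate /= [q.1 + _]addrC addrK [q.2 + _]addrC addrK !normrM (gtr0_norm dgt) -mulrDr mulrC.
    by apply: ler_wpM2r; [exact: ltW|lra_from x1 x2].
  by lra_from q8 d8 r0.
have lip f x y : lip_near f p0 r M -> dom2 x -> dom2 y ->
    `|f (dilate q d x) - f (dilate q d y)| <= M * d * (`|x.1 - y.1| + `|x.2 - y.2|).
  move=> lf dx dy; have [h _] := lf _ _ (ball y dy) (ball x dx); apply: le_trans h _.
  rewrite /dist1 /dilate /= [q.1 + d * x.1]addrC [q.2 + d * x.2]addrC !addrKA -!mulrBr !normrM (gtr0_norm dgt).
  by rewrite -mulrDr mulrA.
have lipC f x y : lip_near f p0 r M -> dom2 x -> dom2 y ->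
    `|f (dilate q d x) - f (dilate q d y)| <= (M + Kw) * d * (`|x.1 - y.1| + `|x.2 - y.2|).
  move=> lf dx dy; apply: le_trans (lip f x y lf dx dy) _; apply: ler_wpM2r; first exact: addr_ge0.
  by apply: ler_wpM2r; [exact: ltW|rewrite lerDl].
have bnd f x : lip_near f p0 r M -> dom2 x -> `|f (dilate q d x)| <= C.
  move=> lf dx; have [_ h] := lf _ _ (ball x dx) (ball x dx); apply: le_trans h _; rewrite /C; lra_from Kv0.
have low f x : (forall p, dist1 p0 p <= r -> 1 <= M * `|f p|) -> dom2 x -> M^-1 <= `|f (dilate q d x)|.
  by move=> H dx; rewrite -[M^-1]mulr1 ler_pdivrMl //; exact: H (ball x dx).
have inn x : inner x -> dom2 x.
  by move=> /andP[x1 x2]; apply/andP; split; [lra_from x1|lra_from x2].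
pose sc c f := fun x => c * f (dilate q d x).
have scl c f : 0 <= c -> c <= 1 -> lip_near f p0 r M -> lip2 (@dom2 R) (M * d) (sc c f).
  move=> c0 c1 lf x y dx dy; rewrite /sc -mulrBr normrM (ger0_norm c0).
  by apply: le_trans (lip f x y lf dx dy); rewrite ler_piMl.
have mk c f x : dd (e1 R) c (sc 1 f) x = d * dd (e1 R) (d * c) f (dilate q d x).
  by rewrite dd_dilate // mul1r.
have := core ((M + Kw) * d) (M * d) (fun x => al (dilate q d x)) (fun x => be (dilate q d x))
   (fun x => ga (dilate q d x)) (fun x => de (dilate q d x)) (sc d w1) (sc d w2) (sc 1 v1) (sc 1 v2).
have dd1 c f e h x : dd e h (sc c f) x = c * d * dd e (d * h) f (dilate q d x) by exact: dd_dilate.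
move=> /(_ (ltW (mulr_gt0 MK0 dgt)) dl).
have A1 x : dom2 x -> [/\ `|al (dilate q d x)| <= C, M^-1 <= `|be (dilate q d x)| & `|be (dilate q d x)| <= C].
  by move=> dx; split; [exact: bnd|apply: low dx => y yr; case: (bel y yr)|exact: bnd].
have A2 x : dom2 x -> [/\ `|ga (dilate q d x)| <= C, M^-1 <= `|de (dilate q d x)| & `|de (dilate q d x)| <= C].
  by move=> dx; split; [exact: bnd|apply: low dx => y yr; case: (bel y yr)|exact: bnd].
move=> /(_ A1 A2); move=> /(_ (And4 _ _ _ _)).
have lipD f : lip_near f p0 r M -> lip2 (@dom2 R) ((M + Kw) * d) (fun x => f (dilate q d x)).
  by move=> lf x y dx dy; exact: lipC.
move=> /(_ (lipD _ lal) (lipD _ lbe) (lipD _ lga) (lipD _ lde)).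
move=> /(_ (ltW (mulr_gt0 M0 dgt))).
move=> /(_ (And4 (scl d w1 (ltW dgt) d1 lw1) (scl d w2 (ltW dgt) d1 lw2) (scl 1 v1 ler01 (lexx _) lv1) (scl 1 v2 ler01 (lexx _) lv2))).
have vn x : sqn x < 1 -> [/\ sc d w1 x = 0, sc d w2 x = 0, sc 1 v1 x = 0 & sc 1 v2 x = 0].
  move=> sx; have [|a b c e] := van (dilate q d x).
    rewrite /sqn /dilate /= [q.1 + _]addrC addrK [q.2 + _]addrC addrK !exprMn -mulrDr.
    by rewrite gtr_pMr // exprn_gt0.
  by rewrite /sc a b c e !mulr0.
move=> /(_ vn).
have Hop eps : 0 < eps -> exists2 h0 : R, 0 < h0 & forall h x, 0 < h -> h < h0 -> inner x ->
   dop1 (fun x => al (dilate q d x)) (fun x => be (dilate q d x)) h (sc d w1) (sc d w2) x ^+ 2 +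
   dop2 (fun x => al (dilate q d x)) (fun x => be (dilate q d x)) h (sc d w1) (sc d w2) x ^+ 2 <=
     (M + Kw) * d * (sc d w1 x ^+ 2 + sc d w2 x ^+ 2 + (sc 1 v1 x ^+ 2 + sc 1 v2 x ^+ 2)
       + (dd (e2 R) h (sc 1 v1) x ^+ 2 + dd (e2 R) h (sc 1 v2) x ^+ 2)) + eps /\
   dop1 (fun x => ga (dilate q d x)) (fun x => de (dilate q d x)) h (sc 1 v1) (sc 1 v2) x ^+ 2 +
   dop2 (fun x => ga (dilate q d x)) (fun x => de (dilate q d x)) h (sc 1 v1) (sc 1 v2) x ^+ 2 <=
     C * (sc d w1 x ^+ 2 + sc d w2 x ^+ 2 + (sc 1 v1 x ^+ 2 + sc 1 v2 x ^+ 2)) + eps.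
  move=> eps0; have [a a0 Ha] := Hw _ eps0; have [b b0 Hb] := Hv _ eps0.
  exists (Num.min a b); first by rewrite lt_min a0.
  move=> h x h0; rewrite lt_min => /andP[ha hb] ix.
  have dh0 : 0 < d * h by rewrite mulr_gt0.
  have dhh : d * h <= h by rewrite ler_piMl // ltW.
  have bx := ball x (inn _ x ix).
  have := Ha (d * h) _ dh0 (le_lt_trans dhh ha) bx; have := Hb (d * h) _ dh0 (le_lt_trans dhh hb) bx.
  rewrite /QW /QV /dop1 /dop2 !dd1 /sc; set y := dilate q d x.
  rewrite !mul1r ![(d * _) ^+ 2]exprMn => U2 U1.
  have dg := ltW dgt.
  have d20 : 0 <= d ^+ 2 by rewrite sqr_ge0.
  have d2 : d ^+ 2 <= 1 by rewrite exprn_ile1.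
  have d4 : d ^+ 4 <= 1 by rewrite exprn_ile1.
  have d40 : 0 <= d ^+ 4 by rewrite exprn_ge0.
  have d3 (z : R) : 0 <= z -> d ^+ 3 * z <= d ^+ 2 * z.
    by move=> z0; apply: ler_wpM2r => //; rewrite exprSr ler_piMr.
  have d3' (z : R) : 0 <= z -> d ^+ 3 * z <= z.
    by move=> z0; rewrite ler_piMl // exprn_ile1.
  have P0 : 0 <= w1 y ^+ 2 + w2 y ^+ 2 by rewrite addr_ge0 // sqr_ge0.
  have V0 : 0 <= v1 y ^+ 2 + v2 y ^+ 2 by rewrite addr_ge0 // sqr_ge0.
  have D0 : 0 <= dd (e2 R) (d * h) v1 y ^+ 2 + dd (e2 R) (d * h) v2 y ^+ 2 by rewrite addr_ge0 // sqr_ge0.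
  have deps : d ^+ 4 * eps <= eps by rewrite ler_piMl // ltW.
  have deps2 : d ^+ 2 * eps <= eps by rewrite ler_piMl // ltW.
  split.
    apply: (@le_trans _ _ (d ^+ 4 * (Kw * (w1 y ^+ 2 + w2 y ^+ 2 + (v1 y ^+ 2 + v2 y ^+ 2) +
       (dd (e2 R) (d * h) v1 y ^+ 2 + dd (e2 R) (d * h) v2 y ^+ 2)) + eps))).
      apply: le_trans (ler_wpM2l d40 U1); rewrite le_eqVlt; apply/orP; left; apply/eqP; ring.
    move: P0 V0 D0; set P := w1 y ^+ 2 + _; set Q := v1 y ^+ 2 + _; set D := dd _ _ v1 y ^+ 2 + _ => P0 V0 D0.
    have X : d ^+ 3 * P + d ^+ 3 * Q + d ^+ 3 * D <= d ^+ 2 * P + Q + d ^+ 2 * D.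
      by apply: lerD; [apply: lerD; [exact: d3|exact: d3']|exact: d3].
    have X0 : 0 <= d ^+ 2 * P + Q + d ^+ 2 * D by apply: addr_ge0; [apply: addr_ge0 => //|]; apply: mulr_ge0.
    have Y := ler_wpM2l (mulr_ge0 Kw0 dg) X.
    have Z := mulr_ge0 (mulr_ge0 (ltW M0) dg) X0.
    rewrite (_ : d ^+ 2 * w1 y ^+ 2 + d ^+ 2 * w2 y ^+ 2 + Q + _ = d ^+ 2 * P + Q + d ^+ 2 * D); last by rewrite /P /D; ring.
    rewrite (_ : d ^+ 4 * _ = Kw * d * (d ^+ 3 * P + d ^+ 3 * Q + d ^+ 3 * D) + d ^+ 4 * eps); last by ring.
    rewrite (mulrDl M Kw d) [X in _ <= X + _]mulrDl.
    move: Y Z deps; set Y1 := Kw * d * _; set Y2 := Kw * d * _; set Y3 := M * d * _; clear; lra.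
  apply: (@le_trans _ _ (d ^+ 2 * (Kv * (w1 y ^+ 2 + w2 y ^+ 2 + (v1 y ^+ 2 + v2 y ^+ 2)) + eps))).
    apply: le_trans (ler_wpM2l d20 U2); rewrite le_eqVlt; apply/orP; left; apply/eqP; ring.
  move: P0 V0; set P := w1 y ^+ 2 + _; set Q := v1 y ^+ 2 + _ => P0 V0.
  have X : d ^+ 2 * P + d ^+ 2 * Q <= d ^+ 2 * P + Q by rewrite lerD2l ler_piMl.
  have X0 : 0 <= d ^+ 2 * P + Q by apply: addr_ge0 => //; apply: mulr_ge0.
  have Y := ler_wpM2l Kv0 X.
  have Z := mulr_ge0 (ltW M0) X0.
  rewrite (_ : d ^+ 2 * w1 y ^+ 2 + d ^+ 2 * w2 y ^+ 2 + Q = d ^+ 2 * P + Q); last by rewrite /P; ring.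
  rewrite (_ : d ^+ 2 * (_ + eps) = Kv * (d ^+ 2 * P + d ^+ 2 * Q) + d ^+ 2 * eps); last by ring.
  rewrite /C (_ : (M + Kv + 1) * (d ^+ 2 * P + Q) = M * (d ^+ 2 * P + Q) + Kv * (d ^+ 2 * P + Q) + (d ^+ 2 * P + Q)); last by ring.
  move: Y Z deps2 X0; set Y1 := Kv * _; set Y2 := Kv * _; set Y3 := M * _; set Y4 := _ + Q; clear; lra.
move=> /(_ Hop ((p.1 - q.1) / d, (p.2 - q.2) / d)).
have E : dilate q d ((p.1 - q.1) / d, (p.2 - q.2) / d) = p.
  rewrite /dilate /= [d * _]mulrC divfK // [d * _]mulrC divfK //.
  by rewrite addrC subrK addrC subrK -surjective_pairing.
rewrite /sc E !mul1r; apply; move: sp; rewrite /sqn /= !exprMn -mulrDl exprVn.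
by rewrite ltr_pdivrMr ?exprn_gt0 // mulrC.
Qed.

End Scaling.

(** * Reduction of the system to two complex first order equations *)


Section PencilAlgebra.
Variable R : rcfType.

Lemma posdef_det (k al be ga : R) : 0 < k ->
  (forall x y, k * (x ^+ 2 + y ^+ 2) <= al * x ^+ 2 + 2 * be * x * y + ga * y ^+ 2) ->
  0 < al * ga - be ^+ 2.
Proof.
move=> k0 H; have a0 : 0 < al by have := H 1 0; rewrite expr1n expr0n /=; lra.
rewrite -(pmulr_rgt0 _ a0); have := H (- be) al.
rewrite (_ : _ + ga * al ^+ 2 = al * (al * ga - be ^+ 2)); last by ring.
apply: lt_le_trans; apply: mulr_gt0 => //.
by apply: ltr_wpDl; [exact: sqr_ge0|exact: exprn_gt0].
Qed.

Variables (a b c e f g k : R).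
Hypothesis k0 : 0 < k.
Hypothesis ell : forall x1 x2 y1 y2, k * (x1 ^+ 2 + x2 ^+ 2) * (y1 ^+ 2 + y2 ^+ 2) <=
  (a * y1 ^+ 2 + 2 * b * y1 * y2 + e * y2 ^+ 2) * x1 ^+ 2
  + 2 * (b * y1 ^+ 2 + (e + c) * y1 * y2 + f * y2 ^+ 2) * x1 * x2
  + (e * y1 ^+ 2 + 2 * f * y1 * y2 + g * y2 ^+ 2) * x2 ^+ 2.

Definition pencil_det (t : R) :=
  (a * t ^+ 2 + 2 * b * t + e) * (e * t ^+ 2 + 2 * f * t + g)
  - (b * t ^+ 2 + (e + c) * t + f) ^+ 2.

Lemma pencil_det_gt0 t : 0 < pencil_det t.
Proof.
apply: (@posdef_det k) => // x y; have := ell x y t 1; rewrite expr1n !mulr1.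
apply: le_trans; apply: ler_peMr; last by rewrite lerDr sqr_ge0.
by rewrite mulr_ge0 ?(ltW k0) // addr_ge0 ?sqr_ge0.
Qed.

Lemma leading_det_gt0 : 0 < a * e - b ^+ 2.
Proof.
apply: (@posdef_det k) => // x y; have := ell x y 1 0; rewrite expr1n expr0n /=; clear; lra.
Qed.

Variables (tr ti z1r z1i z2r z2i : R).
Hypothesis row1r : (a * (tr ^+ 2 - ti ^+ 2) + 2 * b * tr + e) * z1r
  - (a * (2 * tr * ti) + 2 * b * ti) * z1i
  + (b * (tr ^+ 2 - ti ^+ 2) + (e + c) * tr + f) * z2r
  - (b * (2 * tr * ti) + (e + c) * ti) * z2i = 0.
Hypothesis row1i : (a * (tr ^+ 2 - ti ^+ 2) + 2 * b * tr + e) * z1i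
  + (a * (2 * tr * ti) + 2 * b * ti) * z1r
  + (b * (tr ^+ 2 - ti ^+ 2) + (e + c) * tr + f) * z2i
  + (b * (2 * tr * ti) + (e + c) * ti) * z2r = 0.
Hypothesis row2r : (b * (tr ^+ 2 - ti ^+ 2) + (e + c) * tr + f) * z1r
  - (b * (2 * tr * ti) + (e + c) * ti) * z1i
  + (e * (tr ^+ 2 - ti ^+ 2) + 2 * f * tr + g) * z2r
  - (e * (2 * tr * ti) + 2 * f * ti) * z2i = 0.
Hypothesis row2i : (b * (tr ^+ 2 - ti ^+ 2) + (e + c) * tr + f) * z1i
  + (b * (2 * tr * ti) + (e + c) * ti) * z1r
  + (e * (tr ^+ 2 - ti ^+ 2) + 2 * f * tr + g) * z2i
  + (e * (2 * tr * ti) + 2 * f * ti) * z2r = 0.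

Variables (kr1 kr2 ki1 ki2 nr1 nr2 ni1 ni2 : R).
Hypothesis kr1E : kr1 = z1r * a + z2r * b.
Hypothesis kr2E : kr2 = z1r * b + z2r * e.
Hypothesis ki1E : ki1 = z1i * a + z2i * b.
Hypothesis ki2E : ki2 = z1i * b + z2i * e.
Hypothesis nr1E : nr1 = tr * kr1 - ti * ki1 + (z1r * (2 * b) + z2r * (e + c)).
Hypothesis nr2E : nr2 = tr * kr2 - ti * ki2 + (z1r * (e + c) + z2r * (2 * f)).
Hypothesis ni1E : ni1 = tr * ki1 + ti * kr1 + (z1i * (2 * b) + z2i * (e + c)).
Hypothesis ni2E : ni2 = tr * ki2 + ti * kr2 + (z1i * (e + c) + z2i * (2 * f)).

(* With [w = Z^T Lambda11 u_x + Z^T (theta Lambda11 + Lambda12) u_y], the two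
   identities below are the real and imaginary parts of
   [(d_x - theta d_y) w = Z^T (Lambda11 u_xx + Lambda12 u_xy + Lambda22 u_yy)]
   (up to derivatives of the coefficients), a consequence of the pencil equation. *)
Lemma dbar_real (p1 p2 q1 q2 s1 s2 : R) :
  (kr1 * p1 + kr2 * p2 + nr1 * q1 + nr2 * q2)
  - tr * (kr1 * q1 + kr2 * q2 + nr1 * s1 + nr2 * s2)
  + ti * (ki1 * q1 + ki2 * q2 + ni1 * s1 + ni2 * s2)
  = z1r * (a * p1 + 2 * b * q1 + e * s1 + (b * p2 + (e + c) * q2 + f * s2))
  + z2r * (b * p1 + (e + c) * q1 + f * s1 + (e * p2 + 2 * f * q2 + g * s2)).
Proof.
apply/eqP; rewrite -subr_eq0; apply/eqP.
transitivity (- (0 * s1 + 0 * s2)); last by rewrite !mul0r addr0 oppr0.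
rewrite -{1}row1r -row2r nr1E nr2E ni1E ni2E kr1E kr2E ki1E ki2E; ring.
Qed.

Lemma dbar_imag (p1 p2 q1 q2 s1 s2 : R) :
  (ki1 * p1 + ki2 * p2 + ni1 * q1 + ni2 * q2)
  - tr * (ki1 * q1 + ki2 * q2 + ni1 * s1 + ni2 * s2)
  - ti * (kr1 * q1 + kr2 * q2 + nr1 * s1 + nr2 * s2)
  = z1i * (a * p1 + 2 * b * q1 + e * s1 + (b * p2 + (e + c) * q2 + f * s2))
  + z2i * (b * p1 + (e + c) * q1 + f * s1 + (e * p2 + 2 * f * q2 + g * s2)).
Proof.
apply/eqP; rewrite -subr_eq0; apply/eqP.
transitivity (- (0 * s1 + 0 * s2)); last by rewrite !mul0r addr0 oppr0.
rewrite -{1}row1i -row2i nr1E nr2E ni1E ni2E kr1E kr2E ki1E ki2E; ring.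
Qed.

Hypothesis z_indep : z1r * z2i - z1i * z2r != 0.

Lemma det_lead_neq0 : kr1 * ki2 - kr2 * ki1 != 0.
Proof.
rewrite (_ : _ - _ = (z1r * z2i - z1i * z2r) * (a * e - b ^+ 2)).
  by rewrite mulf_neq0 // gt_eqF // leading_det_gt0.
by rewrite kr1E kr2E ki1E ki2E; ring.
Qed.

Lemma theta_not_real : ti != 0.
Proof.
apply/negP => /eqP ti0; have := pencil_det_gt0 tr; rewrite /pencil_det.
move: row1r row1i row2r row2i; rewrite ti0 !mulr0 expr0n /= !subr0 !addr0 !mul0r !addr0 !subr0.
set m1 := _ + e; set m2 := _ + f; set m3 := _ + g => h1 h2 h3 h4 D.
move/eqP: z_indep; apply.
have z1 : (m1 * m3 - m2 ^+ 2) * z1r = 0.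
  by rewrite (_ : _ * z1r = m3 * (m1 * z1r + m2 * z2r) - m2 * (m2 * z1r + m3 * z2r)); [rewrite h1 h3 !mulr0 subr0|ring].
have z2 : (m1 * m3 - m2 ^+ 2) * z1i = 0.
  by rewrite (_ : _ * z1i = m3 * (m1 * z1i + m2 * z2i) - m2 * (m2 * z1i + m3 * z2i)); [rewrite h2 h4 !mulr0 subr0|ring].
by move: z1 z2 => /eqP; rewrite mulf_eq0 gt_eqF //= => /eqP -> /eqP; rewrite mulf_eq0 gt_eqF //= => /eqP ->; ring.
Qed.

Lemma shifted_det_neq0 t :
  (kr1 * t + nr1) * (ki2 * t + ni2) - (kr2 * t + nr2) * (ki1 * t + ni1) != 0.
Proof.
set D := _ - _; apply: contraNneq z_indep => D0.
have : ((t - tr) ^+ 2 + ti ^+ 2) * D = (z1r * z2i - z1i * z2r) * pencil_det t.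
  set A1 := (t - tr) * (kr1 * t + nr1) + ti * (ki1 * t + ni1).
  set A2 := (t - tr) * (kr2 * t + nr2) + ti * (ki2 * t + ni2).
  set B1 := (t - tr) * (ki1 * t + ni1) - ti * (kr1 * t + nr1).
  set B2 := (t - tr) * (ki2 * t + ni2) - ti * (kr2 * t + nr2).
  have -> : ((t - tr) ^+ 2 + ti ^+ 2) * D = A1 * B2 - A2 * B1 by rewrite /D /A1 /A2 /B1 /B2; ring.
  have -> : A1 = z1r * (a * t ^+ 2 + 2 * b * t + e) + z2r * (b * t ^+ 2 + (e + c) * t + f).
    apply/eqP; rewrite -subr_eq0; apply/eqP; transitivity (- (0 : R)); last by rewrite oppr0.
    by rewrite -row1r /A1 nr1E ni1E kr1E ki1E; ring.
  have -> : A2 = z1r * (b * t ^+ 2 + (e + c) * t + f) + z2r * (e * t ^+ 2 + 2 * f * t + g).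
    apply/eqP; rewrite -subr_eq0; apply/eqP; transitivity (- (0 : R)); last by rewrite oppr0.
    by rewrite -row2r /A2 nr2E ni2E kr2E ki2E; ring.
  have -> : B1 = z1i * (a * t ^+ 2 + 2 * b * t + e) + z2i * (b * t ^+ 2 + (e + c) * t + f).
    apply/eqP; rewrite -subr_eq0; apply/eqP; transitivity (- (0 : R)); last by rewrite oppr0.
    by rewrite -row1i /B1 nr1E ni1E kr1E ki1E; ring.
  have -> : B2 = z1i * (b * t ^+ 2 + (e + c) * t + f) + z2i * (e * t ^+ 2 + 2 * f * t + g).
    apply/eqP; rewrite -subr_eq0; apply/eqP; transitivity (- (0 : R)); last by rewrite oppr0.
    by rewrite -row2i /B2 nr2E ni2E kr2E ki2E; ring.
  by rewrite /pencil_det; ring.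
by rewrite D0 mulr0 => /esym/eqP; rewrite mulf_eq0 => /orP[//|/eqP E]; move: (pencil_det_gt0 t); rewrite E ltxx.
Qed.

Variables (b11 b12 b21 b22 : R).
Let d1 := kr1 * ki2 - kr2 * ki1.
Hypothesis b11E : b11 = (ki2 * nr1 - kr2 * ni1) / d1.
Hypothesis b12E : b12 = (ki2 * nr2 - kr2 * ni2) / d1.
Hypothesis b21E : b21 = (kr1 * ni1 - ki1 * nr1) / d1.
Hypothesis b22E : b22 = (kr1 * ni2 - ki1 * nr2) / d1.

Lemma disc_gt0 : 0 < - ((b11 - b22) ^+ 2 + 4 * b12 * b21).
Proof.
rewrite oppr_gt0 ltNge; apply/negP; set disc := _ + _ => disc0.
pose t := - ((b11 + b22) / 2) + Num.sqrt disc / 2.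
have d0 : d1 != 0 := det_lead_neq0.
move/eqP: (shifted_det_neq0 t); apply.
have -> : (kr1 * t + nr1) * (ki2 * t + ni2) - (kr2 * t + nr2) * (ki1 * t + ni1) =
    d1 * ((t + b11) * (t + b22) - b12 * b21).
  by rewrite b11E b12E b21E b22E /d1; field; exact: d0.
rewrite (_ : _ - b12 * b21 = (Num.sqrt disc ^+ 2 - disc) / 4); last first.
  by rewrite /t; set s := Num.sqrt _; rewrite /disc; field.
by rewrite sqr_sqrtr // subrr mul0r mulr0.
Qed.

Lemma b21_neq0 : b21 != 0.
Proof.
apply/negP => /eqP b0; have := disc_gt0; rewrite b0 mulr0 addr0 oppr_gt0.
by rewrite ltNge sqr_ge0.
Qed.

End PencilAlgebra.

Section EllipticPair.
Variable R : realType.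
Variables (p0 : R * R) (s M : R).
Hypothesis s0 : 0 < s.
Let r := s / 2.
Let r0 : 0 < r. Proof. by rewrite divr_gt0. Qed.
Let rs : r < s. Proof. by rewrite /r ltr_pdivrMr // ltr_pMr // ltr1n. Qed.
Local Notation ale := (@ale R p0 r).
Local Notation lipn f := (lip_near f p0 s M).
Local Notation D1 := (dd (e1 R)).
Local Notation D2 := (dd (e2 R)).

Lemma e1_norm : `|(e1 R).1| + `|(e1 R).2| <= 1.
Proof. by rewrite /= normr1 normr0 addr0. Qed.

Lemma e2_norm : `|(e2 R).1| + `|(e2 R).2| <= 1.
Proof. by rewrite /= normr1 normr0 add0r. Qed.

Let bnd (f : R * R -> R) p : lipn f -> dist1 p0 p <= r -> `|f p| <= M.
Proof.
move=> H pr; have ps : dist1 p0 p <= s by apply: le_trans pr _; exact: ltW.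
by have [_] := H p p ps ps.
Qed.

Let M0 (f : R * R -> R) : lipn f -> 0 <= M.
Proof. by apply: lip_near_ge0; exact: ltW. Qed.

Let aleL (A W : R -> R * R -> R) (c : R * R -> R) : lipn c -> ale A W ->
  ale (fun h p => c p * A h p) W.
Proof. by move=> lc; apply: aleM; [exact: M0 lc|move=> p; exact: bnd]. Qed.

Lemma ale_abs (A W : R -> R * R -> R) : ale A W -> ale (fun h p => `|A h p|) W.
Proof.
by move=> [C C0 H]; exists C => // eps /H[a a0 Ha]; exists a => // h p; rewrite normr_id; exact: Ha.
Qed.

Lemma ale_ddD e (F G F' G' : R * R -> R) (W : R -> R * R -> R) :
  (forall h p, dist1 p0 p <= r -> 0 <= W h p) ->
  ale (fun h p => dd e h F p - F' p) W -> ale (fun h p => dd e h G p - G' p) W ->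
  ale (fun h p => dd e h (fun q => F q + G q) p - (F' p + G' p)) W.
Proof.
move=> W0 HF HG; apply: ale_ext (aleD W0 HF HG) => h p h0 _.
by rewrite /dd; field; rewrite gt_eqF.
Qed.

Variables u1 u2 : R * R -> R.
Hypothesis cu1 : C2_near u1 p0 s M.
Hypothesis cu2 : C2_near u2 p0 s M.

Let X1 := partial i1 u1. Let X2 := partial i1 u2.
Let Y1 := partial i2 u1. Let Y2 := partial i2 u2.
Definition jet_norm p := `|u1 p| + `|u2 p| + `|partial i1 u1 p| + `|partial i1 u2 p|
  + `|partial i2 u1 p| + `|partial i2 u2 p|.
Let W0 (h : R) p := jet_norm p.
Let WU (h : R) p := `|u1 p| + `|u2 p|.

Let W0_ge0 h p : dist1 p0 p <= r -> 0 <= W0 h p.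
Proof. by move=> _; rewrite /W0 /jet_norm !addr_ge0. Qed.

Let WU_ge0 h p : dist1 p0 p <= r -> 0 <= WU h p.
Proof. by move=> _; rewrite /WU addr_ge0. Qed.

Let C2_dd u W : (forall h p, dist1 p0 p <= r -> 0 <= W h p) -> C2_near u p0 s M ->
 [/\ ale (fun h p => D1 h u p - partial i1 u p) W,
     ale (fun h p => D2 h u p - partial i2 u p) W,
     ale (fun h p => D1 h (partial i1 u) p - partial i1 (partial i1 u) p) W,
     ale (fun h p => D2 h (partial i1 u) p - partial i1 (partial i2 u) p) W &
   ale (fun h p => D1 h (partial i2 u) p - partial i1 (partial i2 u) p) W /\
     ale (fun h p => D2 h (partial i2 u) p - partial i2 (partial i2 u) p) W].
Proof.
move=> Wp [_ H _ _].
have rr p : dist1 p0 p <= r -> dist1 p0 p <= s by move=> pr; apply: le_trans pr _; exact: ltW.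
have X F F1 F2 : (forall eps, 0 < eps -> exists2 d : R, 0 < d & forall p q, dist1 p0 p <= r ->
     dist1 p q <= d -> expands_at eps F F1 F2 p q) ->
   ale (fun h p => D1 h F p - F1 p) W /\ ale (fun h p => D2 h F p - F2 p) W.
  move=> HF; split.
    by apply: ale_ext (ale_dd_expand e1_norm Wp HF) => h p _ _; rewrite /= mul1r mul0r addr0.
  by apply: ale_ext (ale_dd_expand e2_norm Wp HF) => h p _ _; rewrite /= mul1r mul0r add0r.
have [a1 a2] := X u (partial i1 u) (partial i2 u) (fun eps eps0 => let: ex_intro2 d d0 Hd := H eps eps0 in
  ex_intro2 _ _ d d0 (fun p q pr pq => let: And3 h _ _ := Hd p q (rr p pr) pq in h)).
have [b1 b2] := X (partial i1 u) (partial i1 (partial i1 u)) (partial i1 (partial i2 u))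
  (fun eps eps0 => let: ex_intro2 d d0 Hd := H eps eps0 in
  ex_intro2 _ _ d d0 (fun p q pr pq => let: And3 _ h _ := Hd p q (rr p pr) pq in h)).
have [c1 c2] := X (partial i2 u) (partial i1 (partial i2 u)) (partial i2 (partial i2 u))
  (fun eps eps0 => let: ex_intro2 d d0 Hd := H eps eps0 in
  ex_intro2 _ _ d d0 (fun p q pr pq => let: And3 _ _ h := Hd p q (rr p pr) pq in h)).
by [].
Qed.

Let le0 (x1 x2 x3 x4 x5 x6 y : R) : 0 <= x1 -> 0 <= x2 -> 0 <= x3 -> 0 <= x4 -> 0 <= x5 -> 0 <= x6 ->
  [/\ x1 <= x1 + x2 + x3 + x4 + x5 + x6, x2 <= x1 + x2 + x3 + x4 + x5 + x6,
   x3 <= x1 + x2 + x3 + x4 + x5 + x6, x4 <= x1 + x2 + x3 + x4 + x5 + x6 &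
   x5 <= x1 + x2 + x3 + x4 + x5 + x6 /\ x6 <= x1 + x2 + x3 + x4 + x5 + x6].
Proof. by move=> *; do ! split; lra. Qed.

Let jet_le p : [/\ `|u1 p| <= W0 0 p, `|u2 p| <= W0 0 p, `|X1 p| <= W0 0 p, `|X2 p| <= W0 0 p
   & `|Y1 p| <= W0 0 p /\ `|Y2 p| <= W0 0 p].
Proof. exact: le0. Qed.

Let lipX1 : lipn X1. Proof. by have [_ _ [_ H] _] := cu1; exact: H. Qed.
Let lipY1 : lipn Y1. Proof. by have [_ _ [_ H] _] := cu1; exact: H. Qed.
Let lipX2 : lipn X2. Proof. by have [_ _ [_ H] _] := cu2; exact: H. Qed.
Let lipY2 : lipn Y2. Proof. by have [_ _ [_ H] _] := cu2; exact: H. Qed.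
Let lipu1 : lipn u1. Proof. by have [_ _ [H _] _] := cu1. Qed.
Let lipu2 : lipn u2. Proof. by have [_ _ [H _] _] := cu2. Qed.

Let comb4 c1 c2 c3 c4 e F1 F2 F3 F4 : `|e.1| + `|e.2| <= 1 ->
  lipn c1 -> lipn c2 -> lipn c3 -> lipn c4 ->
  ale (fun h p => dd e h X1 p - F1 p) W0 -> ale (fun h p => dd e h X2 p - F2 p) W0 ->
  ale (fun h p => dd e h Y1 p - F3 p) W0 -> ale (fun h p => dd e h Y2 p - F4 p) W0 ->
  ale (fun h p => dd e h (fun q => c1 q * X1 q + c2 q * X2 q + c3 q * Y1 q + c4 q * Y2 q) p
    - (c1 p * F1 p + c2 p * F2 p + c3 p * F3 p + c4 p * F4 p)) W0.
Proof.
move=> en l1 l2 l3 l4 H1 H2 H3 H4.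
have J p := jet_le p.
apply: ale_ddD => //; [apply: ale_ddD => //; [apply: ale_ddD => //|]|].
- by apply: (ale_ddM en (ltW r0) rs W0_ge0 l1 lipX1 _ H1) => h p _; case: (J p).
- by apply: (ale_ddM en (ltW r0) rs W0_ge0 l2 lipX2 _ H2) => h p _; case: (J p).
- by apply: (ale_ddM en (ltW r0) rs W0_ge0 l3 lipY1 _ H3) => h p _; case: (J p) => _ _ _ _ [].
- by apply: (ale_ddM en (ltW r0) rs W0_ge0 l4 lipY2 _ H4) => h p _; case: (J p) => _ _ _ _ [].
Qed.

Let comb2 c1 c2 e F1 F2 : `|e.1| + `|e.2| <= 1 -> lipn c1 -> lipn c2 ->
  ale (fun h p => dd e h u1 p - F1 p) WU -> ale (fun h p => dd e h u2 p - F2 p) WU ->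
  ale (fun h p => dd e h (fun q => c1 q * u1 q + c2 q * u2 q) p - (c1 p * F1 p + c2 p * F2 p)) WU.
Proof.
move=> en l1 l2 H1 H2; apply: ale_ddD => //.
- by apply: (ale_ddM en (ltW r0) rs WU_ge0 l1 lipu1 _ H1) => h p _; rewrite /WU lerDl.
- by apply: (ale_ddM en (ltW r0) rs WU_ge0 l2 lipu2 _ H2) => h p _; rewrite /WU lerDr.
Qed.

Variables kr1 kr2 ki1 ki2 nr1 nr2 ni1 ni2 tr ti : R * R -> R.
Hypotheses (lkr1 : lipn kr1) (lkr2 : lipn kr2) (lki1 : lipn ki1) (lki2 : lipn ki2).
Hypotheses (lnr1 : lipn nr1) (lnr2 : lipn nr2) (lni1 : lipn ni1) (lni2 : lipn ni2).
Hypotheses (ltr : lipn tr) (lti : lipn ti).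
Let w1 q := kr1 q * X1 q + kr2 q * X2 q + nr1 q * Y1 q + nr2 q * Y2 q.
Let w2 q := ki1 q * X1 q + ki2 q * X2 q + ni1 q * Y1 q + ni2 q * Y2 q.
Variable N : R.
Hypothesis N0 : 0 <= N.
Let dX (c1 c2 c3 c4 : R * R -> R) p := c1 p * partial i1 (partial i1 u1) p + c2 p * partial i1 (partial i1 u2) p
  + c3 p * partial i1 (partial i2 u1) p + c4 p * partial i1 (partial i2 u2) p.
Let dY (c1 c2 c3 c4 : R * R -> R) p := c1 p * partial i1 (partial i2 u1) p + c2 p * partial i1 (partial i2 u2) p
  + c3 p * partial i2 (partial i2 u1) p + c4 p * partial i2 (partial i2 u2) p.
Hypothesis dbar1 : forall p, dist1 p0 p <= s ->
  `|dX kr1 kr2 nr1 nr2 p - tr p * dY kr1 kr2 nr1 nr2 p + ti p * dY ki1 ki2 ni1 ni2 p| <= N * jet_norm p.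
Hypothesis dbar2 : forall p, dist1 p0 p <= s ->
  `|dX ki1 ki2 ni1 ni2 p - tr p * dY ki1 ki2 ni1 ni2 p - ti p * dY kr1 kr2 nr1 nr2 p| <= N * jet_norm p.

Let ps p : dist1 p0 p <= r -> dist1 p0 p <= s.
Proof. by move=> pr; apply: le_trans pr _; exact: ltW. Qed.

Let dop_w : ale (fun h => dop1 tr ti h w1 w2) W0 /\ ale (fun h => dop2 tr ti h w1 w2) W0.
Proof.
have [_ _ a1 a2 [a3 a4]] := C2_dd W0_ge0 cu1; have [_ _ b1 b2 [b3 b4]] := C2_dd W0_ge0 cu2.
have K1 (x y z x' y' z' t t' : R) : x - x' + - t * (y - y') + t' * (z - z') +
  (x' - t * y' + t' * z') = x - t * y + t' * z by ring.
have K2 (x y z x' y' z' t t' : R) : x - x' + - t * (y - y') + - t' * (z - z') +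
  (x' - t * y' - t' * z') = x - t * y - t' * z by ring.
have x1 := comb4 e1_norm lkr1 lkr2 lnr1 lnr2 a1 b1 a3 b3.
have x2 := comb4 e1_norm lki1 lki2 lni1 lni2 a1 b1 a3 b3.
have y1 := comb4 e2_norm lkr1 lkr2 lnr1 lnr2 a2 b2 a4 b4.
have y2 := comb4 e2_norm lki1 lki2 lni1 lni2 a2 b2 a4 b4.
have m1 : lipn (fun p => - tr p).
  by move=> p q pr qr; have [a b] := ltr pr qr; split; rewrite -?opprD ?normrN // opprK addrC distrC.
have m2 : lipn (fun p => - ti p).
  by move=> p q pr qr; have [a b] := lti pr qr; split; rewrite -?opprD ?normrN // opprK addrC distrC.
split.
  have B : ale (fun h p => dX kr1 kr2 nr1 nr2 p - tr p * dY kr1 kr2 nr1 nr2 p + ti p * dY ki1 ki2 ni1 ni2 p) W0.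
    by apply: (ale_bound N0) => h p _ pr; exact: dbar1 (ps pr).
  apply: ale_ext (aleD W0_ge0 (aleD W0_ge0 (aleD W0_ge0 x1 (aleL m1 y1)) (aleL lti y2)) B) => h p _ _.
  exact: K1.
have B : ale (fun h p => dX ki1 ki2 ni1 ni2 p - tr p * dY ki1 ki2 ni1 ni2 p - ti p * dY kr1 kr2 nr1 nr2 p) W0.
  by apply: (ale_bound N0) => h p _ pr; exact: dbar2 (ps pr).
apply: ale_ext (aleD W0_ge0 (aleD W0_ge0 (aleD W0_ge0 x2 (aleL m1 y2)) (aleL m2 y1)) B) => h p _ _.
exact: K2.
Qed.

Variables b11 b12 b21 b22 mb ga de id1 ide ib21 : R * R -> R.
Hypotheses (lb11 : lipn b11) (lb12 : lipn b12) (lb21 : lipn b21) (lb22 : lipn b22) (lmb : lipn mb).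
Hypotheses (lga : lipn ga) (lde : lipn de) (lid1 : lipn id1) (lide : lipn ide) (lib21 : lipn ib21).
(* [v = v1 + i v2] pairs [u] with the left eigenvector [(b21, mu - b11)] of the
   matrix [(b_ij)], for its eigenvalue [mu = - ga - i de]. *)
Let v1 q := b21 q * u1 q + mb q * u2 q.
Let v2 q := - de q * u2 q.
Hypothesis X1E : forall p, dist1 p0 p <= s ->
  X1 p = id1 p * (ki2 p * w1 p - kr2 p * w2 p) - b11 p * Y1 p - b12 p * Y2 p.
Hypothesis X2E : forall p, dist1 p0 p <= s ->
  X2 p = id1 p * (kr1 p * w2 p - ki1 p * w1 p) - b21 p * Y1 p - b22 p * Y2 p.
Hypothesis mbE : forall p, dist1 p0 p <= s -> mb p = - ga p - b11 p.
Hypothesis gaE : forall p, dist1 p0 p <= s -> - ga p - ga p = b11 p + b22 p.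
Hypothesis deE : forall p, dist1 p0 p <= s -> de p ^+ 2 = - ((b11 p - b22 p) ^+ 2 + 4 * b12 p * b21 p) / 4.
Hypothesis ideE : forall p, dist1 p0 p <= s -> ide p * de p = 1.
Hypothesis ib21E : forall p, dist1 p0 p <= s -> ib21 p * b21 p = 1.

Let V (h : R) p := `|w1 p| + `|w2 p| + (`|v1 p| + `|v2 p|).
Let W (h : R) p := V h p + (`|D2 h v1 p| + `|D2 h v2 p|).

Let V_ge0 h p : dist1 p0 p <= r -> 0 <= V h p. Proof. by move=> _; rewrite /V !addr_ge0. Qed.
Let W_ge0 h p : dist1 p0 p <= r -> 0 <= W h p.
Proof. by move=> pr; apply: addr_ge0; [exact: V_ge0|rewrite addr_ge0]. Qed.

Let VW h p : V h p <= W h p. Proof. by rewrite /W lerDl addr_ge0. Qed.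

Let u2E p : dist1 p0 p <= s -> u2 p = - ide p * v2 p.
Proof. by move=> pr; rewrite /v2 mulrA mulrNN ideE // mul1r. Qed.

Let u1E p : dist1 p0 p <= s -> u1 p = ib21 p * (v1 p - mb p * u2 p).
Proof. by move=> pr; rewrite /v1 addrK mulrA ib21E // mul1r. Qed.

Let lipN c : lipn c -> lipn (fun p => - c p).
Proof.
by move=> lc p q pr qr; have [a b] := lc p q pr qr; split; rewrite -?opprD ?normrN // opprK addrC distrC.
Qed.

Let lde' : lipn (fun p => - de p) := lipN lde.

Let le_V p : [/\ `|w1 p| <= V 0 p, `|w2 p| <= V 0 p, `|v1 p| <= V 0 p & `|v2 p| <= V 0 p].
Proof.
have H (x y z t : R) : 0 <= x -> 0 <= y -> 0 <= z -> 0 <= t -> [/\ x <= x + y + (z + t),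
    y <= x + y + (z + t), z <= x + y + (z + t) & t <= x + y + (z + t)].
  by move=> *; split; lra.
exact: H.
Qed.

Let one (F : R * R -> R) (Q : R -> R * R -> R) : (forall h p, `|F p| <= Q h p) -> ale (fun=> F) Q.
Proof. by move=> H; apply: (ale_bound ler01) => h p _ _; rewrite mul1r. Qed.

Let aw1 : ale (fun=> w1) V. Proof. by apply: one => h p; case: (le_V p). Qed.
Let aw2 : ale (fun=> w2) V. Proof. by apply: one => h p; case: (le_V p). Qed.
Let av1 : ale (fun=> v1) V. Proof. by apply: one => h p; case: (le_V p). Qed.
Let av2 : ale (fun=> v2) V. Proof. by apply: one => h p; case: (le_V p). Qed.

Let au2 : ale (fun=> u2) V.
Proof. by apply: ale_ext (aleL (lipN lide) av2) => h p _ pr; rewrite -u2E // ps. Qed.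

Let au1 : ale (fun=> u1) V.
Proof.
apply: ale_ext (aleL lib21 (aleD V_ge0 av1 (aleL (lipN lmb) au2))) => h p _ pr.
by rewrite [RHS]u1E ?ps // mulNr.
Qed.

Let aWU : ale WU V.
Proof. by apply: aleD; [exact: V_ge0|exact: ale_abs au1|exact: ale_abs au2]. Qed.

Let ddv : [/\ ale (fun h p => D1 h v1 p - (b21 p * X1 p + mb p * X2 p)) WU,
   ale (fun h p => D2 h v1 p - (b21 p * Y1 p + mb p * Y2 p)) WU,
   ale (fun h p => D1 h v2 p - (- de p * X2 p)) WU &
   ale (fun h p => D2 h v2 p - (- de p * Y2 p)) WU].
Proof.
have [a1 a2 _ _ _] := C2_dd WU_ge0 cu1; have [b1 b2 _ _ _] := C2_dd WU_ge0 cu2.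
have uW h p : dist1 p0 p <= r -> `|u2 p| <= WU h p by rewrite /WU lerDr.
split; [exact: comb2 e1_norm lb21 lmb a1 b1|exact: comb2 e2_norm lb21 lmb a2 b2| |].
  exact: (ale_ddM e1_norm (ltW r0) rs WU_ge0 lde' lipu2 uW b1).
exact: (ale_ddM e2_norm (ltW r0) rs WU_ge0 lde' lipu2 uW b2).
Qed.

Let aVW A : ale A V -> ale A W.
Proof.
move=> H; apply: (ale_trans H); apply: (ale_bound ler01) => h p _ pr.
by rewrite mul1r ger0_norm; [exact: VW|exact: V_ge0].
Qed.

Let jet_W : ale W0 W.
Proof.
have [_ x _ y] := ddv.
have dW1 : ale (fun h p => D2 h v1 p) W.
  by apply: (ale_bound ler01) => h p _ pr; rewrite mul1r /W addrA -addrA [V h p + _]addrC -!addrA lerDl !addr_ge0 // V_ge0.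
have dW2 : ale (fun h p => D2 h v2 p) W.
  by apply: (ale_bound ler01) => h p _ pr; rewrite mul1r /W addrA lerDr addr_ge0 // V_ge0.
have neg A : ale A W -> ale (fun h p => (-1) * A h p) W.
  by apply: (@aleM R p0 r A W (fun=> -1) 1) => // p _; rewrite normrN normr1.
have aY2 : ale (fun=> Y2) W.
  apply: ale_ext (aleL lide (aleD W_ge0 (neg _ dW2) (aVW (ale_trans y aWU)))) => h p _ pr; cbv beta.
  have K (x' y' z' : R) : -1 * x' + (x' - - y' * z') = y' * z' by ring.
  rewrite K.
  by rewrite mulrA ideE ?mul1r // ps.
have aY1 : ale (fun=> Y1) W.
  have z := neg _ (aVW (ale_trans x aWU)).
  apply: ale_ext (aleL lib21 (aleD W_ge0 (aleD W_ge0 dW1 z) (aleL (lipN lmb) aY2))) => h p _ pr; cbv beta.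
  have K (x' y' z' t y'' : R) : x' + -1 * (x' - (y' * y'' + z' * t)) + - z' * t = y' * y'' by ring.
  rewrite K.
  by rewrite mulrA ib21E ?mul1r // ps.
have aX1 : ale (fun=> X1) W.
  have z := aleL lid1 (aleD V_ge0 (aleL lki2 aw1) (aleL (lipN lkr2) aw2)).
  apply: ale_ext (aleD W_ge0 (aleD W_ge0 (aVW z) (aleL (lipN lb11) aY1)) (aleL (lipN lb12) aY2)) => h p _ pr; cbv beta.
  by rewrite (X1E (ps pr)); ring.
have aX2 : ale (fun=> X2) W.
  have z := aleL lid1 (aleD V_ge0 (aleL lkr1 aw2) (aleL (lipN lki1) aw1)).
  apply: ale_ext (aleD W_ge0 (aleD W_ge0 (aVW z) (aleL (lipN lb21) aY1)) (aleL (lipN lb22) aY2)) => h p _ pr; cbv beta.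
  by rewrite (X2E (ps pr)); ring.
exact: aleD W_ge0 (aleD W_ge0 (aleD W_ge0 (aleD W_ge0 (aleD W_ge0 (ale_abs (aVW au1)) (ale_abs (aVW au2)))
  (ale_abs aX1)) (ale_abs aX2)) (ale_abs aY1)) (ale_abs aY2).
Qed.

Let dop_v : ale (fun h => dop1 ga de h v1 v2) V /\ ale (fun h => dop2 ga de h v1 v2) V.
Proof.
have [x1 x2 y1 y2] := ddv.
have t1 := aleL lid1 (aleD V_ge0 (aleL lki2 aw1) (aleL (lipN lkr2) aw2)).
have t2 := aleL lid1 (aleD V_ge0 (aleL lkr1 aw2) (aleL (lipN lki1) aw1)).
split.
  have z := aleD WU_ge0 (aleD WU_ge0 x1 (aleL (lipN lga) x2)) (aleL lde y2).
  apply: ale_ext (aleD V_ge0 (ale_trans z aWU) (aleD V_ge0 (aleL lb21 t1) (aleL lmb t2))) => h p _ pr; cbv beta.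
  have psp := ps pr; rewrite /dop1.
  have K : b21 p * X1 p + mb p * X2 p - ga p * (b21 p * Y1 p + mb p * Y2 p) + de p * (- de p * Y2 p)
     = b21 p * (id1 p * (ki2 p * w1 p + - kr2 p * w2 p)) + mb p * (id1 p * (kr1 p * w2 p + - ki1 p * w1 p)).
    have d2 := deE psp; have g2 := gaE psp.
    have b2 : b22 p = - ga p - ga p - b11 p by rewrite g2; ring.
    rewrite (X1E psp) (X2E psp) (mbE psp).
    rewrite (_ : de p * (- de p * Y2 p) = - (de p ^+ 2) * Y2 p); last by ring.
    by rewrite d2 b2; field.
  rewrite -K; ring.
have z := aleD WU_ge0 (aleD WU_ge0 y1 (aleL (lipN lga) y2)) (aleL lde' x2).
apply: ale_ext (aleD V_ge0 (ale_trans z aWU) (aleL lde' t2)) => h p _ pr; cbv beta.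
have psp := ps pr; rewrite /dop2.
have K : - de p * X2 p - ga p * (- de p * Y2 p) - de p * (b21 p * Y1 p + mb p * Y2 p)
   = - de p * (id1 p * (kr1 p * w2 p + - ki1 p * w1 p)).
  have g2 := gaE psp.
  have b2 : b22 p = - ga p - ga p - b11 p by rewrite g2; ring.
  by rewrite (X2E psp) (mbE psp) b2; ring.
rewrite -K; ring.
Qed.

Hypothesis ti_big : forall p, dist1 p0 p <= s -> 1 <= M * `|ti p|.

Theorem ucp_elliptic : exists eta d0 : R, [/\ 0 < eta, 0 < d0 &
  forall q d, dist1 p0 q <= d0 -> 0 < d -> d <= d0 ->
    (forall p, sqn (p.1 - q.1, p.2 - q.2) < d ^+ 2 -> u1 p = 0 /\ u2 p = 0) ->
    forall p, sqn (p.1 - q.1, p.2 - q.2) < d ^+ 2 * (1 + eta) -> u1 p = 0 /\ u2 p = 0].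
Proof.
have Mp := M0 ltr; have MM : 0 <= M * M by rewrite mulr_ge0.
have s00 := ltW s0; have rs' := ltW rs.
pose M' := M + 8 * (M * M).
have M'0 : M <= M' by rewrite /M' lerDl mulr_ge0.
have up f (x : R) : x <= M' -> lip_near f p0 s x -> lip_near f p0 r M' by move=> xM; exact: lip_near_le.
have P2 f g : lipn f -> lipn g -> lip_near (fun p => f p * g p) p0 s (2 * (M * M)) by exact: lip_nearM.
have lw1 : lip_near w1 p0 r M'.
  apply: up (lip_nearD (lip_nearD (lip_nearD (P2 _ _ lkr1 lipX1) (P2 _ _ lkr2 lipX2)) (P2 _ _ lnr1 lipY1)) (P2 _ _ lnr2 lipY2)).
  by rewrite /M'; move: (M * M) MM => x; lra.
have lw2 : lip_near w2 p0 r M'.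
  apply: up (lip_nearD (lip_nearD (lip_nearD (P2 _ _ lki1 lipX1) (P2 _ _ lki2 lipX2)) (P2 _ _ lni1 lipY1)) (P2 _ _ lni2 lipY2)).
  by rewrite /M'; move: (M * M) MM => x; lra.
have lv1 : lip_near v1 p0 r M'.
  apply: up (lip_nearD (P2 _ _ lb21 lipu1) (P2 _ _ lmb lipu2)).
  by rewrite /M'; move: (M * M) MM => x; lra.
have lv2 : lip_near v2 p0 r M'.
  by apply: up (P2 _ _ lde' lipu2); rewrite /M'; move: (M * M) MM => x; lra.
have big p : dist1 p0 p <= r -> 1 <= M' * `|ti p| /\ 1 <= M' * `|de p|.
  move=> pr; split; first by apply: le_trans (ti_big (ps pr)) _; apply: ler_wpM2r.
  have : `|ide p * de p| = 1 by rewrite (ideE (ps pr)) normr1.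
  rewrite normrM => <-; apply: ler_wpM2r => //; apply: le_trans M'0; exact: bnd lide pr.
have [eta [d0 [eta0 d00 H]]] := ucp_scaled r0 (And4 (up _ _ M'0 ltr) (up _ _ M'0 lti) (up _ _ M'0 lga) (up _ _ M'0 lde))
  (And4 lw1 lw2 lv1 lv2) big (ale_trans dop_w.1 jet_W) (ale_trans dop_w.2 jet_W) dop_v.1 dop_v.2.
exists (Num.min 1 eta), (Num.min d0 (r / 4)); split; [by rewrite lt_min ltr01|by rewrite lt_min d00 divr_gt0|].
move=> q d; rewrite !le_min => /andP[qd qr] dgt /andP[dd0 dr] Z p pe.
have pe' : sqn (p.1 - q.1, p.2 - q.2) < d ^+ 2 * (1 + eta).
  by apply: lt_le_trans pe _; apply: ler_wpM2l; [exact: sqr_ge0|rewrite lerD2l ge_min lexx orbT].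
have pe2 : sqn (p.1 - q.1, p.2 - q.2) < d ^+ 2 * 2.
  by apply: lt_le_trans pe _; apply: ler_wpM2l; [exact: sqr_ge0|rewrite [2]mulr2n lerD2l ge_min lexx].
have pr : dist1 p0 p <= r.
  apply: le_trans (dist1_tri _ q _) _.
  have : dist1 q p <= 2 * d.
    rewrite -ler_sqr ?nnegrE ?dist1_ge0 //; last by rewrite mulr_ge0 // ltW.
    apply: (@le_trans _ _ (2 * sqn (p.1 - q.1, p.2 - q.2))).
      rewrite /dist1 /sqn /= -(sqr_normE (p.1 - q.1)) -(sqr_normE (p.2 - q.2)).
      have K (x y : R) : (x + y) ^+ 2 <= 2 * (x ^+ 2 + y ^+ 2).
        by have := sqr_ge0 (x - y); rewrite sqrrB sqrrD; lra.
      exact: K.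
    by rewrite exprMn; move: pe2; move: (d ^+ 2) => x; lra.
  by move: qr dr; move: (dist1 _ _) (dist1 _ _) r => x y z; lra.
have zero_jet x : sqn (x.1 - q.1, x.2 - q.2) < d ^+ 2 ->
   [/\ X1 x = 0, X2 x = 0, Y1 x = 0 & Y2 x = 0].
  move=> xd.
  have NN : \forall y \near x, u1 y = 0 /\ u2 y = 0.
    have cf : {for x, continuous (fun y : R * R => sqn (y.1 - q.1, y.2 - q.2))}.
      by rewrite /sqn /=; apply: cvgD; apply: cvgM; (apply: cvgB; [|exact: cvg_cst]); (exact: cvg_fst || exact: cvg_snd).
    have : \forall y \near x, sqn (y.1 - q.1, y.2 - q.2) < d ^+ 2 by exact: (cvgr_lt _ cf).
    by apply: filterS => y; exact: Z.
  have E (u : R * R -> R) k : (\forall y \near x, u y = 0) -> partial k u x = 0.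
    move=> Nu; rewrite /partial (near_eq_derive _ (_ : \forall y \near x, u y = cst 0 y)) ?derive_cst //.
  have N1 : \forall y \near x, u1 y = 0 by apply: filterS NN => y [].
  have N2 : \forall y \near x, u2 y = 0 by apply: filterS NN => y [].
  by split; exact: E.
have van x : sqn (x.1 - q.1, x.2 - q.2) < d ^+ 2 -> [/\ w1 x = 0, w2 x = 0, v1 x = 0 & v2 x = 0].
  move=> xd; have [a1 a2 a3 a4] := zero_jet x xd; have [a5 a6] := Z x xd.
  by rewrite /w1 /w2 /v1 /v2 a1 a2 a3 a4 a5 a6 !mulr0 !addr0.
have [z1 z2] := H q d qd dgt dd0 van p pe'.
have u20 : u2 p = 0 by rewrite (u2E (ps pr)) z2 mulr0.
by split=> //; rewrite (u1E (ps pr)) z1 u20 mulr0 subr0 mulr0.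
Qed.

End EllipticPair.

Section LocalData.
Variable R : realType.
Implicit Types (p q : R * R) (f : R * R -> R).

Lemma locally_lipschitz_loclip (Omega : set (R * R)) f p0 : open Omega -> Omega p0 ->
  [locally [lipschitz f p | p in Omega]] -> loclip p0 f.
Proof.
move=> oO Op H; have := H (p0, p0) (conj Op Op); rewrite /lipschitz_on => -[N [_ HN]].
have := HN (N + 1) ltac:(by rewrite ltrDl); rewrite /within /= {1}/nbhs /=.
move=> [[U V] /= [/nbhs_dist1[a a0 Ha] /nbhs_dist1[b b0 Hb]] AB].
have [d d0 Hd] := open_dist1 oO Op.
pose r := Num.min a (Num.min b d) / 2.
have m0 : 0 < Num.min a (Num.min b d) by rewrite !lt_min a0 b0.
have rm : r < Num.min a (Num.min b d) by rewrite ltr_pdivrMr // ltr_pMr // ltr1n.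
have [ra rb rd] : [/\ r < a, r < b & r < d] by move: rm; rewrite !lt_min => /and3P[].
have L p q : dist1 p0 p <= r -> dist1 p0 q <= r -> `|f q - f p| <= `|N + 1| * dist1 p q.
  move=> pr qr; have := AB (q, p) (conj (Ha _ (le_lt_trans qr ra)) (Hb _ (le_lt_trans pr rb)))
    (conj (Hd _ (le_lt_trans qr rd)) (Hd _ (le_lt_trans pr rd))).
  move=> /= h; apply: le_trans h _; apply: le_trans (ler_wpM2r _ (ler_norm _)) _ => //.
  by apply: ler_wpM2l => //; exact: norm_dist1.
exists r, (`|N + 1| + (`|N + 1| * r + `|f p0|)); split; first by rewrite divr_gt0.
have r0 : 0 <= r by rewrite divr_ge0 // ltW.
have z : 0 <= `|N + 1| * r + `|f p0| by rewrite addr_ge0 // mulr_ge0.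
move=> p q pr qr; split.
  by apply: le_trans (L p q pr qr) _; apply: ler_wpM2r; [exact: dist1_ge0|rewrite lerDl].
have pp : dist1 p0 p0 <= r by rewrite dist1xx.
have h := le_trans (L _ _ pp pr) (ler_wpM2l (normr_ge0 (N + 1)) pr).
have := ler_normD (f p - f p0) (f p0); rewrite subrK; have := normr_ge0 (N + 1); lra_from h.
Qed.

Lemma locally_bounded_near (Omega : set (R * R)) f p0 : open Omega -> Omega p0 ->
  [locally [bounded f p | p in Omega]] ->
  exists r M, [/\ 0 < r, 0 <= M & forall p, dist1 p0 p <= r -> `|f p| <= M].
Proof.
move=> oO Op H; have := H p0 Op; rewrite /bounded_near => -[N [_ HN]].
have := HN (N + 1) ltac:(by rewrite ltrDl); rewrite /within /=.
move=> /nbhs_dist1[a a0 Ha]; have [d d0 Hd] := open_dist1 oO Op.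
have m0 : 0 < Num.min a d by rewrite !lt_min a0.
have rm : Num.min a d / 2 < Num.min a d by rewrite ltr_pdivrMr // ltr_pMr // ltr1n.
exists (Num.min a d / 2), `|N + 1|; split=> //; first by rewrite divr_gt0.
move=> p pr; have := le_lt_trans pr rm; rewrite lt_min => /andP[pa pd].
by apply: le_trans (ler_norm _); exact: Ha _ pa (Hd _ pd).
Qed.

Lemma sum_I2 (V : nmodType) (F : 'I_2 -> V) : \sum_i F i = F i1 + F i2.
Proof.
rewrite big_ord_recl big_ord_recl big_ord0 addr0; congr (F _ + F _); exact: val_inj.
Qed.

Lemma det_I2 (K : comPzRingType) (A : 'M[K]_2) : \det A = A i1 i1 * A i2 i2 - A i1 i2 * A i2 i1.
Proof.
rewrite (expand_det_row _ i1) sum_I2 /cofactor !det_mx11 !mxE /= expr0 expr1 mul1r mulN1r mulrN.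
have E1 : lift i1 0 = i2 by exact: val_inj.
have E2 : lift i2 0 = i1 by exact: val_inj.
by rewrite !E1 !E2.
Qed.

Lemma complex_lipschitz_parts (A : set (R * R)) (f : R * R -> R[i]) p0 : open A -> A p0 ->
  complex_lipschitz A f -> loclip p0 (fun p => complex.Re (f p)) /\ loclip p0 (fun p => complex.Im (f p)).
Proof.
move=> oA Ap [M HM]; have [d d0 Hd] := open_dist1 oA Ap.
have d2 : 0 < d / 2 by rewrite divr_gt0.
have dd : d / 2 < d by rewrite ltr_pdivrMr // ltr_pMr // ltr1n.
have X (g : R * R -> R) : (forall p q, `|g q - g p| <= Normc.normc (f q - f p)) -> loclip p0 g.
  move=> gf; have L p q : dist1 p0 p <= d / 2 -> dist1 p0 q <= d / 2 -> `|g q - g p| <= `|M| * dist1 p q.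
    move=> pr qr; apply: le_trans (gf p q) _; apply: le_trans (HM q p (Hd _ (le_lt_trans qr dd)) (Hd _ (le_lt_trans pr dd))) _.
    apply: le_trans (ler_wpM2r _ (ler_norm _)) _ => //.
    by apply: ler_wpM2l => //; exact: norm_dist1.
  have z : 0 <= `|M| * (d / 2) + `|g p0| by rewrite addr_ge0 // mulr_ge0 // ltW.
  exists (d / 2), (`|M| + (`|M| * (d / 2) + `|g p0|)); split=> // p q pr qr; split.
    by apply: le_trans (L p q pr qr) _; apply: ler_wpM2r; [exact: dist1_ge0|rewrite lerDl].
  have pp : dist1 p0 p0 <= d / 2 by rewrite dist1xx ltW.
  have h := le_trans (L _ _ pp pr) (ler_wpM2l (normr_ge0 M) pr).
  have := ler_normD (g p - g p0) (g p0); rewrite subrK; have := normr_ge0 M; lra_from h.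
split; apply: X => p q; case: (f p) (f q) => [a b] [c e] /=.
  by rewrite -[X in X <= _]sqrtr_sqr ler_sqrt ?addr_ge0 ?sqr_ge0 // lerDl sqr_ge0.
by rewrite -[X in X <= _]sqrtr_sqr ler_sqrt ?addr_ge0 ?sqr_ge0 // lerDr sqr_ge0.
Qed.

(* Unfolding derivatives makes unification of two different ones very slow. *)
Local Opaque partial.
Variable a : 'I_2 -> 'I_2 -> 'I_2 -> 'I_2 -> R * R -> R.
Local Notation ca := (a i1 i1 i1 i1). Local Notation cb := (a i1 i1 i1 i2).
Local Notation cc := (a i1 i1 i2 i2). Local Notation ce := (a i1 i2 i1 i2).
Local Notation cf := (a i1 i2 i2 i2). Local Notation cg := (a i2 i2 i2 i2).

Lemma symmetric_reduce (D : set (R * R)) p : fully_symmetric a D -> D p ->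
  [/\ a i1 i1 i2 i1 p = cb p, a i1 i2 i1 i1 p = cb p, a i2 i1 i1 i1 p = cb p & a i1 i2 i2 i1 p = ce p] /\
  [/\ a i2 i1 i1 i2 p = ce p, a i2 i1 i2 i1 p = ce p, a i2 i2 i1 i1 p = cc p, a i2 i1 i2 i2 p = cf p
    & a i2 i2 i1 i2 p = cf p /\ a i2 i2 i2 i1 p = cf p].
Proof.
move=> S Dp; have s1 i j k l : a i j k l p = a j i k l p by case: (S i j k l p Dp).
have s2 i j k l : a i j k l p = a k l i j p by case: (S i j k l p Dp) => -> ->.
have e1 : a i1 i2 i1 i1 p = cb p by exact: s2.
have e1' : a i2 i1 i1 i1 p = cb p by rewrite (s1 i2 i1).
have e2 : a i1 i1 i2 i1 p = cb p by rewrite (s2 i1 i1).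
have e3' : a i2 i1 i1 i2 p = ce p by exact: s1.
have e3 : a i1 i2 i2 i1 p = ce p by rewrite (s2 i1 i2).
have e3'' : a i2 i1 i2 i1 p = ce p by rewrite (s1 i2 i1).
have e4 : a i2 i2 i1 i2 p = cf p by exact: s2.
have e5 : a i2 i1 i2 i2 p = cf p by exact: s1.
have e6 : a i2 i2 i2 i1 p = cf p by rewrite (s2 i2 i2).
have e7 : a i2 i2 i1 i1 p = cc p by exact: s2.
by do ! split.
Qed.

Lemma elliptic_reduce (D : set (R * R)) p : fully_symmetric a D -> strongly_elliptic a D -> D p ->
  exists2 k : R, 0 < k & forall x1 x2 y1 y2, k * (x1 ^+ 2 + x2 ^+ 2) * (y1 ^+ 2 + y2 ^+ 2) <=
  (ca p * y1 ^+ 2 + 2 * cb p * y1 * y2 + ce p * y2 ^+ 2) * x1 ^+ 2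
  + 2 * (cb p * y1 ^+ 2 + (ce p + cc p) * y1 * y2 + cf p * y2 ^+ 2) * x1 * x2
  + (ce p * y1 ^+ 2 + 2 * cf p * y1 * y2 + cg p * y2 ^+ 2) * x2 ^+ 2.
Proof.
move=> S [k k0 H] Dp; exists k => // x1 x2 y1 y2.
have := H p Dp (fun i => if i == i1 then x1 else x2) (fun i => if i == i1 then y1 else y2).
rewrite !sum_I2 /=; have [[-> -> -> ->] [-> -> -> -> [-> ->]]] := symmetric_reduce S Dp.
move=> h; apply: le_trans h _; rewrite le_eqVlt; apply/orP; left; apply/eqP; ring.
Qed.

Variables (b : 'I_2 -> 'I_2 -> 'I_2 -> R * R -> R) (c : 'I_2 -> 'I_2 -> R * R -> R).
Variable u : 'I_2 -> R * R -> R.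

Lemma system_reduce (D : set (R * R)) p : fully_symmetric a D -> D p ->
  (forall k, partial i2 (partial i1 (u k)) p = partial i1 (partial i2 (u k)) p) ->
  (forall i, system_lhs a b c u i p = 0) ->
  ca p * partial i1 (partial i1 (u i1)) p + 2 * cb p * partial i1 (partial i2 (u i1)) p
   + ce p * partial i2 (partial i2 (u i1)) p
   + (cb p * partial i1 (partial i1 (u i2)) p + (ce p + cc p) * partial i1 (partial i2 (u i2)) p
   + cf p * partial i2 (partial i2 (u i2)) p)
   = - (\sum_j \sum_k b i1 j k p * partial k (u j) p + \sum_j c i1 j p * u j p) /\
  cb p * partial i1 (partial i1 (u i1)) p + (ce p + cc p) * partial i1 (partial i2 (u i1)) p
   + cf p * partial i2 (partial i2 (u i1)) p
   + (ce p * partial i1 (partial i1 (u i2)) p + 2 * cf p * partial i1 (partial i2 (u i2)) p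
   + cg p * partial i2 (partial i2 (u i2)) p)
   = - (\sum_j \sum_k b i2 j k p * partial k (u j) p + \sum_j c i2 j p * u j p).
Proof.
move=> S Dp sym H; have [[a1 a2 a3 a4] [a5 a6 a7 a8 [a9 a10]]] := symmetric_reduce S Dp.
have X (x y z : R) : x + y + z = 0 -> - (y + z) = x by move=> h; rewrite -[RHS]subr0 -h; ring.
suff [G1 G2] :
  ca p * partial i1 (partial i1 (u i1)) p + 2 * cb p * partial i1 (partial i2 (u i1)) p
   + ce p * partial i2 (partial i2 (u i1)) p
   + (cb p * partial i1 (partial i1 (u i2)) p + (ce p + cc p) * partial i1 (partial i2 (u i2)) p
   + cf p * partial i2 (partial i2 (u i2)) p)
   = \sum_j \sum_k \sum_l a i1 j k l p * partial j (partial l (u k)) p /\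
  cb p * partial i1 (partial i1 (u i1)) p + (ce p + cc p) * partial i1 (partial i2 (u i1)) p
   + cf p * partial i2 (partial i2 (u i1)) p
   + (ce p * partial i1 (partial i1 (u i2)) p + 2 * cf p * partial i1 (partial i2 (u i2)) p
   + cg p * partial i2 (partial i2 (u i2)) p)
   = \sum_j \sum_k \sum_l a i2 j k l p * partial j (partial l (u k)) p.
  split; [exact (etrans G1 (esym (X _ _ _ (H i1))))|exact (etrans G2 (esym (X _ _ _ (H i2))))].
clear H X.
have E3 (F : 'I_2 -> 'I_2 -> 'I_2 -> R) : \sum_j \sum_k \sum_l F j k l =
  F i1 i1 i1 + F i1 i1 i2 + (F i1 i2 i1 + F i1 i2 i2) + (F i2 i1 i1 + F i2 i1 i2 + (F i2 i2 i1 + F i2 i2 i2)).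
  by rewrite !sum_I2.
have K1 (v1 v2 v3 v4 v5 x1 x2 x3 x4 x5 x6 y1 y2 : R) : y1 = x1 -> y2 = x2 ->
  v1 * x3 + 2 * v2 * x1 + v4 * x5 + (v2 * x4 + (v4 + v3) * x2 + v5 * x6) =
  v1 * x3 + v2 * x1 + (v2 * x4 + v3 * x2) + (v2 * y1 + v4 * x5 + (v4 * y2 + v5 * x6)).
  by move=> -> ->; ring.
have K2 (v2 v3 v4 v5 v6 x1 x2 x3 x4 x5 x6 y1 y2 : R) : y1 = x1 -> y2 = x2 ->
  v2 * x3 + (v4 + v3) * x1 + v5 * x5 + (v4 * x4 + 2 * v5 * x2 + v6 * x6) =
  v2 * x3 + v4 * x1 + (v4 * x4 + v5 * x2) + (v3 * y1 + v5 * x5 + (v5 * y2 + v6 * x6)).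
  by move=> -> ->; ring.
split; (apply: etrans (esym (E3 _)); cbv beta); rewrite ?a1 ?a2 ?a3 ?a4 ?a5 ?a6 ?a7 ?a8 ?a9 ?a10.
  exact: K1 (sym i1) (sym i2).
exact: K2 (sym i1) (sym i2).
Qed.

Lemma lower_order_bound (Omega : set (R * R)) p0 : open Omega -> Omega p0 ->
  (forall i j k, [locally [bounded b i j k p | p in Omega]]) ->
  (forall i j, [locally [bounded c i j p | p in Omega]]) ->
  exists r M, [/\ 0 < r, 0 <= M & forall i p, dist1 p0 p <= r ->
    `|- (\sum_j \sum_k b i j k p * partial k (u j) p + \sum_j c i j p * u j p)| <= M * jet_norm (u i1) (u i2) p].
Proof.
move=> oO Op Hb Hc.
have [r [M [r0 M0 H]]] : exists r M, [/\ 0 < r, 0 <= M & forall p, dist1 p0 p <= r ->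
   forall i j, [/\ `|b i j i1 p| <= M, `|b i j i2 p| <= M & `|c i j p| <= M]].
  have X1 i j : exists r M, [/\ 0 < r, 0 <= M & forall p, dist1 p0 p <= r ->
     [/\ `|b i j i1 p| <= M, `|b i j i2 p| <= M & `|c i j p| <= M]].
    have [r1 [M1 [r10 M10 H1]]] := locally_bounded_near oO Op (Hb i j i1).
    have [r2 [M2 [r20 M20 H2]]] := locally_bounded_near oO Op (Hb i j i2).
    have [r3 [M3 [r30 M30 H3]]] := locally_bounded_near oO Op (Hc i j).
    exists (Num.min r1 (Num.min r2 r3)), (M1 + M2 + M3); split; first by rewrite !lt_min r10 r20.
      by rewrite !addr_ge0.
    move=> p; rewrite !le_min => /and3P[/H1 h1 /H2 h2 /H3 h3].
    by split; [lra_from h1 M20 M30|lra_from h2 M10 M30|lra_from h3 M10 M20].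
  have X2 i : exists r M, [/\ 0 < r, 0 <= M & forall p, dist1 p0 p <= r ->
     forall j, [/\ `|b i j i1 p| <= M, `|b i j i2 p| <= M & `|c i j p| <= M]].
    have [r1 [M1 [r10 M10 H1]]] := X1 i i1; have [r2 [M2 [r20 M20 H2]]] := X1 i i2.
    exists (Num.min r1 r2), (M1 + M2); split; [by rewrite lt_min r10|by rewrite addr_ge0|].
    move=> p; rewrite !le_min => /andP[/H1[x1 x2 x3] /H2[y1 y2 y3]].
    apply: forall_I2; first by split; [lra_from x1 M20|lra_from x2 M20|lra_from x3 M20].
    by split; [lra_from y1 M10|lra_from y2 M10|lra_from y3 M10].
  have [r1 [M1 [r10 M10 H1]]] := X2 i1; have [r2 [M2 [r20 M20 H2]]] := X2 i2.
  exists (Num.min r1 r2), (M1 + M2); split; [by rewrite lt_min r10|by rewrite addr_ge0|].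
  move=> p; rewrite !le_min => /andP[/H1 x /H2 y].
  apply: forall_I2 => j; first by have [x1 x2 x3] := x j; split; [lra_from x1 M20|lra_from x2 M20|lra_from x3 M20].
  by have [y1 y2 y3] := y j; split; [lra_from y1 M10|lra_from y2 M10|lra_from y3 M10].
exists r, M; split=> // i p pr; have [h1 h2 h3] := H p pr i i1; have [h4 h5 h6] := H p pr i i2.
rewrite normrN !sum_I2 /jet_norm.
have K (x y : R) : `|x| <= M -> `|x * y| <= M * `|y| by move=> xM; rewrite normrM ler_wpM2r.
have KM (x1 x2 x3 x4 x5 x6 : R) : M * (x1 + x2 + x3 + x4 + x5 + x6) =
  M * x3 + M * x5 + (M * x4 + M * x6) + (M * x1 + M * x2) by ring.
rewrite KM.
apply: le_trans (ler_normD _ _) _; apply: lerD; apply: le_trans (ler_normD _ _) _; apply: lerD;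
  try (by apply: K); apply: le_trans (ler_normD _ _) _; apply: lerD; exact: K.
Qed.

End LocalData.

Section LipList.
Variable R : realType.
Variable p0 : R * R.

Fixpoint all_loclip (fs : seq (R * R -> R)) : Prop :=
  if fs is f :: fs' then loclip p0 f /\ all_loclip fs' else True.

Fixpoint all_lip_near r M (fs : seq (R * R -> R)) : Prop :=
  if fs is f :: fs' then lip_near f p0 r M /\ all_lip_near r M fs' else True.

Lemma all_lip_near_le fs r r' M M' : r' <= r -> M <= M' ->
  all_lip_near r M fs -> all_lip_near r' M' fs.
Proof.
move=> rr MM; elim: fs => //= f fs IH [H Hs]; split; [exact: lip_near_le H|exact: IH].
Qed.

Lemma all_loclip_near fs : all_loclip fs -> exists r M, 0 < r /\ all_lip_near r M fs.
Proof.
elim: fs => [_|f fs IH /= [[r [M [r0 H]]] /IH[s [N [s0 Hs]]]]]; first by exists 1, 1.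
exists (Num.min r s), (Num.max M N); split; first by rewrite lt_min r0.
split; first by apply: lip_near_le H; rewrite ?ge_min ?le_max lexx.
by apply: all_lip_near_le Hs; rewrite ?ge_min ?le_max lexx orbT.
Qed.

End LipList.

Section Eigenpair.
Variable R : realType.
Variable a : 'I_2 -> 'I_2 -> 'I_2 -> 'I_2 -> R * R -> R.
Local Notation ca := (a i1 i1 i1 i1). Local Notation cb := (a i1 i1 i1 i2).
Local Notation cc := (a i1 i1 i2 i2). Local Notation ce := (a i1 i2 i1 i2).
Local Notation cf := (a i1 i2 i2 i2). Local Notation cg := (a i2 i2 i2 i2).

Lemma pencil_rows (p : R * R) (tr ti z1r z1i z2r z2i : R) :
  pencil a (tr +i* ti)%C p *m cv2 (z1r +i* z1i)%C (z2r +i* z2i)%C = 0 ->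
  [/\ (ca p * (tr ^+ 2 - ti ^+ 2) + 2 * cb p * tr + ce p) * z1r
  - (ca p * (2 * tr * ti) + 2 * cb p * ti) * z1i
  + (cb p * (tr ^+ 2 - ti ^+ 2) + (ce p + cc p) * tr + cf p) * z2r
  - (cb p * (2 * tr * ti) + (ce p + cc p) * ti) * z2i = 0,
  (ca p * (tr ^+ 2 - ti ^+ 2) + 2 * cb p * tr + ce p) * z1i
  + (ca p * (2 * tr * ti) + 2 * cb p * ti) * z1r
  + (cb p * (tr ^+ 2 - ti ^+ 2) + (ce p + cc p) * tr + cf p) * z2i
  + (cb p * (2 * tr * ti) + (ce p + cc p) * ti) * z2r = 0,
  (cb p * (tr ^+ 2 - ti ^+ 2) + (ce p + cc p) * tr + cf p) * z1r
  - (cb p * (2 * tr * ti) + (ce p + cc p) * ti) * z1i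
  + (ce p * (tr ^+ 2 - ti ^+ 2) + 2 * cf p * tr + cg p) * z2r
  - (ce p * (2 * tr * ti) + 2 * cf p * ti) * z2i = 0 &
  (cb p * (tr ^+ 2 - ti ^+ 2) + (ce p + cc p) * tr + cf p) * z1i
  + (cb p * (2 * tr * ti) + (ce p + cc p) * ti) * z1r
  + (ce p * (tr ^+ 2 - ti ^+ 2) + 2 * cf p * tr + cg p) * z2i
  + (ce p * (2 * tr * ti) + 2 * cf p * ti) * z2r = 0].
Proof.
move=> H; have H1 := congr1 (fun A : 'cV[R[i]]_2 => A i1 0) H; have H2 := congr1 (fun A : 'cV[R[i]]_2 => A i2 0) H.
move: H1 H2; rewrite !mxE !sum_I2 !mxE /= !expr2.
move=> /eqP; rewrite eq_complex /= => /andP[/eqP h1 /eqP h2].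
move=> /eqP; rewrite eq_complex /= => /andP[/eqP h3 /eqP h4].
by split; [rewrite -[RHS]h1|rewrite -[RHS]h2|rewrite -[RHS]h3|rewrite -[RHS]h4]; ring.
Qed.

Lemma conj_indep (z1r z1i z2r z2i : R) :
  mx2 (z1r +i* z1i)%C (conjc (z1r +i* z1i)%C) (z2r +i* z2i)%C (conjc (z2r +i* z2i)%C) \in unitmx ->
  z1r * z2i - z1i * z2r != 0.
Proof.
rewrite unitmxE det_I2 !mxE /= unitfE; apply: contraNneq => H.
rewrite eq_complex /=; apply/andP; split; apply/eqP; first by ring.
by rewrite -[RHS](mulr0 (-2)) -H; ring.
Qed.

Lemma eigenpair_real (Omega : set (R * R)) p0 : local_eigenpair a Omega p0 ->
  exists (tr ti z1r z1i z2r z2i : R * R -> R) (r : R),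
  [/\ 0 < r, all_loclip p0 [:: tr; ti; z1r; z1i; z2r; z2i], z1r p0 * z2i p0 - z1i p0 * z2r p0 != 0 &
   forall p, dist1 p0 p <= r ->
   pencil a (tr p +i* ti p)%C p *m cv2 (z1r p +i* z1i p)%C (z2r p +i* z2i p)%C = 0].
Proof.
move=> [om [th [z1 [z2 [[oo op _] [lt l1 l2 H U]]]]]].
have [r r0 Hr] := open_dist1 oo op.
exists (fun p => complex.Re (th p)), (fun p => complex.Im (th p)), (fun p => complex.Re (z1 p)),
  (fun p => complex.Im (z1 p)), (fun p => complex.Re (z2 p)), (fun p => complex.Im (z2 p)), (r / 2).
have E (z : R[i]) : (complex.Re z +i* complex.Im z)%C = z by case: z.
split.
- by rewrite divr_gt0.
- have [x1 x2] := complex_lipschitz_parts oo op lt; have [x3 x4] := complex_lipschitz_parts oo op l1.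
  by have [x5 x6] := complex_lipschitz_parts oo op l2; do ! split.
- by apply: conj_indep; rewrite !E; exact: U.
- by move=> p pr; rewrite !E; apply: H; apply: Hr; apply: le_lt_trans pr _; rewrite ltr_pdivrMr // ltr_pMr // ltr1n.
Qed.

Variables (b : 'I_2 -> 'I_2 -> 'I_2 -> R * R -> R) (c : 'I_2 -> 'I_2 -> R * R -> R).
Variable u : 'I_2 -> R * R -> R.
Local Opaque partial.

Theorem ucp_system (Omega : set (R * R)) (p0 : R * R) : open Omega -> Omega p0 ->
  (forall i j k l, [locally [lipschitz a i j k l p | p in Omega]]) ->
  (forall i j k, [locally [bounded b i j k p | p in Omega]]) ->
  (forall i j, [locally [bounded c i j p | p in Omega]]) ->
  fully_symmetric a (closure Omega) -> strongly_elliptic a (closure Omega) ->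
  local_eigenpair a Omega p0 -> (forall k, C2_closure Omega (u k)) ->
  (forall i p, Omega p -> system_lhs a b c u i p = 0) ->
  exists eta d0 : R, [/\ 0 < eta, 0 < d0 &
  forall q d, dist1 p0 q <= d0 -> 0 < d -> d <= d0 ->
    (forall p, sqn (p.1 - q.1, p.2 - q.2) < d ^+ 2 -> u i1 p = 0 /\ u i2 p = 0) ->
    forall p, sqn (p.1 - q.1, p.2 - q.2) < d ^+ 2 * (1 + eta) -> u i1 p = 0 /\ u i2 p = 0].
Proof.
move=> oO Op La Lb Lc Sa Ea Hz Cu Su.
have clO p : Omega p -> closure Omega p by exact: subset_closure.
have [tr [ti [z1r [z1i [z2r [z2i [rz [rz0 [ltr [lti [l1r [l1i [l2r [l2i _]]]]]] zn Hpen]]]]]]]] := eigenpair_real Hz.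
have LA i j k l : loclip p0 (a i j k l) by exact: locally_lipschitz_loclip oO Op (La i j k l).
have [k k0 ell] := elliptic_reduce Sa Ea (clO _ Op).
have [rl [K [rl0 K0 HK]]] := lower_order_bound u oO Op Lb Lc.
have [r1 [M1 [r10 M10 C1 HO1]]] := C2_closure_near oO (Cu i1) Op.
have [r2 [M2 [r20 M20 C2 _]]] := C2_closure_near oO (Cu i2) Op.
pose kr1 p := z1r p * ca p + z2r p * cb p. pose kr2 p := z1r p * cb p + z2r p * ce p.
pose ki1 p := z1i p * ca p + z2i p * cb p. pose ki2 p := z1i p * cb p + z2i p * ce p.
pose nr1 p := tr p * kr1 p - ti p * ki1 p + (z1r p * (2 * cb p) + z2r p * (ce p + cc p)).
pose nr2 p := tr p * kr2 p - ti p * ki2 p + (z1r p * (ce p + cc p) + z2r p * (2 * cf p)).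
pose ni1 p := tr p * ki1 p + ti p * kr1 p + (z1i p * (2 * cb p) + z2i p * (ce p + cc p)).
pose ni2 p := tr p * ki2 p + ti p * kr2 p + (z1i p * (ce p + cc p) + z2i p * (2 * cf p)).
pose d1 p := kr1 p * ki2 p - kr2 p * ki1 p.
pose id1 p := (d1 p)^-1.
pose b11 p := (ki2 p * nr1 p - kr2 p * ni1 p) * id1 p.
pose b12 p := (ki2 p * nr2 p - kr2 p * ni2 p) * id1 p.
pose b21 p := (kr1 p * ni1 p - ki1 p * nr1 p) * id1 p.
pose b22 p := (kr1 p * ni2 p - ki1 p * nr2 p) * id1 p.
pose disc p := - ((b11 p - b22 p) * (b11 p - b22 p) + 4 * b12 p * b21 p).
pose de p := Num.sqrt (disc p) * 2^-1.
pose ide p := (de p)^-1.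
pose ga p := - ((b11 p + b22 p) * 2^-1).
pose mb p := - ga p - b11 p.
pose ib21 p := (b21 p)^-1.
have cst x : loclip p0 (fun=> x) by exact: loclip_cst.
have lkr1 : loclip p0 kr1 by apply: loclipD; apply: loclipM.
have lkr2 : loclip p0 kr2 by apply: loclipD; apply: loclipM.
have lki1 : loclip p0 ki1 by apply: loclipD; apply: loclipM.
have lki2 : loclip p0 ki2 by apply: loclipD; apply: loclipM.
have lC : loclip p0 (fun p => ce p + cc p) by exact: loclipD.
have l2b : loclip p0 (fun p => 2 * cb p) by exact: loclipM.
have l2f : loclip p0 (fun p => 2 * cf p) by exact: loclipM.
have lnr1 : loclip p0 nr1 by apply: loclipD; [apply: loclipB|apply: loclipD]; apply: loclipM.
have lnr2 : loclip p0 nr2 by apply: loclipD; [apply: loclipB|apply: loclipD]; apply: loclipM.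
have lni1 : loclip p0 ni1 by apply: loclipD; [apply: loclipD|apply: loclipD]; apply: loclipM.
have lni2 : loclip p0 ni2 by apply: loclipD; [apply: loclipD|apply: loclipD]; apply: loclipM.
have ld1 : loclip p0 d1 by apply: loclipB; apply: loclipM.
have p0p0 : dist1 p0 p0 = 0 by rewrite dist1xx.
have rz0' : dist1 p0 p0 <= rz by rewrite p0p0 ltW.
have [q1 q2 q3 q4] := pencil_rows (Hpen p0 rz0').
have d1n : d1 p0 != 0 by exact: (det_lead_neq0 k0 ell (erefl _) (erefl _) (erefl _) (erefl _) zn).
have lid1 : loclip p0 id1 by exact: loclipV.
have lb11 : loclip p0 b11 by apply: loclipM => //; apply: loclipB; apply: loclipM.
have lb12 : loclip p0 b12 by apply: loclipM => //; apply: loclipB; apply: loclipM.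
have lb21 : loclip p0 b21 by apply: loclipM => //; apply: loclipB; apply: loclipM.
have lb22 : loclip p0 b22 by apply: loclipM => //; apply: loclipB; apply: loclipM.
have ldisc : loclip p0 disc.
  apply: loclipN; apply: loclipD; first by apply: loclipM; exact: loclipB.
  by apply: loclipM => //; exact: loclipM.
have disc0 : 0 < disc p0.
  by rewrite /disc -expr2; exact: (disc_gt0 k0 ell q1 q2 q3 q4 (erefl _) (erefl _) (erefl _) (erefl _)
   (erefl _) (erefl _) (erefl _) (erefl _) zn (erefl _) (erefl _) (erefl _) (erefl _)).
have b21n : b21 p0 != 0.
  exact: (b21_neq0 k0 ell q1 q2 q3 q4 (erefl _) (erefl _) (erefl _) (erefl _)
   (erefl _) (erefl _) (erefl _) (erefl _) zn (erefl _) (erefl _) (erefl _) (erefl _)).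
have tin : ti p0 != 0 by exact: (theta_not_real k0 ell q1 q2 q3 q4 zn).
have lde : loclip p0 de by apply: loclipM => //; exact: loclip_sqrt.
have den : de p0 != 0 by rewrite mulf_neq0 ?invr_eq0 ?pnatr_eq0 // gt_eqF // sqrtr_gt0.
have lide : loclip p0 ide by exact: loclipV.
have lga : loclip p0 ga by apply: loclipN; apply: loclipM => //; exact: loclipD.
have lmb : loclip p0 mb by apply: loclipB => //; exact: loclipN.
have lib21 : loclip p0 ib21 by exact: loclipV.
have liti : loclip p0 (fun p => (ti p)^-1) by exact: loclipV.
have [s1 [m1 [s10 _ _ N1]]] := loclip_near0 ld1 d1n.
have [s2 [m2 [s20 _ _ N2]]] := loclip_near0 ldisc (lt0r_neq0 disc0).
have [s3 [m3 [s30 _ _ N3]]] := loclip_near0 lb21 b21n.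
have [s4 [m4 [s40 _ _ N4]]] := loclip_near0 lti tin.
have := @all_loclip_near R p0 [:: tr; ti; z1r; z1i; z2r; z2i; kr1; kr2; ki1; ki2; nr1; nr2; ni1; ni2;
  b11; b12; b21; b22; mb; ga; de; id1; ide; ib21; fun p => (ti p)^-1].
move=> [|rr [MM [rr0 LL]]]; first by do ! split.
pose s := Num.min rr (Num.min rz (Num.min rl (Num.min r1 (Num.min r2 (Num.min s1 (Num.min s2 (Num.min s3 s4))))))).
have s0 : 0 < s by rewrite !lt_min rr0 rz0 rl0 r10 r20 s10 s20 s30 s40.
pose M := Num.max MM (Num.max M1 M2).
have sl p : dist1 p0 p <= s -> [/\ dist1 p0 p <= rz, dist1 p0 p <= rl, dist1 p0 p <= r1, dist1 p0 p <= s1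
    & [/\ dist1 p0 p <= s2, dist1 p0 p <= s3 & dist1 p0 p <= s4]].
  by rewrite !le_min => /and5P[_ ? ? ? /and5P[_ ? ? ? ?]].
have srr : s <= rr by rewrite /s ge_min lexx.
have sr1 : s <= r1 by rewrite /s !ge_min lexx !orbT.
have sr2 : s <= r2 by rewrite /s !ge_min lexx !orbT.
have MM' : MM <= M by rewrite /M le_max lexx.
have M1' : M1 <= M by rewrite /M !le_max lexx !orbT.
have M2' : M2 <= M by rewrite /M !le_max lexx !orbT.
have := all_lip_near_le srr MM' LL.
move=> [htr [hti [h1r [h1i [h2r [h2i [hkr1 [hkr2 [hki1 [hki2 [hnr1 [hnr2 [hni1 [hni2
  [hb11 [hb12 [hb21 [hb22 [hmb [hga [hde [hid1 [hide [hib21 [hiti _]]]]]]]]]]]]]]]]]]]]]]]]].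
have cu1 := C2_near_le sr1 M1' C1; have cu2 := C2_near_le sr2 M2' C2.
have M0 : 0 <= M by apply: le_trans M1'; exact: ltW.
have bd f p : lip_near f p0 s M -> dist1 p0 p <= s -> `|f p| <= M by move=> h pr; have [] := h p p pr pr.
have d1id p : dist1 p0 p <= s -> d1 p * id1 p = 1.
  by move=> /sl[_ _ _ h _]; have [h' _ _ _] := N1 p h; rewrite /id1 divff.
have [sym1 _ _ _] := cu1; have [sym2 _ _ _] := cu2.
have sym p : dist1 p0 p <= s -> forall k, partial i2 (partial i1 (u k)) p = partial i1 (partial i2 (u k)) p.
  by move=> pr; apply: forall_I2; [exact: sym1|exact: sym2].
have red p (pr : dist1 p0 p <= s) := system_reduce Sa (clO _ (HO1 _ (le_trans pr sr1))) (sym p pr)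
   (fun i => Su i p (HO1 _ (le_trans pr sr1))).
have jet0 p : 0 <= jet_norm (u i1) (u i2) p by rewrite /jet_norm !addr_ge0.
have eqb (f g : R * R -> R) p x y : lip_near f p0 s M -> lip_near g p0 s M -> dist1 p0 p <= s ->
   `|x| <= K * jet_norm (u i1) (u i2) p -> `|y| <= K * jet_norm (u i1) (u i2) p ->
   `|f p * x + g p * y| <= 2 * M * K * jet_norm (u i1) (u i2) p.
  move=> lf lg pr hx hy; apply: le_trans (ler_normD _ _) _; rewrite !normrM.
  have h1 := ler_pM (normr_ge0 _) (normr_ge0 _) (bd f p lf pr) hx.
  have h2 := ler_pM (normr_ge0 _) (normr_ge0 _) (bd g p lg pr) hy.
  rewrite (_ : 2 * M * K * _ = M * (K * jet_norm (u i1) (u i2) p) + M * (K * jet_norm (u i1) (u i2) p)); last by ring.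
  exact: lerD.
have dpos p : dist1 p0 p <= s -> 0 < disc p.
  by move=> /sl[_ _ _ _ [h _ _]]; have [_ _ _] := N2 p h; rewrite pmulr_rgt0.
have KX1 (x1 x2 y1 y2 a1 a2 c1 c2 n1 n2 o1 o2 i : R) : (a1 * c2 - a2 * c1) * i = 1 ->
    x1 = i * (c2 * (a1 * x1 + a2 * x2 + n1 * y1 + n2 * y2) - a2 * (c1 * x1 + c2 * x2 + o1 * y1 + o2 * y2))
      - (c2 * n1 - a2 * o1) * i * y1 - (c2 * n2 - a2 * o2) * i * y2.
  by move=> h; rewrite -[LHS]mul1r -h; ring.
have KX2 (x1 x2 y1 y2 a1 a2 c1 c2 n1 n2 o1 o2 i : R) : (a1 * c2 - a2 * c1) * i = 1 ->
    x2 = i * (a1 * (c1 * x1 + c2 * x2 + o1 * y1 + o2 * y2) - c1 * (a1 * x1 + a2 * x2 + n1 * y1 + n2 * y2))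
      - (a1 * o1 - c1 * n1) * i * y1 - (a1 * o2 - c1 * n2) * i * y2.
  by move=> h; rewrite -[LHS]mul1r -h; ring.
have N0 : 0 <= 2 * M * K by rewrite !mulr_ge0.
apply: (@ucp_elliptic R p0 s M s0 (u i1) (u i2) cu1 cu2 kr1 kr2 ki1 ki2 nr1 nr2 ni1 ni2 tr ti
  hkr1 hkr2 hki1 hki2 hnr1 hnr2 hni1 hni2 htr hti (2 * M * K) N0 _ _
  b11 b12 b21 b22 mb ga de id1 ide ib21 hb11 hb12 hb21 hb22 hmb hga hde hid1 hide hib21).
- move=> p pr; have [z _ _ _ _] := sl p pr; have [x1 x2 x3 x4] := pencil_rows (Hpen p z).
  rewrite (dbar_real x1 x3 (erefl _) (erefl _) (erefl _) (erefl _) (erefl _) (erefl _) (erefl _) (erefl _)).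
  have [e1 e2] := red p pr; have [_ l _ _ _] := sl p pr.
  apply: eqb (eq_ind_r (fun x => `|x| <= _) (HK i1 p l) e1) (eq_ind_r (fun x => `|x| <= _) (HK i2 p l) e2); [exact: h1r|exact: h2r|exact: pr].
- move=> p pr; have [z _ _ _ _] := sl p pr; have [x1 x2 x3 x4] := pencil_rows (Hpen p z).
  rewrite (dbar_imag x2 x4 (erefl _) (erefl _) (erefl _) (erefl _) (erefl _) (erefl _) (erefl _) (erefl _)).
  have [e1 e2] := red p pr; have [_ l _ _ _] := sl p pr.
  apply: eqb (eq_ind_r (fun x => `|x| <= _) (HK i1 p l) e1) (eq_ind_r (fun x => `|x| <= _) (HK i2 p l) e2); [exact: h1i|exact: h2i|exact: pr].
- by move=> p pr; exact: KX1 (d1id p pr).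
- by move=> p pr; exact: KX2 (d1id p pr).
- by [].
- by move=> p pr; rewrite /ga; field.
- by move=> p pr; rewrite /de exprMn sqr_sqrtr ?(ltW (dpos p pr)) // /disc -expr2; field.
- by move=> p pr; rewrite /ide mulVf // mulf_neq0 ?invr_eq0 ?pnatr_eq0 // gt_eqF // sqrtr_gt0 dpos.
- by move=> p /sl[_ _ _ _ [_ h _]]; have [h' _ _ _] := N3 p h; rewrite /ib21 mulVf.
- move=> p pr; have [_ _ _ _ [_ _ h]] := sl p pr; have [h' _ _ _] := N4 p h.
  have <- : `|(ti p)^-1 * ti p| = 1 by rewrite mulVf // normr1.
  by rewrite normrM; apply: ler_wpM2r => //; exact: (bd (fun p => (ti p)^-1)).
Qed.

End Eigenpair.

(** * The open set where the solution vanishes *)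


Section Clip.
Variable R : realType.
Implicit Types (p q : R * R) (r : R).

Definition clamp r (x y : R) : R := x + Num.max (- r) (Num.min r (y - x)).
Definition clip p0 r p : R * R := (clamp r p0.1 p.1, clamp r p0.2 p.2).

Lemma clamp_near r x y : 0 <= r -> `|clamp r x y - x| <= r.
Proof.
move=> r0; rewrite /clamp addrAC subrr add0r ler_norml le_max lexx /= ge_max ge_min lexx /= andbT.
by move: r0; clear; lra.
Qed.

Lemma clamp_lip r x y z : `|clamp r x y - clamp r x z| <= `|y - z|.
Proof.
rewrite /clamp; set a := y - x; set b := z - x.
rewrite (_ : y - z = a - b); last by rewrite /a /b; ring.
rewrite (_ : x + _ - _ = Num.max (- r) (Num.min r a) - Num.max (- r) (Num.min r b)); last by ring.
rewrite ler_norml lerBlDr lerBrDr; have := ler_norm (a - b); have := ler_norm (b - a).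
rewrite (distrC b a); set n := `|_|; move=> h1 h2.
have n0 : 0 <= n by exact: normr_ge0.
move: a b n h1 h2 n0; clear; move=> a b n *; rewrite /Num.max /Num.min; do ! case: ifP; move=> *; apply/andP; split; lra.
Qed.

Lemma clamp_id r x y : `|y - x| <= r -> clamp r x y = y.
Proof.
rewrite ler_norml => /andP[h1 h2]; rewrite /clamp.
by rewrite /Order.min; case: ifP => h; rewrite /Order.max; case: ifP => h'; lra.
Qed.

Lemma clip_near p0 r p : 0 <= r -> dist1 p0 (clip p0 r p) <= 2 * r.
Proof. by move=> r0; rewrite /dist1 mulrDl mul1r lerD // clamp_near. Qed.

Lemma clip_lip p0 r p q : dist1 (clip p0 r p) (clip p0 r q) <= dist1 p q.
Proof. by rewrite /dist1 lerD // clamp_lip. Qed.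

Lemma clip_id p0 r p : dist1 p0 p <= r -> clip p0 r p = p.
Proof.
rewrite /dist1 => H; rewrite /clip !clamp_id -?surjective_pairing //.
  by apply: le_trans H; rewrite lerDr.
by apply: le_trans H; rewrite lerDl.
Qed.

End Clip.

Section NetLocal.
Variable R : realType.
Local Opaque partial.

Theorem net_local (p0 : R * R) (A B C E F G v : R * R -> R) (r1 M1 K0 kap : R) :
  loclip p0 A -> loclip p0 B -> loclip p0 C -> loclip p0 E -> loclip p0 F -> loclip p0 G ->
  0 < B p0 ^+ 2 - 4 * A p0 * C p0 -> C p0 = F p0 -> 0 < kap ->
  (forall y1 y2, kap * (y1 ^+ 2 + y2 ^+ 2) <= E p0 * y1 ^+ 2 + 2 * F p0 * y1 * y2 + G p0 * y2 ^+ 2) ->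
  0 < r1 -> 0 <= K0 -> C2_near v p0 r1 M1 ->
  let J p := `|v p| + `|partial i1 v p| + `|partial i2 v p| in
  (forall p, dist1 p0 p <= r1 ->
     `|A p * partial i1 (partial i1 v) p + B p * partial i1 (partial i2 v) p
       + C p * partial i2 (partial i2 v) p| <= K0 * J p /\
     `|E p * partial i1 (partial i1 v) p + 2 * F p * partial i1 (partial i2 v) p
       + G p * partial i2 (partial i2 v) p| <= K0 * J p) ->
  v p0 = 0 -> partial i1 v p0 = 0 -> partial i2 v p0 = 0 ->
  partial i1 (partial i1 v) p0 = 0 -> partial i2 (partial i2 v) p0 = 0 ->
  exists q0 r, 0 < r /\ forall p, dist1 q0 p < r -> dist1 p0 p < r1 /\ v p = 0.
Proof.
move=> lA lB lC lE lF lG D0 CF kap0 ell r10 K00 Cv J Hsys v0 v10 v20 v110 v220.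
have cst x : loclip p0 (fun=> x) by exact: loclip_cst.
(* [m] is the root of [m^2 - B m + A C] of larger modulus: it does not vanish
   even where [A C = 0]. *)
pose sg : R := if 0 <= B p0 then 1 else -1.
have sg2 : sg * sg = 1 by rewrite /sg; case: ifP => _; rewrite ?mulr1 // mulrNN mulr1.
have sgB : 0 <= sg * B p0.
  by rewrite /sg; case: ifP => h; rewrite ?mul1r // mulN1r oppr_ge0 ltW // ltNge h.
pose De p := B p * B p - 4 * A p * C p.
have lDe : loclip p0 De by apply: loclipB; apply: loclipM => //; exact: loclipM.
have De0 : 0 < De p0 by rewrite /De -expr2.
pose s p := Num.sqrt (De p).
have ls : loclip p0 s by exact: loclip_sqrt.
pose m p := (B p + sg * s p) * 2^-1.
have lm : loclip p0 m by apply: loclipM => //; apply: loclipD => //; exact: loclipM.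
have s0 : 0 < s p0 by rewrite sqrtr_gt0.
have sgm : 0 < sg * m p0.
  rewrite /m mulrA pmulr_lgt0 ?invr_gt0 // mulrDr mulrA sg2 mul1r.
  by apply: ltr_wpDl.
have m0 : m p0 != 0 by apply/negP => /eqP z; move: sgm; rewrite z mulr0 ltxx.
pose im p := (m p)^-1.
have lim : loclip p0 im by exact: loclipV.
pose l p := A p * im p. pose k p := C p * im p.
have ll : loclip p0 l by exact: loclipM.
have lk : loclip p0 k by exact: loclipM.
pose N p := E p * (k p * k p) - 2 * F p * k p + G p.
have lN : loclip p0 N by apply: loclipD => //; apply: loclipB; do ? (done || apply: loclipM).
have N0 : 0 < N p0.
  have := ell (k p0) (-1); rewrite (_ : _ + G p0 * _ = N p0); last by rewrite /N; ring.
  apply: lt_le_trans; apply: mulr_gt0 => //; rewrite sqrrN expr1n; by apply: ltr_wpDl; [exact: sqr_ge0|exact: ltr01].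
pose iN p := (N p)^-1.
have liN : loclip p0 iN by apply: loclipV => //; rewrite gt_eqF.
pose nu p := E p - 2 * F p * l p + G p * (l p * l p).
have lnu : loclip p0 nu by apply: loclipD; [apply: loclipB|]; do ? (done || apply: loclipM).
pose c p := nu p * iN p.
have lc : loclip p0 c by exact: loclipM.
have c0 : 0 < c p0.
  have nu0 : 0 < nu p0.
    have := ell 1 (- l p0); rewrite (_ : _ + G p0 * _ = nu p0); last by rewrite /nu; ring.
    apply: lt_le_trans; apply: mulr_gt0 => //; rewrite expr1n; by apply: ltr_pwDl; [exact: ltr01|exact: sqr_ge0].
  by rewrite mulr_gt0 // invr_gt0.
pose g1 p := (1 - k p * l p) * (1 - k p * l p) * iN p.
have lkl : loclip p0 (fun p => k p * l p) by exact: loclipM.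
have lg1 : loclip p0 g1 by apply: loclipM => //; apply: loclipM; exact: loclipB.
pose g2 p := (2 * F p * (1 + k p * l p) - 2 * k p * E p - 2 * l p * G p) * iN p.
have lg2 : loclip p0 g2.
  apply: loclipM => //; apply: loclipB; [apply: loclipB|]; do ? (done || apply: loclipM).
  exact: loclipD.
have Dl0 : 0 < 1 - k p0 * l p0.
  have mm : 0 < m p0 * m p0 by rewrite -expr2 exprn_even_gt0.
  rewrite -(pmulr_rgt0 _ mm).
  have -> : m p0 * m p0 * (1 - k p0 * l p0) = (De p0 + sg * B p0 * s p0) / 2.
    rewrite (_ : _ * _ = m p0 * m p0 - A p0 * C p0 * (m p0 * im p0) * (m p0 * im p0)); last by rewrite /k /l; ring.
    rewrite /im divff // !mulr1 /m.
    have ss : s p0 * s p0 = De p0 by rewrite -expr2 sqr_sqrtr // ltW.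
    rewrite (_ : _ - _ = (B p0 * B p0 + 2 * (sg * B p0 * s p0) + (sg * sg) * (s p0 * s p0)) / 4 - A p0 * C p0); last by field.
    by rewrite sg2 ss /De; field.
  by rewrite divr_gt0 // ltr_pwDl // mulr_ge0 // ltW.
have [sm [mm [sm0 _ _ Nm]]] := loclip_near0 lm m0.
have [sN [mN [sN0 _ _ NN]]] := loclip_near0 lN (lt0r_neq0 N0).
have [sD [mD [sD0 _ _ ND]]] := loclip_near0 lDe (lt0r_neq0 De0).
have := @all_loclip_near R p0 [:: k; l; c; im; g1; g2].
move=> [|rr [M' [rr0 LL]]]; first by do ! split.
pose M := `|M'| + 1.
have M'M : M' <= M by apply: le_trans (ler_norm _) _; rewrite lerDl.
have M0 : 0 < M by rewrite ltr_wpDl.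
pose del := 1 - k p0 * l p0.
pose tot := Num.min r1 (Num.min rr (Num.min sm (Num.min sN (Num.min sD (del / (4 * M * M)))))).
have MM0 : 0 < 4 * M * M by rewrite !mulr_gt0.
have tot0 : 0 < tot by rewrite !lt_min r10 rr0 sm0 sN0 sD0 divr_gt0.
pose rho := tot / 2.
have rho0 : 0 < rho by rewrite divr_gt0.
have rt : 2 * rho = tot by rewrite mulrC divfK.
have tl p : dist1 p0 p <= tot -> [/\ dist1 p0 p <= r1, dist1 p0 p <= rr, dist1 p0 p <= sm & dist1 p0 p <= sN /\ dist1 p0 p <= sD].
  by rewrite !le_min => /and5P[? ? ? ? /andP[? _]].
have trr : tot <= rr by rewrite /tot !ge_min lexx !orbT.
have tdel : 4 * M * M * tot <= del.
  have : tot <= del / (4 * M * M) by rewrite /tot !ge_min lexx !orbT.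
  by rewrite ler_pdivlMr // mulrC.
have := all_lip_near_le trr M'M LL => -[hk [hl [hc [him [hg1 [hg2 _]]]]]].
have p00 : dist1 p0 p0 <= tot by rewrite dist1xx ltW.
have clt p : dist1 p0 (clip p0 rho p) <= tot by rewrite -rt; apply: clip_near; exact: ltW.
pose cl (f : R * R -> R) p := f (clip p0 rho p).
have clb f p : lip_near f p0 tot M -> `|cl f p| <= M by move=> h; have [] := h _ _ (clt p) (clt p).
have cll f p q : lip_near f p0 tot M -> `|cl f q - cl f p| <= M * dist1 p q.
  move=> h; have [h1 _] := h _ _ (clt p) (clt q); apply: le_trans h1 _.
  by apply: ler_wpM2l; [exact: ltW|exact: clip_lip].
have cl0 f p : lip_near f p0 tot M -> `|cl f p - f p0| <= M * tot.
  move=> h; have [h1 _] := h _ _ p00 (clt p); apply: le_trans h1 _.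
  by apply: ler_wpM2l; [exact: ltW|exact: clt].
have clE f p : dist1 p0 p < rho -> cl f p = f p by move=> h; rewrite /cl clip_id // ltW.
have inr p : dist1 p0 p < rho -> dist1 p0 p <= tot by move=> h; rewrite -rt; move: h rho0; clear; lra.
pose K := 1 + M + 2 / del + (c p0)^-1 + M * K0 + M * K0 + M * (M * K0).
have K1 : [/\ 1 <= K, M <= K, 2 / del <= K, (c p0)^-1 <= K & M * K0 <= K /\ M * K0 + M * (M * K0) <= K].
  have x1 : 0 <= 2 / del by rewrite divr_ge0 // ltW.
  have x2 : 0 <= (c p0)^-1 by rewrite invr_ge0 ltW.
  have x3 : 0 <= M * K0 by rewrite mulr_ge0 // ltW.
  have x4 : 0 <= M * (M * K0) by rewrite mulr_ge0 // ltW.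
  rewrite /K; move: x1 x2 x3 x4 M0; clear.
  set a := 2 / del; set b := _^-1; set d := M * K0; set e := M * d => *; do ! split; lra.
have [K1' KM Kd Kc [KJ1 KJ2]] := K1.
have rel p : dist1 p0 p <= tot -> B p * im p = 1 + k p * l p.
  move=> /tl[_ _ h [_ hD]]; have [mn _ _ _] := Nm p h; have [_ _ _ Dp] := ND p hD.
  have Dp0 : 0 < De p by rewrite -(pmulr_rgt0 _ De0).
  have ss : s p * s p = De p by rewrite -expr2 sqr_sqrtr // ltW.
  have mq : m p * m p - B p * m p + A p * C p = 0.
    rewrite (_ : _ + _ = ((sg * sg) * (s p * s p) - B p * B p) / 4 + A p * C p); last by rewrite /m; field.
    by rewrite sg2 ss /De; field.
  have i1 : m p * im p = 1 by rewrite divff.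
  rewrite /k /l; apply/eqP; rewrite eq_sym -subr_eq0; apply/eqP.
  rewrite (_ : _ - _ = (m p * m p - B p * m p + A p * C p) * (im p * im p) + (1 - (m p * im p) ^+ 2) + B p * im p * (m p * im p - 1)); last by ring.
  by rewrite mq i1; ring.
have [q0 [r [r0 Hq]]] : exists (q0 : R * R) (r : R), 0 < r /\ forall p, dist1 q0 p < r -> dist1 p0 p < rho /\ v p = 0.
  apply: (@net_vanish R K rho (cl k) (cl l) (cl c) v (partial i1 v) (partial i2 v)
    (partial i1 (partial i1 v)) (partial i1 (partial i2 v)) (partial i2 (partial i2 v)) p0 K1' rho0).
  - by move=> p; apply: le_trans (clb _ _ hk) KM.
  - by move=> p; apply: le_trans (clb _ _ hl) KM.
  - by move=> p; apply: le_trans (clb _ _ hc) KM.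
  - by move=> p q; apply: le_trans (cll _ _ _ hk) _; apply: ler_wpM2r => //; exact: dist1_ge0.
  - by move=> p q; apply: le_trans (cll _ _ _ hl) _; apply: ler_wpM2r => //; exact: dist1_ge0.
  - by move=> p q; apply: le_trans (cll _ _ _ hc) _; apply: ler_wpM2r => //; exact: dist1_ge0.
  - move=> p q.
    have y1 := ler_pM (normr_ge0 _) (normr_ge0 _) (cl0 k p hk) (clb l q hl).
    have [_ kM] := hk _ _ p00 p00.
    have y2 := ler_pM (normr_ge0 _) (normr_ge0 _) kM (cl0 l q hl).
    have d2 : del / 2 <= 1 - cl k p * cl l q.
      set a := (cl k p - k p0) * cl l q + k p0 * (cl l q - l p0).
      rewrite (_ : 1 - _ = del - a); last by rewrite /a /del; ring.
      have := ler_normD ((cl k p - k p0) * cl l q) (k p0 * (cl l q - l p0)); rewrite (normrM (cl k p - k p0)) (normrM (k p0)) -/a.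
      have := ler_norm a.
      move: y1 y2 tdel; rewrite (_ : 4 * M * M * tot = 4 * (M * tot * M)); last by ring.
      rewrite (_ : M * (M * tot) = M * tot * M); last by ring.
      move: (M * tot * M) a => y a; clear; lra.
    have := ler_wpM2r (le_trans _ d2) Kd.
    have dd : 0 <= del / 2 by rewrite divr_ge0 // ltW.
    have K0' : 0 <= K by exact: le_trans ler01 K1'.
    move=> _; apply: le_trans (ler_wpM2l K0' d2).
    by have := ler_wpM2r dd Kd; rewrite (_ : 2 / del * (del / 2) = 1) //; field; rewrite gt_eqF.
  - have cp : cl c p0 = c p0 by apply: clE; rewrite dist1xx.
    rewrite cp gtr0_norm //; have := ler_wpM2r (ltW c0) Kc; rewrite mulVf // gt_eqF //.
  - move=> eps eps0; have [_ HH _ _] := Cv; have [d d0 Hd] := HH eps eps0; exists d => // p q pr _.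
    by apply: Hd; have [] := tl p (inr p pr).
  - move=> p pr; have pt := inr p pr; have [p1 _ _ [pN _]] := tl p pt; have [h1 h2] := Hsys p p1.
    have [Nn _ _ _] := NN p pN; have J0 : 0 <= J p by rewrite /J !addr_ge0.
    have b f : lip_near f p0 tot M -> `|f p| <= M by move=> h; have [] := h p p pt pt.
    rewrite !clE // -/(J p).
    suff : forall H1 H2 H3 : R, `|A p * H1 + B p * H2 + C p * H3| <= K0 * J p ->
        `|E p * H1 + 2 * F p * H2 + G p * H3| <= K0 * J p ->
        `|l p * H1 + (1 + k p * l p) * H2 + k p * H3| <= K * J p /\
        `|l p ^+ 2 * H1 + 2 * l p * H2 + H3 + c p * (H1 + 2 * k p * H2 + k p ^+ 2 * H3)| <= K * J p.
      by apply; [exact: h1|exact: h2].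
    move=> {}H1 {}H2 {}H3 {}h1 {}h2.
    have e1 : l p * H1 + (1 + k p * l p) * H2 + k p * H3 = im p * (A p * H1 + B p * H2 + C p * H3).
      by rewrite -(rel p pt) /l /k; ring.
    have x1 : `|l p * H1 + (1 + k p * l p) * H2 + k p * H3| <= M * K0 * J p.
      by rewrite e1 normrM -mulrA; apply: ler_pM => //; exact: b.
    split; first by apply: le_trans x1 _; apply: ler_wpM2r.
    have iNN : N p * iN p = 1 by rewrite divff.
    have -> : l p ^+ 2 * H1 + 2 * l p * H2 + H3 + c p * (H1 + 2 * k p * H2 + k p ^+ 2 * H3) =
       g1 p * (E p * H1 + 2 * F p * H2 + G p * H3) - g2 p * (l p * H1 + (1 + k p * l p) * H2 + k p * H3).
      apply/eqP; rewrite -subr_eq0; apply/eqP.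
      transitivity ((1 - N p * iN p) * (l p ^+ 2 * H1 + 2 * l p * H2 + H3)); last by rewrite iNN subrr mul0r.
      by rewrite /c /g1 /g2 /nu /N; ring.
    apply: le_trans (ler_normB _ _) _; rewrite (normrM (g1 p)) (normrM (g2 p)); apply: (@le_trans _ _ ((M * K0 + M * (M * K0)) * J p)); last exact: ler_wpM2r.
    rewrite (_ : (M * K0 + M * (M * K0)) * J p = M * (K0 * J p) + M * (M * K0 * J p)); last by ring.
    by apply: lerD; apply: ler_pM => //; exact: b.
  - by [].
  - by [].
  - by [].
  - by [].
  - have [h1 h2] := Hsys p0 ltac:(by rewrite dist1xx ltW).
    have Z (x1 x2 x3 y1 y2 y3 t1 t2 t3 : R) : y1 = 0 -> y3 = 0 -> t1 = 0 -> t2 = 0 -> t3 = 0 ->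
        `|x1 * y1 + x2 * y2 + x3 * y3| <= K0 * (`|t1| + `|t2| + `|t3|) -> (x2 == 0) || (y2 == 0).
      by move=> -> -> -> -> ->; rewrite !normr0 !addr0 !mulr0 add0r addr0 normr_le0 mulf_eq0.
    have /orP[/eqP B0|/eqP //] := Z _ _ _ _ _ _ _ _ _ v110 v220 v0 v10 v20 h1.
    have /orP[|/eqP //] := Z _ _ _ _ _ _ _ _ _ v110 v220 v0 v10 v20 h2.
    rewrite mulf_eq0 pnatr_eq0 /= => /eqP F0.
    have AC : A p0 * C p0 < 0 by move: D0; rewrite B0 expr0n /= sub0r oppr_gt0 -mulrA pmulr_rlt0.
    by exfalso; move: AC; rewrite CF F0 mulr0 ltxx.
  - by [].
exists q0, r; split=> // p pr; have [h1 h2] := Hq p pr; split=> //.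
apply: lt_le_trans h1 _; have : tot <= r1 by rewrite /tot ge_min lexx.
by move: rho0; rewrite -rt; clear; lra.
Qed.

End NetLocal.

Section Propagation.
Variable R : realType.

Lemma disc_iterate (P : R * R -> Prop) (q : R * R) (eta d0 s : R) : 0 < eta -> 0 < d0 -> 0 < s ->
  (forall d, 0 < d -> d <= d0 ->
    (forall p, sqn (p.1 - q.1, p.2 - q.2) < d ^+ 2 -> P p) ->
    forall p, sqn (p.1 - q.1, p.2 - q.2) < d ^+ 2 * (1 + eta) -> P p) ->
  (forall p, sqn (p.1 - q.1, p.2 - q.2) < s -> P p) ->
  forall p, sqn (p.1 - q.1, p.2 - q.2) < d0 ^+ 2 -> P p.
Proof.
move=> eta0 d00 s0 step start.
pose S t := forall p, sqn (p.1 - q.1, p.2 - q.2) < t -> P p.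
have grow n : S (s * (1 + eta) ^+ n) \/ S (d0 ^+ 2).
  elim: n => [|n [IH|]]; [by left; rewrite expr0 mulr1| |by right].
  set t := s * (1 + eta) ^+ n in IH.
  have t0 : 0 < t by rewrite mulr_gt0 // exprn_gt0 // addr_gt0.
  have [td|td] := leP t (d0 ^+ 2); last first.
    by right=> p pd; apply: IH; exact: lt_trans td.
  left; rewrite exprSr mulrA -/t -(sqr_sqrtr (ltW t0)); apply: step.
  - by rewrite sqrtr_gt0.
  - by rewrite -[leRHS](ger0_norm (ltW d00)) -sqrtr_sqr ler_sqrt // sqr_ge0.
  - by rewrite sqr_sqrtr ?ltW.
have bern n : 1 + n%:R * eta <= (1 + eta) ^+ n.
  elim: n => [|n IH]; first by rewrite mul0r addr0 expr0.
  have e1 : 0 <= 1 + eta by rewrite addr_ge0 // ltW.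
  have := ler_wpM2r e1 IH; rewrite -exprSr -natr1.
  have : 0 <= n%:R * eta * eta by rewrite !mulr_ge0 ?ler0n // ltW.
  by rewrite (_ : (1 + n%:R * eta) * (1 + eta) = 1 + n%:R * eta + eta + n%:R * eta * eta); [lra|ring].
pose n := `|Num.ceil (d0 ^+ 2 / (s * eta))|%N.
have se : 0 < s * eta by rewrite mulr_gt0.
have nd : d0 ^+ 2 <= s * (1 + eta) ^+ n.
  have : d0 ^+ 2 / (s * eta) <= n%:R.
    rewrite /n natr_absz ger0_norm; first exact: ceil_ge.
    by rewrite -(ler_int R); apply: le_trans (ceil_ge _); rewrite divr_ge0 ?sqr_ge0 // ltW.
  rewrite ler_pdivrMr // => h; apply: le_trans h _.
  apply: le_trans (ler_wpM2l (ltW s0) (bern n)); rewrite mulrCA; apply: ler_wpM2l; first exact: ltW.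
  by rewrite lerDr.
by case: (grow n) => [H p pd|//]; apply: H; exact: lt_le_trans nd.
Qed.

Lemma sqn_dist1 (p q : R * R) : sqn (p.1 - q.1, p.2 - q.2) <= dist1 q p ^+ 2.
Proof.
rewrite /sqn /dist1 /= -(sqr_normE (p.1 - q.1)) -(sqr_normE (p.2 - q.2)).
have : 0 <= `|p.1 - q.1| * `|p.2 - q.2| by rewrite mulr_ge0.
by rewrite sqrrD; lra.
Qed.

Lemma dist1_sqn (p q : R * R) (d : R) : 0 < d ->
  sqn (p.1 - q.1, p.2 - q.2) < d ^+ 2 -> dist1 q p < 2 * d.
Proof.
move=> d0; rewrite /sqn /dist1 /= => H.
have X (x y : R) : x ^+ 2 + y ^+ 2 < d ^+ 2 -> `|x| < d.
  move=> h; rewrite -ltr_sqr ?nnegrE ?(ltW d0) // sqr_normE.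
  by apply: le_lt_trans h; rewrite lerDl sqr_ge0.
have := X _ _ H; have := X (p.2 - q.2) (p.1 - q.1); rewrite addrC => /(_ H); lra.
Qed.

Theorem connected_propagation (Omega : set (R * R)) (P : R * R -> Prop) :
  connected Omega -> open Omega ->
  (forall p0, Omega p0 -> exists eta d0 : R, [/\ 0 < eta, 0 < d0 &
    forall q d, dist1 p0 q <= d0 -> 0 < d -> d <= d0 ->
    (forall p, sqn (p.1 - q.1, p.2 - q.2) < d ^+ 2 -> P p) ->
    forall p, sqn (p.1 - q.1, p.2 - q.2) < d ^+ 2 * (1 + eta) -> P p]) ->
  (exists q0 r, [/\ Omega q0, 0 < r & forall p, dist1 q0 p < r -> P p]) ->
  forall p, Omega p -> P p.
Proof.
move=> cO oO step [q0 [r [Oq0 r0 Pq0]]].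
pose Z := Omega `&` interior P.
have ZE : Z = Omega.
  apply: cO.
  - by exists q0; split=> //; apply/nbhs_dist1; exists r.
  - by exists (interior P) => //; exact: open_interior.
  exists (closure Z); first exact: closed_closure.
  apply/seteqP; split=> p0; first by move=> Zp; split; [case: Zp|exact: subset_closure].
  move=> [Op cZ]; split=> //; have [eta [d0 [eta0 d00 H]]] := step p0 Op.
  have d8 : 0 < d0 / 8 by rewrite divr_gt0.
  have [q [[Oq /nbhs_dist1[rho rho0 Hrho]] qd]] : Z `&` [set q | dist1 p0 q < d0 / 8] !=set0.
    by apply: cZ; apply/nbhs_dist1; exists (d0 / 8).
  apply/nbhs_dist1; exists (d0 / 8) => // p pd.
  have r2 : 0 < rho / 2 by rewrite divr_gt0.
  apply: (@disc_iterate P q eta d0 ((rho / 2) ^+ 2)) => //.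
  - by rewrite exprn_gt0.
  - by move=> d; apply: H; apply: le_trans (ltW qd) _; move: d00; clear; lra.
  - by move=> x xq; apply: Hrho; have := dist1_sqn r2 xq; rewrite mulrC divfK.
  apply: le_lt_trans (sqn_dist1 _ _) _; rewrite ltr_sqr ?nnegrE ?dist1_ge0 ?(ltW d00) //.
  apply: le_lt_trans (dist1_tri _ p0 _) _; rewrite [dist1 q p0]dist1C.
  by move: qd pd d00 => /=; clear; lra.
by move=> p; rewrite -ZE => -[_ /interior_subset].
Qed.

End Propagation.

Lemma partial_locally_zero (R : realType) (k : 'I_2) (f : R * R -> R) (U : set (R * R)) (p : R * R) :
  open U -> U p -> (forall q, U q -> f q = 0) -> partial k f p = 0.
Proof.
move=> oU Up fU; have N : \forall q \near p, f q = cst 0 q.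
  have : \forall q \near p, U q by exact: open_nbhs_nbhs.
  by apply: filterS => q /fU.
by rewrite /partial (near_eq_derive _ N) derive_cst.
Qed.

Theorem theorem2p3 (R : realType) (Omega : set (R * R)) (p0 : R * R)
  (omega : set (R * R))
  (a : 'I_2 -> 'I_2 -> 'I_2 -> 'I_2 -> R * R -> R)
  (b : 'I_2 -> 'I_2 -> 'I_2 -> R * R -> R)
  (c : 'I_2 -> 'I_2 -> R * R -> R)
  (u : 'I_2 -> R * R -> R)
  (Omega_connected : connected Omega)
  (Omega_open : open Omega)
  (Omega_bounded : bounded_set Omega)
  (Omega_p0 : Omega p0)
  (omega_open : open omega)
  (omega_p0 : omega p0)
  (omega_sub : omega `<=` Omega)
  (a_lipschitz : forall i j k l, [locally [lipschitz a i j k l p | p in Omega]])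
  (b_bounded : forall i j k, [locally [bounded b i j k p | p in Omega]])
  (c_bounded : forall i j, [locally [bounded c i j p | p in Omega]])
  (a_symmetric : fully_symmetric a (closure Omega))
  (a_elliptic : strongly_elliptic a (closure Omega))
  (a_eigenpair : forall p, Omega p -> local_eigenpair a Omega p)
  (u_C2 : forall k, C2_closure Omega (u k))
  (u_solution : forall i p, Omega p -> system_lhs a b c u i p = 0)
  (Delta_gt0 : forall p, closure omega p -> 0 < Delta a p)
  (u1_eq0 : forall p, omega p -> u i1 p = 0)
  (u2_eq0 : [/\ u i2 p0 = 0,
                partial i1 (u i2) p0 = 0,
                partial i2 (u i2) p0 = 0,
                partial i1 (partial i1 (u i2)) p0 = 0
              & partial i2 (partial i2 (u i2)) p0 = 0]) :
  forall k p, Omega p -> u k p = 0.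
Proof.
have clO p : Omega p -> closure Omega p by exact: subset_closure.
suff H : forall p, Omega p -> u i1 p = 0 /\ u i2 p = 0.
  by apply: (@forall_I2 (fun k => forall p, Omega p -> u k p = 0)) => p /H[h1 h2]; [exact: h1|exact: h2].
apply: (@connected_propagation R Omega (fun p => u i1 p = 0 /\ u i2 p = 0)) => //.
  by move=> p Op; exact: (ucp_system Omega_open Op a_lipschitz b_bounded c_bounded a_symmetric a_elliptic (a_eigenpair p Op) u_C2 u_solution).
have [r1 [M1 [r10 M10 C2 HO]]] := C2_closure_near Omega_open (u_C2 i2) Omega_p0.
have [rl [K [rl0 K0 HK]]] := lower_order_bound u Omega_open Omega_p0 b_bounded c_bounded.
have [ro ro0 Hro] := open_dist1 omega_open omega_p0.
pose r := Num.min r1 (Num.min rl (ro / 2)).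
have r0 : 0 < r by rewrite !lt_min r10 rl0 divr_gt0.
have ball p : dist1 p0 p <= r -> [/\ dist1 p0 p <= r1, dist1 p0 p <= rl & omega p].
  rewrite !le_min => /and3P[h1 h2 h3]; split=> //; apply: Hro; apply: le_lt_trans h3 _.
  by rewrite ltr_pdivrMr // ltr_pMr // ltr1n.
have rr1 : r <= r1 by rewrite /r ge_min lexx.
have LA i j k l : loclip p0 (a i j k l) by exact: locally_lipschitz_loclip Omega_open Omega_p0 (a_lipschitz i j k l).
have [k k0 ell] := elliptic_reduce a_symmetric a_elliptic (clO _ Omega_p0).
have z1 l p : omega p -> partial l (u i1) p = 0.
  by move=> op; exact: (@partial_locally_zero R l _ omega).
have z2 l m p : omega p -> partial l (partial m (u i1)) p = 0.
  by move=> op; apply: (@partial_locally_zero R l _ omega) => // q; exact: z1.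
have [sym2 _ _ _] := C2.
have sys p (pr : dist1 p0 p <= r) :
  `|a i1 i1 i1 i2 p * partial i1 (partial i1 (u i2)) p
     + (a i1 i2 i1 i2 p + a i1 i1 i2 i2 p) * partial i1 (partial i2 (u i2)) p
     + a i1 i2 i2 i2 p * partial i2 (partial i2 (u i2)) p|
    <= K * (`|u i2 p| + `|partial i1 (u i2) p| + `|partial i2 (u i2) p|) /\
  `|a i1 i2 i1 i2 p * partial i1 (partial i1 (u i2)) p
     + 2 * a i1 i2 i2 i2 p * partial i1 (partial i2 (u i2)) p
     + a i2 i2 i2 i2 p * partial i2 (partial i2 (u i2)) p|
    <= K * (`|u i2 p| + `|partial i1 (u i2) p| + `|partial i2 (u i2) p|).
  have [p1 pl po] := ball p pr.
  have sym : forall k, partial i2 (partial i1 (u k)) p = partial i1 (partial i2 (u k)) p.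
    by apply: forall_I2; [rewrite (z2 i2 i1 p po) (z2 i1 i2 p po)|exact: sym2].
  have [e1 e2] := system_reduce a_symmetric (clO _ (HO p p1)) sym (fun i => u_solution i p (HO p p1)).
  have J : jet_norm (u i1) (u i2) p = `|u i2 p| + `|partial i1 (u i2) p| + `|partial i2 (u i2) p|.
    by rewrite /jet_norm (u1_eq0 p po) (z1 i1 p po) (z1 i2 p po) !normr0 add0r !addr0.
  have h1 := HK i1 p pl; have h2 := HK i2 p pl; rewrite J in h1 h2.
  have X (x1 x2 x3 y1 y2 y3 s m y : R) : y1 = 0 -> y2 = 0 -> y3 = 0 ->
    x1 * y1 + x2 * y2 + x3 * y3 + s = m -> `|m| <= y -> `|s| <= y.
    by move=> -> -> ->; rewrite !mulr0 !add0r => ->.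
  split; [exact: X (z2 i1 i1 p po) (z2 i1 i2 p po) (z2 i2 i2 p po) e1 h1|
          exact: X (z2 i1 i1 p po) (z2 i1 i2 p po) (z2 i2 i2 p po) e2 h2].
have [v0 v10 v20 v110 v220] := u2_eq0.
have ell' y1 y2 : k * (y1 ^+ 2 + y2 ^+ 2) <= a i1 i2 i1 i2 p0 * y1 ^+ 2
    + 2 * a i1 i2 i2 i2 p0 * y1 * y2 + a i2 i2 i2 i2 p0 * y2 ^+ 2.
  have := ell 0 1 y1 y2; rewrite expr0n expr1n /=; clear.
  move: (a _ _ _ _ p0) (a _ _ _ _ p0) (a _ _ _ _ p0) (a _ _ _ _ p0) (a _ _ _ _ p0) (a _ _ _ _ p0) => *; lra.
have D0 : 0 < (a i1 i2 i1 i2 p0 + a i1 i1 i2 i2 p0) ^+ 2 - 4 * a i1 i1 i1 i2 p0 * a i1 i2 i2 i2 p0.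
  by apply: Delta_gt0; exact: subset_closure.
have [q0 [d [d0 Hd]]] := net_local (LA i1 i1 i1 i2) (loclipD (LA i1 i2 i1 i2) (LA i1 i1 i2 i2)) (LA i1 i2 i2 i2)
  (LA i1 i2 i1 i2) (LA i1 i2 i2 i2) (LA i2 i2 i2 i2) D0 (erefl _) k0 ell' r0 K0
  (C2_near_le rr1 (lexx M1) C2) sys v0 v10 v20 v110 v220.
have in_omega p : dist1 q0 p < d -> omega p.
  by move=> /Hd[h _]; have [] := ball p (ltW h).
exists q0, d; split=> //.
  by apply: omega_sub; apply: in_omega; rewrite dist1xx.
by move=> p pd; split; [apply: u1_eq0; exact: in_omega|case: (Hd p pd)].
Qed.
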